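(* Let $(M,H,\mathcal{J})$ be an almost CR manifold of CR dimension $n$ with a real structure $L$ on $H$, equipped with a Riemannian metric $g_L$ on $L$, the associated metric $g_H$ on $H$, and a supplement $\mathcal{N}$ of $H$ in $TM$. Let $Q_L$ be the operator $$Q_{L}=(\bar\partial_{H}^{*}\bar\partial_{H} - \bar\partial_{H}\bar\partial_{H}^{*}) - \gamma (\bar\partial_{H}^{*}\bar\partial_{H} - \bar\partial_{H}\bar\partial_{H}^{*})\gamma$$ acting on sections of $\Lambda^{*,*}$. Let $\{Z_j,Z_{\bar j}\}$ be a local admissible orthonormal frame of $H\otimes\mathbb{C}$ with dual coframe $\{\theta^j,\theta^{\bar j}\}$. Then, in the local trivialization of $\Lambda^{*,*}$ defined by the orthonormal coframe $\{\theta^{J,\bar K}\}$, $$Q_{L}=\sum_{j,k=1}^{n} \left( \varepsilon(\theta^{\bar{j}})\iota(\theta^{k})-\iota(\theta^{j})\varepsilon(\theta^{\bar{k}})\right)( Z_{\bar{j}}Z_{k}+Z_{j}Z_{\bar{k}}) + \mathrm{O}_{H}(1).$$ In particular, in the local trivialization of $\Lambda^{*,0}\oplus\Lambda^{*,n}$, $$Q_{L}=\pm \sum_{j=1}^n (Z_{j}Z_{\bar{j}}+Z_{\bar{j}}Z_{j})+ \mathrm{O}_{H}(1),$$ where the sign $\pm$ is $-$ on $\Lambda^{*,0}$ and $+$ on $\Lambda^{*,n}$.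
   Context: An almost CR manifold is a smooth manifold $M$ with a subbundle $H\subset TM$ and an almost complex structure $\mathcal{J}\in C^\infty(M,\mathrm{End}\,H)$, $\mathcal{J}^2=-1$ ($H$ need not have codimension 1). Its CR dimension is $n=\frac12\operatorname{rank}H$. A real structure on $H$ is a rank $n$ real subbundle $L\subset H$ with $H=L\oplus\mathcal{J}L$. Metric: $g_L$ is a Riemannian metric on $L$, extended by zero to $\mathcal{J}L\times H$ and $H\times\mathcal{J}L$; $g_H:=g_L(\cdot,\cdot)+g_L(\mathcal{J}\cdot,\mathcal{J}\cdot)$ on $H$, extended to a Hermitian metric on $H\otimes\mathbb{C}$. Fix a supplement $\mathcal{N}$ of $H$ in $TM$ and identify $H^*$ with the annihilator of $\mathcal{N}$ in $T^*M$. Forms: $T_{1,0}=\ker(\mathcal{J}-i)$ and $T_{0,1}=\overline{T_{1,0}}=\ker(\mathcal{J}+i)$ in $H\otimes\mathbb{C}$. $\Lambda^{1,0}$ (resp. $\Lambda^{0,1}$) is the annihilator in $T^*_{\mathbb{C}}M$ of $T_{0,1}\oplus(\mathcal{N}\otimes\mathbb{C})$ (resp. $T_{1,0}\oplus(\mathcal{N}\otimes\mathbb{C})$), and $\Lambda^{p,q}=(\Lambda^{1,0})^p\wedge(\Lambda^{0,1})^q$, so that $\Lambda^*_{\mathbb{C}}H^*=\bigoplus_{p,q=0}^n\Lambda^{p,q}=:\Lambda^{*,*}$; $g_H^*$ is the induced Hermitian metric on $\Lambda^{*,*}$. Involution: on $H$, $\underline{X+\mathcal{J}Y}=X-\mathcal{J}Y$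 for $X,Y$ sections of $L$; on $H\otimes\mathbb{C}$, $\underline{X+iY}=\underline{X}-i\underline{Y}$ for $X,Y$ sections of $H$ (antilinear, preserving $T_{1,0}$ and $T_{0,1}$). By duality ($\underline{\alpha}(X)=\overline{\alpha(\underline{X})}$, extended multiplicatively) it gives an antilinear involution of $\Lambda^{*,*}$ preserving bidegree. Chirality operator: with $v_H$ the volume form of $g_H$ ($H$ oriented by $\mathcal{J}$), seen as a section of $\Lambda^{n,n}$, the operator $\star:\Lambda^{p,q}\to\Lambda^{n-p,n-q}$ is determined by $\beta\wedge\underline{\star\alpha}=g_H^*(\beta,\alpha)v_H$ for all $\alpha,\beta\in C^\infty(M,\Lambda^{p,q})$. Set $\gamma=i^{n+(p+q)^2}\star$ on $\Lambda^{p,q}$. $\bar\partial_H$: for $\eta\in C^\infty(M,\Lambda^{p,q})$, $\bar\partial_H\eta\in C^\infty(M,\Lambda^{p,q+1})$ is the $\Lambda^{p,q+1}$-component of $d\eta$ with respect to the splitting of $\Lambda^*T^*_{\mathbb{C}}M$ into $\bigoplus\Lambda^{p,q}$ and the ideal generated by the annihilator of $H$. $\bar\partial_H^*$ is its formal adjoint for the $L^2$ inner product given by $g_H^*$ and a fixed smooth positive density on $M$. Admissible frames: given a local orthonormal frame $X_1,\dots,X_n$ of $L$, put $Z_j=\frac1{\sqrt2}(X_j-i\mathcal{J}X_j)$, $Z_{\bar j}=\frac1{\sqrt2}(X_j+i\mathcal{J}X_j)$; frames $\{Z_j,Z_{\bar j}\}$ of $H\otimes\mathbb{C}$ so obtained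 are called admissible (they are orthonormal). With $\{\theta^j,\theta^{\bar j}\}$ the dual coframe, for $J=\{j_1<\dots<j_p\}$, $K=\{k_1<\dots<k_q\}$ set $\theta^{J,\bar K}=\theta^{j_1}\wedge\cdots\wedge\theta^{j_p}\wedge\theta^{\bar{k_1}}\wedge\cdots\wedge\theta^{\bar{k_q}}$; these form an orthonormal frame of $\Lambda^{*,*}$. $\varepsilon(\theta^{\bar j})$ is exterior multiplication (on the left) by $\theta^{\bar j}$; $\iota(\theta^j)$ is contraction of forms with the vector field $Z_{\bar j}$. $\mathrm{O}_H(1)$ denotes a differential operator of order at most one (with smooth matrix coefficients) involving only differentiations along $H\otimes\mathbb{C}$. In the formulas, the vector fields act componentwise in the given trivialization. $\Lambda^{*,0}=\bigoplus_p\Lambda^{p,0}$ and $\Lambda^{*,n}=\bigoplus_p\Lambda^{p,n}$. *)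

(* Defs.v *)
From HB Require Import structures.
From mathcomp Require Import all_boot all_order all_algebra.
From mathcomp Require Import all_classical all_reals all_analysis.
From mathcomp Require Import complex.

Set Implicit Arguments.
Unset Strict Implicit.
Unset Printing Implicit Defensive.
Import Order.TTheory GRing.Theory Num.Theory.
Import numFieldNormedType.Exports.
Local Open Scope ring_scope.

Section ExteriorAlgebra.
Variables (R : rcfType) (m : nat).
Local Notation C := R[i].

(* A complex exterior form on R^m, given by its coefficients on the basis
   e^S = e^{s_1} /\ ... /\ e^{s_k}, S = {s_1 < ... < s_k}. *)
Definition ext := {ffun {set 'I_m} -> C^o}.

Definition inversions (I K : {set 'I_m}) : nat :=
  #|[set p : 'I_m * 'I_m | [&& p.1 \in I, p.2 \in K & (p.2 < p.1)%N]]|.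

Definition ewedge (a b : ext) : ext :=
  [ffun S : {set 'I_m} => \sum_(I : {set 'I_m} | I \subset S)
    (-1) ^+ inversions I (S :\: I) * a I * b (S :\: I)].

Definition ext_one : ext := [ffun S => (S == finset.set0)%:R].

(* 1-forms are rows of coefficients (xi_j) of xi = sum_j xi_j e^j. *)
Definition ext_of_covec (xi : 'rV[C]_m) : ext :=
  [ffun S => \sum_(j < m | S == [set j]) xi 0 j].

Definition wedge_covecs (s : seq 'rV[C]_m) : ext :=
  foldr (fun xi w => ewedge (ext_of_covec xi) w) ext_one s.

Definition pairing (xi v : 'rV[C]_m) : C := \sum_(j < m) xi 0 j * v 0 j.

(* (ext_contr v w)(v_2, ..., v_k) = w(v, v_2, ..., v_k) *)
Definition ext_contr (v : 'rV[C]_m) (w : ext) : ext :=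
  [ffun S : {set 'I_m} => \sum_(j < m | j \notin S)
    (-1) ^+ #|[set i in S | (i < j)%N]| * v 0 j * w (j |: S)].

(* The value w(v_1, ..., v_k) of the degree k component of w. *)
Definition ext_eval (w : ext) (vs : seq 'rV[C]_m) : C :=
  foldl (fun w' v => ext_contr v w') w vs finset.set0.

(* The pullback of w under v |-> v *m A, i.e. the multiplicative extension of
   the map of 1-forms sending e^j to the j-th column of A. *)
Definition pullback (A : 'M[C]_m) (w : ext) : ext :=
  \sum_(S : {set 'I_m}) w S *: wedge_covecs [seq (col j A)^T | j <- enum S].

Definition ext_conj (w : ext) : ext := [ffun S => conjc (w S)].

Definition ext_span (A : set ext) : set ext :=
  [set w | exists (k : nat) (a : 'I_k -> C) (e : 'I_k -> ext),
     (forall i, A (e i)) /\ w = \sum_(i < k) a i *: e i].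

Definition toCv (u : 'rV[R]_m) : 'rV[C]_m := map_mx (real_complex R) u.
Definition toCm (A : 'M[R]_m) : 'M[C]_m := map_mx (real_complex R) A.
Definition Re_vec (w : 'rV[C]_m) : 'rV[R]_m := map_mx (@complex.Re R) w.
Definition Im_vec (w : 'rV[C]_m) : 'rV[R]_m := map_mx (@complex.Im R) w.

End ExteriorAlgebra.

Local Open Scope classical_set_scope.

Section Smooth.
Variables (R : realType) (m : nat).
Local Notation C := R[i].

Definition evec (j : 'I_m) : 'rV[R]_m := delta_mx 0 j.

Fixpoint Ck_on (k : nat) (O : set 'rV[R]_m) (f : 'rV[R]_m -> R) : Prop :=
  match k with
  | 0 => forall x, O x -> {for x, continuous f}
  | k'.+1 => forall j : 'I_m,
      (forall x, O x -> derivable f x (evec j)) /\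
      Ck_on k' O (fun x => 'D_(evec j) f x)
  end.

Definition smooth_on (O : set 'rV[R]_m) (f : 'rV[R]_m -> R) : Prop :=
  forall k, Ck_on k O f.

Definition smoothC_on (O : set 'rV[R]_m) (f : 'rV[R]_m -> C) : Prop :=
  smooth_on O (fun x => complex.Re (f x)) /\
  smooth_on O (fun x => complex.Im (f x)).

Definition partialC (j : 'I_m) (f : 'rV[R]_m -> C) (x : 'rV[R]_m) : C :=
  ('D_(evec j) (fun y => complex.Re (f y)) x +i*
   'D_(evec j) (fun y => complex.Im (f y)) x)%C.

End Smooth.

(* Iterated Lebesgue integral over R^m; it is only applied to continuous
   compactly supported functions. *)
Fixpoint iter_integral (R : realType) (m : nat) : ('rV[R]_m -> R) -> R :=
  match m with
  | 0 => fun f => f 0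
  | m'.+1 => fun f =>
      (\int[@lebesgue_measure R]_t
         iter_integral (fun y : 'rV[R]_m' =>
           f (row_mx (t%:M : 'rV[R]_1) y : 'rV[R]_(1 + m'))))%R
  end.

Record chart (R : realType) (m : nat) (T : topologicalType) := Chart {
  cdom : set T;
  cmap : T -> 'rV[R]_m;
  cinv : 'rV[R]_m -> T;
  cdom_open : open cdom;
  cimg_open : open (cmap @` cdom);
  cmapK : forall x, cdom x -> cinv (cmap x) = x;
  cmap_continuous : forall x, cdom x -> {for x, continuous cmap};
  cinv_continuous : forall y, (cmap @` cdom) y -> {for y, continuous cinv}
}.

(* Any choice of a chart around each point will do for chart_at: it only serves
   to give the tangent spaces a concrete model. A tangent vector at x is
   represented by its coordinates in chart_at x. *)
Record manifold (R : realType) (m : nat) := Manifold {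
  mcarrier :> ptopologicalType;
  mhausdorff : hausdorff_space mcarrier;
  msecond_countable : @second_countable mcarrier;
  atlas : set (chart R m mcarrier);
  chart_at : mcarrier -> chart R m mcarrier;
  chart_at_atlas : forall x, atlas (chart_at x);
  chart_at_dom : forall x, cdom (chart_at x) x;
  atlas_smooth : forall c d, atlas c -> atlas d -> forall j : 'I_m,
    smooth_on (cmap c @` (cdom c `&` cdom d)) (fun y => cmap d (cinv c y) 0 j)
}.

Section ManifoldCalculus.
Variables (R : realType) (m : nat) (M : manifold R m).
Local Notation C := R[i].
Local Notation V := 'rV[R]_m.
Local Notation ext := (ext R m).

Definition transition_jac (c d : chart R m M) (x : M) : 'M[R]_m :=
  jacobian (fun y : V => cmap d (cinv c y)) (cmap c x).

(* Coordinates in the chart c of a tangent vector, resp. a form, at x. *)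
Definition vec_in (c : chart R m M) (x : M) (v : V) : V :=
  v *m transition_jac (chart_at x) c x.

Definition form_in (c : chart R m M) (x : M) (w : ext) : ext :=
  pullback (toCm (transition_jac c (chart_at x) x)) w.

Definition smooth_fun (U : set M) (f : M -> R) : Prop :=
  forall c, atlas c -> smooth_on (cmap c @` (U `&` cdom c)) (f \o cinv c).

Definition smoothC_fun (U : set M) (f : M -> C) : Prop :=
  forall c, atlas c -> smoothC_on (cmap c @` (U `&` cdom c)) (f \o cinv c).

Definition smooth_vfield (U : set M) (X : M -> V) : Prop :=
  forall c, atlas c -> forall j : 'I_m,
    smooth_on (cmap c @` (U `&` cdom c))
      (fun y => vec_in c (cinv c y) (X (cinv c y)) 0 j).

Definition smooth_form (U : set M) (w : M -> ext) : Prop :=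
  forall c, atlas c -> forall S : {set 'I_m},
    smoothC_on (cmap c @` (U `&` cdom c))
      (fun y => form_in c (cinv c y) (w (cinv c y)) S).

Definition vfield_act (Z : M -> 'rV[C]_m) (f : M -> C) (x : M) : C :=
  \sum_(j < m) Z x 0 j *
    partialC j (f \o cinv (chart_at x)) (cmap (chart_at x) x).

(* d w = sum_j dx^j /\ (dw/dx^j), computed at x in the chart chart_at x. *)
Definition ext_d (w : M -> ext) (x : M) : ext :=
  let c := chart_at x in
  \sum_(j < m) ewedge (ext_of_covec (delta_mx 0 j))
    [ffun S => partialC j
       (fun y => form_in c (cinv c y) (w (cinv c y)) S) (cmap c x)].

Definition subbundle (r : nat) (S : M -> {vspace V}) : Prop :=
  forall x0 : M, exists (U : set M) (E : 'I_r -> M -> V),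
    [/\ open U, U x0, forall i, smooth_vfield U (E i) &
      forall x, U x -> basis_of (S x) [seq E i x | i <- enum 'I_r]].

Definition borel := g_sigma_algebraType (@open M).

(* A smooth positive density, seen as the measure that it defines: in each
   chart it is a smooth positive multiple of the Lebesgue measure. *)
Definition smooth_positive_density (mu : {measure set borel -> \bar R}) : Prop :=
  forall c, atlas c -> exists rho : V -> R,
    [/\ smooth_on (cmap c @` cdom c) rho,
        forall y, (cmap c @` cdom c) y -> 0 < rho y &
        forall f : M -> R, continuous f -> (forall x, 0 <= f x) ->
          compact (closure [set x | f x != 0]) ->
          closure [set x | f x != 0] `<=` cdom c ->
          (\int[mu]_x (f x)%:E)%E =
          (iter_integral (fun y => if y \in cmap c @` cdom c
                                   then f (cinv c y) * rho y else 0))%:E].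

Definition integralC (mu : {measure set borel -> \bar R}) (f : M -> C) : C :=
  ((\int[mu]_x (complex.Re (f x)))%R +i* (\int[mu]_x (complex.Im (f x)))%R)%C.

End ManifoldCalculus.

Record real_CR (R : realType) (m : nat) (M : manifold R m) (n : nat) := RealCR {
  crH : M -> {vspace 'rV[R]_m};
  crJ : M -> 'End('rV[R]_m);      (* only its restriction to H is relevant *)
  crL : M -> {vspace 'rV[R]_m};
  crg : M -> 'M[R]_m;             (* only its restriction to L is relevant *)
  crN : M -> {vspace 'rV[R]_m};
  crH_subbundle : subbundle n.*2 crH;
  crJ_H : forall x u, u \in crH x -> crJ x u \in crH x;
  crJ_sqr : forall x u, u \in crH x -> crJ x (crJ x u) = - u;
  crJ_smooth : forall (U : set M) (X : M -> 'rV[R]_m), open U ->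
    smooth_vfield U X -> (forall x, U x -> X x \in crH x) ->
    smooth_vfield U (fun x => crJ x (X x));
  crL_subbundle : subbundle n crL;
  crL_sum : forall x, (crL x + (crJ x @: crL x))%VS = crH x;
  crL_direct : forall x, (crL x :&: (crJ x @: crL x))%VS = 0%VS;
  crg_sym : forall x u v, u \in crL x -> v \in crL x ->
    (u *m crg x *m v^T) 0 0 = (v *m crg x *m u^T) 0 0;
  crg_pos : forall x u, u \in crL x -> u != 0 -> 0 < (u *m crg x *m u^T) 0 0;
  crg_smooth : forall (U : set M) (X Y : M -> 'rV[R]_m), open U ->
    smooth_vfield U X -> smooth_vfield U Y ->
    (forall x, U x -> X x \in crL x) -> (forall x, U x -> Y x \in crL x) ->
    smooth_fun U (fun x => (X x *m crg x *m (Y x)^T) 0 0);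
  crN_subbundle : subbundle (m - n.*2) crN;
  crN_sum : forall x, (crH x + crN x)%VS = fullv;
  crN_direct : forall x, (crH x :&: crN x)%VS = 0%VS
}.

Section CRGeometry.
Variables (R : realType) (m : nat) (M : manifold R m) (n : nat).
Variable S : real_CR M n.
Local Notation C := R[i].
Local Notation V := 'rV[R]_m.
Local Notation VC := 'rV[C]_m.
Local Notation ext := (ext R m).

Definition gL (x : M) (u v : V) : R := (u *m crg S x *m v^T) 0 0.

Definition JL (x : M) : {vspace V} := (crJ S x @: crL S x)%VS.

Definition projL (x : M) (u : V) : V := daddv_pi (crL S x) (JL x) u.
Definition projJL (x : M) (u : V) : V := daddv_pi (JL x) (crL S x) u.
Definition projH (x : M) (u : V) : V := daddv_pi (crH S x) (crN S x) u.

Definition gL_ext (x : M) (u v : V) : R := gL x (projL x u) (projL x v).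

Definition gH (x : M) (u v : V) : R :=
  gL_ext x u v + gL_ext x (crJ S x u) (crJ S x v).

Definition HC (x : M) : set VC :=
  [set w | Re_vec w \in crH S x /\ Im_vec w \in crH S x].
Definition NC (x : M) : set VC :=
  [set w | Re_vec w \in crN S x /\ Im_vec w \in crN S x].

Definition JC (x : M) (w : VC) : VC :=
  toCv (crJ S x (Re_vec w)) + 'i%C *: toCv (crJ S x (Im_vec w)).

Definition T10 (x : M) : set VC := [set w | HC x w /\ JC x w = 'i%C *: w].
Definition T01 (x : M) : set VC := [set w | HC x w /\ JC x w = - 'i%C *: w].

Definition annihilator (A : set VC) : set VC :=
  [set xi | forall v, A v -> pairing xi v = 0].

Definition Lambda10 (x : M) : set VC := annihilator (T01 x `|` NC x).
Definition Lambda01 (x : M) : set VC := annihilator (T10 x `|` NC x).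

Definition Lambda (p q : nat) (x : M) : set ext :=
  ext_span [set w | exists a b : seq VC,
    [/\ size a = p, size b = q, [set` a] `<=` Lambda10 x,
        [set` b] `<=` Lambda01 x & w = wedge_covecs (a ++ b)]].

Definition LambdaH (x : M) : set ext :=
  ext_span [set w | exists p q, Lambda p q x w].

(* The Lambda^{p,q}-component with respect to the splitting into the
   Lambda^{p',q'} and the ideal generated by the annihilator of H. *)
Definition component (p q : nat) (x : M) (w : ext) : ext :=
  xget 0 [set a | Lambda p q x a /\
    ext_span [set b | (exists p' q', (p', q') <> (p, q) /\ Lambda p' q' x b) \/
                      (exists xi c, annihilator (HC x) xi /\
                                    b = ewedge (ext_of_covec xi) c)]
      (w - a)].

Definition section (w : M -> ext) : Prop :=
  smooth_form setT w /\ forall x, LambdaH x (w x).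

(* The cometric: xi |-> xi *m cometric x is the musical map T^*M -> H,
   which factors through the restriction T^*M -> H^*. *)
Definition cometric (x : M) : 'M[R]_m :=
  xget 0 [set G | forall xi : V, xi *m G \in crH S x /\
    forall v, v \in crH S x -> gH x (xi *m G) v = (xi *m v^T) 0 0].

(* The Hermitian metric induced by gH on forms, linear in the first variable:
   the conjugate of b is turned into a multivector by the multiplicative
   extension of the (symmetric) cometric, and paired with a. Hence
   gstar (a_1 /\ .. /\ a_k) (b_1 /\ .. /\ b_k) = det (gstar a_i b_j). *)
Definition gstar (x : M) (a b : ext) : C :=
  \sum_(I : {set 'I_m}) a I * pullback (toCm (cometric x)) (ext_conj b) I.

(* The matrix of the involution X + JY |-> X - JY of H, extended by 0 on N. *)
Definition involution_mx (x : M) : 'M[R]_m :=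
  lin1_mx (fun u => projL x (projH x u) - projJL x (projH x u)).

(* a |-> (X |-> conj (a (underline X))); on a real vector X the antilinear
   extension of the involution to H (x) C is the involution of H. *)
Definition underline (x : M) (w : ext) : ext :=
  pullback (toCm (involution_mx x)) (ext_conj w).

(* Orientation of H: the frames (e_1, J e_1, ..., e_n, J e_n) are positive. *)
Definition J_frame (x : M) (e : 'I_n -> V) : seq V :=
  flatten [seq [:: e j; crJ S x (e j)] | j <- enum 'I_n].

Definition volume_form (x : M) : ext :=
  xget 0 [set v | Lambda n n x v /\
    forall e : 'I_n -> V,
      (forall j, e j \in crH S x) ->
      (forall j k, gH x (e j) (e k) = (j == k)%:R /\
                   gH x (e j) (crJ S x (e k)) = 0 /\
                   gH x (crJ S x (e j)) (crJ S x (e k)) = (j == k)%:R) ->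
      ext_eval v [seq toCv u | u <- J_frame x e] = 1].

Definition star (p q : nat) (x : M) (a : ext) : ext :=
  xget 0 [set s | Lambda (n - p) (n - q) x s /\
    forall b, Lambda p q x b ->
      ewedge b (underline x s) = gstar x b a *: volume_form x].

Definition chirality (x : M) (w : ext) : ext :=
  \sum_(p < n.+1) \sum_(q < n.+1)
    ('i%C ^+ (n + (p + q) ^ 2)%N : C) *: star p q x (component p q x w).

Definition dbarH (w : M -> ext) (x : M) : ext :=
  \sum_(p < n.+1) \sum_(q < n.+1)
    component p q.+1 x (ext_d (fun y => component p q y (w y)) x).

Definition inner_L2 (mu : {measure set (borel M) -> \bar R})
    (a b : M -> ext) : C := integralC mu (fun x => gstar x (a x) (b x)).

Definition formal_adjoint (mu : {measure set (borel M) -> \bar R})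
    (D Dstar : (M -> ext) -> M -> ext) : Prop :=
  (forall w, section w -> section (Dstar w)) /\
  (forall a b, section a -> section b ->
     compact (closure [set x | a x != 0]) \/
     compact (closure [set x | b x != 0]) ->
     inner_L2 mu (D a) b = inner_L2 mu a (Dstar b)).

Definition QL (dbarHstar : (M -> ext) -> M -> ext) (w : M -> ext) (x : M) : ext :=
  let A := fun a y => dbarHstar (dbarH a) y - dbarH (dbarHstar a) y in
  A w x - chirality x (A (fun y => chirality y (w y)) x).

Definition orthonormal_frameL (U : set M) (X : 'I_n -> M -> V) : Prop :=
  (forall j, smooth_vfield U (X j)) /\
  (forall x, U x -> forall j, X j x \in crL S x) /\
  (forall x, U x -> forall j k, gL x (X j x) (X k x) = (j == k)%:R).

Definition Zf (X : 'I_n -> M -> V) (j : 'I_n) (x : M) : VC :=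
  ((Num.sqrt 2)^-1)%:C%C *: (toCv (X j x) - 'i%C *: toCv (crJ S x (X j x))).
Definition Zbarf (X : 'I_n -> M -> V) (j : 'I_n) (x : M) : VC :=
  ((Num.sqrt 2)^-1)%:C%C *: (toCv (X j x) + 'i%C *: toCv (crJ S x (X j x))).

(* Elements of H^* are identified with 1-forms vanishing on N. *)
Definition dual_coframe (U : set M) (Z Zbar th thbar : 'I_n -> M -> VC) : Prop :=
  forall x, U x -> forall j,
    [/\ annihilator (NC x) (th j x), annihilator (NC x) (thbar j x),
        forall k, pairing (th j x) (Z k x) = (j == k)%:R /\
                  pairing (th j x) (Zbar k x) = 0 &
        forall k, pairing (thbar j x) (Zbar k x) = (j == k)%:R /\
                  pairing (thbar j x) (Z k x) = 0].

Definition theta (th thbar : 'I_n -> M -> VC) (J K : {set 'I_n}) (x : M) : ext :=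
  wedge_covecs ([seq th j x | j <- enum J] ++ [seq thbar k x | k <- enum K]).

Definition frame_expand (I : finType) (Th : I -> M -> ext) (f : I -> M -> C) (x : M) :
  ext := \sum_(i : I) f i x *: Th i x.

(* P is O_H(1) on U in a trivialization with index set I; the Z_j, Z_jbar are a
   frame of H (x) C, so they give all the differentiations along H (x) C. *)
Definition OH1 (U : set M) (Z Zbar : 'I_n -> M -> VC) (I : finType)
    (P : (I -> M -> C) -> I -> M -> C) : Prop :=
  exists (A Abar : 'I_n -> I -> I -> M -> C) (B : I -> I -> M -> C),
    [/\ forall j i i', smoothC_fun U (A j i i'),
        forall j i i', smoothC_fun U (Abar j i i'),
        forall i i', smoothC_fun U (B i i') &
        forall f i x, U x ->
          P f i x = \sum_(i' : I)
            (\sum_(j < n) (A j i i' x * vfield_act (Z j) (f i') x +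
                           Abar j i i' x * vfield_act (Zbar j) (f i') x) +
             B i i' x * f i' x)].

Definition eps_bar (thbar : 'I_n -> M -> VC) (j : 'I_n) (x : M) (w : ext) : ext :=
  ewedge (ext_of_covec (thbar j x)) w.

(* iota(theta^j) is by convention the contraction with Z_jbar, not Z_j. *)
Definition iota_th (Zbar : 'I_n -> M -> VC) (j : 'I_n) (x : M) (w : ext) : ext :=
  ext_contr (Zbar j x) w.

End CRGeometry.

(* Main.v *)
(* In an adapted frame Z_j, Zbar_j, N_l the form bundle is trivial and every
   fibrewise object of the statement becomes an operator on exterior forms of C^m:
   the metric is the standard one and gamma is, up to powers of i, the
   complementation of index sets, so that gamma^2 = 1 and gamma exchanges
   e_j = eps(theta^jbar) and c_j = iota(theta^j): gamma c_j = - i e_j gamma and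
   gamma e_j = i c_j gamma. To first order dbar_H = sum_j e_j Zbar_j. Integrating
   by parts against bump forms, dbar_H^* = - sum_j c_j Z_j to first order.
   Therefore, modulo O_H(1),
     A := dbar_H^* dbar_H - dbar_H dbar_H^* = sum_jk (e_j c_k Zbar_j Z_k - c_k e_j Z_k Zbar_j),
     gamma A gamma = sum_jk (c_j e_k Zbar_j Z_k - e_k c_j Z_k Zbar_j),
   and subtracting gives the formula for Q_L; no commutator of vector fields is
   needed. On forms of type ( *, 0) and ( *, n) the operators c_j, resp. e_j,
   vanish, so e_j c_k - c_j e_k reduces to -delta_jk, resp. delta_jk. *)

Require Import Defs.
From HB Require Import structures.
From mathcomp Require Import all_boot all_order all_algebra.
From mathcomp Require Import all_classical all_reals all_analysis.
From mathcomp Require Import complex ring lra zify.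
Set Implicit Arguments.
Unset Strict Implicit.
Unset Printing Implicit Defensive.
Import Order.TTheory GRing.Theory Num.Theory.
Import numFieldNormedType.Exports.
Local Open Scope ring_scope.

(** What shapes the proof is that hardly anything is given in closed form. The component, the star,
    the volume form and the cometric are chosen solutions of a characterization, so each has to be
    identified in coordinates through existence and uniqueness. The operator [dbarHstar] is any map
    of global sections that satisfies the adjunction: its locality, its first order form and the
    smoothness of its coefficients are all extracted from global test sections chi theta^T that
    vanish outside a ball in a chart. No commutator appears because the two terms of A already carry
    the derivatives in the orders Zbar_j Z_k and Z_k Zbar_j. Conjugation by gamma keeps these orders
    and exchanges e with c, and renaming j and k in one term of each sum lines up the coefficients.
    The second formula is more than a specialization of the first: its O_H(1) term must not leave
    the types (p,0) and (p,n). Hence the zeroth order terms are followed too, with the change that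
    they make to the second degree. *)

Lemma sum_mul_delta (A : pzSemiRingType) (I : finType) (f : I -> A) i :
  \sum_j f j * (i == j)%:R = f i.
Proof.
rewrite (bigD1 i) //= eqxx mulr1 big1 ?addr0 // => j /negPf ne.
by rewrite eq_sym ne mulr0.
Qed.

Lemma lin_aux (A : comPzRingType) (V : lmodType A) (c k : A) (a b x y : V) :
  c *: (k *: a + b) - (k *: x + y) = k *: (c *: a - x) + (c *: b - y).
Proof. by rewrite !scalerDr scalerA mulrC -scalerA scalerN opprD addrACA. Qed.

Lemma anti_aux (V : zmodType) (x y z : V) : y - (z + x) + (z - (y - x)) = 0.
Proof. by rewrite opprB (addrA z x) addrA subrK subrr. Qed.

Lemma sign_addnn (A : pzRingType) n : (-1) ^+ (n + n) = 1 :> A.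
Proof. by rewrite addnn -signr_odd odd_double. Qed.

(** * Exterior algebra *)

Section ExtAlgebra.
Variables (R : rcfType) (m : nat).
Local Notation C := R[i].
Local Notation ext := (ext R m).
Implicit Types (w a b c : ext) (S T : {set 'I_m}) (xi ze u v : 'rV[C]_m).

Lemma extZE k w S : (k *: w) S = k * w S.
Proof. by rewrite /GRing.scale /= ffunE. Qed.

Lemma extDE a b S : (a + b) S = a S + b S.
Proof. by rewrite [LHS]ffunE. Qed.

Lemma extNE a S : (- a) S = - a S.
Proof. by rewrite [LHS]ffunE. Qed.

Lemma ext0E S : (0 : ext) S = 0.
Proof. by rewrite [LHS]ffunE. Qed.

Lemma ext_sumE I (r : seq I) P (F : I -> ext) S :
  (\sum_(i <- r | P i) F i) S = \sum_(i <- r | P i) F i S.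
Proof. exact: sum_ffunE. Qed.

Lemma ewedgeE a b S : ewedge a b S =
  \sum_(I : {set 'I_m} | I \subset S) (-1) ^+ inversions I (S :\: I) * a I * b (S :\: I).
Proof. by rewrite [LHS]ffunE. Qed.

Lemma contrE v w S : ext_contr v w S =
  \sum_(j < m | j \notin S) (-1) ^+ #|[set i in S | (i < j)%N]| * v 0 j * w (j |: S).
Proof. by rewrite [LHS]ffunE. Qed.

Lemma ext_of_covec_coef xi S : ext_of_covec xi S = \sum_(j < m | S == [set j]) xi 0 j.
Proof. by rewrite [LHS]ffunE. Qed.

Definition eb S : ext := [ffun T => (T == S)%:R].

Lemma ebE S T : eb S T = (T == S)%:R.
Proof. by rewrite [LHS]ffunE. Qed.

Lemma ext_eb w : w = \sum_S w S *: eb S.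
Proof.
apply/ffunP => T; rewrite ext_sumE -[LHS](sum_mul_delta (w : _ -> C)).
by apply: eq_bigr => S _; rewrite extZE ebE.
Qed.

Lemma ext_one_eb : ext_one R m = eb finset.set0.
Proof. by []. Qed.

Definition eps xi w : ext := ewedge (ext_of_covec xi) w.

Lemma ewedge_linear_r a : linear (ewedge a).
Proof.
move=> k b c; apply/ffunP => S; rewrite extDE extZE !ewedgeE mulr_sumr -big_split.
by apply: eq_bigr => I _ /=; rewrite extDE extZE; ring.
Qed.

Lemma ewedge_linear_l b : linear (fun a : ext => ewedge a b).
Proof.
move=> k a c; apply/ffunP => S; rewrite extDE extZE !ewedgeE mulr_sumr -big_split.
by apply: eq_bigr => I _ /=; rewrite extDE extZE; ring.
Qed.

HB.instance Definition _ a := GRing.isLinear.Build C ext ext *:%R (ewedge a) (ewedge_linear_r a).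
HB.instance Definition _ xi := GRing.isLinear.Build C ext ext *:%R (eps xi) (ewedge_linear_r (ext_of_covec xi)).

Lemma ewedge_suml I (r : seq I) P (F : I -> ext) b :
  ewedge (\sum_(i <- r | P i) F i) b = \sum_(i <- r | P i) ewedge (F i) b.
Proof.
elim/big_rec2: _ => [|i x y _ <-].
  by have := ewedge_linear_l b (-1) 0 0; rewrite scaler0 addr0 scaleN1r addNr.
by have := ewedge_linear_l b 1 (F i) y; rewrite !scale1r.
Qed.

Lemma ewedge0l b : ewedge (0 : ext) b = 0.
Proof. by have := ewedge_linear_l b (-1) 0 0; rewrite scaler0 addr0 scaleN1r addNr. Qed.

Lemma ewedgeZl k a b : ewedge (k *: a) b = k *: ewedge a b.
Proof. by have := ewedge_linear_l b k a 0; rewrite /= ewedge0l !addr0. Qed.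

Lemma ewedgeDl a c b : ewedge (a + c) b = ewedge a b + ewedge c b.
Proof. by have := ewedge_linear_l b 1 a c; rewrite !scale1r. Qed.

Lemma ext_of_covecE xi : ext_of_covec xi = \sum_j xi 0 j *: eb [set j].
Proof.
apply/ffunP => S; rewrite ext_of_covec_coef ext_sumE [in LHS]big_mkcond; apply: eq_bigr => j _.
by rewrite extZE ebE; case: eqP; rewrite ?mulr1 ?mulr0.
Qed.

Lemma ext_of_covec_linear : linear (@ext_of_covec R m).
Proof.
move=> k u v; rewrite !ext_of_covecE scaler_sumr -big_split; apply: eq_bigr => j _.
by rewrite !mxE scalerDl scalerA.
Qed.

Lemma ext_of_covec_delta j : ext_of_covec (delta_mx 0 j) = eb [set j].
Proof.
rewrite ext_of_covecE (bigD1 j) //= mxE !eqxx scale1r big1 ?addr0 // => i /negPf ne.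
by rewrite mxE ne scale0r.
Qed.

Lemma epsDl u v w : eps (u + v) w = eps u w + eps v w.
Proof. by rewrite /eps -ewedgeDl -[u in LHS]scale1r ext_of_covec_linear scale1r. Qed.

Lemma epsZl k u w : eps (k *: u) w = k *: eps u w.
Proof.
have E0 : ext_of_covec (0 : 'rV[C]_m) = 0.
  by rewrite ext_of_covecE big1 // => j _; rewrite mxE scale0r.
by rewrite /eps -ewedgeZl -[k *: u]addr0 ext_of_covec_linear E0 addr0.
Qed.

Lemma eps_sum xi w : eps xi w = \sum_j xi 0 j *: eps (delta_mx 0 j) w.
Proof.
rewrite /eps ext_of_covecE ewedge_suml; apply: eq_bigr => j _.
by rewrite ewedgeZl ext_of_covec_delta.
Qed.

Lemma eps0l w : eps 0 w = 0.
Proof. by rewrite eps_sum big1 // => j _; rewrite mxE scale0r. Qed.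

Lemma contr_linear v : linear (ext_contr v).
Proof.
move=> k b c; apply/ffunP => S; rewrite extDE extZE !contrE mulr_sumr -big_split.
by apply: eq_bigr => I _ /=; rewrite extDE extZE; ring.
Qed.

HB.instance Definition _ v := GRing.isLinear.Build C ext ext *:%R (ext_contr v) (contr_linear v).

Lemma contr_linear_l w : linear (fun v => ext_contr v w).
Proof.
move=> k u v; apply/ffunP => S; rewrite extDE extZE !contrE mulr_sumr -big_split.
by apply: eq_bigr => I _ /=; rewrite !mxE; ring.
Qed.

Lemma contrDl u v w : ext_contr (u + v) w = ext_contr u w + ext_contr v w.
Proof. by have := contr_linear_l w 1 u v; rewrite !scale1r. Qed.

Lemma contr0l w : ext_contr 0 w = 0.
Proof. by have := contr_linear_l w (-1) 0 0; rewrite scaler0 addr0 scaleN1r addNr. Qed.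

Lemma contrZl k u w : ext_contr (k *: u) w = k *: ext_contr u w.
Proof. by have := contr_linear_l w k u 0; rewrite /= contr0l !addr0. Qed.

Lemma contr_suml I (r : seq I) P (F : I -> 'rV[C]_m) w :
  ext_contr (\sum_(i <- r | P i) F i) w = \sum_(i <- r | P i) ext_contr (F i) w.
Proof.
by elim/big_rec2: _ => [|i x y _ <-]; rewrite ?contr0l ?contrDl.
Qed.

Lemma contr_sum v w : ext_contr v w = \sum_j v 0 j *: ext_contr (delta_mx 0 j) w.
Proof.
rewrite {1}[v]row_sum_delta contr_suml.
by apply: eq_bigr => j _; rewrite contrZl.
Qed.

(** The exponent of the sign picked up when e^j is inserted into, or contracted out of, its sorted
    place in e^S. *)
Definition sg (j : 'I_m) S := #|[set i in S | (i < j)%N]|.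

Lemma sgE j S : sg j S = (\sum_(i in S) (i < j)%N)%N.
Proof.
rewrite /sg -sum1_card [LHS](eq_bigl (fun i => (i \in S) && (i < j)%N)); last by move=> i; rewrite inE.
by rewrite big_mkcondr; apply: eq_bigr => i _; case: ltnP.
Qed.

Lemma inversionsE S T : inversions S T = (\sum_(i in S) \sum_(j in T) (j < i)%N)%N.
Proof.
rewrite /inversions pair_big_dep /= -sum1_card.
rewrite [LHS](eq_bigl (fun p => ((p.1 \in S) && (p.2 \in T)) && (p.2 < p.1)%N)); last first.
  by move=> p; rewrite inE andbA.
by rewrite big_mkcondr; apply: eq_bigr => i _; case: ltnP.
Qed.

Lemma big_setU_disj S S' (F : 'I_m -> nat) : [disjoint S & S'] ->
  (\sum_(i in S :|: S') F i = \sum_(i in S) F i + \sum_(i in S') F i)%N.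
Proof. by move=> dS; rewrite -bigU //; apply: eq_bigl => i; rewrite !inE. Qed.

Lemma disjointUr S T T' : [disjoint S & T :|: T'] = [disjoint S & T] && [disjoint S & T'].
Proof. by rewrite -!setI_eq0 finset.setIUr finset.setU_eq0. Qed.

Lemma disjointUl S T T' : [disjoint T :|: T' & S] = [disjoint T & S] && [disjoint T' & S].
Proof. by rewrite -!setI_eq0 finset.setIUl finset.setU_eq0. Qed.

Lemma inversionsUl S S' T : [disjoint S & S'] ->
  inversions (S :|: S') T = (inversions S T + inversions S' T)%N.
Proof. by move=> dS; rewrite !inversionsE big_setU_disj. Qed.

Lemma inversionsUr S T T' : [disjoint T & T'] ->
  inversions S (T :|: T') = (inversions S T + inversions S T')%N.
Proof.
by move=> dS; rewrite !inversionsE -big_split; apply: eq_bigr => i _; rewrite big_setU_disj.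
Qed.

Lemma inversions1l j S : inversions [set j] S = sg j S.
Proof. by rewrite inversionsE big_set1 sgE. Qed.

(** In the sum that defines the product only I = S can contribute, and what is left must then be T;
    this happens exactly when S and T are disjoint. *)
Lemma ewedge_eb S T : ewedge (eb S) (eb T) =
  if [disjoint S & T] then (-1) ^+ inversions S T *: eb (S :|: T) else 0.
Proof.
apply/ffunP => V; rewrite ewedgeE.
have E : \sum_(I : {set 'I_m} | I \subset V)
    (-1) ^+ inversions I (V :\: I) * eb S I * eb T (V :\: I) =
   if (S \subset V) && (V :\: S == T) then (-1) ^+ inversions S T else 0 :> C.
  case: ifPn => [/andP[sSV /eqP E]|H].
    rewrite (bigD1 S) //= big1 ?addr0 => [|I /andP[_ /negPf ne]].
      by rewrite !ebE E !eqxx !mulr1.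
    by rewrite ebE ne mulr0 mul0r.
  rewrite big1 // => I sI; rewrite !ebE; case: eqP => [EI|]; last by rewrite mulr0 mul0r.
  by move: H; rewrite -EI sI /= => /negPf ->; rewrite mulr0.
rewrite E; case: ifP => [/andP[sSV /eqP ET]|H].
  have dST : [disjoint S & T] by rewrite -ET -setI_eq0 finset.setDE finset.setICA finset.setICr finset.setI0.
  rewrite dST extZE ebE -ET finset.setDE finset.setUIr finset.setUCr finset.setIT.
  by rewrite (finset.setUidPr sSV) eqxx mulr1.
case: ifP => [dST|]; last by rewrite ext0E.
rewrite extZE ebE; case: eqP => [EV|]; last by rewrite mulr0.
move: H; rewrite EV finset.subsetUl /= finset.setDUl finset.setDv finset.set0U.
by move: dST; rewrite disjoint_sym => /finset.setDidPl ->; rewrite eqxx.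
Qed.

Lemma epsP xi k a b : eps xi (k *: a + b) = k *: eps xi a + eps xi b.
Proof. exact: ewedge_linear_r. Qed.

Lemma contrP v k a b : ext_contr v (k *: a + b) = k *: ext_contr v a + ext_contr v b.
Proof. exact: contr_linear. Qed.

(** Both bracketings of a triple product of basis forms carry the same exponent, the sum of the
    three pairwise inversion counts. Associativity follows by trilinearity. *)
Lemma ewedge_eb3r S T V : ewedge (eb S) (ewedge (eb T) (eb V)) =
  if [&& [disjoint S & T], [disjoint S & V] & [disjoint T & V]] then
    (-1) ^+ (inversions S T + inversions S V + inversions T V) *: eb (S :|: T :|: V) else 0.
Proof.
rewrite [X in ewedge _ X]ewedge_eb; case dTV: [disjoint T & V]; last by rewrite linear0 !andbF.
rewrite linearZ /= ewedge_eb disjointUr andbT.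
case: ifP => dS; last by rewrite scaler0.
rewrite scalerA -exprD inversionsUr // finset.setUA; congr (_ ^+ _ *: _).
by rewrite addnC.
Qed.

Lemma ewedge_eb3l S T V : ewedge (ewedge (eb S) (eb T)) (eb V) =
  if [&& [disjoint S & T], [disjoint S & V] & [disjoint T & V]] then
    (-1) ^+ (inversions S T + inversions S V + inversions T V) *: eb (S :|: T :|: V) else 0.
Proof.
rewrite [X in ewedge X _]ewedge_eb; case dST: [disjoint S & T]; last by rewrite ewedge0l.
rewrite ewedgeZl ewedge_eb disjointUl /=.
case: ifP => dS; last by rewrite scaler0.
rewrite scalerA -exprD inversionsUl //; congr (_ ^+ _ *: _).
by rewrite addnA.
Qed.

Lemma ewedgeA a b c : ewedge a (ewedge b c) = ewedge (ewedge a b) c.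
Proof.
rewrite [a]ext_eb !ewedge_suml; apply: eq_bigr => I _; rewrite !ewedgeZl; congr (_ *: _).
rewrite [b]ext_eb [in RHS]linear_sum !ewedge_suml linear_sum; apply: eq_bigr => J _.
rewrite ewedgeZl !linearZ /= ewedgeZl; congr (_ *: _).
rewrite [c]ext_eb !linear_sum; apply: eq_bigr => K _.
by rewrite !linearZ /= ewedge_eb3r ewedge_eb3l.
Qed.

Lemma ewedge1l w : ewedge (ext_one R m) w = w.
Proof.
rewrite [w]ext_eb linear_sum; apply: eq_bigr => S _; rewrite linearZ /= ext_one_eb ewedge_eb.
rewrite -setI_eq0 finset.set0I eqxx finset.set0U inversionsE big_set0 expr0 scale1r.
by [].
Qed.

Lemma ewedge_epsl xi a b : ewedge (eps xi a) b = eps xi (ewedge a b).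
Proof. by rewrite /eps ewedgeA. Qed.

Lemma eps_eb j S : eps (delta_mx 0 j) (eb S) =
  if j \in S then 0 else (-1) ^+ sg j S *: eb (j |: S).
Proof.
rewrite /eps ext_of_covec_delta ewedge_eb inversions1l.
by rewrite disjoints1; case: (j \in S).
Qed.

Lemma contr_eb j S : ext_contr (delta_mx 0 j) (eb S) =
  if j \in S then (-1) ^+ sg j S *: eb (S :\ j) else 0.
Proof.
apply/ffunP => V; rewrite contrE.
rewrite (eq_bigr (fun i => if i == j then (-1) ^+ sg j V * eb S (j |: V) else 0)); last first.
  move=> i _; rewrite mxE eqxx /=; case: eqP => [->|]; last by rewrite mulr0 mul0r.
  by rewrite mulr1.
rewrite -big_mkcondr /=.
have [jV|jV] := boolP (j \in V).
  rewrite big_pred0; last by move=> i; case: eqP => [->|]; rewrite ?andbF // jV.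
  case: ifP => [_|]; last by rewrite ext0E.
  rewrite extZE ebE; case: eqP => [EV|_]; last by rewrite mulr0.
  by move: jV; rewrite EV !inE eqxx.
rewrite (big_pred1 j); last by move=> i /=; case: (eqVneq i j) => [->|]; rewrite ?andbF ?jV.
rewrite ebE; case: eqP => [<-|H].
  rewrite setU11 extZE ebE setU1K // eqxx !mulr1; congr (_ ^+ _).
  by apply: eq_card => i; rewrite !inE; case: eqP => [->|//]; rewrite ltnn !andbF.
case: ifP => [jS|]; last by rewrite ext0E mulr0.
rewrite extZE ebE; case: eqP => [EV|_]; last by rewrite !mulr0.
by case: H; rewrite EV finset.setD1K.
Qed.

(** Up to sign, e^S arises from 1 by wedging with its covectors one at a time. Identities between
    operators with a known commutation rule with [eps] thus need a computation only on 1. *)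
Lemma ext_ind (P : ext -> Prop) : P (ext_one R m) ->
  (forall xi w, P w -> P (eps xi w)) ->
  (forall k a b, P a -> P b -> P (k *: a + b)) -> forall w, P w.
Proof.
move=> P1 Pe PD w.
have P0 : P 0 by have := PD (-1) _ _ P1 P1; rewrite scaleN1r addNr.
have PZ k a : P a -> P (k *: a) by move=> Pa; have := PD k _ _ Pa P0; rewrite addr0.
rewrite [w]ext_eb; elim/big_rec: _ => // S x _ Px; apply: PD => //.
have [n] := ubnP #|S|; elim: n => // n IH in S *; rewrite ltnS => cS.
have [->|[j jS]] := set_0Vmem S; first by [].
have -> : eb S = (-1) ^+ sg j (S :\ j) *: eps (delta_mx 0 j) (eb (S :\ j)).
  by rewrite eps_eb !inE eqxx /= scalerA -expr2 sqrr_sign scale1r finset.setD1K.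
by apply: PZ; apply: Pe; apply: IH; rewrite (leq_trans _ cS) // [in X in (_ < X)%N](cardsD1 j) jS.
Qed.

Lemma ext_ind_eb (P : ext -> Prop) : (forall S, P (eb S)) ->
  (forall k a b, P a -> P b -> P (k *: a + b)) -> forall w, P w.
Proof.
move=> Pe PD w.
have P0 : P 0 by have := PD (-1) _ _ (Pe finset.set0) (Pe finset.set0); rewrite scaleN1r addNr.
by rewrite [w]ext_eb; elim/big_rec: _ => // S x _ Px; apply: PD.
Qed.

(** On basis covectors e^i and e^j with i different from j, exactly one of the two orders has an
    inversion. *)
Lemma covec_anti xi ze : ewedge (ext_of_covec xi) (ext_of_covec ze) =
  - ewedge (ext_of_covec ze) (ext_of_covec xi).
Proof.
rewrite [in LHS]ext_of_covecE [in RHS](ext_of_covecE xi) ewedge_suml linear_sum -sumrN.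
apply: eq_bigr => i _; rewrite ewedgeZl linearZ /= -scalerN; congr (_ *: _).
rewrite (ext_of_covecE ze) linear_sum ewedge_suml -sumrN; apply: eq_bigr => j _.
rewrite linearZ ewedgeZl /= -scalerN; congr (_ *: _).
rewrite !ewedge_eb !disjoints1 !inE (eq_sym j i); case: eqP => [|/eqP ne]; first by rewrite oppr0.
rewrite /= finset.setUC -scaleNr; congr (_ *: _).
rewrite !inversions1l !sgE !big_set1; move: ne; rewrite -(inj_eq val_inj) /=.
by case: ltngtP => // _ _; rewrite ?expr0 ?expr1 ?opprK.
Qed.

Lemma eps_anti xi ze w : eps xi (eps ze w) = - eps ze (eps xi w).
Proof.
rewrite /eps !ewedgeA covec_anti -scaleN1r ewedgeZl scaleN1r; by [].
Qed.

Lemma eps_sq xi w : eps xi (eps xi w) = 0.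
Proof.
have /eqP := eps_anti xi xi w; rewrite -addr_eq0 -mulr2n -scaler_nat scaler_eq0.
by rewrite pnatr_eq0 /= => /eqP.
Qed.

Lemma sgU1 i j S : j \notin S -> sg i (j |: S) = ((j < i)%N + sg i S)%N.
Proof. by move=> jS; rewrite !sgE big_setU1. Qed.

Lemma sgD1 i j S : j \in S -> sg i S = ((j < i)%N + sg i (S :\ j))%N.
Proof. by move=> jS; rewrite !sgE (big_setD1 j). Qed.

Lemma pairing_delta_l j v : pairing (delta_mx 0 j) v = v 0 j.
Proof.
rewrite /pairing (bigD1 j) //= mxE !eqxx mul1r big1 ?addr0 // => i /negPf ne.
by rewrite mxE ne mul0r.
Qed.

(** By linearity all reduces to e^i, the j-th basis vector and e^S, and then to four cases according
    to whether i and j lie in S. It says that contraction is an antiderivation, the relation behind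
    all later exchanges of [eps] and [ext_contr]. *)
Lemma contr_eps v xi w :
  ext_contr v (eps xi w) = pairing xi v *: w - eps xi (ext_contr v w).
Proof.
rewrite eps_sum linear_sum /= [eps xi (ext_contr _ _)]eps_sum /pairing scaler_suml -sumrB.
apply: eq_bigr => i _; rewrite linearZ /= -scalerA -scalerBr; congr (_ *: _).
rewrite contr_sum [ext_contr v w]contr_sum linear_sum.
transitivity (\sum_j (v 0 j *: ((i == j)%:R *: w - eps (delta_mx 0 i) (ext_contr (delta_mx 0 j) w)))); last first.
  under eq_bigr do rewrite scalerBr; rewrite sumrB; congr (_ - _).
    rewrite (bigD1 i) //= eqxx scale1r big1 ?addr0 // => j /negPf ne.
    by rewrite eq_sym ne scale0r scaler0.
  by apply: eq_bigr => j _; rewrite linearZ.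
apply: eq_bigr => j _; congr (_ *: _).
elim/ext_ind_eb: w => [S|k a b Ea Eb]; last first.
  by rewrite epsP contrP Ea Eb contrP epsP lin_aux.
rewrite eps_eb contr_eb.
case: (boolP (i \in S)) => iS; case: (boolP (j \in S)) => jS; rewrite ?linear0 ?linearZ /= ?eps_eb ?contr_eb ?scaler0 ?subr0.
- rewrite !inE iS andbT; case: (eqVneq i j) => [->|ne] /=; last by rewrite oppr0 scaler0 scale0r addr0.
  by rewrite finset.setD1K // scalerN scalerA -exprD scale1r (sgD1 j jS) ltnn add0n sign_addnn scale1r subrr.
- by case: eqP jS => [<-|_ _]; rewrite ?iS // scale0r addr0.
- rewrite !inE jS orbT (negPf iS) andbF; case: (eqVneq i j) => [E|ne].
    by move: iS; rewrite E jS.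
  rewrite scale0r add0r scalerN !scalerA -scaleNr.
  have -> : (i |: S) :\ j = i |: S :\ j.
    by apply/setP => k; rewrite !inE; case: (eqVneq k j) => // -> ; rewrite eq_sym (negPf ne).
  (* The two exponents differ by (i < j) + (j < i), which is 1 since i and j are distinct; this is
     the extra minus sign. *)
  congr (_ *: _); rewrite sgU1 // (sgD1 i jS) -!exprD.
  move: ne; rewrite -(inj_eq val_inj) /=; case: ltngtP => // _ _; rewrite ?add0n ?add1n ?addn1 ?addnS ?addSn ?exprS ?mulN1r ?opprK addnC //.
- rewrite !inE (negPf jS) orbF eq_sym; case: (eqVneq i j) => [E|ne] /=; last by rewrite scaler0 scale0r addr0.
  by rewrite -E setU1K // scalerA -exprD sgU1 // ltnn add0n sign_addnn scale1r addr0.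
Qed.

Lemma contr_one v : ext_contr v (ext_one R m) = 0.
Proof.
apply/ffunP => S; rewrite !ffunE big1 // => j jS; rewrite ffunE.
by case: eqP => [/setP/(_ j)|]; rewrite ?mulr0 // !inE eqxx.
Qed.

(** Moving both contractions past a covector produces pairing terms that cancel in the sum, so the
    anticommutator commutes with [eps] and vanishes as it does on 1. *)
Lemma contr_anti u v w : ext_contr u (ext_contr v w) = - ext_contr v (ext_contr u w).
Proof.
apply/eqP; rewrite -addr_eq0; apply/eqP; elim/ext_ind: w => [|xi w IH|k a b Ea Eb].
- by rewrite !contr_one !linear0 addr0.
- rewrite !contr_eps !linearB !linearZ /= !contr_eps.
  have -> : ext_contr u (ext_contr v w) = - ext_contr v (ext_contr u w).
    by apply/eqP; rewrite -addr_eq0 IH.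
  by rewrite linearN /= opprK; exact: anti_aux.
- by rewrite !contrP addrACA -scalerDr Ea Eb scaler0 addr0.
Qed.

Lemma ext_conjE w S : ext_conj w S = conjc (w S).
Proof. by rewrite [LHS]ffunE. Qed.

Lemma ext_conjP k a b : ext_conj (k *: a + b) = conjc k *: ext_conj a + ext_conj b.
Proof.
by apply/ffunP => S; rewrite !(ext_conjE, extDE, extZE) rmorphD rmorphM.
Qed.

Lemma ext_conj_eb S : ext_conj (eb S) = eb S.
Proof. by apply/ffunP => T; rewrite ext_conjE ebE rmorph_nat. Qed.

Lemma ext_conj_eps xi w :
  ext_conj (eps xi w) = eps (map_mx (@conjc R) xi) (ext_conj w).
Proof.
apply/ffunP => S; rewrite ext_conjE !ewedgeE rmorph_sum; apply: eq_bigr => I _.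
rewrite !rmorphM rmorphXn rmorphN1 ext_conjE !ext_of_covec_coef rmorph_sum; congr (_ * _ * _).
by apply: eq_bigr => j _; rewrite mxE.
Qed.

Lemma pullback_linear A : linear (@pullback R m A).
Proof.
move=> k a b; rewrite /pullback scaler_sumr -big_split; apply: eq_bigr => S _.
by rewrite extDE extZE scalerDl scalerA.
Qed.

HB.instance Definition _ A := GRing.isLinear.Build C ext ext *:%R (@pullback R m A) (pullback_linear A).

Lemma pullbackP A k a b : pullback A (k *: a + b) = k *: pullback A a + pullback A b.
Proof. exact: pullback_linear. Qed.

Lemma pullback_eb A S : pullback A (eb S) = wedge_covecs [seq (col j A)^T | j <- enum S].
Proof.
rewrite /pullback (bigD1 S) //= ebE eqxx scale1r big1 ?addr0 // => T /negPf ne.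
by rewrite ebE ne scale0r.
Qed.

Lemma pullback_one A : pullback A (ext_one R m) = ext_one R m.
Proof. by rewrite {1}ext_one_eb pullback_eb enum_set0. Qed.

(** In the increasing enumeration, j is inserted after exactly [sg j S] entries. This turns the
    combinatorial sign of [eps_eb] into a number of transpositions of factors. *)
Lemma enum_sorted_split j S : exists s t, enum S = s ++ t /\ enum (j |: S) = s ++ j :: (if j \in S then behead t else t)
  /\ (j \in S -> t = j :: behead t) /\ size s = sg j S.
Proof.
(* Both lists are strictly increasing and have the same elements. *)
have E : enum 'I_m = [seq i : 'I_m <- enum 'I_m | (i < j)%N] ++
                     j :: [seq i : 'I_m <- enum 'I_m | (j < i)%N].
  apply: (@irr_sorted_eq _ (fun a b : 'I_m => (a < b)%N)).
  - by move=> a b c; apply: ltn_trans.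
  - by move=> a; rewrite ltnn.
  - by have := iota_ltn_sorted 0 m; rewrite -val_enum_ord sorted_map.
  - have tr : transitive (fun a b : 'I_m => (a < b)%N) by move=> a b c; apply: ltn_trans.
    have so : sorted (fun a b : 'I_m => (a < b)%N) (enum 'I_m).
      by have := iota_ltn_sorted 0 m; rewrite -val_enum_ord sorted_map.
    rewrite sorted_pairwise // pairwise_cat pairwise_cons; apply/and3P; split.
    + apply/allrelP => a b; rewrite mem_filter => /andP[aj _]; rewrite inE => /orP[/eqP -> //|].
      by rewrite mem_filter => /andP[jb _]; apply: ltn_trans jb.
    + by rewrite -sorted_pairwise // sorted_filter.
    + apply/andP; split; first by apply/allP => b; rewrite mem_filter => /andP[].
      by rewrite -sorted_pairwise // sorted_filter.
  - have mE (i : 'I_m) : i \in enum 'I_m by apply: mem_enum.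
    move=> i; move: (enum 'I_m) (mE : forall i : 'I_m, i \in enum 'I_m) => e {}mE.
    rewrite mem_cat in_cons !mem_filter !mE !andbT -(inj_eq val_inj) /=.
    by case: ltngtP.
set s1 := [seq i : 'I_m <- enum 'I_m | (i < j)%N] in E; set t1 := [seq i : 'I_m <- enum 'I_m | (j < i)%N] in E.
pose s := seq.filter (mem S) s1; pose t := seq.filter (mem S) t1.
have ES (T : {set 'I_m}) : enum T = seq.filter (mem T) (enum 'I_m) by rewrite {1}/enum_mem -enumT.
have s1P i : i \in s1 -> i != j by rewrite mem_filter => /andP[ij _]; rewrite -(inj_eq val_inj) neq_ltn ij.
have t1P i : i \in t1 -> i != j by rewrite mem_filter => /andP[ij _]; rewrite -(inj_eq val_inj) neq_ltn ij orbT.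
exists s, (if j \in S then j :: t else t); split.
  by rewrite ES E filter_cat /=; case: ifP.
split; last split; first 2 last.
- rewrite /s size_filter /s1 count_filter /sg.
  rewrite cardE ES size_filter; apply: eq_count => i; rewrite /= !inE.
  by [].
- rewrite ES E filter_cat /= setU11.
  have -> : [seq x <- s1 | mem (j |: S) x] = s.
    by apply: eq_in_filter => i /s1P; rewrite /= !inE => /negPf ->.
  have -> : [seq x <- t1 | mem (j |: S) x] = t.
    by apply: eq_in_filter => i /t1P; rewrite /= !inE => /negPf ->.
  by case: (j \in S).
- by move=> ->.
Qed.

Lemma wedge_covecs_eps_cat xi (s t : seq 'rV[C]_m) :
  wedge_covecs (s ++ xi :: t) = (-1) ^+ size s *: eps xi (wedge_covecs (s ++ t)).
Proof.
elim: s => [|ze s IH] /=; first by rewrite scale1r.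
by rewrite -!/(eps _ _) IH linearZ /= eps_anti exprS mulN1r scaleNr scalerN.
Qed.

(** [pullback] is defined on sorted products, so multiplicativity has to be proved: the new factor
    is moved past [sg j S] others, which yields the sign already present in [eps_eb]. If j already
    lies in S, a repeated factor makes both sides vanish. *)
Lemma pullback_eps A xi w : pullback A (eps xi w) = eps (xi *m A^T) (pullback A w).
Proof.
have main j S : pullback A (eps (delta_mx 0 j) (eb S)) = eps (col j A)^T (pullback A (eb S)).
  rewrite eps_eb [in RHS]pullback_eb.
  have [s [t [ES [EU [Et Es]]]]] := enum_sorted_split j S.
  case: ifP => jS.
    rewrite linear0 ES Et // map_cat /= wedge_covecs_eps_cat linearZ /= eps_sq scaler0.
    by [].
  rewrite linearZ /= pullback_eb EU jS ES !map_cat /= wedge_covecs_eps_cat size_map Es.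
  by rewrite scalerA -exprD sign_addnn scale1r.
elim/ext_ind_eb: w => [S|k a b Ea Eb]; last by rewrite epsP !pullbackP Ea Eb epsP.
rewrite eps_sum linear_sum /= [RHS]eps_sum.
under eq_bigr do rewrite linearZ /= main eps_sum scaler_sumr.
rewrite exchange_big; apply: eq_bigr => i _ /=.
rewrite mxE scaler_suml; apply: eq_bigr => j _; rewrite !mxE scalerA.
by [].
Qed.

Lemma pullback_wedge_covecs A s :
  pullback A (wedge_covecs s) = wedge_covecs [seq xi *m A^T | xi <- s].
Proof.
elim: s => [|xi s IH] /=; first exact: pullback_one.
by rewrite -!/(eps _ _) pullback_eps IH.
Qed.

Lemma pullback_ewedge A a b : pullback A (ewedge a b) = ewedge (pullback A a) (pullback A b).
Proof.
elim/ext_ind: a => [|xi w IH|k a c Ea Ec]; first by rewrite pullback_one !ewedge1l.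
  by rewrite ewedge_epsl !pullback_eps ewedge_epsl IH.
by rewrite ewedge_linear_l !pullbackP Ea Ec [RHS]ewedge_linear_l.
Qed.

Lemma pairing_mul A xi v : pairing (xi *m A^T) v = pairing xi (v *m A).
Proof.
rewrite /pairing; under eq_bigr do rewrite mxE mulr_suml.
rewrite exchange_big; apply: eq_bigr => j _ /=; rewrite mxE mulr_sumr.
by apply: eq_bigr => k _; rewrite mxE; ring.
Qed.

Lemma contr_pullback v A w : ext_contr v (pullback A w) = pullback A (ext_contr (v *m A) w).
Proof.
elim/ext_ind: w => [|xi w IH|k a b Ea Eb].
- by rewrite pullback_one !contr_one linear0.
- rewrite pullback_eps !contr_eps IH pairing_mul linearB linearZ /= pullback_eps.
  by [].
- by rewrite pullbackP !contrP Ea Eb pullbackP.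
Qed.

Lemma pullback_comp A B w : pullback A (pullback B w) = pullback (A *m B) w.
Proof.
elim/ext_ind: w => [|xi w IH|k a b Ea Eb].
- by rewrite !pullback_one.
- by rewrite !pullback_eps IH trmx_mul mulmxA.
- by rewrite !pullbackP Ea Eb.
Qed.

Lemma pullback1 w : pullback 1%:M w = w.
Proof.
elim/ext_ind: w => [|xi w IH|k a b Ea Eb].
- by rewrite pullback_one.
- by rewrite pullback_eps IH trmx1 mulmx1.
- by rewrite pullbackP Ea Eb.
Qed.

Lemma ext_conj_one : ext_conj (ext_one R m) = ext_one R m.
Proof. by rewrite ext_one_eb ext_conj_eb. Qed.

Lemma ext_conj_pullback A w :
  ext_conj (pullback A w) = pullback (map_mx (@conjc R) A) (ext_conj w).
Proof.
elim/ext_ind: w => [|xi w IH|k a b Ea Eb].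
- by rewrite pullback_one !ext_conj_one pullback_one.
- by rewrite pullback_eps !ext_conj_eps pullback_eps IH map_mxM map_trmx.
- by rewrite pullbackP !ext_conjP Ea Eb pullbackP.
Qed.

(* The bilinear pairing for which eps and ext_contr are transposes of each other. *)
Definition edot a b : C := \sum_S a S * b S.

Lemma edotDl k a c b : edot (k *: a + c) b = k * edot a b + edot c b.
Proof.
rewrite /edot mulr_sumr -big_split; apply: eq_bigr => S _ /=.
by rewrite extDE extZE mulrDl mulrA.
Qed.

Lemma edotDr k a c b : edot b (k *: a + c) = k * edot b a + edot b c.
Proof.
rewrite /edot mulr_sumr -big_split; apply: eq_bigr => S _ /=.
by rewrite extDE extZE mulrDr mulrCA.
Qed.

Lemma edot0r a : edot a 0 = 0.
Proof. by rewrite /edot big1 // => S _; rewrite ext0E mulr0. Qed.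

Lemma edot_eb_l S b : edot (eb S) b = b S.
Proof.
rewrite /edot -[RHS](sum_mul_delta (b : _ -> C)); apply: eq_bigr => T _.
by rewrite ebE eq_sym mulrC.
Qed.

Lemma edot_eps xi a b : edot (eps xi a) b = edot a (ext_contr xi b).
Proof.
elim/ext_ind_eb: a => [S|k a c Ea Ec]; last by rewrite epsP !edotDl Ea Ec.
rewrite edot_eb_l contrE eps_sum.
have -> : edot (\sum_j xi 0 j *: eps (delta_mx 0 j) (eb S)) b =
   \sum_j xi 0 j * edot (eps (delta_mx 0 j) (eb S)) b.
  elim/big_rec2: _ => [|j x y _ <-]; last by rewrite edotDl.
  by rewrite /edot big1 // => T _; rewrite ext0E mul0r.
rewrite [RHS]big_mkcond; apply: eq_bigr => j _; rewrite eps_eb.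
case: (j \in S) => /=.
  by rewrite [edot _ _]big1 ?mulr0 // => T _; rewrite ext0E mul0r.
rewrite -[_ *: eb _]addr0 edotDl edot_eb_l [edot 0 _]big1 ?addr0; last by move=> T _; rewrite ext0E mul0r.
by rewrite mulrCA mulrA.
Qed.

(** Each covector of a is moved across as a contraction. The base case says that a pullback keeps
    the degree 0 coefficient; it takes an induction on b, where a product with a covector never has
    a degree 0 part. *)
Lemma edot_pullback A a b : edot (pullback A a) b = edot a (pullback A^T b).
Proof.
elim/ext_ind: a b => [|xi a IH|k a c Ea Ec] b; last by rewrite pullbackP !edotDl Ea Ec.
  rewrite pullback_one ext_one_eb !edot_eb_l.
  elim/ext_ind: b => [|xi w IH|k a b Ea Eb]; first by rewrite pullback_one.
    have eps0 ze (c : ext) : eps ze c finset.set0 = 0.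
      rewrite /eps ewedgeE big1 // => I; rewrite finset.subset0 => /eqP ->.
      by rewrite ext_of_covec_coef big1 ?mulr0 ?mul0r // => j /eqP/setP/(_ j); rewrite !inE eqxx.
    by rewrite pullback_eps !eps0.
  by rewrite pullbackP !extDE !extZE Ea Eb.
by rewrite pullback_eps !edot_eps IH contr_pullback.
Qed.

End ExtAlgebra.

Local Open Scope classical_set_scope.

Lemma continuous_sum (R : realType) (T : topologicalType) I (r : seq I) (P : pred I)
    (F : I -> T -> R) (x : T) : (forall i, P i -> {for x, continuous (F i)}) ->
  {for x, continuous (fun y => \sum_(i <- r | P i) F i y)}.
Proof.
move=> H; elim: r => [|i r IH].
  rewrite (_ : (fun y => _) = cst 0); first exact: cst_continuous.
  by apply/funext => y; rewrite big_nil.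
rewrite (_ : (fun y => _) = (fun y => (if P i then F i y else 0) + \sum_(j <- r | P j) F j y)).
  apply: cvgD => //; case Pi: (P i); [exact: H|exact: cvg_cst].
by apply/funext => y; rewrite big_cons; case: ifP => //; rewrite add0r.
Qed.

(** * Smooth functions on R^m *)

Section SmoothBasics.
Variables (R : realType) (m : nat).
Local Notation V := 'rV[R]_m.
Implicit Types (O : set V) (f g : V -> R).

(** Derivatives are taken in the ambient space, so [Ck_on] is a conjunction of conditions at single
    points. *)
Lemma Ck_on_local k O f :
  (forall x, O x -> exists B, B x /\ Ck_on k B f) -> Ck_on k O f.
Proof.
elim: k f => [|k IH] f H /=.
  by move=> x /H [B [Bx HB]]; exact: HB.
move=> j; split.
  by move=> x /H [B [Bx HB]]; have [H1 _] := HB j; exact: H1.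
by apply: IH => x /H [B [Bx HB]]; exists B; split=> //; have [] := HB j.
Qed.

Lemma Ck_on_sub k O O' f : O' `<=` O -> Ck_on k O f -> Ck_on k O' f.
Proof. by move=> sO H; apply: Ck_on_local => x /sO Ox; exists O. Qed.

Lemma smooth_on_local O f :
  (forall x, O x -> exists B, B x /\ smooth_on B f) -> smooth_on O f.
Proof. by move=> H k; apply: Ck_on_local => x /H [B [Bx HB]]; exists B. Qed.

Lemma smooth_on_sub O O' f : O' `<=` O -> smooth_on O f -> smooth_on O' f.
Proof. by move=> sO H k; exact: Ck_on_sub (H k). Qed.

(** The induction works because functions that agree near x agree near every point close to x, hence
    so do their partial derivatives. *)
Lemma Ck_on_near k O f g :
  (forall x, O x -> \forall y \near x, f y = g y) -> Ck_on k O f -> Ck_on k O g.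
Proof.
elim: k f g => [|k IH] f g fg /=.
  move=> cf x Ox; have E := fg x Ox; rewrite /prop_for /continuous_at.
  rewrite -(nbhs_singleton E) => B /= /(cf x Ox) H.
  have H' : nbhs x (f @^-1` B) by exact: H.
  by change (nbhs x (g @^-1` B)); apply: filterS (filterI H' E) => y [/= Bfy <-].
move=> H j; have [d1 d2] := H j; split.
  by move=> x Ox; apply: near_eq_derivable (fg x Ox) (d1 x Ox).
apply: IH d2 => x Ox; have := near_join (fg x Ox).
by apply: filterS => y; exact: near_eq_derive.
Qed.

Lemma near_open O x (P : V -> Prop) : open O -> O x -> (forall y, O y -> P y) -> \forall y \near x, P y.
Proof. by move=> oO Ox H; apply: filterS (open_nbhs_nbhs (conj oO Ox)). Qed.

Lemma smooth_on_near O f g :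
  (forall x, O x -> \forall y \near x, f y = g y) -> smooth_on O f -> smooth_on O g.
Proof. by move=> H sf k; apply: Ck_on_near (sf k). Qed.

Lemma smooth_on_congr O f g : open O -> (forall x, O x -> f x = g x) ->
  smooth_on O f -> smooth_on O g.
Proof. by move=> oO fg; apply: smooth_on_near => x Ox; exact: near_open fg. Qed.

(* A coinduction principle: a class of continuous functions closed under partial
   derivatives consists of smooth functions. *)
Lemma smooth_coind O (P : (V -> R) -> Prop) : open O ->
  (forall p, P p -> (forall x, O x -> {for x, continuous p}) /\
    forall j, (forall x, O x -> derivable p x (evec R j)) /\
      exists2 q, P q & forall x, O x -> 'D_(evec R j) p x = q x) ->
  forall p, P p -> smooth_on O p.
Proof.
move=> oO H p Pp k; elim: k p Pp => [|k IH] p Pp /=; first by have [] := H p Pp.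
move=> j; have [_ /(_ j) [d1 [q Pq E]]] := H p Pp; split=> //.
by apply: Ck_on_near (IH q Pq) => x Ox; apply: (near_open oO Ox) => y Oy; rewrite E.
Qed.

Lemma smooth_on_continuous O f x : smooth_on O f -> O x -> {for x, continuous f}.
Proof. by move=> /(_ 0%N); exact. Qed.

Lemma smooth_on_derivable O f x j : smooth_on O f -> O x -> derivable f x (evec R j).
Proof. by move=> /(_ 1%N) /(_ j) []; move=> + _; exact. Qed.

Lemma smooth_on_derive O f j : smooth_on O f -> smooth_on O (fun x => 'D_(evec R j) f x).
Proof. by move=> H k; have [] := H k.+1 j. Qed.

Lemma smooth_on_cst O (c : R) : open O -> smooth_on O (fun=> c).
Proof.
move=> oO; apply: (@smooth_coind O (fun p => exists c, p = cst c)) => //; last by exists c.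
move=> _ [{}c ->]; split=> [x _|j]; first exact: cst_continuous.
split=> [x _|]; first exact: derivable_cst.
by exists (cst 0); [exists 0|move=> x _; rewrite derive_cst].
Qed.

Lemma derivable_coord x v j : derivable (fun y : V => y 0 j) x v.
Proof. by have /derivable_mxP := @derivable_id _ _ x v; apply. Qed.

Lemma derive_coord x v j : 'D_v (fun y : V => y 0 j) x = v 0 j.
Proof.
have := derive_mx (@derivable_id _ _ x v); rewrite derive_id => /matrixP /(_ 0 j).
by rewrite mxE.
Qed.

Lemma smooth_on_coord O j : open O -> smooth_on O (fun x => x 0 j).
Proof.
move=> oO; apply: (@smooth_coind O (fun p => (exists c, p = cst c) \/ p = (fun x => x 0 j))) => //; last by right.
move=> _ [[c ->]|->]; (split=> [x _|k]; last split=> [x _|]).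
- exact: cst_continuous.
- exact: derivable_cst.
- by exists (cst 0); [left; exists 0|move=> x _; rewrite derive_cst].
- exact: coord_continuous.
- exact: derivable_coord.
- by exists (cst (evec R k 0 j)); [left; eexists|move=> x _; rewrite derive_coord].
Qed.

Lemma smooth_onD O f g : open O -> smooth_on O f -> smooth_on O g ->
  smooth_on O (fun x => f x + g x).
Proof.
move=> oO sf sg.
apply: (@smooth_coind O (fun p => exists f g, [/\ smooth_on O f, smooth_on O g & p = fun x => f x + g x])) => //; last by exists f, g.
move=> _ {f g sf sg}[f [g [sf sg ->]]]; split=> [x Ox|j].
  exact: (cvgD (smooth_on_continuous sf Ox) (smooth_on_continuous sg Ox)).
split=> [x Ox|].
  by apply: (derivableD (f := f) (g := g)); exact: smooth_on_derivable Ox.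
exists (fun x => 'D_(evec R j) f x + 'D_(evec R j) g x).
  by do 2!eexists; split; [exact: smooth_on_derive sf|exact: smooth_on_derive sg|].
by move=> x Ox; apply: (deriveD (f := f) (g := g)); exact: smooth_on_derivable Ox.
Qed.

(** By the Leibniz rule this class contains the partial derivatives of its members, as
    [smooth_coind] demands. Closing under sums is what allows the two terms of the rule;
    compositions are treated with classes of the same design. *)
Inductive prod_class O : (V -> R) -> Prop :=
| prod_class_mul f g of smooth_on O f & smooth_on O g : prod_class O (fun x => f x * g x)
| prod_class_add p q of prod_class O p & prod_class O q : prod_class O (fun x => p x + q x).

Lemma prod_class_smooth O p : open O -> prod_class O p -> smooth_on O p.
Proof.
move=> oO; apply: smooth_coind => // {}p; elim=> {p} [f g sf sg|p q pp [cp dp] pq [cq dq]].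
  split=> [x Ox|j].
    exact: (cvgM (smooth_on_continuous sf Ox) (smooth_on_continuous sg Ox)).
  split=> [x Ox|].
    by apply: (derivableM (f := f) (g := g)); exact: smooth_on_derivable Ox.
  exists (fun x => f x * 'D_(evec R j) g x + g x * 'D_(evec R j) f x).
    by apply: prod_class_add; apply: prod_class_mul => //; apply: smooth_on_derive.
  by move=> x Ox; apply: (deriveM (f := f) (g := g)); exact: smooth_on_derivable Ox.
split=> [x Ox|j]; first exact: (cvgD (cp x Ox) (cq x Ox)).
have [dp1 [p' Pp' Ep]] := dp j; have [dq1 [q' Pq' Eq]] := dq j.
split=> [x Ox|].
  by apply: (derivableD (f := p) (g := q)); [exact: dp1|exact: dq1].
exists (fun x => p' x + q' x); first exact: prod_class_add.
by move=> x Ox; rewrite -Ep // -Eq //; apply: (deriveD (f := p) (g := q)); [exact: dp1|exact: dq1].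
Qed.

Lemma smooth_onM O f g : open O -> smooth_on O f -> smooth_on O g ->
  smooth_on O (fun x => f x * g x).
Proof. by move=> oO sf sg; apply: prod_class_smooth => //; apply: prod_class_mul. Qed.

Lemma smooth_onN O f : open O -> smooth_on O f -> smooth_on O (fun x => - f x).
Proof.
move=> oO sf; have := smooth_onM oO (smooth_on_cst (-1) oO) sf.
by apply: smooth_on_congr => // x _; rewrite mulN1r.
Qed.

Lemma smooth_onB O f g : open O -> smooth_on O f -> smooth_on O g ->
  smooth_on O (fun x => f x - g x).
Proof. by move=> oO sf sg; apply: smooth_onD => //; apply: smooth_onN. Qed.

Lemma smooth_on_sum O I (r : seq I) (P : pred I) (F : I -> V -> R) : open O ->
  (forall i, P i -> smooth_on O (F i)) -> smooth_on O (fun x => \sum_(i <- r | P i) F i x).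
Proof.
move=> oO H; elim: r => [|i r IH].
  by apply: (smooth_on_congr oO) (smooth_on_cst 0 oO) => x _; rewrite big_nil.
case Pi: (P i).
  by apply: (smooth_on_congr oO) (smooth_onD oO (H i Pi) IH) => x _; rewrite big_cons Pi.
by apply: (smooth_on_congr oO) IH => x _; rewrite big_cons Pi.
Qed.

End SmoothBasics.

(** * Differentiability from continuous partial derivatives *)

Section Differentiability.
Variables (R : realType) (m : nat).
Local Notation V := 'rV[R]_m.
Implicit Types (O : set V) (f g : V -> R).

Lemma coord_le_norm (v : V) j : `|v 0 j| <= `|v|.
Proof.
rewrite [leRHS]/Num.Def.normr/= mx_normrE.
exact: (le_bigmax 0 (fun ij : 'I_1 * 'I_m => `|v ij.1 ij.2|) (0, j)).
Qed.

Lemma norm_le_coord (v : V) c : 0 <= c -> (forall j, `|v 0 j| <= c) -> `|v| <= c.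
Proof.
move=> c0 H; rewrite [leLHS]/Num.Def.normr/= mx_normrE; apply: bigmax_le => // -[i j] _ /=.
by rewrite ord1.
Qed.

Lemma is_derive_line f (y v : V) t : derivable f (y + t *: v) v ->
  is_derive t 1 (fun s : R => f (y + s *: v)) ('D_v f (y + t *: v)).
Proof.
have E : (fun h : R => h^-1 *: (f (y + (h *: 1 + t) *: v) - f (y + t *: v))) =
         (fun h => h^-1 *: (f (h *: v + (y + t *: v)) - f (y + t *: v))).
  by apply/funext => h; rewrite [_%:A]mulr1 scalerDl addrCA.
by move=> df; apply: DeriveDef; rewrite /derivable /derive /= E.
Qed.

(** The bound by absolute values covers both signs of s; the two cases apply the mean value theorem
    on [0, s] and on [s, 0]. *)
Lemma mvt_line f (y v : V) (s : R) :
  (forall t, `|t| <= `|s| -> derivable f (y + t *: v) v) ->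
  exists2 t, `|t| <= `|s| & f (y + s *: v) - f y = 'D_v f (y + t *: v) * s.
Proof.
move=> H; pose g (t : R) := f (y + t *: v); pose dg (t : R) := 'D_v f (y + t *: v).
have g0 : g 0 = f y by rewrite /g scale0r addr0.
have dgP (t : R) : `|t| <= `|s| -> is_derive (t : R) (1 : R) g (dg t) by move=> /H /is_derive_line.
have cg a b : (forall t, t \in `[a, b]%R -> `|t| <= `|s|) -> {within `[a, b], continuous g}.
  by move=> Hab; apply: derivable_within_continuous => t tab; have [] := dgP t (Hab t tab).
case: (leP 0 s) => s0.
  have Hs t : t \in `[0, s]%R -> `|t| <= `|s|.
    by rewrite in_itv /= => /andP[t0 ts]; rewrite !ger0_norm.
  have [|t ts E] := @MVT_segment R g dg 0 s s0 _ (cg 0 s Hs).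
    by move=> t ts; apply: dgP; apply: Hs; move: ts; rewrite !in_itv /= => /andP[/ltW -> /ltW ->].
  by exists t; rewrite ?Hs // -g0 E subr0.
have Hs t : t \in `[s, 0]%R -> `|t| <= `|s|.
  by rewrite in_itv /= => /andP[t0 ts]; rewrite !ler0_norm ?lerN2 // ltW.
have [|t ts E] := @MVT_segment R g dg s 0 (ltW s0) _ (cg s 0 Hs).
  by move=> t ts; apply: dgP; apply: Hs; move: ts; rewrite !in_itv /= => /andP[/ltW -> /ltW ->].
exists t; first exact: Hs.
by rewrite -g0 -opprB E sub0r mulrN opprK.
Qed.

Definition lincomb (a : 'I_m -> R) (h : V) : R := \sum_j h 0 j * a j.

Lemma lincomb_linear a : linear (lincomb a).
Proof.
move=> k u v; rewrite /lincomb scaler_sumr -big_split; apply: eq_bigr => j _ /=.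
by rewrite !mxE mulrDl /GRing.scale /= mulrA.
Qed.

HB.instance Definition _ a := GRing.isLinear.Build R V R *:%R (lincomb a) (lincomb_linear a).

Lemma lincomb_continuous a : continuous (lincomb a).
Proof.
move=> x; apply: continuous_sum => j _.
have C : {for x, continuous (fun y : V => y 0 j)} by exact: coord_continuous.
exact: (cvgM C (cvg_cst (a j))).
Qed.

(** The points x + [head_coords h k], for k from 0 to m, are the corners of a broken line along the
    axes from x to x + h. *)
Definition head_coords (h : V) (k : nat) : V := \row_j (if (j < k)%N then h 0 j else 0).

Lemma head_coordsS h (k : 'I_m) : head_coords h k.+1 = head_coords h k + h 0 k *: evec R k.
Proof.
apply/rowP => j; rewrite !mxE eqxx /= ltnS leq_eqVlt -(inj_eq val_inj) /=.
by case: ltngtP => [| |/val_inj ->] /=; rewrite ?mulr0 ?addr0 ?mulr1 ?add0r.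
Qed.

(** The increment of f telescopes along the broken line. On each segment the mean value theorem
    replaces the difference by a partial derivative at a nearby point, which continuity compares
    with its value at x. *)
Lemma diff_partials O f x : open O -> O x ->
  (forall y, O y -> forall j, derivable f y (evec R j)) ->
  (forall j, {for x, continuous (fun y => 'D_(evec R j) f y)}) ->
  differentiable f x /\ 'd f x = lincomb (fun j => 'D_(evec R j) f x) :> (V -> R).
Proof.
move=> oO Ox dO cD; pose a j := 'D_(evec R j) f x.
have main : f \o shift x = cst (f x) + (lincomb a : V -> R) +o_ (0 : V) (id : V -> V).
  apply/eqaddoP => e e0.
  (* There are m segments, each with an error e' |h|; dividing by m + 1 also covers m = 0. *)
  pose e' := e / m.+1%:R; have e'0 : 0 < e' by rewrite divr_gt0.
  have /nbhs_ballP [d /= d0 Hd] : \forall y \near x, O y /\ forall j, `|'D_(evec R j) f y - a j| <= e'.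
    apply: filterI; first exact: open_nbhs_nbhs.
    refine (@filter_forall _ _ (fun j y => `|'D_(evec R j) f y - a j| <= e') (nbhs x) _ _) => j.
    have /cvgrPdist_le /(_ _ e'0) := cD j.
    by apply: filterS => y; rewrite distrC.
  have Hd' y : `|y - x| < d -> O y /\ forall j, `|'D_(evec R j) f y - a j| <= e'.
    by move=> yx; apply: Hd; rewrite -ball_normE /= distrC.
  apply/nbhs_ballP; exists d => // h; rewrite -ball_normE /= sub0r normrN => hd.
  (* Every coordinate of the displacement is bounded by that of h, so the broken line stays in the
     ball. *)
  have hk k t j : (k <= m)%N -> `|t| <= `|h 0 j| -> (j : nat) = k -> `|x + head_coords h k + t *: evec R j - x| < d.
    move=> km th jk; rewrite addrAC [x + _]addrC addrK; apply: le_lt_trans hd.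
    apply: norm_le_coord => // i; rewrite !mxE eqxx /=.
    case: ltngtP => [ik|ik|ik].
    - by rewrite (_ : (i == j) = false) ?mulr0 ?addr0 ?coord_le_norm //; apply/eqP => E; move: ik; rewrite E jk ltnn.
    - by rewrite (_ : (i == j) = false) ?mulr0 ?addr0 ?normr0 //; apply/eqP => E; move: ik; rewrite E jk ltnn.
    - rewrite (_ : i = j) ?eqxx ?mulr1 ?add0r; last by apply: val_inj; rewrite /= ik.
      by apply: le_trans th _; exact: coord_le_norm.
  have step (k : 'I_m) : `|f (x + head_coords h k.+1) - f (x + head_coords h k) - h 0 k * a k| <= e' * `|h|.
    have [t|t th] := @mvt_line f (x + head_coords h k) (evec R k) (h 0 k).
      by move=> th; apply: dO; have [] := Hd' _ (hk k t k (ltnW (ltn_ord k)) th erefl).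
    rewrite head_coordsS addrA => ->; rewrite mulrC -mulrBr normrM mulrC.
    apply: ler_pM => //; last exact: coord_le_norm.
    by have [_] := Hd' _ (hk k t k (ltnW (ltn_ord k)) th erefl).
  have -> : (f \o shift x - (cst (f x) + lincomb a)) h =
      \sum_(k < m) (f (x + head_coords h k.+1) - f (x + head_coords h k) - h 0 k * a k).
    rewrite sumrB -(big_mkord xpredT (fun k => f (x + head_coords h k.+1) - f (x + head_coords h k))).
    rewrite (telescope_sumr (fun k => f (x + head_coords h k))) //.
    have -> : head_coords h 0 = 0 by apply/rowP => j; rewrite !mxE.
    have -> : head_coords h m = h by apply/rowP => j; rewrite !mxE ltn_ord.
    by rewrite addr0 -[LHS]/(f (h + x) - (f x + lincomb a h)) opprD addrA [h + x]addrC.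
  apply: le_trans (ler_norm_sum _ _ _) _.
  apply: (@le_trans _ _ (\sum_(k < m) e' * `|h|)); first by apply: ler_sum.
  rewrite sumr_const card_ord -mulrnAl ler_wpM2r // /e' -mulr_natr mulrAC ler_pdivrMr //.
  by rewrite ler_pM2l // ler_nat.
have E := diff_unique (lincomb_continuous (a := a)) main.
split=> //; apply/diff_locallyP; rewrite E; split=> //; exact: lincomb_continuous.
Qed.

Lemma smooth_on_differentiable O f x : open O -> smooth_on O f -> O x -> differentiable f x.
Proof.
move=> oO sf Ox; have [] // := @diff_partials O f x oO Ox.
  by move=> y Oy j; exact: smooth_on_derivable sf Oy.
by move=> j; exact: smooth_on_continuous (smooth_on_derive j sf) Ox.
Qed.

End Differentiability.

(** * The chain rule and compositions of smooth maps *)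

Section Chain.
Variables (R : realType) (m p : nat).
Local Notation V := 'rV[R]_m.
Local Notation W := 'rV[R]_p.

Lemma differentiable_row (F : V -> W) (x : V) :
  (forall k, differentiable (fun y => F y 0 k) x) -> differentiable F x.
Proof.
move=> H.
have -> : F = \sum_(k < p) (fun y => F y 0 k *: evec R k).
  by apply/funext => y; rewrite fct_sumE [LHS]row_sum_delta.
by apply: differentiable_sum => k; apply: differentiableZl.
Qed.

Lemma derive_row (F : V -> W) (x v : V) : differentiable F x ->
  'D_v F x = \row_k 'D_v (fun y => F y 0 k) x.
Proof.
move=> dF; rewrite derive_mx; first by apply/rowP => k; rewrite !mxE.
exact: diff_derivable.
Qed.

Lemma chain_rule (f : W -> R) (F : V -> W) (x v : V) : differentiable f (F x) ->
  (forall k, differentiable (fun y => F y 0 k) x) ->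
  derivable (fun y => f (F y)) x v /\
  'D_v (fun y => f (F y)) x = \sum_k 'D_(evec R k) f (F x) * 'D_v (fun y => F y 0 k) x.
Proof.
move=> df dFk; have dF := differentiable_row dFk.
have dc := differentiable_comp dF df.
split; first exact: diff_derivable dc.
rewrite (_ : (fun y => f (F y)) = f \o F) // (deriveE v dc) (diff_comp dF df) /=.
rewrite -(deriveE v dF) derive_row // [X in 'd f _ X]row_sum_delta linear_sum.
apply: eq_bigr => k _; rewrite linearZ mxE /= -deriveE //.
exact: mulrC.
Qed.

Lemma jacobian_entry (F : V -> W) (x : V) i j : differentiable F x ->
  jacobian F x i j = 'D_(evec R i) (fun y => F y 0 j) x.
Proof.
move=> dF; have := deriveEjacobian (evec R i) dF; rewrite derive_row // -rowE.
by move=> /rowP /(_ j); rewrite !mxE.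
Qed.

(** Closed under partial derivatives by the chain rule: differentiating f(F x) g(x) gives f(F x)
    times a derivative of g, plus a sum over k of (D_k f)(F x) times the smooth function (D_j F_k)
    g. *)
Inductive comp_class (O : set V) (O' : set W) (F : V -> W) : (V -> R) -> Prop :=
| comp_class_mul f g of smooth_on O' f & smooth_on O g :
    comp_class O O' F (fun x => f (F x) * g x)
| comp_class_add u w of comp_class O O' F u & comp_class O O' F w :
    comp_class O O' F (fun x => u x + w x).

Lemma comp_class_sum O O' F I (r : seq I) (G : I -> V -> R) : open O -> open O' ->
  (forall i, comp_class O O' F (G i)) ->
  exists2 q, comp_class O O' F q & forall x, q x = \sum_(i <- r) G i x.
Proof.
move=> oO oO' HG; elim: r => [|i r [q Pq E]].
  exists (fun x => (fun=> 0) (F x) * (fun=> 0) x); last by move=> x; rewrite big_nil mulr0.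
  by apply: (@comp_class_mul _ _ _ (fun=> 0) (fun=> 0)); exact: smooth_on_cst.
exists (fun x => G i x + q x); first exact: comp_class_add.
by move=> x; rewrite big_cons E.
Qed.

Lemma comp_class_smooth (O : set V) (O' : set W) (F : V -> W) u : open O -> open O' -> (forall x, O x -> O' (F x)) ->
  (forall k, smooth_on O (fun x => F x 0 k)) -> comp_class O O' F u -> smooth_on O u.
Proof.
move=> oO oO' FO sF; have dF x k : O x -> differentiable (fun y => F y 0 k) x.
  by move=> Ox; exact: smooth_on_differentiable Ox.
apply: smooth_coind => // {}u; elim=> {u} [f g sf sg|u w pu [cu du] pw [cw dw]].
  have dfF x : O x -> differentiable f (F x).
    by move=> /FO; exact: smooth_on_differentiable.
  have cr x v : O x -> _ := fun Ox => chain_rule v (dfF x Ox) (fun k => dF x k Ox).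
  split=> [x Ox|j].
    have cF : {for x, continuous (fun y => f (F y))}.
      have dc := differentiable_comp (differentiable_row (fun k => dF x k Ox)) (dfF x Ox).
      exact: differentiable_continuous dc.
    exact: (cvgM cF (smooth_on_continuous sg Ox)).
  split=> [x Ox|].
    apply: (derivableM (f := fun y => f (F y)) (g := g)).
      by have [] := cr x (evec R j) Ox.
    exact: smooth_on_derivable Ox.
  have [q Pq Eq] : exists2 q, comp_class O O' F q & forall x, q x =
      \sum_k 'D_(evec R k) f (F x) * ('D_(evec R j) (fun y => F y 0 k) x * g x).
    apply: comp_class_sum => // k.
    apply: (@comp_class_mul _ _ _ ('D_(evec R k) f) (fun x => 'D_(evec R j) (fun y => F y 0 k) x * g x)).
      exact: smooth_on_derive.
    by apply: smooth_onM => //; apply: smooth_on_derive (sF k).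
  exists (fun x => f (F x) * 'D_(evec R j) g x + q x).
    by apply: comp_class_add => //; apply: comp_class_mul => //; apply: smooth_on_derive.
  move=> x Ox.
  have E : 'D_(evec R j) (fun y => f (F y) * g y) x =
     f (F x) *: 'D_(evec R j) g x + g x *: 'D_(evec R j) (fun y => f (F y)) x.
    apply: (deriveM (f := fun y => f (F y)) (g := g)); first by have [] := cr x (evec R j) Ox.
    exact: smooth_on_derivable Ox.
  rewrite E; congr (_ + _); have [_ ->] := cr x (evec R j) Ox.
  rewrite Eq /GRing.scale /= mulr_sumr; apply: eq_bigr => k _.
  by rewrite mulrC mulrA.
split=> [x Ox|j]; first exact: (cvgD (cu x Ox) (cw x Ox)).
have [dp1 [p' Pp' Ep]] := du j; have [dq1 [q' Pq' Eq]] := dw j.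
split=> [x Ox|].
  by apply: (derivableD (f := u) (g := w)); [exact: dp1|exact: dq1].
exists (fun x => p' x + q' x); first exact: comp_class_add.
by move=> x Ox; rewrite -Ep // -Eq //; apply: (deriveD (f := u) (g := w)); [exact: dp1|exact: dq1].
Qed.

Lemma smooth_on_comp (O : set V) (O' : set W) (f : W -> R) (F : V -> W) : open O -> open O' ->
  (forall x, O x -> O' (F x)) -> (forall k, smooth_on O (fun x => F x 0 k)) ->
  smooth_on O' f -> smooth_on O (fun x => f (F x)).
Proof.
move=> oO oO' FO sF sf.
have : smooth_on O (fun x => f (F x) * (fun=> 1) x).
  apply: (comp_class_smooth oO oO' FO sF); apply: comp_class_mul => //; exact: smooth_on_cst.
by apply: smooth_on_congr => // x _; rewrite mulr1.
Qed.

End Chain.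

(** * Inverses and square roots of smooth functions *)

Section RealComposition.
Variables (R : realType) (m : nat).
Local Notation V := 'rV[R]_m.

Lemma chain_rule1 (h : R -> R) (f : V -> R) (x v : V) : derivable h (f x) 1 ->
  differentiable f x -> derivable (fun y => h (f y)) x v /\
  'D_v (fun y => h (f y)) x = 'D_(1 : R) h (f x) * 'D_v f x.
Proof.
move=> /derivable1_diffP dh df; have dc := differentiable_comp df dh.
split; first exact: diff_derivable dc.
rewrite (_ : (fun y => h (f y)) = h \o f) // (deriveE v dc) (diff_comp df dh) /=.
rewrite -(deriveE v df) -[X in 'd h _ X]mulr1 (deriveE _ dh).
by rewrite -[_ * 1]/(_ *: (1 : R)) linearZ mulrC.
Qed.

Inductive rcomp_class (O : set V) (H : (R -> R) -> Prop) (f : V -> R) : (V -> R) -> Prop :=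
| rcomp_class_mul h g of H h & smooth_on O g : rcomp_class O H f (fun x => h (f x) * g x)
| rcomp_class_add u w of rcomp_class O H f u & rcomp_class O H f w :
    rcomp_class O H f (fun x => u x + w x).

(** [H] is a family of functions of one variable that contains, on [D], the derivatives of its
    members. Exhibiting such an explicit family replaces a theory of smooth functions of one
    variable; it is applied to 1/t, to the square root and to the flat function. *)
Lemma smooth_on_rcomp (O : set V) (D : set R) (H : (R -> R) -> Prop) (f : V -> R) h : open O ->
  (forall h, H h -> (forall t, D t -> derivable h t 1) /\
     exists2 h', H h' & forall t, D t -> 'D_(1 : R) h t = h' t) ->
  (forall x, O x -> D (f x)) -> smooth_on O f -> H h -> smooth_on O (fun x => h (f x)).
Proof.
move=> oO HH fD sf Hh.
have df x : O x -> differentiable f x by exact: smooth_on_differentiable.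
suff : smooth_on O (fun x => h (f x) * (fun=> 1) x).
  by apply: smooth_on_congr => // x _; rewrite mulr1.
have : rcomp_class O H f (fun x => h (f x) * (fun=> 1) x).
  by apply: rcomp_class_mul => //; exact: smooth_on_cst.
move: (fun x => _) => u; apply: smooth_coind => // {h Hh} {}u.
elim=> {u} [h g Hh sg|u w pu [cu du] pw [cw dw]].
  have [dh [h' Hh' Eh]] := HH h Hh.
  have cr x v : O x -> _ := fun Ox => chain_rule1 v (dh _ (fD x Ox)) (df x Ox).
  split=> [x Ox|j].
    have cF : {for x, continuous (fun y => h (f y))}.
      have /derivable1_diffP dhx := dh _ (fD x Ox).
      have dc := differentiable_comp (df x Ox) dhx.
      exact: differentiable_continuous dc.
    exact: (cvgM cF (smooth_on_continuous sg Ox)).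
  split=> [x Ox|].
    apply: (derivableM (f := fun y => h (f y)) (g := g)).
      by have [] := cr x (evec R j) Ox.
    exact: smooth_on_derivable Ox.
  exists (fun x => h (f x) * 'D_(evec R j) g x + h' (f x) * ('D_(evec R j) f x * g x)).
    apply: rcomp_class_add; first by apply: rcomp_class_mul => //; apply: smooth_on_derive.
    apply: (@rcomp_class_mul _ _ _ h' (fun x => 'D_(evec R j) f x * g x)) => //.
    by apply: smooth_onM => //; apply: smooth_on_derive.
  move=> x Ox.
  have E : 'D_(evec R j) (fun y => h (f y) * g y) x =
     h (f x) *: 'D_(evec R j) g x + g x *: 'D_(evec R j) (fun y => h (f y)) x.
    apply: (deriveM (f := fun y => h (f y)) (g := g)); first by have [] := cr x (evec R j) Ox.
    exact: smooth_on_derivable Ox.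
  rewrite E; congr (_ + _); have [_ ->] := cr x (evec R j) Ox.
  by rewrite Eh; [rewrite /GRing.scale /=; ring|exact: fD].
split=> [x Ox|j]; first exact: (cvgD (cu x Ox) (cw x Ox)).
have [dp1 [p' Pp' Ep]] := du j; have [dq1 [q' Pq' Eq]] := dw j.
split=> [x Ox|].
  by apply: (derivableD (f := u) (g := w)); [exact: dp1|exact: dq1].
exists (fun x => p' x + q' x); first exact: rcomp_class_add.
by move=> x Ox; rewrite -Ep // -Eq //; apply: (deriveD (f := u) (g := w)); [exact: dp1|exact: dq1].
Qed.

Lemma is_derive_invX (c : R) n (t : R) : t != 0 ->
  is_derive (t : R) (1 : R) (fun s : R => c * s^-1 ^+ n) (- (c * n%:R) * t^-1 ^+ n.+1).
Proof.
move=> t0.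
have dV : is_derive (t : R) (1 : R) (fun s : R => s^-1) (- (t^-1 ^+ 2)).
  have dV : derivable (fun s : R => s^-1) t 1.
    by apply: (derivableV (f := id)) => //; exact: derivable_id.
  apply: DeriveDef; first exact: dV.
  have := @deriveV R R id t 1 t0 (@derivable_id _ _ t 1); rewrite derive_id => ->.
  by rewrite exprVn /GRing.scale /= mulr1.
have dX : is_derive (t : R) (1 : R) (fun s : R => s^-1 ^+ n) (- n%:R * t^-1 ^+ n.+1).
  elim: n => [|n IH].
    rewrite oppr0 mul0r (_ : (fun s : R => _) = cst 1); first exact: is_derive_cst.
    by apply/funext => s; rewrite expr0.
  rewrite (_ : (fun s : R => _) = (fun s => s^-1) * (fun s => s^-1 ^+ n)); last by apply/funext => s; rewrite exprS.
  apply: is_derive_eq; rewrite /GRing.scale /=.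
  by rewrite -(natr1 n) !exprS; ring.
rewrite (_ : (fun s : R => _) = cst c * (fun s => s^-1 ^+ n)) //.
apply: is_derive_eq; rewrite /GRing.scale /= mulr0 addr0; ring.
Qed.

Lemma smooth_on_inv (O : set V) (f : V -> R) : open O -> (forall x, O x -> f x != 0) ->
  smooth_on O f -> smooth_on O (fun x => (f x)^-1).
Proof.
move=> oO f0 sf.
pose H (h : R -> R) := exists c n, h = fun s : R => c * s^-1 ^+ n.
suff : smooth_on O (fun x => (fun s : R => 1 * s^-1 ^+ 1) (f x)).
  by apply: smooth_on_congr => // x _; rewrite mul1r expr1.
apply: (@smooth_on_rcomp O [set t | t != 0] H f (fun s => 1 * s^-1 ^+ 1)) => //; last by exists 1, 1%N.
move=> _ [c [n ->]]; split=> [t /= t0|].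
  by have [] := is_derive_invX c n t0.
exists (fun s => - (c * n%:R) * s^-1 ^+ n.+1); first by exists (- (c * n%:R)), n.+1.
by move=> t /= t0; have [_ ->] := is_derive_invX c n t0.
Qed.

(** The functions sqrt(t) c t^(-n) form a family closed under differentiation, because the
    derivative of sqrt(t) is sqrt(t) / (2 t). The square root is its member with c = 1 and n = 0. *)
Lemma smooth_on_sqrt (O : set V) (f : V -> R) : open O -> (forall x, O x -> 0 < f x) ->
  smooth_on O f -> smooth_on O (fun x => Num.sqrt (f x)).
Proof.
move=> oO f0 sf.
pose H (h : R -> R) := exists c n, h = fun s : R => Num.sqrt s * (c * s^-1 ^+ n).
suff : smooth_on O (fun x => (fun s : R => Num.sqrt s * (1 * s^-1 ^+ 0)) (f x)).
  by apply: smooth_on_congr => // x _; rewrite mul1r expr0 mulr1.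
have D (c : R) n (t : R) : 0 < t -> is_derive (t : R) (1 : R) (fun s : R => Num.sqrt s * (c * s^-1 ^+ n))
    (Num.sqrt t * ((c / 2 - c * n%:R) * t^-1 ^+ n.+1)).
  move=> t0; have tn0 : t != 0 by rewrite gt_eqF.
  have d1 := is_derive_invX c n tn0.
  have d2 : is_derive (t : R) (1 : R) Num.sqrt (2 * Num.sqrt t)^-1.
    exact: is_derive1_sqrt.
  rewrite (_ : (fun s : R => _) = Num.sqrt * (fun s => c * s^-1 ^+ n)) //.
  apply: (is_derive_eq (is_deriveM d2 d1)); rewrite /GRing.scale /=.
  have s0 : Num.sqrt t != 0 by rewrite gt_eqF // sqrtr_gt0.
  have -> : (2 * Num.sqrt t)^-1 = Num.sqrt t * (t^-1 / 2).
    by rewrite -{3}(sqr_sqrtr (ltW t0)); field; rewrite s0.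
  by rewrite exprS; ring.
apply: (@smooth_on_rcomp O [set t | 0 < t] H f (fun s => Num.sqrt s * (1 * s^-1 ^+ 0))) => //; last by exists 1, 0%N.
move=> _ [c [n ->]]; split=> [t /= t0|].
  by have [] := D c n t t0.
exists (fun t => Num.sqrt t * ((c / 2 - c * n%:R) * t^-1 ^+ n.+1)).
  by exists (c / 2 - c * n%:R), n.+1.
by move=> t /= t0; have [_ ->] := D c n t t0.
Qed.

End RealComposition.

Lemma subr_swap (A : zmodType) (a b c d : A) : a - b - (c - d) = a - c - (b - d).
Proof. by rewrite !opprB addrACA [RHS]addrACA [- c - b]addrC. Qed.

Lemma mulI2 (F : fieldType) (a b s : F) : s != 0 -> a * s * s = b * s * s -> a = b.
Proof. by move=> s0 /(mulIf s0)/(mulIf s0). Qed.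

(** * Symmetry of second derivatives *)

Section Schwarz.
Variables (R : realType) (m : nat).
Local Notation V := 'rV[R]_m.

Lemma derive_translate (f : V -> R) (c x v : V) :
  'D_v (fun y => f (y + c)) x = 'D_v f (x + c).
Proof.
rewrite /derive; have -> // : (fun h : R => h^-1 *: (((fun y => f (y + c)) \o shift x) (h *: v) - f (x + c))) =
   (fun h : R => h^-1 *: ((f \o shift (x + c)) (h *: v) - f (x + c))).
by apply/funext => h /=; rewrite addrA.
Qed.

Lemma derivable_translate (f : V -> R) (c x v : V) :
  derivable f (x + c) v -> derivable (fun y => f (y + c)) x v.
Proof.
rewrite /derivable; have -> // : (fun h : R => h^-1 *: (((fun y => f (y + c)) \o shift x) (h *: v) - f (x + c))) =
   (fun h : R => h^-1 *: ((f \o shift (x + c)) (h *: v) - f (x + c))).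
by apply/funext => h /=; rewrite addrA.
Qed.

Lemma evec_norm (j : 'I_m) (t : R) : `|t *: evec R j| <= `|t|.
Proof.
apply: norm_le_coord => // k; rewrite !mxE eqxx /=; case: eqP; rewrite ?mulr1 // mulr0 normr0 //.
Qed.

(** Apply the mean value theorem along e_i to the difference y |-> f(y + s e_j) - f(y), and then
    along e_j to D_i f. The left-hand side is symmetric in i and j, so the two mixed derivatives
    agree at two points close to x; continuity gives [schwarz]. *)
Lemma second_difference (O : set V) (f : V -> R) (x : V) (i j : 'I_m) (s d : R) :
  open O -> smooth_on O f -> (forall y, `|y - x| < d -> O y) -> 0 < s -> s + s < d ->
  exists2 y, `|y - x| < d &
  f (x + s *: evec R i + s *: evec R j) - f (x + s *: evec R i) - (f (x + s *: evec R j) - f x) =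
  'D_(evec R j) ('D_(evec R i) f) y * s * s.
Proof.
move=> oO sf xO s0 sd.
have near t t' : `|t| <= `|s| -> `|t'| <= `|s| -> `|x + t *: evec R i + t' *: evec R j - x| < d.
  move=> ht ht'; rewrite addrAC [_ - x]addrAC subrr add0r; apply: le_lt_trans sd.
  rewrite -{1 2}(gtr0_norm s0); apply: (le_trans (ler_normD _ _)); apply: lerD.
    exact: le_trans (evec_norm _ _) ht.
  exact: le_trans (evec_norm _ _) ht'.
pose g y := f (y + s *: evec R j) - f y.
have dg t : `|t| <= `|s| -> derivable g (x + t *: evec R i) (evec R i) /\
   'D_(evec R i) g (x + t *: evec R i) =
   'D_(evec R i) f (x + t *: evec R i + s *: evec R j) - 'D_(evec R i) f (x + t *: evec R i).
  move=> ht; have d1 : derivable f (x + t *: evec R i) (evec R i).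
    have Oxt : O (x + t *: evec R i).
      by apply: xO; rewrite -[_ + _ *: _]addr0 -(scale0r (evec R j)); apply: near; rewrite ?normr0.
    exact: smooth_on_derivable sf Oxt.
  have d2 : derivable (fun y => f (y + s *: evec R j)) (x + t *: evec R i) (evec R i).
    have Oxt : O (x + t *: evec R i + s *: evec R j) by apply: xO; apply: near.
    by apply: derivable_translate; exact: smooth_on_derivable sf Oxt.
  split; first exact: (derivableB (f := fun y => f (y + s *: evec R j)) (g := f)).
  rewrite -(derive_translate f).
  exact: (deriveB (f := fun y => f (y + s *: evec R j)) (g := f)).
have [|t ht E] := @mvt_line R m g x (evec R i) s.
  by move=> t /dg [].
have [|t' ht' E'] := @mvt_line R m ('D_(evec R i) f) (x + t *: evec R i) (evec R j) s.
  move=> t' ht'; have Oxt : O (x + t *: evec R i + t' *: evec R j) by apply: xO; apply: near.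
  exact: smooth_on_derivable (smooth_on_derive i sf) Oxt.
exists (x + t *: evec R i + t' *: evec R j); first exact: near.
by rewrite -E' -[LHS]/(g (x + s *: evec R i) - g x) E; have [_ ->] := dg t ht.
Qed.

Lemma schwarz (O : set V) (f : V -> R) (x : V) (i j : 'I_m) :
  open O -> smooth_on O f -> O x ->
  'D_(evec R i) ('D_(evec R j) f) x = 'D_(evec R j) ('D_(evec R i) f) x.
Proof.
move=> oO sf Ox.
set A := LHS; set B := RHS.
apply/eqP; rewrite -subr_eq0 -normr_le0; apply/ler_addgt0Pl => e e0; rewrite addr0.
have e20 : 0 < e / 2 by rewrite divr_gt0.
have c1 : \forall y \near x, `|A - 'D_(evec R i) ('D_(evec R j) f) y| <= e / 2.
  have /cvgrPdist_le /(_ _ e20) := smooth_on_continuous (smooth_on_derive i (smooth_on_derive j sf)) Ox.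
  exact.
have c2 : \forall y \near x, `|B - 'D_(evec R j) ('D_(evec R i) f) y| <= e / 2.
  have /cvgrPdist_le /(_ _ e20) := smooth_on_continuous (smooth_on_derive j (smooth_on_derive i sf)) Ox.
  exact.
have c3 : \forall y \near x, O y by exact: open_nbhs_nbhs.
have /nbhs_ballP [d /= d0 Hd] : \forall y \near x, O y /\
    (`|A - 'D_(evec R i) ('D_(evec R j) f) y| <= e / 2 /\
     `|B - 'D_(evec R j) ('D_(evec R i) f) y| <= e / 2).
  exact: (filterI c3 (filterI c1 c2)).
have Hd' y : `|y - x| < d -> O y /\ (`|A - 'D_(evec R i) ('D_(evec R j) f) y| <= e / 2 /\
      `|B - 'D_(evec R j) ('D_(evec R i) f) y| <= e / 2).
  by move=> yx; apply: Hd; rewrite -ball_normE /= distrC.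
(* The two steps of length s then stay inside the ball of radius d. *)
pose s := d / 3; have s0 : 0 < s by rewrite divr_gt0.
have sd : s + s < d by rewrite /s; lra.
have xO y : `|y - x| < d -> O y by move=> /Hd' [].
have [y1 hy1 E1] := @second_difference O f x i j s d oO sf xO s0 sd.
have [y2 hy2 E2] := @second_difference O f x j i s d oO sf xO s0 sd.
have E : 'D_(evec R j) ('D_(evec R i) f) y1 = 'D_(evec R i) ('D_(evec R j) f) y2.
  have sn : s != 0 by rewrite gt_eqF.
  apply: (mulI2 sn).
  apply: (etrans (esym E1)); apply: (etrans _ E2).
  by rewrite (addrAC x (s *: evec R i) (s *: evec R j)); exact: subr_swap.
have [_ [_ h1]] := Hd' _ hy1; have [_ [h2 _]] := Hd' _ hy2.
rewrite (splitr e); rewrite -E in h2.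
apply: le_trans (lerD h2 h1).
rewrite [X in _ <= _ + X]distrC; apply: le_trans (ler_normD _ _).
by rewrite addrA subrK.
Qed.

End Schwarz.

(** * Bump functions *)

Section Bump.
Variables (R : realType).

(* The span of these functions is closed under differentiation, so flat 0 is smooth. *)
Definition flat (k : nat) (t : R) : R := if 0 < t then t^-1 ^+ k * expR (- t^-1) else 0.

(** With u = 1/t and N = k + 2, exp(u/N) >= u/N gives exp(u) >= (u/N)^N, so u^(k+1) exp(-u) is at
    most N^N / u. *)
Lemma flat_bound k (t : R) : 0 < t -> t^-1 ^+ k.+1 * expR (- t^-1) <= k.+2%:R ^+ k.+2 * t.
Proof.
move=> t0; set u := t^-1; have u0 : 0 < u by rewrite invr_gt0.
have -> : t = u^-1 by rewrite invrK.
have h : (u / k.+2%:R) ^+ k.+2 <= expR u.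
  have -> : expR u = expR (u / k.+2%:R) ^+ k.+2.
    by rewrite -expRM_natl; congr expR; rewrite mulrC divfK // pnatr_eq0.
  rewrite lerXn2r ?nnegrE ?expR_ge0 ?divr_ge0 ?ltW //.
  by apply: lt_le_trans (expR_ge1Dx _); rewrite ltrDr.
have N0 : 0 < k.+2%:R ^+ k.+2 :> R by rewrite exprn_gt0.
move: h; rewrite expr_div_n; set N : R := k.+2%:R ^+ k.+2 in N0 *.
rewrite ler_pdivrMr // => h.
by rewrite expRN ler_pdivrMr ?expR_gt0 // -mulrA mulrCA ler_pdivlMl // -exprS mulrC.
Qed.

(** Away from 0 this is a computation. At 0 the difference quotient is t^(-k-1) exp(-1/t) for t > 0,
    and [flat_bound] makes it O(t). *)
Lemma is_derive_flat k (t : R) :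
  is_derive (t : R) (1 : R) (flat k) (flat k.+2 t - k%:R * flat k.+1 t).
Proof.
case: (ltrgtP 0 t) => t0.
- have tn0 : t != 0 by rewrite gt_eqF.
  apply: (@near_eq_is_derive _ _ _ (fun s : R => (1 * s^-1 ^+ k) * expR (- s^-1))).
    have : \forall s \near t, 0 < s by exact: (cvgr_gt t (@cvg_id _ _) 0 t0).
    by apply: filterS => s s0; rewrite /flat s0 mul1r.
  have d1 := is_derive_invX 1 k tn0.
  have d2 : is_derive (t : R) (1 : R) (fun s : R => - s^-1) (t^-1 ^+ 2).
    have := is_derive_invX (-1) 1 tn0; rewrite mulr1 opprK mul1r.
    by rewrite (_ : (fun s : R => - 1 * s^-1 ^+ 1) = (fun s => - s^-1)) //; apply/funext => s; rewrite mulN1r expr1.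
  have d3 := @is_derive1_comp _ expR (fun s : R => - s^-1) t _ _ (is_derive_expR _) d2.
  rewrite (_ : (fun s : R => _) = (fun s => 1 * s^-1 ^+ k) * (expR \o (fun s : R => - s^-1))) //.
  apply: (is_derive_eq (is_deriveM d1 d3)); rewrite /flat t0 /GRing.scale /=.
  by rewrite !exprS; ring.
- apply: (@near_eq_is_derive _ _ _ (cst 0)).
    have : \forall s \near t, s < 0 by exact: (cvgr_lt t (@cvg_id _ _) 0 t0).
    by apply: filterS => s s0; rewrite /flat ltNge ltW.
  by rewrite /flat ltNge ltW //= mulr0 subr0; exact: is_derive_cst.
- rewrite -t0 /flat ltxx mulr0 subr0.
  have C : (fun h : R => h^-1 *: (flat k (h *: 1 + 0) - flat k 0)) @ 0^' --> (0 : R).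
    apply/cvgrPdist_le => e e0; near=> h.
    rewrite sub0r normrN addr0 [_%:A]mulr1 {2}/flat ltxx subr0 /flat.
    case: ltP => h0; last by rewrite scaler0 normr0 ltW.
    rewrite /GRing.scale /= mulrA -exprS ger0_norm; last by rewrite mulr_ge0 ?expR_ge0 ?exprn_ge0 ?invr_ge0 ?ltW.
    apply: le_trans (flat_bound k h0) _.
    rewrite mulrC -ler_pdivlMr ?exprn_gt0 //; apply: le_trans (ler_norm _) _.
    near: h; apply: dnbhs0_le; rewrite divr_gt0 // exprn_gt0 //.
  apply: DeriveDef; first by apply/cvg_ex; exists 0.
  exact: cvg_lim C.
Unshelve. all: by end_near.
Qed.

Inductive flat_class : (R -> R) -> Prop :=
| flat_class_base k c : flat_class (fun t => c * flat k t)
| flat_class_add h h' of flat_class h & flat_class h' : flat_class (fun t => h t + h' t).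

Lemma flat_class_derive h : flat_class h ->
  (forall t, [set: R] t -> derivable h t 1) /\
     exists2 h', flat_class h' & forall t, [set: R] t -> 'D_(1 : R) h t = h' t.
Proof.
elim=> {h} [k c|h h' _ [d1 [g pg E1]] _ [d2 [g' pg' E2]]].
  have D t : is_derive (t : R) (1 : R) (fun t => c * flat k t) (c * flat k.+2 t + (- (c * k%:R)) * flat k.+1 t).
    rewrite (_ : (fun t => _) = cst c * flat k) //.
    have dc := is_derive_cst c t (1 : R).
    apply: (is_derive_eq (is_deriveM dc (is_derive_flat k t))).
    by rewrite /GRing.scale /= mulr0 addr0; ring.
  split=> [t _|]; first by have [] := D t.
  exists (fun t => c * flat k.+2 t + (- (c * k%:R)) * flat k.+1 t).
    by apply: flat_class_add; apply: flat_class_base.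
  by move=> t _; have [_ ->] := D t.
split=> [t Tt|].
  by apply: (derivableD (f := h) (g := h')); [exact: d1|exact: d2].
exists (fun t => g t + g' t); first exact: flat_class_add.
move=> t Tt; rewrite -E1 // -E2 //.
by apply: (deriveD (f := h) (g := h')); [exact: d1|exact: d2].
Qed.

Lemma bump_exists m (O : set 'rV[R]_m) (y0 : 'rV[R]_m) : open O -> O y0 ->
  exists (chi : 'rV[R]_m -> R) (r : R),
    [/\ smooth_on setT chi, forall y, 0 <= chi y, 0 < chi y0,
        forall y, `|y - y0| <= r -> O y & forall y, chi y != 0 -> `|y - y0| <= r].
Proof.
move=> oO Oy0.
have /nbhs_ballP [d /= d0 Hd] := open_nbhs_nbhs (conj oO Oy0).
pose r := d / 2; have r0 : 0 < r by rewrite divr_gt0.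
(* The square of the Euclidean distance is used because it is smooth, unlike the norm at hand, which
   is the maximum norm. Where q > 0 the latter is still at most r. *)
pose q (y : 'rV[R]_m) := r ^+ 2 - \sum_j (y 0 j - y0 0 j) * (y 0 j - y0 0 j).
exists (fun y => 1 * flat 0 (q y)), r.
have sq : smooth_on setT q.
  apply: smooth_onB; [exact: openT|apply: smooth_on_cst; exact: openT|].
  apply: smooth_on_sum => [|j _]; first exact: openT.
  by apply: smooth_onM; try exact: openT; (apply: smooth_onB; [exact: openT|apply: smooth_on_coord; exact: openT|apply: smooth_on_cst; exact: openT]).
split.
- apply: (@smooth_on_rcomp R m setT setT flat_class q (fun t => 1 * flat 0 t)) => //.
  + exact: openT.
  + exact: flat_class_derive.
  + exact: flat_class_base.
- by move=> y; rewrite mul1r /flat; case: ifP => // q0; rewrite mul1r expR_ge0.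
- rewrite mul1r /flat /q big1 ?subr0 ?exprn_gt0 ?mul1r ?expR_gt0 // => j _.
  by rewrite subrr mulr0.
- move=> y yr; apply: Hd; rewrite -ball_normE /= distrC; apply: le_lt_trans yr _.
  by rewrite /r ltr_pdivrMr // ltr_pMr // ltr1n.
- move=> y; rewrite mul1r /flat; case: ifP => [q0 _|]; last by rewrite eqxx.
  apply: norm_le_coord => [|j]; first exact: ltW.
  rewrite -ler_sqr ?nnegrE ?normr_ge0 ?(ltW r0) // real_normK ?num_real //.
  move: q0; rewrite /q subr_gt0 => /ltW; apply: le_trans.
  rewrite (bigD1 j) //= !mxE expr2 lerDl sumr_ge0 // => k _.
  by rewrite -expr2 sqr_ge0.
Qed.

End Bump.

(** * Integration by parts *)

Section LineIntegral.
Variable (R : realType).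
Local Notation mu := (@lebesgue_measure R).
Implicit Types (f g : R -> R).

Definition Cc1 f := continuous f /\ exists K, forall t, K < `|t| -> f t = 0.

Lemma Cc1P f : Cc1 f -> exists2 K, 0 < K & forall t, K < `|t| -> f t = 0.
Proof.
move=> [_ [K HK]]; exists (Num.max 1 K); first by rewrite lt_max ltr01.
by move=> t; rewrite gt_max => /andP[_ /HK].
Qed.

Lemma restrict_support f K : (forall t, K < `|t| -> f t = 0) -> f = f \_ `[- K, K].
Proof.
move=> HK; apply/funext => t; rewrite patchE; case: ifPn => // tK; apply: HK.
rewrite ltNge; apply: contra tK => tK; rewrite inE /= in_itv /= -ler_norml //.
Qed.

Lemma Cc1_integrable f : Cc1 f -> mu.-integrable setT (EFin \o f).
Proof.
move=> cf; have [K K0 HK] := Cc1P cf; case: cf => cf _.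
have : mu.-integrable `[- K, K] (EFin \o f).
  apply: continuous_compact_integrable; first exact: segment_compact.
  exact: continuous_subspaceT.
move=> /integrable_mkcond; rewrite [X in _.-integrable _ X](_ : _ = EFin \o f); first by apply.
rewrite {2}(restrict_support HK); apply/funext => t /=; rewrite !patchE.
by case: ifP.
Qed.

Lemma Rintegral_lin f g a : Cc1 f -> Cc1 g ->
  (\int[mu]_t (a * f t + g t) = a * (\int[mu]_t f t) + \int[mu]_t g t)%R.
Proof.
move=> /Cc1_integrable cf /Cc1_integrable cg.
rewrite RintegralD //; first by rewrite RintegralZl.
rewrite (_ : _ \o _ = (fun x => (a%:E * (EFin \o f) x)%E)) //.
exact: integrableZl.
Qed.

Lemma Rintegral_bound f K B : Cc1 f -> 0 <= K -> (forall t, K < `|t| -> f t = 0) ->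
  (forall t, `|f t| <= B) -> `|(\int[mu]_t f t)%R| <= K *+ 2 * B.
Proof.
move=> cf K0 HK HB.
rewrite (restrict_support HK) -Rintegral_mkcond.
have mK : measurable (`[- K, K] : set R) by exact: measurable_itv.
have iK : mu.-integrable `[- K, K] (EFin \o f).
  by apply: (integrableS _ _ _ (Cc1_integrable cf)).
have E : (fine (mu `[- K, K]) = K *+ 2)%R.
  rewrite lebesgue_measure_itv /= lte_fin; case: ltP => [_|h] /=.
    by rewrite opprK mulr2n.
  have -> : K = 0 by apply/eqP; rewrite eq_le K0 andbT; lra.
  by rewrite mul0rn.
have h1 : `|(\int[mu]_(t in `[- K, K]) f t)%R| <= (\int[mu]_(t in `[- K, K]) `|f t|)%R.
  by apply: le_normr_Rintegral => //; exact: measurable_itv.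
apply: (le_trans h1).
rewrite -E mulrC -Rintegral_cst //; apply: le_Rintegral => //.
  by have := integrable_abse iK.
apply: continuous_compact_integrable; first exact: segment_compact.
by apply: continuous_subspaceT => ?; exact: cvg_cst.
Qed.

(** Comparison with the constant f(t0)/2 on a segment around t0, where f exceeds it. *)
Lemma Rintegral_gt0 f t0 : Cc1 f -> (forall t, 0 <= f t) -> 0 < f t0 ->
  0 < (\int[mu]_t f t)%R.
Proof.
move=> cf f0 ft0; pose c := f t0 / 2; have c0 : 0 < c by rewrite divr_gt0.
have [cc _] := cf.
have : \forall t \near t0, c < f t.
  by apply: (cvgr_gt (f t0) (cc t0)); rewrite /c ltr_pdivrMr // ltr_pMr // ltr1n.
move=> /nbhs_ballP [d /= d0 Hd].
pose e := d / 2; have e0 : 0 < e by rewrite divr_gt0.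
have mI : measurable (`[t0 - e, t0 + e] : set R) by exact: measurable_itv.
have le : (\int[mu]_(t in `[t0 - e, t0 + e]) c)%R <= (\int[mu]_t f t)%R.
  rewrite Rintegral_mkcond; apply: le_Rintegral => //.
  - have : mu.-integrable `[t0 - e, t0 + e] (EFin \o (fun=> c)).
      apply: continuous_compact_integrable; first exact: segment_compact.
      by apply: continuous_subspaceT => ?; exact: cvg_cst.
    have E2 : (EFin \o (fun=> c)) \_ `[t0 - e, t0 + e] = EFin \o ((fun=> c) \_ `[t0 - e, t0 + e]).
      by apply/funext => t /=; rewrite !patchE; case: ifP.
    by move=> /integrable_mkcond; rewrite E2; apply.
  - exact: Cc1_integrable.
  - move=> t _; rewrite patchE; case: ifPn => // /set_mem /=; rewrite in_itv /= => /andP[h1 h2].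
    apply: ltW; apply: Hd; rewrite -ball_normE /= ltr_norml /e in h1 h2 *; apply/andP; split; lra.
have E : (fine (mu `[(t0 - e)%R, (t0 + e)%R]) = e *+ 2)%R.
  rewrite lebesgue_measure_itv /= lte_fin ifT; last by lra.
  by rewrite /= mulr2n; ring.
have -> : 0 = c * 0 by rewrite mulr0.
apply: (@lt_le_trans _ _ (c * (e *+ 2))); first by rewrite ltr_pM2l // pmulrn_lgt0.
apply: le_trans le; rewrite -E Rintegral_cst //; exact: measurable_itv.
Qed.

(** The change of variables is made on the segment [a, b]. The margin |h| in a and b ensures that
    [a, b] contains the support of the translated function and [a + h, b + h] that of f. *)
Lemma Rintegral_translate f h : Cc1 f -> (\int[mu]_t f (t + h) = \int[mu]_t f t)%R.
Proof.
move=> cf; have [K K0 HK] := Cc1P cf; case: cf => cf _.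
pose a := - K - `|h|; pose b := K + `|h|.
have ab : a <= b by rewrite /a /b; have := normr_ge0 h; lra.
have D1 (t : R) : is_derive (t : R) (1 : R) (fun t : R => t + h) (1 : R).
  rewrite (_ : (fun t : R => t + h) = id + cst h) //.
  by apply: is_derive_eq; rewrite addr0.
have dE : (fun t : R => t + h)^`() = cst 1.
  by apply/funext => t; rewrite derive1E; have [_ ->] := D1 t.
have S1 : (\int[mu]_(t in `[a + h, b + h]) f t)%R = (\int[mu]_t f t)%R.
  rewrite Rintegral_mkcond; congr (Rintegral _ _ _); apply/funext => t; rewrite patchE.
  case: ifPn => // tn; rewrite HK // ltNge; apply: contra tn => tK; rewrite inE /= in_itv /=.
  move: tK; rewrite ler_norml => /andP[t1 t2]; have := ler_norm h; have := ler_norm (- h); rewrite normrN.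
  by rewrite /a /b => h1 h2; apply/andP; split; lra.
have S2 : (\int[mu]_(t in `[a, b]) f (t + h))%R = (\int[mu]_t f (t + h))%R.
  rewrite Rintegral_mkcond; congr (Rintegral _ _ _); apply/funext => t; rewrite patchE.
  case: ifPn => // tn; rewrite HK // ltNge; apply: contra tn => tK; rewrite inE /= in_itv /=.
  move: tK; rewrite ler_norml => /andP[t1 t2]; have := ler_norm h; have := ler_norm (- h); rewrite normrN.
  by rewrite /a /b => h1 h2; apply/andP; split; lra.
rewrite -S1 -S2 /Rintegral.
rewrite (@integration_by_substitution_increasing R (fun t => t + h) f a b) //.
- congr fine; apply: eq_integral => t _ /=; rewrite dE /= mulr1; by [].
- by move=> x y _ _; rewrite ltrD2r.
- by rewrite dE => ? _; exact: cvg_cst.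
- by rewrite dE; exact: is_cvg_cst.
- by rewrite dE; exact: is_cvg_cst.
- have cs : continuous (fun t : R => t + h) by move=> t; apply: cvgD; [exact: cvg_id|exact: cvg_cst].
  split; first by move=> t _; have [] := D1 t.
    by apply: cvg_at_right_filter; exact: cs.
  by apply: cvg_at_left_filter; exact: cs.
- exact: continuous_subspaceT.
Qed.

End LineIntegral.

(** * Uniform continuity of compactly supported functions *)

Section UniformContinuity.
Variables (R : realType) (m : nat).
Local Notation V := 'rV[R]_m.
Implicit Types (f g : V -> R).

Definition Cc f := continuous f /\ exists K, forall y, K < `|y| -> f y = 0.

Lemma CcP f : Cc f -> exists2 K, 0 < K & forall t, K < `|t| -> f t = 0.
Proof.
move=> [_ [K HK]]; exists (Num.max 1 K); first by rewrite lt_max ltr01.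
by move=> t; rewrite gt_max => /andP[_ /HK].
Qed.

Lemma compact_norm_ball (K : R) : compact [set y : V | `|y| <= K].
Proof.
apply: bounded_closed_compact.
  exists K; split; first exact: num_real.
  by move=> M KM y /= yK; apply: le_trans yK (ltW KM).
rewrite (_ : [set y : V | `|y| <= K] = (fun y : V => `|y|) @^-1` [set t | t <= K]) //.
apply: closed_comp; last exact: closed_le.
by move=> y _; exact: norm_continuous.
Qed.

(** Only x is confined to the compact set while y ranges over the whole space, so that pairs
    straddling its boundary are covered. *)
Lemma compact_unif_continuous f (A : set V) (e : R) : compact A -> continuous f -> 0 < e ->
  exists2 d, 0 < d & forall x y, A x -> `|y - x| < d -> `|f y - f x| <= e.
Proof.
move=> /compact_near_coveringP cA cf e0.
pose P (d : R) (x : V) := forall y, `|y - x| < d -> `|f y - f x| <= e.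
have H : forall x, A x -> \forall x' \near x & d \near (0 : R)^'+, P d x'.
  move=> x Ax; have e20 : 0 < e / 2 by rewrite divr_gt0.
  have /cvgrPdist_le /(_ _ e20) /nbhs_ballP [d /= d0 Hd] := cf x.
  have Hd' y : `|y - x| < d -> `|f x - f y| <= e / 2.
    by move=> yx; apply: Hd; rewrite -ball_normE /= distrC.
  have d20 : 0 < d / 2 by rewrite divr_gt0.
  exists (ball x (d / 2), [set s | s < d / 2]); first split => /=.
  - exact: nbhsx_ballx.
  - by apply: nbhs_right_lt.
  - move=> [x' s] /= [+ sd] y yx'; rewrite -ball_normE /= => xx'.
    rewrite (splitr e) -(subrKA (f x)); apply: le_trans (ler_normD _ _) _.
    apply: lerD; last by apply: Hd'; rewrite distrC; apply: lt_trans xx' _; lra.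
    rewrite distrC; apply: Hd'; rewrite -(subrKA x'); apply: le_lt_trans (ler_normD _ _) _.
    by rewrite distrC in xx'; lra.
have := cA _ _ P _ H => /(_ _) HH.
have [d [d0 Hd]] : exists d, 0 < d /\ A `<=` P d.
  have : \forall d \near (0 : R)^'+, 0 < d /\ A `<=` P d.
    by apply: filterI; [exact: nbhs_right_gt|exact: HH].
  by move=> /filter_ex [d ?]; exists d.
by exists d => // x y Ax; exact: Hd.
Qed.

Lemma Cc_unif_continuous f (e : R) : Cc f -> 0 < e ->
  exists2 d, 0 < d & forall x y, `|y - x| < d -> `|f y - f x| <= e.
Proof.
move=> cf e0; have [K K0 HK] := CcP cf; case: cf => cf _.
(* With the radius enlarged by 1 and d at most 1, a point x outside the larger ball forces both x
   and y out of the support. *)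
have [d d0 Hd] := compact_unif_continuous (@compact_norm_ball (K + 1)) cf e0.
exists (Num.min d 1); first by rewrite lt_min d0 ltr01.
move=> x y; rewrite lt_min => /andP[yd y1].
case: (leP `|x| (K + 1)) => xK; first exact: Hd.
rewrite !HK ?subrr ?normr0 ?ltW //; first by lra.
have := ler_normD (x - y) y; rewrite subrK distrC => h; lra.
Qed.

Lemma Cc0 : Cc (fun=> 0 : R).
Proof. by split; [move=> y; exact: cst_continuous|exists 0]. Qed.

Lemma Cc_lin f g a : Cc f -> Cc g -> Cc (fun y => a * f y + g y).
Proof.
move=> [cf [K HK]] [cg [K' HK']]; split.
  by move=> y; exact: (cvgD (cvgM (cvg_cst a) (cf y)) (cg y)).
by exists (Num.max K K') => y; rewrite gt_max => /andP[/HK -> /HK' ->]; rewrite mulr0 addr0.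
Qed.

End UniformContinuity.

(** * The iterated integral: linearity, bounds, translations, derivatives *)

Section IteratedIntegral.
Variable R : realType.

Definition slice m (f : 'rV[R]_m.+1 -> R) (t : R) (y : 'rV[R]_m) : R :=
  f (row_mx (t%:M : 'rV_1) y : 'rV_(1 + m)).

Lemma iter_integralS m (f : 'rV[R]_m.+1 -> R) :
  iter_integral f = (\int[@lebesgue_measure R]_t iter_integral (slice f t))%R.
Proof. by []. Qed.

Lemma row_mx0E m (t : R) (y : 'rV[R]_m) :
  (row_mx (t%:M : 'rV_1) y : 'rV_(1 + m)) 0 (lshift m (0 : 'I_1)) = t.
Proof. by rewrite row_mxEl mxE eqxx mulr1n. Qed.

Lemma row_mx_diff m (t s : R) (y z : 'rV[R]_m) :
  (row_mx (t%:M : 'rV_1) y - row_mx (s%:M : 'rV_1) z : 'rV_(1 + m)) =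
  row_mx ((t - s)%:M : 'rV_1) (y - z).
Proof. by rewrite opp_row_mx add_row_mx raddfB. Qed.

Lemma norm_row_mx_le m (t : R) (y : 'rV[R]_m) c : `|t| <= c -> `|y| <= c ->
  `|row_mx (t%:M : 'rV_1) y : 'rV_(1 + m)| <= c.
Proof.
move=> tc yc; apply: norm_le_coord => [|j]; first exact: le_trans tc.
case: (fintype.splitP j) => k jk.
  have -> : j = lshift m k by apply: val_inj.
  by rewrite (ord1 k) row_mx0E.
have -> : j = rshift 1 k by apply: val_inj.
by rewrite row_mxEr; apply: le_trans yc; exact: coord_le_norm.
Qed.

Lemma norm_row_mx_l m (t : R) (y : 'rV[R]_m) : `|t| <= `|row_mx (t%:M : 'rV_1) y : 'rV_(1 + m)|.
Proof. by rewrite -{1}(row_mx0E t y); exact: coord_le_norm. Qed.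

Lemma norm_row_mx_r m (t : R) (y : 'rV[R]_m) : `|y| <= `|row_mx (t%:M : 'rV_1) y : 'rV_(1 + m)|.
Proof.
apply: norm_le_coord => // j; rewrite -(row_mxEr (t%:M : 'rV_1) y).
exact: coord_le_norm.
Qed.

Lemma slice_continuous m (f : 'rV[R]_m.+1 -> R) t : continuous f -> continuous (slice f t).
Proof.
move=> cf y; apply/(@cvgrPdist_le _ _ _ (nbhs y) _ (slice f t) (slice f t y)) => e e0.
have /cvgrPdist_le /(_ _ e0) /nbhs_ballP [d /= d0 Hd] := cf (row_mx (t%:M : 'rV_1) y : 'rV_(1 + m)).
apply/nbhs_ballP; exists d => // z; rewrite -ball_normE /= => yz.
apply: Hd; rewrite -ball_normE /= row_mx_diff subrr; apply: le_lt_trans yz.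
by apply: norm_row_mx_le; rewrite ?normr0.
Qed.

Lemma slice_support m (f : 'rV[R]_m.+1 -> R) K : (forall y, K < `|y| -> f y = 0) ->
  (forall t y, K < `|y| -> slice f t y = 0) /\ (forall t, K < `|t| -> slice f t = fun=> 0).
Proof.
move=> HK; split=> [t y yK|t tK]; last apply/funext => y; apply: HK.
  exact: lt_le_trans yK (norm_row_mx_r _ _).
exact: lt_le_trans tK (norm_row_mx_l _ _).
Qed.

Lemma slice_Cc m (f : 'rV[R]_m.+1 -> R) t : Cc f -> Cc (slice f t).
Proof.
move=> [cf [K HK]]; split; first exact: slice_continuous.
by exists K => y yK; have [s _] := slice_support HK; exact: s.
Qed.

(** The three facts need a common induction. Linearity and the bound in dimension m + 1 require that
    the inner integrals depend continuously on the outer variable, which is the third fact for m.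
    The third fact in turn follows from linearity and the bound, applied to the difference of two
    slices, which is uniformly small. *)
Lemma iter_integral_lin_bound m :
  (forall (f g : 'rV[R]_m -> R) a, Cc f -> Cc g ->
     iter_integral (fun y => a * f y + g y) = a * iter_integral f + iter_integral g) /\
  (forall (f : 'rV[R]_m -> R) (K B : R), Cc f -> 0 <= K -> (forall y, K < `|y| -> f y = 0) ->
     (forall y, `|f y| <= B) -> `|iter_integral f| <= (K *+ 2) ^+ m * B) /\
  (forall (f : 'rV[R]_m.+1 -> R), Cc f -> Cc1 (fun t => iter_integral (slice f t))).
Proof.
elim: m => [|m [IH1 [IH2 IH3]]].
  have b0 : forall (f : 'rV[R]_0 -> R) K B, Cc f -> 0 <= K -> (forall y, K < `|y| -> f y = 0) ->
     (forall y, `|f y| <= B) -> `|iter_integral f| <= (K *+ 2) ^+ 0 * B.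
    by move=> f K B _ _ _ HB; rewrite expr0 mul1r; exact: HB.
  split=> //; split=> // f cf; have [K K0 HK] := CcP cf; split.
    move=> t; apply/cvgrPdist_le => e e0; have [d d0 Hd] := Cc_unif_continuous cf e0.
    apply/nbhs_ballP; exists d => // s ts'; have ts : `|t - s| < d by exact: ts'.
    apply: Hd; apply: le_lt_trans ts; rewrite row_mx_diff; apply: norm_row_mx_le => //.
    by rewrite subrr normr0.
  by exists K => t tK; have [_ /(_ t tK) ->] := slice_support HK.
have key (f g : 'rV[R]_m.+1 -> R) a : Cc f -> Cc g ->
     iter_integral (fun y => a * f y + g y) = a * iter_integral f + iter_integral g.
  move=> cf cg; rewrite !iter_integralS -Rintegral_lin; [|exact: IH3|exact: IH3].
  by congr (Rintegral _ _ _); apply/funext => t; rewrite -IH1 //; exact: slice_Cc.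
have bnd (f : 'rV[R]_m.+1 -> R) K B : Cc f -> 0 <= K -> (forall y, K < `|y| -> f y = 0) ->
     (forall y, `|f y| <= B) -> `|iter_integral f| <= (K *+ 2) ^+ m.+1 * B.
  move=> cf K0 HK HB; rewrite iter_integralS exprS -mulrA.
  have [s1 s2] := slice_support HK.
  apply: Rintegral_bound => //; first exact: IH3.
    move=> t tK; rewrite (s2 t tK).
    have c0 := @Cc0 R m.
    have := IH1 (fun=> 0) (fun=> 0) (-1) c0 c0; rewrite mulr0 addr0 mulN1r addNr; exact.
  move=> t; apply: IH2 => //; first exact: slice_Cc.
    by move=> y; exact: s1.
  by move=> y; exact: HB.
split=> //; split=> // f cf; have [K K0 HK] := CcP cf; have [s1 s2] := slice_support HK.
have i0 : @iter_integral R m.+1 (fun=> 0) = 0.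
  have c0 := @Cc0 R m.+1.
  have := key (fun=> 0) (fun=> 0) (-1) c0 c0; rewrite mulr0 addr0 mulN1r addNr; exact.
split; last by exists K => t tK; rewrite (s2 t tK).
move=> t; apply/cvgrPdist_le => e e0.
pose c := (K *+ 2) ^+ m.+1; have c0 : 0 < c by rewrite exprn_gt0 // pmulrn_rgt0.
have [d d0 Hd] := Cc_unif_continuous cf (divr_gt0 e0 c0).
apply/nbhs_ballP; exists d => // s ts'; have ts : `|t - s| < d by exact: ts'.
have E : iter_integral (slice f t) - iter_integral (slice f s) =
   iter_integral (fun y => (-1) * slice f s y + slice f t y).
  by rewrite key; [rewrite mulN1r addrC|exact: slice_Cc|exact: slice_Cc].
rewrite E; have -> : e = c * (e / c) by rewrite mulrC divfK // gt_eqF.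
apply: bnd; [|exact: ltW| |].
- by apply: Cc_lin; exact: slice_Cc.
- by move=> y yK; rewrite !s1 // mulr0 addr0.
- move=> y; rewrite mulN1r addrC; apply: Hd; apply: le_lt_trans ts.
  rewrite row_mx_diff; apply: norm_row_mx_le => //.
  by rewrite subrr normr0.
Qed.

Lemma iter_integral_lin m (f g : 'rV[R]_m -> R) a : Cc f -> Cc g ->
  iter_integral (fun y => a * f y + g y) = a * iter_integral f + iter_integral g.
Proof. by have [] := iter_integral_lin_bound m => + _; exact. Qed.

Lemma iter_integral_bound m (f : 'rV[R]_m -> R) K B : Cc f -> 0 <= K ->
  (forall y, K < `|y| -> f y = 0) -> (forall y, `|f y| <= B) ->
  `|iter_integral f| <= (K *+ 2) ^+ m * B.
Proof. by have [_ []] := iter_integral_lin_bound m => + _; exact. Qed.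

Lemma iter_slice_Cc1 m (f : 'rV[R]_m.+1 -> R) : Cc f -> Cc1 (fun t => iter_integral (slice f t)).
Proof. by have [_ [_]] := iter_integral_lin_bound m; exact. Qed.

Lemma iter_integral_ge0 m (f : 'rV[R]_m -> R) : (forall y, 0 <= f y) -> 0 <= iter_integral f.
Proof.
elim: m f => [|m IH] f f0; first exact: f0.
by rewrite iter_integralS; apply: Rintegral_ge0 => t _; apply: IH => y; exact: f0.
Qed.

Lemma iter_integral_gt0 m (f : 'rV[R]_m -> R) y0 : Cc f -> (forall y, 0 <= f y) -> 0 < f y0 ->
  0 < iter_integral f.
Proof.
elim: m f y0 => [|m IH] f y0 cf f0 fy0 /=.
  by rewrite (_ : 0 = y0) //; apply/rowP => -[].
rewrite -/(iter_integral _).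
have E : y0 = row_mx ((y0 0 ord0)%:M : 'rV_1) (\row_j y0 0 (rshift 1 j)) :> 'rV_(1 + m).
  apply/rowP => j; case: (fintype.splitP j) => k jk.
    have -> : j = lshift m k by apply: val_inj.
    by rewrite (ord1 k) row_mx0E; congr (y0 _ _); apply: val_inj.
  have -> : j = rshift 1 k by apply: val_inj.
  by rewrite row_mxEr mxE.
apply: (@Rintegral_gt0 _ (fun t => iter_integral (slice f t)) (y0 0 ord0)).
- exact: iter_slice_Cc1.
- by move=> t; apply: iter_integral_ge0 => y; exact: f0.
- apply: (IH _ (\row_j y0 0 (rshift 1 j))); first exact: slice_Cc.
    by move=> y; exact: f0.
  by rewrite /slice -E.
Qed.

(** Only one of the nested integrals is affected; the induction descends to the one over the j-th
    coordinate and translates there. *)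
Lemma iter_integral_translate m (f : 'rV[R]_m -> R) j h : Cc f ->
  iter_integral (fun y => f (y + h *: evec R j)) = iter_integral f.
Proof.
elim: m f j => [|m IH] f j cf; first by case: j.
rewrite !iter_integralS; case: (fintype.splitP (j : 'I_(1 + m))) => k jk.
  rewrite -(Rintegral_translate h (iter_slice_Cc1 cf)).
  congr (Rintegral _ _ _); apply/funext => t; congr iter_integral; apply/funext => y.
  rewrite /slice; congr f; apply/rowP => i; rewrite !mxE eqxx /=.
  case: (fintype.splitP (i : 'I_(1 + m))) => l il; rewrite ?mxE.
    have lk : l = k :> nat by rewrite (ord1 l) (ord1 k).
    have -> : i = j by apply: val_inj; exact: (etrans il (etrans lk (esym jk))).
    by rewrite (ord1 l) !eqxx !mulr1n mulr1.
  have -> : (i == j) = false.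
    apply/eqP => ij; have := etrans (esym il) (etrans (congr1 _ ij) jk).
    by rewrite (ord1 k).
  by rewrite mulr0 addr0.
congr (Rintegral _ _ _); apply/funext => t.
rewrite -(IH (slice f t) k); last exact: slice_Cc.
congr iter_integral; apply/funext => y; rewrite /slice; congr f.
apply/rowP => i; rewrite !mxE eqxx /=.
case: (fintype.splitP (i : 'I_(1 + m))) => l il; rewrite ?mxE.
  have -> : (i == j) = false.
    apply/eqP => ij; have := etrans (esym jk) (etrans (congr1 _ (esym ij)) il).
    by rewrite (ord1 l).
  by rewrite mulr0 addr0.
congr (_ + _ * _%:R); congr (nat_of_bool _); rewrite eqxx /=.
have iE : (i == j) = ((1 + l)%N == (1 + k)%N) by exact: (congr2 (fun a b : nat => a == b) il jk).
by rewrite iE eqn_add2l.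
Qed.

(** The integral of a difference quotient vanishes by translation invariance, and the quotients
    converge uniformly to the derivative on a fixed ball. In this way the order of the nested
    integrals never has to be exchanged. *)
Lemma iter_integral_derive m (f : 'rV[R]_m -> R) j : Cc f ->
  (forall y, derivable f y (evec R j)) -> continuous ('D_(evec R j) f) ->
  iter_integral ('D_(evec R j) f) = 0.
Proof.
move=> cf df cD; have [K K0 HK] := CcP cf.
have DK y : K < `|y| -> 'D_(evec R j) f y = 0.
  move=> yK; rewrite (@near_eq_derive _ _ _ f (cst 0)) ?derive_cst //.
  have : \forall z \near y, K < `|z| by apply: (cvgr_gt `|y| (@norm_continuous _ _ y)).
  by apply: filterS => z /HK.
have cg : Cc ('D_(evec R j) f) by split=> //; exists K.
(* A translation by h <= 1 keeps the support in the ball of radius K + 1; c is the volume of the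
   corresponding cube. *)
pose c := ((K + 1) *+ 2) ^+ m; have c0 : 0 < c by rewrite exprn_gt0 // pmulrn_rgt0 // ; lra.
apply/eqP; rewrite -normr_le0; apply/ler_addgt0Pl => e e0; rewrite addr0.
have -> : e = c * (e / c) by rewrite mulrC divfK // gt_eqF.
have [d d0 Hd] := Cc_unif_continuous cg (divr_gt0 e0 c0).
pose h := Num.min (d / 2) 1.
have h0 : 0 < h by rewrite lt_min ltr01 andbT divr_gt0.
have hd : h < d by rewrite gt_min; apply/orP; left; rewrite ltr_pdivrMr // ltr_pMr // ltr1n.
have h1 : h <= 1 by rewrite ge_min lexx orbT.
have fhK y : K + 1 < `|y| -> f (y + h *: evec R j) = 0.
  move=> yK; apply: HK; have := ler_normD (y + h *: evec R j) (- (h *: evec R j)).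
  rewrite addrK normrN; have := evec_norm j h; rewrite (gtr0_norm h0) => h2 h3; lra.
have cfh : Cc (fun y => f (y + h *: evec R j)).
  split; last by exists (K + 1).
  move=> y; apply/(@cvgrPdist_le _ _ _ (nbhs y) _ _ (f (y + h *: evec R j))) => e' e'0.
  have [d' d'0 Hd'] := Cc_unif_continuous cf e'0.
  apply/nbhs_ballP; exists d' => // z; rewrite -ball_normE /= => yz.
  by apply: Hd'; rewrite opprD addrACA subrr addr0.
have cq : Cc (fun y => h^-1 * ((-1) * f y + f (y + h *: evec R j)) + (fun=> 0) y).
  by apply: Cc_lin; [exact: Cc_lin|exact: Cc0].
have E : iter_integral (fun y => (-1) * ('D_(evec R j) f) y + (h^-1 * ((-1) * f y + f (y + h *: evec R j)) + (fun=> 0) y)) =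
   - iter_integral ('D_(evec R j) f).
  rewrite iter_integral_lin // iter_integral_lin; [|exact: Cc_lin|exact: Cc0].
  rewrite iter_integral_lin // iter_integral_translate // mulN1r mulN1r addNr mulr0 add0r.
  have c00 := @Cc0 R m.
  have := iter_integral_lin (-1) c00 c00 (m := m); rewrite mulr0 addr0 mulN1r addNr => ->.
  by rewrite addr0.
rewrite -normrN -E; apply: iter_integral_bound.
- exact: Cc_lin.
- by rewrite addr_ge0 // ltW.
- move=> y yK; have yK' : K < `|y| by apply: lt_trans yK; rewrite ltrDl.
  by rewrite fhK // HK // DK // !(mulr0, addr0).
- move=> y; have [|t th Et] := @mvt_line R m f y (evec R j) h; first by move=> t _; exact: df.
  rewrite addr0 mulN1r mulN1r [- f y + _]addrC Et mulrCA mulVf ?gt_eqF // mulr1 addrC.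
  apply: Hd; rewrite addrC addKr; apply: le_lt_trans hd; apply: le_trans (evec_norm _ _) _.
  by rewrite (gtr0_norm h0) in th.
Qed.

End IteratedIntegral.

(** * Calculus in charts *)

Section ComplexSmooth.
Variables (R : realType) (m : nat).
Local Notation C := R[i].
Local Notation V := 'rV[R]_m.
Implicit Types (O : set V) (f g : V -> C).

Lemma ReD (x y : C) : complex.Re (x + y) = complex.Re x + complex.Re y.
Proof. by case: x y => [a b] [c d]. Qed.

Lemma ImD (x y : C) : complex.Im (x + y) = complex.Im x + complex.Im y.
Proof. by case: x y => [a b] [c d]. Qed.

Lemma ReM (x y : C) : complex.Re (x * y) = complex.Re x * complex.Re y - complex.Im x * complex.Im y.
Proof. by case: x y => [a b] [c d]. Qed.

Lemma ImM (x y : C) : complex.Im (x * y) = complex.Re x * complex.Im y + complex.Im x * complex.Re y.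
Proof. by case: x y => [a b] [c d]. Qed.

Lemma Re_sum I (r : seq I) (P : pred I) (F : I -> C) :
  complex.Re (\sum_(i <- r | P i) F i) = \sum_(i <- r | P i) complex.Re (F i).
Proof. by elim/big_rec2: _ => // i x y _ <-; rewrite ReD. Qed.

Lemma Im_sum I (r : seq I) (P : pred I) (F : I -> C) :
  complex.Im (\sum_(i <- r | P i) F i) = \sum_(i <- r | P i) complex.Im (F i).
Proof. by elim/big_rec2: _ => // i x y _ <-; rewrite ImD. Qed.

Lemma nearV (x : V) (P : V -> Prop) : (forall y, P y) -> \forall y \near x, P y.
Proof. by move=> H; apply: (near_open (O := setT) openT). Qed.

Lemma smoothC_on_local O f :
  (forall x, O x -> exists B, B x /\ smoothC_on B f) -> smoothC_on O f.
Proof.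
by move=> H; split; apply: smooth_on_local => x /H [B [Bx [H1 H2]]]; exists B.
Qed.

Lemma smoothC_on_near O f g :
  (forall x, O x -> \forall y \near x, f y = g y) -> smoothC_on O f -> smoothC_on O g.
Proof.
move=> H [s1 s2]; split; [apply: smooth_on_near s1|apply: smooth_on_near s2] => x /H;
  by apply: filterS => y ->.
Qed.

Lemma smoothC_on_congr O f g : open O -> (forall x, O x -> f x = g x) ->
  smoothC_on O f -> smoothC_on O g.
Proof. by move=> oO fg; apply: smoothC_on_near => x Ox; exact: near_open fg. Qed.

Lemma smoothC_on_cst O (c : C) : open O -> smoothC_on O (fun=> c).
Proof. by move=> oO; split; exact: smooth_on_cst. Qed.

Lemma smoothC_on_real O (f : V -> R) : open O -> smooth_on O f -> smoothC_on O (fun x => (f x)%:C%C).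
Proof. by move=> oO sf; split => //; exact: smooth_on_cst. Qed.

Lemma smoothC_onD O f g : open O -> smoothC_on O f -> smoothC_on O g ->
  smoothC_on O (fun x => f x + g x).
Proof.
move=> oO [f1 f2] [g1 g2]; split.
  by apply: (smooth_on_congr oO) (smooth_onD oO f1 g1) => x _; rewrite ReD.
by apply: (smooth_on_congr oO) (smooth_onD oO f2 g2) => x _; rewrite ImD.
Qed.

Lemma smoothC_onM O f g : open O -> smoothC_on O f -> smoothC_on O g ->
  smoothC_on O (fun x => f x * g x).
Proof.
move=> oO [f1 f2] [g1 g2]; split.
  apply: (smooth_on_congr oO) (smooth_onB oO (smooth_onM oO f1 g1) (smooth_onM oO f2 g2)) => x _.
  by rewrite ReM.
apply: (smooth_on_congr oO) (smooth_onD oO (smooth_onM oO f1 g2) (smooth_onM oO f2 g1)) => x _.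
by rewrite ImM.
Qed.

Lemma smoothC_on_conj O f : open O -> smoothC_on O f -> smoothC_on O (fun x => conjc (f x)).
Proof.
move=> oO [f1 f2]; split.
  by apply: (smooth_on_congr oO) f1 => x _; case: (f x).
by apply: (smooth_on_congr oO) (smooth_onN oO f2) => x _; case: (f x).
Qed.

Lemma smoothC_on_sum O I (r : seq I) (P : pred I) (F : I -> V -> C) : open O ->
  (forall i, P i -> smoothC_on O (F i)) -> smoothC_on O (fun x => \sum_(i <- r | P i) F i x).
Proof.
move=> oO H; split.
  apply: (smooth_on_congr oO (f := fun x => \sum_(i <- r | P i) complex.Re (F i x))).
    by move=> x _; rewrite Re_sum.
  by apply: smooth_on_sum => // i /H [].
apply: (smooth_on_congr oO (f := fun x => \sum_(i <- r | P i) complex.Im (F i x))).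
  by move=> x _; rewrite Im_sum.
by apply: smooth_on_sum => // i /H [].
Qed.

Lemma smoothC_on_prod O I (r : seq I) (P : pred I) (F : I -> V -> C) : open O ->
  (forall i, P i -> smoothC_on O (F i)) -> smoothC_on O (fun x => \prod_(i <- r | P i) F i x).
Proof.
move=> oO H; elim: r => [|i r IH].
  by apply: (smoothC_on_congr oO) (smoothC_on_cst 1 oO) => x _; rewrite big_nil.
case Pi: (P i).
  by apply: (smoothC_on_congr oO) (smoothC_onM oO (H i Pi) IH) => x _; rewrite big_cons Pi.
by apply: (smoothC_on_congr oO) IH => x _; rewrite big_cons Pi.
Qed.

Lemma smoothC_on_inv O f : open O -> (forall x, O x -> f x != 0) ->
  smoothC_on O f -> smoothC_on O (fun x => (f x)^-1).
Proof.
move=> oO f0 [f1 f2].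
pose n x := complex.Re (f x) * complex.Re (f x) + complex.Im (f x) * complex.Im (f x).
have n0 x : O x -> n x != 0.
  move=> /f0; apply: contra; rewrite /n -!expr2 paddr_eq0 ?sqr_ge0 // !sqrf_eq0.
  by case: (f x) => a b /= /andP[/eqP -> /eqP ->].
have sn : smooth_on O n by apply: smooth_onD => //; apply: smooth_onM.
have sv := smooth_on_inv oO n0 sn.
split.
  apply: (smooth_on_congr oO) (smooth_onM oO f1 sv) => x _.
  by rewrite /n -!expr2; case: (f x).
apply: (smooth_on_congr oO) (smooth_onN oO (smooth_onM oO f2 sv)) => x _.
by rewrite /n -!expr2; case: (f x).
Qed.

Lemma smoothC_on_det O n (A : V -> 'M[C]_n) : open O ->
  (forall i j, smoothC_on O (fun x => A x i j)) -> smoothC_on O (fun x => \det (A x)).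
Proof.
move=> oO sA; rewrite /determinant; apply: smoothC_on_sum => // s _.
by apply: smoothC_onM => //; [exact: smoothC_on_cst|apply: smoothC_on_prod].
Qed.

Lemma smoothC_on_invmx O n (A : V -> 'M[C]_n) : open O ->
  (forall x, O x -> A x \in unitmx) ->
  (forall i j, smoothC_on O (fun x => A x i j)) ->
  forall i j, smoothC_on O (fun x => invmx (A x) i j).
Proof.
move=> oO uA sA i j.
apply: (smoothC_on_congr oO (f := fun x => (\det (A x))^-1 * cofactor (A x) j i)).
  by move=> x Ox; rewrite /invmx uA // !mxE.
have d0 x : O x -> \det (A x) != 0 by move=> /uA; rewrite unitmxE unitfE.
apply: (smoothC_onM oO (smoothC_on_inv oO d0 (smoothC_on_det oO sA))).
rewrite /cofactor; apply: smoothC_onM => //; first exact: smoothC_on_cst.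
apply: smoothC_on_det => // k l.
by apply: (smoothC_on_congr oO) (sA (lift j k) (lift i l)) => x _; rewrite !mxE.
Qed.

Lemma smoothC_on_partial O f j : smoothC_on O f -> smoothC_on O (partialC j f).
Proof. by move=> [f1 f2]; split; exact: smooth_on_derive. Qed.

Lemma partialC_near (x : V) j f g : (\forall y \near x, f y = g y) -> partialC j f x = partialC j g x.
Proof.
move=> fg; rewrite /partialC.
congr (_ +i* _)%C; apply: near_eq_derive; apply: filterS fg => y ->; by [].
Qed.

Lemma partialC_cst (x : V) j (c : C) : partialC j (fun=> c) x = 0.
Proof.
rewrite /partialC (_ : (fun y => _) = cst (complex.Re c)) // derive_cst.
by rewrite (_ : (fun y => _) = cst (complex.Im c)) // derive_cst.
Qed.

Lemma partialCD O f g (x : V) j : O x -> smoothC_on O f -> smoothC_on O g ->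
  partialC j (fun y => f y + g y) x = partialC j f x + partialC j g x.
Proof.
move=> Ox [f1 f2] [g1 g2]; rewrite /partialC.
rewrite (_ : (fun y => complex.Re (f y + g y)) = (fun y => complex.Re (f y)) + (fun y => complex.Re (g y))); last first.
  by apply/funext => y; rewrite ReD.
rewrite (_ : (fun y => complex.Im (f y + g y)) = (fun y => complex.Im (f y)) + (fun y => complex.Im (g y))); last first.
  by apply/funext => y; rewrite ImD.
have df1 := smooth_on_derivable (j := j) f1 Ox; have df2 := smooth_on_derivable (j := j) f2 Ox.
have dg1 := smooth_on_derivable (j := j) g1 Ox; have dg2 := smooth_on_derivable (j := j) g2 Ox.
by rewrite (deriveD df1 dg1) (deriveD df2 dg2).
Qed.

Lemma partialCM O f g (x : V) j : O x -> smoothC_on O f -> smoothC_on O g ->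
  partialC j (fun y => f y * g y) x = f x * partialC j g x + partialC j f x * g x.
Proof.
move=> Ox [f1 f2] [g1 g2]; rewrite /partialC.
rewrite (_ : (fun y => complex.Re (f y * g y)) = (fun y => complex.Re (f y)) * (fun y => complex.Re (g y))
   - (fun y => complex.Im (f y)) * (fun y => complex.Im (g y))); last first.
  by apply/funext => y; rewrite ReM.
rewrite (_ : (fun y => complex.Im (f y * g y)) = (fun y => complex.Re (f y)) * (fun y => complex.Im (g y)) +
   (fun y => complex.Im (f y)) * (fun y => complex.Re (g y))); last first.
  by apply/funext => y; rewrite ImM.
have df1 := smooth_on_derivable (j := j) f1 Ox; have df2 := smooth_on_derivable (j := j) f2 Ox.
have dg1 := smooth_on_derivable (j := j) g1 Ox; have dg2 := smooth_on_derivable (j := j) g2 Ox.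
have E1 := etrans (deriveB (derivableM df1 dg1) (derivableM df2 dg2))
  (congr2 (fun a b => a - b) (deriveM df1 dg1) (deriveM df2 dg2)).
have E2 := etrans (deriveD (derivableM df1 dg2) (derivableM df2 dg1))
  (congr2 (fun a b => a + b) (deriveM df1 dg2) (deriveM df2 dg1)).
apply: (etrans (congr2 (fun a b => (a +i* b)%C) E1 E2)).
rewrite /GRing.scale /=.
move: ('D_(evec R j) _ x) ('D_(evec R j) _ x) ('D_(evec R j) _ x) ('D_(evec R j) _ x) => a' b' c' d'.
case: (f x) (g x) => [a b] [c d] /=.
apply/eqP; rewrite eq_complex /=; apply/andP; split; apply/eqP; ring.
Qed.

Lemma partialCZ O f (c : C) (x : V) j : open O -> O x -> smoothC_on O f ->
  partialC j (fun y => c * f y) x = c * partialC j f x.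
Proof.
move=> oO Ox sf; rewrite (@partialCM O (fun=> c)) //; last exact: smoothC_on_cst.
by rewrite partialC_cst mul0r addr0.
Qed.

Lemma partialC_sum O I (r : seq I) (F : I -> V -> C) (x : V) j : open O -> O x ->
  (forall i, smoothC_on O (F i)) ->
  partialC j (fun y => \sum_(i <- r) F i y) x = \sum_(i <- r) partialC j (F i) x.
Proof.
move=> oO Ox sF; elim: r => [|i r IH].
  rewrite big_nil; transitivity (partialC j (fun=> 0) x); last exact: partialC_cst.
  by apply: partialC_near; apply: nearV => y; rewrite big_nil.
rewrite big_cons -IH -(@partialCD O) //; last by apply: smoothC_on_sum.
by apply: partialC_near; apply: nearV => y; rewrite big_cons.
Qed.

Lemma partialC_conj O f (x : V) j : O x -> smoothC_on O f ->
  partialC j (fun y => conjc (f y)) x = conjc (partialC j f x).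
Proof.
move=> Ox [f1 f2]; rewrite /partialC.
rewrite (_ : (fun y => complex.Re (conjc (f y))) = (fun y => complex.Re (f y))); last first.
  by apply/funext => y; case: (f y).
rewrite (_ : (fun y => complex.Im (conjc (f y))) = - (fun y => complex.Im (f y))); last first.
  by apply/funext => y; rewrite -[RHS]/(- complex.Im (f y)); case: (f y).
by rewrite deriveN //; exact: (smooth_on_derivable (j := j) f2 Ox).
Qed.

Lemma partialC_schwarz O f (x : V) i j : open O -> smoothC_on O f -> O x ->
  partialC i (partialC j f) x = partialC j (partialC i f) x.
Proof.
move=> oO [f1 f2] Ox.
have h (u : V -> R) : smooth_on O u -> 'D_(evec R i) ('D_(evec R j) u) x = 'D_(evec R j) ('D_(evec R i) u) x.
  by move=> su; exact: schwarz oO su Ox.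
transitivity ('D_(evec R i) ('D_(evec R j) (fun y => complex.Re (f y))) x +i*
              'D_(evec R i) ('D_(evec R j) (fun y => complex.Im (f y))) x)%C; first exact: erefl.
by rewrite (h _ f1) (h _ f2).
Qed.

End ComplexSmooth.

Lemma sum_complex (R : realType) I (r : seq I) (a b : I -> R) :
  \sum_(k <- r) (a k +i* b k)%C = ((\sum_(k <- r) a k) +i* (\sum_(k <- r) b k))%C.
Proof. by apply/eqP; rewrite eq_complex Re_sum Im_sum /= !eqxx. Qed.

Lemma partialC_chain (R : realType) (m p : nat) (O : set 'rV[R]_m) (O' : set 'rV[R]_p)
    (f : 'rV[R]_p -> R[i]) (F : 'rV[R]_m -> 'rV[R]_p) (x : 'rV[R]_m) j :
  open O -> open O' -> O x -> O' (F x) ->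
  (forall k, smooth_on O (fun y => F y 0 k)) -> smoothC_on O' f ->
  partialC j (fun y => f (F y)) x =
  \sum_k partialC k f (F x) * ('D_(evec R j) (fun y => F y 0 k) x)%:C%C.
Proof.
move=> oO oO' Ox O'x sF [f1 f2].
have dF k : differentiable (fun y => F y 0 k) x by exact: smooth_on_differentiable Ox.
have df1 := smooth_on_differentiable oO' f1 O'x.
have df2 := smooth_on_differentiable oO' f2 O'x.
have [_ E1] := chain_rule (evec R j) df1 dF.
have [_ E2] := chain_rule (evec R j) df2 dF.
rewrite /partialC E1 E2 -sum_complex; apply: eq_bigr => k _.
by apply/eqP; rewrite eq_complex /= !mulr0 subr0 add0r !eqxx.
Qed.

Lemma smoothC_on_comp (R : realType) (m p : nat) (O : set 'rV[R]_m) (O' : set 'rV[R]_p)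
    (f : 'rV[R]_p -> R[i]) (F : 'rV[R]_m -> 'rV[R]_p) : open O -> open O' ->
  (forall x, O x -> O' (F x)) -> (forall k, smooth_on O (fun x => F x 0 k)) ->
  smoothC_on O' f -> smoothC_on O (fun x => f (F x)).
Proof.
move=> oO oO' FO sF [f1 f2]; split.
  exact: (smooth_on_comp oO oO' FO sF f1).
exact: (smooth_on_comp oO oO' FO sF f2).
Qed.

(** * Smooth forms on open subsets of R^m and their exterior derivative *)

Section SmoothForms.
Variables (R : realType) (m : nat).
Local Notation C := R[i].
Local Notation V := 'rV[R]_m.
Local Notation ext := (ext R m).
Implicit Types (O : set V) (w : V -> ext) (xi : V -> 'rV[C]_m).

Definition sform O w := forall S, smoothC_on O (fun y => w y S).
Definition scovec O xi := forall k, smoothC_on O (fun y => xi y 0 k).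

Definition dpart j w (y : V) : ext := [ffun S => partialC j (fun z => w z S) y].
Definition dpartv j xi (y : V) : 'rV[C]_m := \row_k partialC j (fun z => xi z 0 k) y.

Definition dform w (y : V) : ext := \sum_(j < m) eps (delta_mx 0 j) (dpart j w y).

Lemma dpartE j w y S : dpart j w y S = partialC j (fun z => w z S) y.
Proof. by rewrite [LHS]ffunE. Qed.

Lemma sform_near O w w' : (forall x, O x -> \forall y \near x, w y = w' y) ->
  sform O w -> sform O w'.
Proof.
by move=> H sw S; apply: smoothC_on_near (sw S) => x /H; apply: filterS => y ->.
Qed.

Lemma dform_near w w' (x : V) : (\forall y \near x, w y = w' y) -> dform w x = dform w' x.
Proof.
move=> H; apply: eq_bigr => j _; congr eps; apply/ffunP => S; rewrite !dpartE.
by apply: partialC_near; apply: filterS H => y ->.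
Qed.

(** A coefficient of u /\ a is a combination, with constant coefficients, of products of a
    coordinate of u and a coefficient of a. Smoothness and the Leibniz rule for [eps] thus come down
    to products of scalars. *)
Lemma eps_coef (u : 'rV[C]_m) (a : ext) S :
  eps u a S = \sum_k \sum_T (eps (delta_mx 0 k) (eb R T) S) * (u 0 k * a T).
Proof.
rewrite {1}eps_sum ext_sumE; apply: eq_bigr => k _; rewrite extZE.
rewrite {1}[a]ext_eb linear_sum ext_sumE mulr_sumr; apply: eq_bigr => T _.
by rewrite linearZ /= extZE; ring.
Qed.

Lemma sform_eps O xi w : open O -> scovec O xi -> sform O w -> sform O (fun y => eps (xi y) (w y)).
Proof.
move=> oO sxi sw S; apply: (smoothC_on_congr oO); first by move=> y _; rewrite eps_coef; reflexivity.
apply: smoothC_on_sum => // k _; apply: smoothC_on_sum => // T _.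
apply: smoothC_onM => //; first exact: smoothC_on_cst.
by apply: smoothC_onM.
Qed.

Lemma sform_cst O (a : ext) : open O -> sform O (fun=> a).
Proof. by move=> oO S; exact: smoothC_on_cst. Qed.

Lemma sform_wedge O (I : Type) (s : seq I) (xi : I -> V -> 'rV[C]_m) : open O ->
  (forall i, scovec O (xi i)) -> sform O (fun y => wedge_covecs [seq xi i y | i <- s]).
Proof.
move=> oO sxi; elim: s => [|i s IH] /=; first exact: sform_cst.
by apply: sform_eps.
Qed.

Lemma sform_pullback O (A : V -> 'M[C]_m) w : open O ->
  (forall i j, smoothC_on O (fun y => A y i j)) -> sform O w ->
  sform O (fun y => pullback (A y) (w y)).
Proof.
move=> oO sA sw S.
apply: (smoothC_on_congr oO (f := fun y => \sum_T w y T * wedge_covecs [seq (col j (A y))^T | j <- enum T] S)).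
  by move=> y _; rewrite /pullback ext_sumE; apply: eq_bigr => T _; rewrite extZE.
apply: smoothC_on_sum => // T _; apply: smoothC_onM => //.
apply: (sform_wedge (enum T) (xi := fun j y => (col j (A y))^T)) => // j k.
by apply: (smoothC_on_congr oO) (sA k j) => y _; rewrite !mxE.
Qed.

Lemma dpart_eps O xi w j (y : V) : open O -> O y -> scovec O xi -> sform O w ->
  dpart j (fun z => eps (xi z) (w z)) y = eps (dpartv j xi y) (w y) + eps (xi y) (dpart j w y).
Proof.
move=> oO Oy sxi sw; apply/ffunP => S; rewrite dpartE extDE.
have E : partialC j (fun z => eps (xi z) (w z) S) y = partialC j (fun z => \sum_k \sum_T (eps (delta_mx 0 k) (eb R T) S) * (xi z 0 k * w z T)) y.
  by apply: partialC_near; apply: nearV => z; rewrite eps_coef.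
rewrite E.
have s1 k T : smoothC_on O (fun z => xi z 0 k * w z T) by apply: smoothC_onM.
have s2 k T : smoothC_on O (fun z => eps (delta_mx 0 k) (eb R T) S * (xi z 0 k * w z T)).
  by apply: smoothC_onM => //; exact: smoothC_on_cst.
rewrite (partialC_sum _ _ oO Oy); last by move=> k; apply: smoothC_on_sum.
rewrite !(eps_coef _ _ S) -big_split; apply: eq_bigr => k _ /=.
rewrite (partialC_sum _ _ oO Oy) // -big_split; apply: eq_bigr => T _ /=.
rewrite (partialCZ _ _ oO Oy) // (partialCM _ Oy) // dpartE mxE -mulrDr.
by congr (_ * _); rewrite addrC.
Qed.

Lemma dform_eps O xi w (y : V) : open O -> O y -> scovec O xi -> sform O w ->
  dform (fun z => eps (xi z) (w z)) y =
  \sum_j eps (delta_mx 0 j) (eps (dpartv j xi y) (w y)) - eps (xi y) (dform w y).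
Proof.
move=> oO Oy sxi sw; rewrite /dform linear_sum -sumrB; apply: eq_bigr => j _.
by rewrite (dpart_eps _ oO Oy) // linearD /= [X in _ + X]eps_anti.
Qed.

(** The extra term in [dform_eps] is the derivative of the 1-form times w. It changes sign when its
    two summation indices are exchanged, by symmetry of the derivatives and anticommutation of
    covectors, so it is 0. *)
Lemma dform_closed_eps O xi w (y : V) : open O -> O y -> scovec O xi -> sform O w ->
  (forall j k, partialC j (fun z => xi z 0 k) y = partialC k (fun z => xi z 0 j) y) ->
  dform (fun z => eps (xi z) (w z)) y = - eps (xi y) (dform w y).
Proof.
move=> oO Oy sxi sw sym; rewrite (dform_eps oO Oy) //.
suff -> : \sum_j eps (delta_mx 0 j) (eps (dpartv j xi y) (w y)) = 0 by rewrite add0r.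
set A := LHS.
have E : A = \sum_j \sum_k partialC j (fun z => xi z 0 k) y *: eps (delta_mx 0 j) (eps (delta_mx 0 k) (w y)).
  apply: eq_bigr => j _; rewrite [eps (dpartv _ _ _) _]eps_sum linear_sum; apply: eq_bigr => k _.
  by rewrite linearZ /= mxE.
have E2 : A = - A.
  rewrite {1}E exchange_big E -sumrN; apply: eq_bigr => j _; rewrite -sumrN; apply: eq_bigr => k _ /=.
  by rewrite sym eps_anti scalerN.
by move/eqP: E2; rewrite -addr_eq0 -mulr2n -scaler_nat scaler_eq0 pnatr_eq0 /= => /eqP.
Qed.

Lemma dform_cst (a : ext) (y : V) : dform (fun=> a) y = 0.
Proof.
rewrite /dform big1 // => j _; rewrite (_ : dpart _ _ _ = 0) ?linear0 //.
by apply/ffunP => S; rewrite dpartE partialC_cst ext0E.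
Qed.

Lemma dform_wedge_closed O (I : Type) (s : seq I) (xi : I -> V -> 'rV[C]_m) (y : V) : open O -> O y ->
  (forall i, scovec O (xi i)) ->
  (forall i j k, partialC j (fun z => xi i z 0 k) y = partialC k (fun z => xi i z 0 j) y) ->
  dform (fun z => wedge_covecs [seq xi i z | i <- s]) y = 0.
Proof.
move=> oO Oy sxi sym; elim: s => [|i s IH] /=; first exact: dform_cst.
rewrite (@dform_closed_eps O (xi i) (fun z => wedge_covecs [seq xi i z | i <- s])) //.
  by rewrite IH linear0 oppr0.
exact: sform_wedge.
Qed.

Definition gradC (f : V -> C) (y : V) : 'rV[C]_m := \row_j partialC j f y.

Lemma dform_scale O (f : V -> C) w (y : V) : open O -> O y -> smoothC_on O f -> sform O w ->
  dform (fun z => f z *: w z) y = eps (gradC f y) (w y) + f y *: dform w y.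
Proof.
move=> oO Oy sf sw.
rewrite [eps (gradC _ _) _]eps_sum /dform scaler_sumr -big_split; apply: eq_bigr => j _ /=.
have -> : dpart j (fun z => f z *: w z) y = partialC j f y *: w y + f y *: dpart j w y.
  apply/ffunP => S; rewrite dpartE extDE !extZE dpartE addrC -(partialCM _ Oy) //.
  by apply: partialC_near; apply: nearV => z; rewrite extZE.
by rewrite linearD !linearZ /= mxE.
Qed.

Lemma dform_sum O (I : Type) (r : seq I) (W : I -> V -> ext) (y : V) : open O -> O y ->
  (forall i, sform O (W i)) ->
  dform (fun z => \sum_(i <- r) W i z) y = \sum_(i <- r) dform (W i) y.
Proof.
move=> oO Oy sW; rewrite /dform exchange_big; apply: eq_bigr => j _ /=.
rewrite -linear_sum; congr eps; apply/ffunP => S; rewrite dpartE ext_sumE.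
under [RHS]eq_bigr do rewrite dpartE.
rewrite -(partialC_sum _ _ oO Oy); last by move=> i; exact: sW.
by apply: partialC_near; apply: nearV => z; rewrite ext_sumE.
Qed.

Lemma dform_pullback O O' (F : V -> V) w (y : V) : open O -> open O' ->
  (forall x, O x -> O' (F x)) -> (forall k, smooth_on O (fun x => F x 0 k)) ->
  sform O' w -> O y ->
  dform (fun z => pullback (toCm (jacobian F z)) (w (F z))) y =
  pullback (toCm (jacobian F y)) (dform w (F y)).
Proof.
move=> oO oO' FO sF sw Oy.
(* The differential of the k-th component of F; it is the k-th column of the Jacobian matrix in the
   convention of row vectors. *)
pose W (k : 'I_m) (z : V) : 'rV[C]_m := \row_j ('D_(evec R j) (fun x => F x 0 k) z)%:C%C.
have JE z : O z -> forall k, (col k (toCm (jacobian F z)))^T = W k z.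
  move=> Oz k; apply/rowP => j; rewrite [LHS]mxE [LHS]mxE [LHS]mxE [RHS]mxE.
  congr (_%:C%C); apply: jacobian_entry.
  by apply: differentiable_row => l; exact: smooth_on_differentiable Oz.
have sW k : scovec O (W k).
  move=> j; apply: (smoothC_on_congr oO) (smoothC_on_real oO (smooth_on_derive j (sF k))).
  by move=> z _; rewrite mxE.
have symW k i j : partialC i (fun z => W k z 0 j) y = partialC j (fun z => W k z 0 i) y.
  have pW l l' : partialC l (fun z => W k z 0 l') y = partialC l (partialC l' (fun z => (F z 0 k)%:C%C)) y.
    apply: partialC_near; apply: nearV => z; rewrite mxE /partialC /=; congr (_ +i* _)%C.
    by rewrite (_ : (fun y => _) = cst 0) // derive_cst.
  rewrite !pW.
  exact: (@partialC_schwarz R m O (fun z => (F z 0 k)%:C%C) y i j oO (smoothC_on_real oO (sF k)) Oy).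
pose Ws (S : {set 'I_m}) z := wedge_covecs [seq W k z | k <- enum S].
have sWs S : sform O (Ws S) by exact: sform_wedge.
have pE z : O z -> forall a, pullback (toCm (jacobian F z)) a = \sum_S a S *: Ws S z.
  move=> Oz a; apply: eq_bigr => S _; congr (_ *: wedge_covecs _).
  by apply: eq_map => k; exact: JE.
rewrite (@dform_near _ (fun z => \sum_S w (F z) S *: Ws S z)); last first.
  by apply: (near_open oO Oy) => z Oz; exact: pE.
have swF S : smoothC_on O (fun z => w (F z) S) by apply: (smoothC_on_comp oO oO' FO sF (sw S)).
have sZ S : sform O (fun z => w (F z) S *: Ws S z).
  move=> T; apply: (smoothC_on_congr oO (f := fun z => w (F z) S * Ws S z T)).
    by move=> z _; rewrite extZE.
  by apply: smoothC_onM => //; exact: sWs.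
rewrite (dform_sum _ oO Oy sZ).
rewrite [in RHS]/dform linear_sum /=.
under [RHS]eq_bigr => k _.
  rewrite pullback_eps (pE y Oy) linear_sum /=.
  over.
rewrite [RHS]exchange_big /=; apply: eq_bigr => S _.
have dW0 : dform (Ws S) y = 0 by exact: (dform_wedge_closed (enum S) oO Oy sW symW).
rewrite (dform_scale oO Oy) // dW0 scaler0 addr0.
under [RHS]eq_bigr => k _.
  rewrite linearZ dpartE /= -rowE -epsZl. over.
have -> : gradC (fun z => w (F z) S) y =
   \sum_k partialC k (w^~ S) (F y) *: row k (toCm (jacobian F y))^T.
  apply/rowP => j; rewrite mxE (@partialC_chain _ _ _ O O' (w^~ S)) //; last exact: FO.
  rewrite summxE; apply: eq_bigr => k _; rewrite [RHS]mxE [X in _ = _ * X]mxE [X in _ = _ * X]mxE [X in _ = _ * X]mxE.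
  congr (_ * _%:C%C); apply: esym; apply: jacobian_entry.
  by apply: differentiable_row => l; exact: smooth_on_differentiable Oy.
elim: (index_enum _) => [|k r IH]; first by rewrite !big_nil eps0l.
by rewrite !big_cons epsDl IH.
Qed.

End SmoothForms.

(** * Independence of the chart *)

Section ChartCalculus.
Variables (R : realType) (m : nat) (M : manifold R m).
Local Notation C := R[i].
Local Notation V := 'rV[R]_m.
Local Notation VC := 'rV[C]_m.
Local Notation ext := (ext R m).
Implicit Types (c d e : chart R m M) (U W : set M) (x : M).

Lemma chart_img_open c U : open U -> open (cmap c @` (U `&` cdom c)).
Proof.
move=> oU; rewrite openE => y [x [Ux cx] <-{y}].
have cy : (cmap c @` cdom c) (cmap c x) by exists x.
have n1 : \forall z \near cmap c x, U (cinv c z).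
  by apply: (cinv_continuous cy); rewrite (cmapK cx); exact: open_nbhs_nbhs.
have n2 : \forall z \near cmap c x, (cmap c @` cdom c) z.
  by apply: open_nbhs_nbhs; split => //; exact: cimg_open.
apply: filterS (filterI n1 n2) => z [Uz [x' cx' E]]; exists x' => //; split=> //.
by move: Uz; rewrite -E cmapK.
Qed.

Arguments chart_img_open c {U} _.

Lemma chart_img_sub c U W : U `<=` W -> cmap c @` (U `&` cdom c) `<=` cmap c @` (W `&` cdom c).
Proof. by move=> UW y [x [Ux cx] <-]; exists x => //; split=> //; exact: UW. Qed.

Lemma in_chart_img c U x : U x -> cdom c x -> (cmap c @` (U `&` cdom c)) (cmap c x).
Proof. by move=> Ux cx; exists x. Qed.

Lemma near_chart c x (P : M -> Prop) : cdom c x -> (\forall z \near x, P z) ->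
  \forall y \near cmap c x, P (cinv c y).
Proof.
move=> cx H; have cy : (cmap c @` cdom c) (cmap c x) by exists x.
by apply: (cinv_continuous cy); rewrite (cmapK cx).
Qed.

Lemma transition_smooth c d j : atlas c -> atlas d ->
  smooth_on (cmap c @` (cdom d `&` cdom c)) (fun y => cmap d (cinv c y) 0 j).
Proof. by move=> ac ad; rewrite setIC; exact: atlas_smooth. Qed.

Arguments transition_smooth {c d} j _ _.

Lemma transition_differentiable c d x k : atlas c -> atlas d -> cdom c x -> cdom d x ->
  differentiable (fun y => cmap d (cinv c y) 0 k) (cmap c x).
Proof.
move=> ac ad cx dx.
exact: (smooth_on_differentiable (chart_img_open c (@cdom_open _ _ _ d)) (transition_smooth k ac ad) (in_chart_img dx cx)).
Qed.

Lemma transition_jacE c d x i j : atlas c -> atlas d -> cdom c x -> cdom d x ->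
  transition_jac c d x i j = 'D_(evec R i) (fun y => cmap d (cinv c y) 0 j) (cmap c x).
Proof.
move=> ac ad cx dx; apply: jacobian_entry; apply: differentiable_row => k.
exact: transition_differentiable.
Qed.

Arguments transition_jacE {c d x} i j _ _ _ _.

Lemma transition_jac_comp c d e x : atlas c -> atlas d -> atlas e ->
  cdom c x -> cdom d x -> cdom e x ->
  transition_jac c e x = transition_jac c d x *m transition_jac d e x.
Proof.
move=> ac ad ae cx dx ex; apply/matrixP => i j; rewrite (transition_jacE i j ac ae cx ex) [RHS]mxE.
have E : \forall y \near cmap c x, cmap e (cinv c y) 0 j = cmap e (cinv d (cmap d (cinv c y))) 0 j.
  have : \forall z \near x, cdom d z by apply: open_nbhs_nbhs; split=> //; exact: cdom_open.
  by move=> /(near_chart cx); apply: filterS => y dy; rewrite cmapK.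
rewrite (near_eq_derive _ E).
have df : differentiable (fun y => cmap e (cinv d y) 0 j) (cmap d (cinv c (cmap c x))).
  by rewrite (cmapK cx); exact: transition_differentiable.
have [_] := @chain_rule R m m (fun y => cmap e (cinv d y) 0 j) (fun y => cmap d (cinv c y))
  (cmap c x) (evec R i) df (fun k => transition_differentiable k ac ad cx dx).
rewrite (cmapK cx) => E1; apply: (etrans E1); apply: eq_bigr => k _.
apply: (etrans _ (esym (congr2 *%R (transition_jacE i k ac ad cx dx) (transition_jacE k j ad ae dx ex)))).
exact: mulrC.
Qed.

Lemma transition_jac_id c x : atlas c -> cdom c x -> transition_jac c c x = 1%:M.
Proof.
move=> ac cx; apply/matrixP => i j; rewrite (transition_jacE i j ac ac cx cx) [RHS]mxE.
have E : \forall y \near cmap c x, cmap c (cinv c y) 0 j = y 0 j.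
  have : \forall y \near cmap c x, (cmap c @` cdom c) y.
    by apply: open_nbhs_nbhs; split; [exact: cimg_open|exists x].
  by apply: filterS => y [z cz <-]; rewrite cmapK.
by rewrite (near_eq_derive _ E) derive_coord mxE eqxx /= eq_sym.
Qed.

Lemma toCmM n p q (A : 'M[R]_(n, p)) (B : 'M[R]_(p, q)) :
  map_mx (real_complex R) (A *m B) = map_mx (real_complex R) A *m map_mx (real_complex R) B.
Proof. exact: map_mxM. Qed.

Lemma toCm1 n : map_mx (real_complex R) (1%:M : 'M[R]_n) = 1%:M.
Proof. exact: map_mx1. Qed.

Lemma toCmE (A : 'M[R]_m) i j : toCm A i j = (A i j)%:C%C.
Proof. by rewrite mxE. Qed.

Definition vecC_in c x (v : VC) : VC := v *m toCm (transition_jac (chart_at x) c x).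

Lemma transition_jacK c x : atlas c -> cdom c x ->
  transition_jac (chart_at x) c x *m transition_jac c (chart_at x) x = 1%:M.
Proof.
move=> ac cx; have [aa da] := (chart_at_atlas x, chart_at_dom x).
by rewrite -(transition_jac_comp aa ac aa da cx da) transition_jac_id.
Qed.

Lemma transition_jacVK c x : atlas c -> cdom c x ->
  transition_jac c (chart_at x) x *m transition_jac (chart_at x) c x = 1%:M.
Proof. by move=> ac cx; apply: mulmx1C; exact: transition_jacK. Qed.

Lemma form_inK c x (w : ext) : atlas c -> cdom c x ->
  pullback (toCm (transition_jac (chart_at x) c x)) (form_in c x w) = w.
Proof.
by move=> ac cx; rewrite pullback_comp -toCmM transition_jacK // toCm1 pullback1.
Qed.

Lemma form_in_trans c d x (w : ext) : atlas c -> atlas d -> cdom c x -> cdom d x ->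
  form_in d x w = pullback (toCm (transition_jac d c x)) (form_in c x w).
Proof.
move=> ac ad cx dx; rewrite /form_in.
apply: (etrans _ (esym (pullback_comp _ _ _))).
congr (pullback _ w); rewrite /toCm.
apply: (etrans _ (toCmM _ _)); congr (map_mx _ _).
exact: transition_jac_comp ad ac (chart_at_atlas x) dx cx (chart_at_dom x).
Qed.

Lemma smoothC_fun_local U (f : M -> C) :
  (forall x, U x -> exists W, W x /\ smoothC_fun W f) -> smoothC_fun U f.
Proof.
move=> H c ac; apply: smoothC_on_local => y [x [Ux cx] <-].
have [W [Wx sW]] := H x Ux; exists (cmap c @` (W `&` cdom c)); split; last exact: sW.
exact: in_chart_img.
Qed.

Lemma smooth_form_local U (w : M -> ext) :
  (forall x, U x -> exists W, W x /\ smooth_form W w) -> smooth_form U w.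
Proof.
move=> H c ac S; apply: smoothC_on_local => y [x [Ux cx] <-].
have [W [Wx sW]] := H x Ux; exists (cmap c @` (W `&` cdom c)); split; last exact: sW.
exact: in_chart_img.
Qed.

Lemma smoothC_fun_sub U W (f : M -> C) : U `<=` W -> smoothC_fun W f -> smoothC_fun U f.
Proof. by move=> UW H; apply: smoothC_fun_local => x /UW Wx; exists W. Qed.

Lemma smooth_form_sub U W (w : M -> ext) : U `<=` W -> smooth_form W w -> smooth_form U w.
Proof. by move=> UW H; apply: smooth_form_local => x /UW Wx; exists W. Qed.

Lemma smoothC_fun_congr U (f g : M -> C) : open U -> (forall x, U x -> f x = g x) ->
  smoothC_fun U f -> smoothC_fun U g.
Proof.
move=> oU fg sf c ac; apply: (smoothC_on_congr (chart_img_open c oU)) (sf c ac) => y [x [Ux cx] <-].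
by rewrite /= cmapK // fg.
Qed.

Lemma smooth_form_congr U (f g : M -> ext) : open U -> (forall x, U x -> f x = g x) ->
  smooth_form U f -> smooth_form U g.
Proof.
move=> oU fg sf c ac S; apply: (smoothC_on_congr (chart_img_open c oU)) (sf c ac S) => y [x [Ux cx] <-].
by rewrite /= cmapK // fg.
Qed.

Lemma smoothC_fun_chart c U (f : M -> C) : atlas c -> open U -> U `<=` cdom c ->
  smoothC_on (cmap c @` (U `&` cdom c)) (f \o cinv c) -> smoothC_fun U f.
Proof.
move=> ac oU Uc sf e ae.
have oUe := chart_img_open e oU; have oUc := chart_img_open c oU.
apply: (smoothC_on_congr oUe (f := fun y => (f \o cinv c) (cmap c (cinv e y)))).
  by move=> y [x [Ux ex] <-]; rewrite /= !cmapK //; exact: Uc.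
apply: (smoothC_on_comp oUe oUc) sf.
  by move=> y [x [Ux ex] <-]; rewrite cmapK //; apply: in_chart_img => //; exact: Uc.
by move=> k; apply: smooth_on_sub (transition_smooth k ae ac); exact: chart_img_sub.
Qed.

(** [vfield_act] at x uses [chart_at x], which may vary with x without any regularity. This formula
    lets the derivative be computed in one chart for all nearby points, and hence be differentiated
    again. *)
Lemma vfield_act_chart (Z : M -> VC) (f : M -> C) c U x : atlas c -> cdom c x -> open U -> U x ->
  smoothC_fun U f ->
  vfield_act Z f x = \sum_j vecC_in c x (Z x) 0 j * partialC j (f \o cinv c) (cmap c x).
Proof.
move=> ac cx oU Ux sf; rewrite /vfield_act; set d := chart_at x.
have ad : atlas d by exact: chart_at_atlas.
have dx : cdom d x by exact: chart_at_dom.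
pose O := cmap d @` ((U `&` cdom c) `&` cdom d); pose O' := cmap c @` (U `&` cdom c).
have oUc : open (U `&` cdom c) by apply: openI => //; exact: cdom_open.
have oO : open O by exact: chart_img_open.
have oO' : open O' by exact: chart_img_open.
have Ox : O (cmap d x) by exists x.
have OO' y : O y -> O' (cmap c (cinv d y)).
  by move=> [z [[Uz cz] dz] <-]; rewrite cmapK //; exists z.
have E j : partialC j (f \o cinv d) (cmap d x) =
   \sum_k partialC k (f \o cinv c) (cmap c x) * (transition_jac d c x j k)%:C%C.
  have E1 : \forall y \near cmap d x, (f \o cinv d) y = (f \o cinv c) (cmap c (cinv d y)).
    by apply: (near_open oO Ox) => y [z [[Uz cz] dz] <-]; rewrite /= !cmapK.
  rewrite (partialC_near _ E1) (@partialC_chain _ _ _ O O' (f \o cinv c)) //; last first.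
  - exact: sf.
  - by move=> k; apply: smooth_on_sub (transition_smooth k ad ac) => y [z [[Uz cz] dz] <-]; exists z.
  - by apply: OO'.
  by rewrite cmapK //; apply: eq_bigr => k _; rewrite (transition_jacE j k ad ac dx cx).
under eq_bigr do rewrite E mulr_sumr.
rewrite exchange_big; apply: eq_bigr => k _ /=; rewrite /vecC_in mxE mulr_suml.
apply: eq_bigr => j _; rewrite -[RHS]mulrA; congr (_ * _).
exact: (etrans (mulrC _ _) (congr2 *%R (esym (toCmE _ _ _)) erefl)).
Qed.

(** As for vector fields, the chart in the definition of [ext_d] jumps with the point. Naturality of
    d under transition maps shows that any chart gives the same form, so smoothness can be read in a
    fixed one. *)
Lemma ext_d_chart (w : M -> ext) c U x : atlas c -> cdom c x -> open U -> U x ->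
  smooth_form U w ->
  form_in c x (ext_d w x) = dform (fun y => form_in c (cinv c y) (w (cinv c y))) (cmap c x).
Proof.
move=> ac cx oU Ux sw; pose d := chart_at x.
have ad : atlas d by exact: chart_at_atlas.
have dx : cdom d x by exact: chart_at_dom.
have E0 : ext_d w x = dform (fun y => form_in d (cinv d y) (w (cinv d y))) (cmap d x) by [].
pose O := cmap d @` ((U `&` cdom c) `&` cdom d); pose O' := cmap c @` (U `&` cdom c).
have oUc : open (U `&` cdom c) by apply: openI => //; exact: cdom_open.
have oO : open O by exact: chart_img_open.
have oO' : open O' by exact: chart_img_open.
have Ox : O (cmap d x) by exists x.
have OO' y : O y -> O' (cmap c (cinv d y)).
  by move=> [z [[Uz cz] dz] <-]; rewrite cmapK //; exists z.
pose g y := form_in c (cinv c y) (w (cinv c y)).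
have E1 : \forall y \near cmap d x, form_in d (cinv d y) (w (cinv d y)) =
    pullback (toCm (jacobian (fun y => cmap c (cinv d y)) y)) (g (cmap c (cinv d y))).
  apply: (near_open oO Ox) => y [z [[Uz cz] dz] <-]; rewrite /g (cmapK dz) (cmapK cz).
  rewrite -[jacobian _ _]/(transition_jac d c z).
  exact: (form_in_trans _ ac ad cz dz).
have sF k : smooth_on O (fun y => cmap c (cinv d y) 0 k).
  by apply: smooth_on_sub (transition_smooth k ad ac) => y [z [[Uz cz] dz] <-]; exists z.
have E3 := dform_pullback oO oO' OO' sF (sw c ac) Ox.
rewrite E0.
apply: (etrans (congr1 (form_in c x) (dform_near E1))).
apply: (etrans (congr1 (form_in c x) E3)).
rewrite (cmapK dx).
apply: (etrans (pullback_comp _ _ _)).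
have E2 : toCm (transition_jac c (chart_at x) x) *m toCm (transition_jac d c x) = 1%:M.
  apply: (etrans (esym (toCmM _ _))); apply: (etrans _ (toCm1 _)); congr (map_mx _ _).
  exact: transition_jacVK.
exact: (etrans (congr2 (@pullback R m) E2 erefl) (pullback1 _)).
Qed.

Lemma sform_dform (O : set V) (w : V -> ext) : open O -> sform O w -> sform O (dform w).
Proof.
move=> oO sw S; apply: (smoothC_on_congr oO (f := fun y => \sum_j eps (delta_mx 0 j) (dpart j w y) S)).
  by move=> y _; rewrite ext_sumE.
apply: smoothC_on_sum => // j _.
apply: (sform_eps (xi := fun=> delta_mx 0 j) (w := dpart j w)) => //.
  by move=> k; exact: smoothC_on_cst.
move=> T; apply: (smoothC_on_congr oO) (smoothC_on_partial j (sw T)) => y _.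
by rewrite dpartE.
Qed.

Lemma smooth_ext_d U (w : M -> ext) : open U -> smooth_form U w -> smooth_form U (ext_d w).
Proof.
move=> oU sw c ac.
have oUc := chart_img_open c oU.
apply: (@sform_near _ _ _ (dform (fun y => form_in c (cinv c y) (w (cinv c y))))).
  move=> y0 Oy0; apply: (near_open oUc Oy0) => y [x [Ux cx] <-].
  rewrite (cmapK cx); exact: (esym (ext_d_chart ac cx oU Ux sw)).
by apply: sform_dform => //; exact: sw.
Qed.

End ChartCalculus.

(** * Bidegrees and the Hodge star in coordinates *)

Section Support.
Variables (R : rcfType) (m : nat).
Local Notation C := R[i].
Local Notation ext := (ext R m).
Implicit Types (P Q : pred {set 'I_m}) (w : ext) (S T : {set 'I_m}) (k : 'I_m).

(** Bidegrees, membership in the exterior algebra of H^* and bounds on degrees are all stated in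
    this way, as restrictions on the indices that may occur. *)
Definition supp P w := forall S, ~~ P S -> w S = 0.

Definition restr P w : ext := [ffun S => if P S then w S else 0].

Lemma restrE P w S : restr P w S = if P S then w S else 0.
Proof. by rewrite [LHS]ffunE. Qed.

Lemma restr_linear P : linear (restr P).
Proof.
move=> k a b; apply/ffunP => S; rewrite extDE extZE !restrE extDE extZE.
by case: (P S); rewrite ?mulr0 ?addr0.
Qed.
HB.instance Definition _ P :=
  GRing.isLinear.Build C ext ext *:%R (restr P) (restr_linear P).

Lemma supp0 P : supp P 0. Proof. by move=> S _; rewrite ext0E. Qed.

Lemma suppP P (k : C) (a b : ext) : supp P a -> supp P b -> supp P (k *: a + b).
Proof. by move=> sa sb S nP; rewrite extDE extZE sa // sb // mulr0 addr0. Qed.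

Lemma suppZ P (k : C) (a : ext) : supp P a -> supp P (k *: a).
Proof. by move=> sa S nP; rewrite extZE sa // mulr0. Qed.

Lemma suppD P a b : supp P a -> supp P b -> supp P (a + b).
Proof. by move=> sa sb S nP; rewrite extDE sa // sb // addr0. Qed.

Lemma suppN P a : supp P a -> supp P (- a).
Proof. by move=> sa S nP; rewrite extNE sa // oppr0. Qed.

Lemma supp_sum P I (r : seq I) (Pr : pred I) (F : I -> ext) :
  (forall i, Pr i -> supp P (F i)) -> supp P (\sum_(i <- r | Pr i) F i).
Proof. by move=> H S nP; rewrite ext_sumE big1 // => i Pi; exact: H. Qed.

Lemma supp_eb P S : P S -> supp P (eb R S).
Proof. by move=> PS T; rewrite ebE; case: eqP => // ->; rewrite PS. Qed.

Lemma supp_sub P Q w : (forall S, P S -> Q S) -> supp P w -> supp Q w.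
Proof. by move=> PQ sw S nQ; apply: sw; apply: contra nQ; exact: PQ. Qed.

Lemma supp_restr P w : supp P (restr P w).
Proof. by move=> S /negPf nP; rewrite restrE nP. Qed.

Lemma restr_id P w : supp P w -> restr P w = w.
Proof. by move=> sw; apply/ffunP => S; rewrite restrE; case: ifPn => // /sw ->. Qed.

Lemma restr0 P Q w : supp P w -> (forall S, P S -> ~~ Q S) -> restr Q w = 0.
Proof.
move=> sw PQ; apply/ffunP => S; rewrite restrE ext0E; case: ifPn => // QS; apply: sw.
by apply/negP => /PQ; rewrite QS.
Qed.

Lemma restr_eb P S : restr P (eb R S) = if P S then eb R S else 0.
Proof.
case: ifPn => PS; first by apply: restr_id; exact: supp_eb.
apply: (restr0 (P := pred1 S)) => [|T /eqP -> //]; apply: supp_eb; exact: eqxx.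
Qed.

Lemma supp_eps P Q (xi : 'rV[C]_m) w :
  (forall k S, xi 0 k != 0 -> k \notin S -> P S -> Q (k |: S)) -> supp P w -> supp Q (eps xi w).
Proof.
move=> H sw; rewrite eps_sum; apply: supp_sum => k _.
have [->|xk] := eqVneq (xi 0 k) 0; first by rewrite scale0r; exact: supp0.
apply: suppZ; rewrite [w]ext_eb linear_sum; apply: supp_sum => S _; rewrite linearZ /=.
have [PS|/sw ->] := boolP (P S); last by rewrite scale0r; exact: supp0.
apply: suppZ; rewrite eps_eb; case: ifPn => kS; first exact: supp0.
by apply: suppZ; apply: supp_eb; exact: H.
Qed.

Lemma supp_contr P Q (v : 'rV[C]_m) w :
  (forall k S, v 0 k != 0 -> k \in S -> P S -> Q (S :\ k)) -> supp P w -> supp Q (ext_contr v w).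
Proof.
move=> H sw; rewrite contr_sum; apply: supp_sum => k _.
have [->|xk] := eqVneq (v 0 k) 0; first by rewrite scale0r; exact: supp0.
apply: suppZ; rewrite [w]ext_eb linear_sum; apply: supp_sum => S _; rewrite linearZ /=.
have [PS|/sw ->] := boolP (P S); last by rewrite scale0r; exact: supp0.
apply: suppZ; rewrite contr_eb; case: ifPn => kS; last exact: supp0.
by apply: suppZ; apply: supp_eb; exact: H.
Qed.

Lemma sign_sq (a : nat) : ((-1) ^+ a * (-1) ^+ a = 1 :> C).
Proof. by rewrite -exprD sign_addnn. Qed.

Lemma eb_eps k S : k \in S -> eb R S = (-1) ^+ sg k (S :\ k) *: eps (delta_mx 0 k) (eb R (S :\ k)).
Proof. by move=> kS; rewrite eps_eb setD11 scalerA sign_sq scale1r finset.setD1K. Qed.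

Lemma pullback_diag (d : 'rV[C]_m) S : pullback (diag_mx d) (eb R S) = (\prod_(j in S) d 0 j) *: eb R S.
Proof.
have [N] := ubnP #|S|; elim: N S => // N IH S; rewrite ltnS => cS.
have [->|[k kS]] := finset.set_0Vmem S.
  by rewrite big_set0 scale1r -ext_one_eb pullback_one.
have c2 : (#|S :\ k| < N)%N by move: cS; rewrite (cardsD1 k S) kS.
rewrite (eb_eps kS) linearZ /= pullback_eps IH // linearZ /=.
have -> : delta_mx 0 k *m (diag_mx d)^T = d 0 k *: delta_mx (0 : 'I_1) k.
  apply/rowP => j; rewrite tr_diag_mx -rowE !mxE eqxx /= [j == k]eq_sym.
  by case: eqP => [->|_]; rewrite ?mulr1n ?mulr1 ?mulr0n ?mulr0.
rewrite epsZl !scalerA; congr (_ *: _); rewrite (big_setD1 k kS) /=.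
by rewrite mulrC [X in _ * X]mulrC mulrA.
Qed.

Definition deg (p : pred 'I_m) S := #|[set k in S | p k]|.

Lemma degE (p : pred 'I_m) S : deg p S = (\sum_(k in S) p k)%N.
Proof.
rewrite /deg -sum1dep_card [RHS](big_mkcond (fun k => k \in S)) /= [LHS]big_mkcond; apply: eq_bigr => k _.
by case: (k \in S); case: (p k).
Qed.

Lemma degU1 (p : pred 'I_m) k S : k \notin S -> deg p (k |: S) = (p k + deg p S)%N.
Proof. by move=> kS; rewrite !degE big_setU1. Qed.

Lemma degD1 (p : pred 'I_m) k S : k \in S -> deg p S = (p k + deg p (S :\ k))%N.
Proof. by move=> kS; rewrite !degE (big_setD1 k). Qed.

Lemma deg0 (p : pred 'I_m) : deg p finset.set0 = 0%N.
Proof. by rewrite degE big_set0. Qed.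

Lemma deg_setD (p : pred 'I_m) S T : T \subset S -> deg p S = (deg p (S :\: T) + deg p T)%N.
Proof.
move=> TS; rewrite !degE (bigID (fun k => k \in T)) /= addnC; congr (_ + _)%N; apply: eq_bigl => k.
  by rewrite inE andbC.
by apply/andP/idP => [[]//|kT]; split=> //; exact: (fintype.subsetP TS).
Qed.

Lemma edot_eb_r w S : edot w (eb R S) = w S.
Proof.
rewrite /edot; under eq_bigr do rewrite ebE.
by rewrite (bigD1 S) //= eqxx mulr1 big1 ?addr0 // => T /negPf ->; rewrite mulr0.
Qed.

Lemma pullback_set0 (A : 'M[C]_m) w : pullback A w finset.set0 = w finset.set0.
Proof.
have E := edot_pullback A w (eb R finset.set0); rewrite !edot_eb_r in E.
by rewrite E -ext_one_eb pullback_one ext_one_eb edot_eb_r.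
Qed.

Lemma ext_eval_pullback (A : 'M[C]_m) w (vs : seq 'rV[C]_m) :
  ext_eval (pullback A w) vs = ext_eval w [seq v *m A | v <- vs].
Proof.
rewrite /ext_eval; elim: vs w => [|v vs IH] w /=; first exact: pullback_set0.
by rewrite contr_pullback IH.
Qed.

End Support.

(** * Index blocks of an adapted frame, the star and gamma *)

Section CRCoordinates.
Variables (R : rcfType) (n r : nat).
Local Notation C := R[i].
Local Notation m := (n + n + r)%N.
Local Notation ext := (ext R m).
Implicit Types (S T : {set 'I_m}) (w : ext).

(* The frame of C^m is ordered as Z_1, .., Z_n, Zbar_1, .., Zbar_n, N_1, .., N_r;
   ia, ib, ic are the three blocks of indices and kA, kB, kC recognize them. *)
Definition ia (j : 'I_n) : 'I_m := lshift r (lshift n j).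
Definition ib (j : 'I_n) : 'I_m := lshift r (rshift n j).
Definition ic (l : 'I_r) : 'I_m := rshift (n + n) l.

Definition kA (k : 'I_m) := (k < n)%N.
Definition kB (k : 'I_m) := (n <= k < n + n)%N.
Definition kC (k : 'I_m) := (n + n <= k)%N.

Lemma kA_ia j : kA (ia j). Proof. by rewrite /kA /=. Qed.
Lemma kB_ia j : kB (ia j) = false. Proof. by rewrite /kB /= leqNgt ltn_ord. Qed.
Lemma kC_ia j : kC (ia j) = false. Proof. by rewrite /kC /= leqNgt ltn_addr. Qed.
Lemma kA_ib j : kA (ib j) = false. Proof. by rewrite /kA /= ltnNge leq_addr. Qed.
Lemma kB_ib j : kB (ib j). Proof. by rewrite /kB /= leq_addr ltn_add2l ltn_ord. Qed.
Lemma kC_ib j : kC (ib j) = false. Proof. by rewrite /kC /= leqNgt ltn_add2l ltn_ord. Qed.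
Lemma kA_ic l : kA (ic l) = false. Proof. by rewrite /kA /= ltnNge -addnA leq_addr. Qed.
Lemma kB_ic l : kB (ic l) = false. Proof. by rewrite /kB /= [(_ < n + n)%N]ltnNge leq_addr andbF. Qed.
Lemma kC_ic l : kC (ic l). Proof. by rewrite /kC /= leq_addr. Qed.
Definition kE := (kA_ia, kB_ia, kC_ia, kA_ib, kB_ib, kC_ib, kA_ic, kB_ic, kC_ic).

Lemma ia_inj : injective ia. Proof. by move=> i j /(@lshift_inj _ _ _ _)/(@lshift_inj _ _ _ _). Qed.
Lemma ib_inj : injective ib. Proof. by move=> i j /(@lshift_inj _ _ _ _)/(@rshift_inj _ _ _ _). Qed.

Lemma ia_ib i j : (ia i == ib j) = false.
Proof. by apply/negP => /eqP E; have := kA_ia i; rewrite E kA_ib. Qed.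
Lemma ib_ia i j : (ib i == ia j) = false. Proof. by rewrite eq_sym ia_ib. Qed.

Lemma idxP (P : 'I_m -> Prop) :
  (forall j, P (ia j)) -> (forall j, P (ib j)) -> (forall l, P (ic l)) -> forall k, P k.
Proof.
move=> Ha Hb Hc k; rewrite -(splitK k); case: (fintype.split k) => [h|l] /=; last exact: Hc.
by rewrite -(splitK h); case: (fintype.split h) => j /=; [exact: Ha|exact: Hb].
Qed.

Lemma big_idx (V : nmodType) (F : 'I_m -> V) :
  \sum_k F k = \sum_j F (ia j) + \sum_j F (ib j) + \sum_l F (ic l).
Proof. by rewrite big_split_ord /= big_split_ord. Qed.

(* hset S: the basis form eb S involves no covector of the N block, i.e. it lies in
   the exterior algebra of H^*; bideg p q S: it has type (p, q). *)
Definition hset S := deg kC S == 0%N.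
Definition bideg p q S := [&& deg kA S == p, deg kB S == q & hset S].
Definition HS : {set 'I_m} := [set k | ~~ kC k]%SET.

Lemma hsetP S : reflect (S \subset HS) (hset S).
Proof.
apply: (iffP eqP) => [|/fintype.subsetP sS].
  rewrite /deg => /eqP; rewrite cards_eq0 => /eqP E; apply/fintype.subsetP => k kS; rewrite inE.
  by apply/negP => kk; have := finset.in_set0 k; rewrite -E inE kS kk.
apply/eqP; rewrite /deg cards_eq0; apply/eqP/setP => k; rewrite !inE.
by apply/negP => /andP[/sS]; rewrite inE => /negPf ->.
Qed.

Lemma deg_card S : (deg kA S + deg kB S + deg kC S)%N = #|S|.
Proof.
rewrite !degE -!big_split /= -sum1_card; apply: eq_bigr => k _.
by move: k; apply: idxP => j; rewrite !kE.
Qed.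

Lemma bideg_card p q S : bideg p q S -> #|S| = (p + q)%N.
Proof. by case/and3P => /eqP <- /eqP <- /eqP e; rewrite -deg_card e addn0. Qed.

Lemma card_imset_deg (p : pred 'I_m) (T : {set 'I_m}) (f : 'I_n -> 'I_m) : injective f ->
  (forall k, (k \in T) && p k = (k \in f @: 'I_n)%SET) -> deg p T = n.
Proof.
move=> fi H; rewrite /deg (_ : [set k in T | p k]%SET = f @: 'I_n)%SET; last first.
  by apply/setP => k; rewrite inE H.
by rewrite card_imset // card_ord.
Qed.

Lemma degA_HS : deg kA HS = n.
Proof.
apply: (card_imset_deg ia_inj); apply: idxP => j; rewrite inE !kE /=.
- by rewrite imset_f.
- by apply/esym/imsetP => -[i _ /eqP]; rewrite ib_ia.
- by apply/esym/imsetP => -[i _ E]; have := kC_ia i; rewrite -E kE.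
Qed.

Lemma degB_HS : deg kB HS = n.
Proof.
apply: (card_imset_deg ib_inj); apply: idxP => j; rewrite inE !kE /=.
- by apply/esym/imsetP => -[i _ /eqP]; rewrite ia_ib.
- by rewrite imset_f.
- by apply/esym/imsetP => -[i _ E]; have := kC_ib i; rewrite -E kE.
Qed.

Lemma hset_HS : hset HS. Proof. by apply/hsetP. Qed.

Lemma card_HS : #|HS| = (n + n)%N.
Proof. by rewrite -deg_card degA_HS degB_HS (eqP hset_HS) addn0. Qed.

Lemma bideg_HS : bideg n n HS.
Proof. by rewrite /bideg degA_HS degB_HS hset_HS !eqxx. Qed.

Lemma hsetD S T : hset S -> hset (S :\: T).
Proof. by move=> /hsetP h; apply/hsetP; apply: fintype.subset_trans h; exact: subsetDl. Qed.

Lemma HS_DD T : hset T -> HS :\: (HS :\: T) = T.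
Proof. by move=> /hsetP h; rewrite finset.setDDr finset.setDv finset.set0U; apply/finset.setIidPr. Qed.

Lemma degA_le T : hset T -> (deg kA T <= n)%N.
Proof. by move=> /hsetP h; rewrite -[X in (_ <= X)%N]degA_HS (deg_setD _ h) leq_addl. Qed.

Lemma degB_le T : hset T -> (deg kB T <= n)%N.
Proof. by move=> /hsetP h; rewrite -[X in (_ <= X)%N]degB_HS (deg_setD _ h) leq_addl. Qed.

Lemma bidegC p q T : (p <= n)%N -> (q <= n)%N -> hset T ->
  bideg p q (HS :\: T) = bideg (n - p)%N (n - q)%N T.
Proof.
move=> pn qn hT; have h := hsetP _ hT.
have eA : n = (deg kA (HS :\: T) + deg kA T)%N by rewrite -(deg_setD _ h) degA_HS.
have eB : n = (deg kB (HS :\: T) + deg kB T)%N by rewrite -(deg_setD _ h) degB_HS.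
rewrite /bideg hT (hsetD _ hset_HS) !andbT; congr (_ && _); apply/eqP/eqP; lia.
Qed.

(** The projection of C^m onto the first two blocks along the N block; pulling back by it discards
    every basis form that contains a covector of N. *)
Definition Qmx : 'M[C]_m := diag_mx (\row_k (~~ kC k)%:R).

Lemma pullback_Q w : pullback Qmx w = restr hset w.
Proof.
rewrite [w]ext_eb !linear_sum; apply: eq_bigr => S _; rewrite !linearZ /=; congr (_ *: _).
rewrite /Qmx pullback_diag restr_eb; case: ifPn => [/hsetP/fintype.subsetP hS|hS].
  rewrite big1 ?scale1r // => k /hS; by rewrite inE mxE => ->.
have [k /andP[kS kk]] : exists k, (k \in S) && kC k.
  apply/existsP; apply: contraR hS => /existsPn hS; apply/hsetP/fintype.subsetP => k kS.
  by rewrite inE; have := hS k; rewrite kS.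
by rewrite (bigD1 k) //= mxE kk mul0r scale0r.
Qed.

Section Hodge.
Variable lam : C.
Local Notation lamc := (conjc lam).

(* star and gamma in coordinates; lam is the coefficient of the volume form on eb HS. *)
Definition hodge w : ext :=
  [ffun T => if hset T then (-1) ^+ inversions (HS :\: T) T * lamc * w (HS :\: T) else 0].

Lemma hodgeE w T :
  hodge w T = if hset T then (-1) ^+ inversions (HS :\: T) T * lamc * w (HS :\: T) else 0.
Proof. by rewrite [LHS]ffunE. Qed.

(** The cardinalities p + q and 2n - (p + q) add up to that of [HS], so disjoint index sets of these
    types must fill it. *)
Lemma disjoint_bideg p q S T : (p <= n)%N -> (q <= n)%N -> bideg p q S -> bideg (n - p)%N (n - q)%N T ->
  [disjoint S & T]%B -> T = HS :\: S.
Proof.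
move=> pn qn bS dbar_eb dST.
have [hS hT] : hset S /\ hset T by move: bS dbar_eb => /and3P[_ _ ->] /and3P[_ _ ->].
have U : S :|: T = HS.
  apply/eqP; rewrite eqEcard finset.subUset (hsetP _ hS) (hsetP _ hT) /= cardsU.
  move: dST; rewrite -setI_eq0 => /eqP ->; rewrite cards0 subn0.
  by rewrite (bideg_card bS) (bideg_card dbar_eb) card_HS; lia.
rewrite -U finset.setDUl finset.setDv finset.set0U; apply/esym/finset.setDidPl.
by rewrite disjoint_sym.
Qed.

Lemma wedge_top p q S w : (p <= n)%N -> (q <= n)%N -> bideg p q S -> supp (bideg (n - p)%N (n - q)%N) w ->
  ewedge (eb R S) w = ((-1) ^+ inversions S (HS :\: S) * w (HS :\: S)) *: eb R HS.
Proof.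
move=> pn qn bS sw; have hS : hset S by case/and3P: bS.
rewrite {1}[w]ext_eb linear_sum (bigD1 (HS :\: S)) //= [X in _ + X]big1 ?addr0 => [|T TS].
  rewrite linearZ /= ewedge_eb (_ : [disjoint S & _]%B); last first.
    by rewrite -setI_eq0 finset.setIDA finset.setIC -finset.setIDA finset.setDv finset.setI0.
  rewrite scalerA mulrC; congr (_ *: eb R _).
  by rewrite -{1}(finset.setIidPr (hsetP _ hS)) finset.setID.
rewrite linearZ /= ewedge_eb; case: ifPn => [dST|]; last by rewrite scaler0.
have [dbar_eb|/sw ->] := boolP (bideg (n - p)%N (n - q)%N T); last by rewrite scale0r.
by have := disjoint_bideg pn qn bS dbar_eb dST => E; rewrite E eqxx in TS.
Qed.

Lemma supp_hodge p q w : (p <= n)%N -> (q <= n)%N -> supp (bideg p q) w ->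
  supp (bideg (n - p)%N (n - q)%N) (hodge w).
Proof.
move=> pn qn sw T nT; rewrite hodgeE; case: ifPn => // hT.
by rewrite [w _]sw ?mulr0 // bidegC.
Qed.

Lemma conj_sign (a : nat) : conjc ((-1) ^+ a : C) = (-1) ^+ a.
Proof. by rewrite rmorphXn rmorphN1. Qed.

Lemma supp_conj (P : pred {set 'I_m}) w : supp P w -> supp P (ext_conj w).
Proof. by move=> sw S /sw; rewrite ext_conjE => ->; exact: conjc0. Qed.

(** Testing on the basis form indexed by the complement of T isolates the coefficient of s at T.
    Hence the defining identity of the star has exactly one solution, a signed complementation of
    index sets. *)
Lemma hodge_char p q s w : (p <= n)%N -> (q <= n)%N -> supp (bideg p q) w ->
  supp (bideg (n - p)%N (n - q)%N) s ->
  (forall b, supp (bideg p q) b ->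
    ewedge b (ext_conj s) = ((\sum_S b S * conjc (w S)) * lam) *: eb R HS) <-> s = hodge w.
Proof.
move=> pn qn sw ss; split=> [H|->].
  apply/ffunP => T; rewrite hodgeE; case: ifPn => [hT|nT]; last first.
    by apply: ss; apply: contra nT => /and3P[].
  have [dbar_eb|nT] := boolP (bideg (n - p)%N (n - q)%N T); last first.
    by rewrite ss // [w _]sw ?mulr0 // bidegC.
  have bS : bideg p q (HS :\: T) by rewrite bidegC.
  have := H _ (supp_eb _ bS).
  rewrite (wedge_top pn qn bS (supp_conj ss)) HS_DD // ext_conjE.
  move/(congr1 (fun u : ext => u HS)); rewrite !extZE ebE eqxx !mulr1.
  under eq_bigr do rewrite ebE mulrC eq_sym.
  rewrite sum_mul_delta => E.
  have : conjc (s T) = (-1) ^+ inversions (HS :\: T) T * (conjc (w (HS :\: T)) * lam).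
    by rewrite -E mulrA sign_sq mul1r.
  move/(congr1 (@conjc R)); rewrite conjcK => ->.
  by rewrite rmorphM rmorphM /= conj_sign conjcK -mulrA; congr (_ * _); exact: mulrC.
move=> b sb; have sh := supp_conj (supp_hodge pn qn sw).
rewrite {1}[b]ext_eb ewedge_suml big_distrl /= scaler_suml; apply: eq_bigr => S _.
rewrite ewedgeZl -!mulrA -[in RHS]scalerA; have [bS|/sb ->] := boolP (bideg p q S); last by rewrite !scale0r.
congr (_ *: _); rewrite (wedge_top pn qn bS sh) ext_conjE hodgeE (hsetD _ hset_HS).
have hS : hset S by case/and3P: bS.
rewrite HS_DD // rmorphM rmorphM /= conj_sign conjcK; congr (_ *: _).
rewrite -[_ * lam * _]mulrA [LHS]mulrA sign_sq mul1r; exact: mulrC.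
Qed.

(** The argument is read at the complement of T, where its total degree p + q is the cardinality of
    that complement; this expresses the power of i in gamma without mentioning p and q. *)
Definition Gam w : ext := [ffun T =>
  if hset T then 'i%C ^+ (n + #|HS :\: T| ^ 2)%N * (-1) ^+ inversions (HS :\: T) T * lamc * w (HS :\: T) else 0].

Lemma GamE w T : Gam w T = if hset T then
  'i%C ^+ (n + #|HS :\: T| ^ 2)%N * (-1) ^+ inversions (HS :\: T) T * lamc * w (HS :\: T) else 0.
Proof. by rewrite [LHS]ffunE. Qed.

Lemma Gam_linear : linear Gam.
Proof.
move=> k a b; apply/ffunP => T; rewrite extDE extZE !GamE extDE extZE.
by case: ifP => _; rewrite ?mulr0 ?addr0 //; ring.
Qed.
HB.instance Definition _ := GRing.isLinear.Build C ext ext *:%R Gam Gam_linear.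

Lemma supp_Gam w : supp hset (Gam w).
Proof. by move=> T /negPf nT; rewrite GamE nT. Qed.

Lemma Gam_sum w : supp hset w ->
  \sum_(p < n.+1) \sum_(q < n.+1) 'i%C ^+ (n + (p + q) ^ 2)%N *: hodge (restr (bideg p q) w) = Gam w.
Proof.
move=> sw; apply/ffunP => T; rewrite ext_sumE GamE.
under eq_bigr => p _ do (rewrite ext_sumE; under eq_bigr => q _ do rewrite extZE hodgeE restrE).
case: ifPn => hT; last by rewrite big1 // => p _; rewrite big1 // => q _; rewrite mulr0.
have hD := hsetD T hset_HS.
have pA : (deg kA (HS :\: T) < n.+1)%N by rewrite ltnS degA_le.
have pB : (deg kB (HS :\: T) < n.+1)%N by rewrite ltnS degB_le.
have bD : bideg (Ordinal pA) (Ordinal pB) (HS :\: T) by rewrite /bideg /= !eqxx hD.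
rewrite (bigD1 (Ordinal pA)) //= (bigD1 (Ordinal pB)) //= bD.
rewrite [X in _ + X + _]big1 ?[X in _ + X]big1 ?addr0; first last.
- move=> q qB; rewrite (_ : bideg _ _ _ = false) ?mulr0 //; apply/negP => /and3P[_ /eqP E _].
  by move/eqP: qB; apply; apply: val_inj.
- move=> p pB'; rewrite big1 // => q _.
  rewrite (_ : bideg _ _ _ = false) ?mulr0 //; apply/negP => /and3P[/eqP E _ _].
  by move/eqP: pB'; apply; apply: val_inj.
by rewrite (bideg_card bD) !mulrA.
Qed.

Hypothesis lam2 : lam * lam = (-1) ^+ n.

Lemma exprI4 (a b : nat) : (a = b %[mod 4])%N -> 'i%C ^+ a = 'i%C ^+ b :> C.
Proof.
have i4 : 'i%C ^+ 4 = 1 :> C by rewrite (exprM _ 2 2) sqr_i sqrrN expr1n.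
move=> E; rewrite (divn_eq a 4) (divn_eq b 4) !exprD ![(_ * 4)%N]mulnC !exprM i4 !expr1n !mul1r.
by rewrite E.
Qed.

Lemma exprI_double (a : nat) : 'i%C ^+ (a + a) = (-1) ^+ a :> C.
Proof. by rewrite addnn -mul2n exprM sqr_i. Qed.

(** Each pair of elements of S and T is inverted in exactly one of the two orders. *)
Lemma inversions_swap S T : [disjoint S & T]%B -> (inversions S T + inversions T S = #|S| * #|T|)%N.
Proof.
move=> dST; rewrite !inversionsE [X in (_ + X)%N]exchange_big -big_split /=.
rewrite -sum_nat_const; apply: eq_bigr => i iS; rewrite -big_split /= -sum1_card; apply: eq_bigr => j jT.
have : i != j by apply: contraL dST => /eqP E; apply/pred0Pn; exists i; rewrite /= iS E.
by rewrite -val_eqE /=; case: ltngtP.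
Qed.

(** Let d and e be the cardinalities of the complement of T and of T, so d + e = 2n. The two
    inversion signs give (-1)^(d e) and the square of the conjugate of [lam] gives (-1)^n. As a
    power of i the total exponent is (n + d^2) + (n + e^2) + 2 d e + 2 n = 4 n + (2 n)^2, a multiple
    of 4. *)
Lemma GamK w : supp hset w -> Gam (Gam w) = w.
Proof.
move=> sw; apply/ffunP => T; rewrite !GamE; case: ifPn => [hT|/sw -> //].
rewrite (hsetD _ hset_HS) HS_DD //.
set D := HS :\: T; set d := #|D|.
have cT : (#|T| + d)%N = (n + n)%N.
  apply: etrans card_HS; rewrite /d /D cardsD (finset.setIidPr (hsetP _ hT)) subnKC //.
  exact: subset_leq_card (hsetP _ hT).
have sgn : (-1) ^+ inversions D T * (-1) ^+ inversions T D = (-1) ^+ (d * #|T|) :> C.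
  by rewrite -exprD inversions_swap // -setI_eq0 finset.setIC /D finset.setIDA finset.setIC -finset.setIDA finset.setDv finset.setI0.
have ll : lamc * lamc = (-1) ^+ n by rewrite -rmorphM lam2; exact: conj_sign.
transitivity ('i%C ^+ (n + d ^ 2) * 'i%C ^+ (n + #|T| ^ 2) * ((-1) ^+ inversions D T * (-1) ^+ inversions T D) * (lamc * lamc) * w T :> C).
  ring.
rewrite sgn ll -exprD -exprI_double -exprI_double -!exprD.
rewrite (exprI4 (b := 0)) ?expr0 ?mul1r //.
have -> : #|T| = (n + n - d)%N by lia.
have dle : (d <= n + n)%N by lia.

move: (n + n - d)%N (subnK dle) => e E.
have -> : ((n + d ^ 2 + (n + e ^ 2) + (d * e + d * e) + (n + n)) = 4 * n + (e + d) ^ 2)%N by ring.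
rewrite E; have -> : (4 * n + (n + n) ^ 2 = (n + n ^ 2) * 4)%N by ring.
by rewrite modnMl.
Qed.

Lemma sg_split k S : k \notin S -> (sg k S + inversions S [set k]%SET = #|S|)%N.
Proof.
by move=> kS; rewrite -inversions1l addnC inversions_swap ?cards1 ?muln1 // disjoint_sym disjoints1.
Qed.

Lemma contr_coef k w S : ext_contr (delta_mx 0 k) w S = if k \in S then 0 else (-1) ^+ sg k S * w (k |: S).
Proof.
rewrite {1}[w]ext_eb linear_sum ext_sumE.
under eq_bigr => T _ do rewrite linearZ /= extZE contr_eb.
have [kS|kS] := boolP (k \in S).
  apply: big1 => T _; case: ifPn => kT; rewrite ?ext0E ?mulr0 // extZE ebE.
  case: eqP => [E|]; last by rewrite !mulr0.
  by move: kS; rewrite E setD11.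
rewrite (bigD1 (k |: S)) //= [X in _ + X]big1 ?addr0 => [|T TS].
  rewrite setU11 extZE ebE finset.setU1K // eqxx mulr1.
  by rewrite sgU1 // ltnn add0n; exact: mulrC.
case: ifPn => kT; rewrite ?ext0E ?mulr0 // extZE ebE.
case: eqP => [E|]; last by rewrite !mulr0.
by move: TS; rewrite E finset.setD1K // eqxx.
Qed.

Lemma eps_coefd k w S : eps (delta_mx 0 k) w S = if k \in S then (-1) ^+ sg k (S :\ k) * w (S :\ k) else 0.
Proof.
have -> : eps (delta_mx 0 k) w S = edot (eps (delta_mx 0 k) w) (eb R S) by rewrite edot_eb_r.
rewrite edot_eps contr_eb; case: ifPn => kS; last by rewrite edot0r.
have := edotDr ((-1) ^+ sg k S) (eb R (S :\ k)) 0 w; rewrite addr0 edot0r addr0 => ->.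
have -> : sg k S = sg k (S :\ k) by rewrite (sgD1 k kS) ltnn.
congr (_ * _); rewrite /edot; under eq_bigr do rewrite ebE.
by rewrite (bigD1 (S :\ k)) //= eqxx mulr1 big1 ?addr0 // => T /negPf ->; rewrite mulr0.
Qed.

(** This is what the quadratic exponent in gamma is for. Raising the degree d by one multiplies
    i^(d^2) by i (-1)^d, and (-1)^d cancels exactly the degree dependent signs of contraction and
    complementation, so that the constant - i is the same in all degrees. *)
Lemma Gam_contr k w : ~~ kC k -> supp hset w ->
  Gam (ext_contr (delta_mx 0 k) w) = - 'i%C *: eps (delta_mx 0 k) (Gam w).
Proof.
move=> hk sw; apply/ffunP => T; rewrite extZE GamE contr_coef eps_coefd GamE.
have kHS : k \in HS by rewrite inE.
have [hT|hT] := boolP (hset T); last first.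
  case: ifPn => [kT|]; last by rewrite mulr0.
  rewrite (_ : hset (T :\ k) = false) ?mulr0 //; apply: contraNF hT => /hsetP h.
  apply/hsetP; rewrite -(finset.setD1K kT) finset.subUset h andbT; apply/fintype.subsetP => i.
  by rewrite inE => /eqP ->.
rewrite (hsetD _ hT) !inE hk andbT.
have [kT|kT] := boolP (k \in T); last by rewrite /= !mulr0.
rewrite /=; set D := HS :\: T; have kD : k \notin D by rewrite !inE kT.
have -> : HS :\: (T :\ k) = k |: D.
  by apply/setP => i; rewrite !inE negb_and negbK; have [->|_] := eqVneq i k.
set T' := T :\ k; have kT' : k \notin T' by rewrite !inE eqxx.
have TE : T = k |: T' by rewrite finset.setD1K.
have dis : [disjoint [set k]%SET & T']%B by rewrite disjoints1.
have dis2 : [disjoint [set k]%SET & D]%B by rewrite disjoints1.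
rewrite cardsU1 kD [in inversions D T]TE inversionsUr // inversionsUl // inversions1l.
have cs := sg_split kD.
set d := #|D| in cs *.
rewrite -[(true + d)%N]/(1 + d)%N.
have E1 : 'i%C ^+ (n + (1 + d) ^ 2) = 'i%C * 'i%C ^+ (n + d ^ 2) * (-1) ^+ d :> C.
  rewrite -exprI_double -exprS -exprD; congr (_ ^+ _); ring.
have E2 : (-1) ^+ d = (-1) ^+ sg k D * (-1) ^+ inversions D [set k]%SET :> C by rewrite -exprD cs.
rewrite E1 E2 !(exprD (-1)).
transitivity ('i%C ^+ (n + d ^ 2) * ((-1) ^+ inversions D [set k]%SET * (-1) ^+ inversions D T' * (-1) ^+ sg k D) * lamc * w (k |: D)  :> C).
  ring.
(* Inserts - i^2 = 1 and a squared sign, the factors produced by - i and by [eps] on the other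
   side. *)
transitivity (- ('i%C ^+ 2) * 'i%C ^+ (n + d ^ 2) * ((-1) ^+ inversions D [set k]%SET * (-1) ^+ inversions D T' * (-1) ^+ sg k D) * ((-1) ^+ sg k T' * (-1) ^+ sg k T') * lamc * w (k |: D) :> C).
  by rewrite sign_sq sqr_i opprK; ring.
ring.
Qed.

(** [Gam_contr] is applied to [Gam w] and solved for w by [GamK]; no new count of signs is made. *)
Lemma Gam_eps k w : ~~ kC k -> supp hset w ->
  Gam (eps (delta_mx 0 k) w) = 'i%C *: ext_contr (delta_mx 0 k) (Gam w).
Proof.
move=> hk sw.
have sG := supp_Gam w.
have E := Gam_contr hk sG; rewrite (GamK sw) in E.
have -> : eps (delta_mx 0 k) w = 'i%C *: Gam (ext_contr (delta_mx 0 k) (Gam w)).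
  by rewrite E scalerA mulrN -expr2 sqr_i opprK scale1r.
rewrite linearZ /= GamK //; apply: supp_contr sG => i S _ _ /hsetP h; apply/hsetP.
exact: fintype.subset_trans (subsetDl _ _) h.
Qed.

End Hodge.

End CRCoordinates.

(** * The volume form in an adapted frame *)

Section VolumeCoordinates.
Variables (R : rcfType) (n r : nat).
Local Notation C := R[i].
Local Notation m := (n + n + r)%N.
Local Notation ext := (ext R m).
Local Notation VC := 'rV[C]_m.
Local Notation HSn := (HS n r).
Implicit Types (S T : {set 'I_m}) (w : ext) (A : 'M[C]_(n + n)) (U W : 'M[C]_n).

Definition hdiag A : 'M[C]_m := block_mx A 0 0 1%:M.

Lemma hdiagM A A' : hdiag A *m hdiag A' = hdiag (A *m A').
Proof. by rewrite /hdiag mulmx_block !mul0mx !mulmx0 mulmx1 !addr0 add0r. Qed.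

Lemma hdiag1 : hdiag 1%:M = 1%:M.
Proof. by rewrite /hdiag -scalar_mx_block. Qed.

Lemma hdiagT A : (hdiag A)^T = hdiag A^T.
Proof. by rewrite /hdiag tr_block_mx !trmx0 trmx1. Qed.

(** The determinant of A, taken as the factor by which the top form of H is scaled. Multiplicativity
    and invariance under transposition are then inherited from [pullback]. *)
Definition hdet A : C := pullback (hdiag A) (eb R HSn) HSn.

Lemma supp_wedge_covecs (s : seq VC) :
  (forall xi, xi \in s -> forall l, xi 0 (ic n l) = 0) ->
  supp (fun T => hset T && (#|T| == size s)) (wedge_covecs s).
Proof.
elim: s => [|xi s IH] H /=.
  by rewrite ext_one_eb; apply: supp_eb; rewrite cards0 /hset deg0.
apply: supp_eps (IH _) => [k T xk kT /andP[/hsetP hT cT]|ze zs]; last first.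
  by apply: H; rewrite inE zs orbT.
rewrite cardsU1 kT (eqP cT) eqxx andbT; apply/hsetP; rewrite finset.subUset hT andbT.
apply/fintype.subsetP => i; rewrite !inE => /eqP ->; move: k xk {kT}; apply: idxP => j; rewrite kE //.
by rewrite H ?eqxx // mem_head.
Qed.

(** The pullback of the top form is a product of 2n covectors without N components, and the top
    exterior power of the first two blocks is a line. *)
Lemma pullback_hdiag A : pullback (hdiag A) (eb R HSn) = hdet A *: eb R HSn.
Proof.
have s1 : supp (pred1 HSn) (pullback (hdiag A) (eb R HSn)).
  rewrite pullback_eb; apply: supp_sub (supp_wedge_covecs _).
    move=> T /andP[/hsetP hT]; rewrite size_map -cardE => /eqP cT /=.
    by rewrite eqEcard hT cT /=.
  move=> xi /mapP[k]; rewrite mem_enum => kH -> l; rewrite mxE [LHS]mxE.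
  move: k kH; apply: idxP => j; rewrite inE kE //= => _.
    by rewrite block_mxEdl mxE.
  by rewrite block_mxEdl mxE.
apply/ffunP => T; rewrite extZE ebE /hdet; have [->|TH] := eqVneq T HSn; first by rewrite mulr1.
by rewrite mulr0; apply: s1 => /=.
Qed.

Lemma hdetM A A' : hdet (A *m A') = hdet A * hdet A'.
Proof.
rewrite {1}/hdet -hdiagM.
have E : pullback (hdiag A *m hdiag A') (eb R HSn) = (hdet A' * hdet A) *: eb R HSn.
  apply: (etrans (esym (pullback_comp _ _ _))).
  apply: (etrans (congr1 (pullback (hdiag A)) (pullback_hdiag A'))).
  rewrite linearZ /= -scalerA; congr (_ *: _); exact: pullback_hdiag.
rewrite E extZE ebE eqxx mulr1; exact: mulrC.
Qed.

Lemma hdet1 : hdet 1%:M = 1.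
Proof. by rewrite /hdet hdiag1 pullback1 ebE eqxx. Qed.


Lemma hdetT A : hdet A^T = hdet A.
Proof.
have := edot_pullback (hdiag A) (eb R HSn) (eb R HSn).
by rewrite edot_eb_r edot_eb_l hdiagT => E; exact: (esym E).
Qed.

Definition udiag U W : 'M[C]_(n + n) := block_mx U 0 0 W.

Lemma udiagM U W U' W' : udiag U W *m udiag U' W' = udiag (U *m U') (W *m W').
Proof. by rewrite /udiag mulmx_block !mul0mx !mulmx0 !addr0 add0r. Qed.

Lemma udiag_swap U W : hdet (udiag U W) = hdet (udiag W U).
Proof.
pose P : 'M[C]_(n + n) := block_mx 0 1%:M 1%:M 0.
have PP : P *m P = 1%:M.
  by rewrite mulmx_block !mul0mx !mulmx0 !mulmx1 !addr0 add0r -scalar_mx_block.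
have -> : udiag U W = P *m udiag W U *m P.
  by rewrite !mulmx_block !mul0mx !mulmx0 !mulmx1 !mul1mx !addr0 !add0r.
by rewrite !hdetM mulrAC -hdetM PP hdet1 mul1r.
Qed.

(** A change U of the Z_j comes with the conjugate change of the Zbar_j. Swapping the two blocks and
    transposing collects both factors into the determinant of U times its adjoint, which is 1. This
    makes the volume form independent of the frame on which it is evaluated. *)
Lemma hdet_unitary U : U *m (map_mx (@conjc R) U)^T = 1%:M -> hdet (udiag U (map_mx (@conjc R) U)) = 1.
Proof.
move=> UU; set U' := map_mx _ _ in UU *.
have -> : udiag U U' = udiag U 1%:M *m udiag 1%:M U' by rewrite udiagM mulmx1 mul1mx.
rewrite hdetM [hdet (udiag 1%:M U')]udiag_swap -[hdet (udiag U' 1%:M)]hdetT -hdetM.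
by rewrite /udiag tr_block_mx !trmx0 trmx1 -/(udiag _ _) udiagM UU mulmx1 /udiag -scalar_mx_block hdet1.
Qed.

Definition shalf : C := ((Num.sqrt (2 : R))^-1)%:C%C.

Lemma shalf2 : shalf * shalf + shalf * shalf = 1.
Proof.
rewrite /shalf -rmorphM /= -invfM -expr2 sqr_sqrtr ?ler0n // -rmorphD /=.
by rewrite (_ : 2^-1 + 2^-1 = 1 :> R) //; field.
Qed.

(* The coordinates of X_j and J X_j with respect to the frame Z, Zbar. *)
Definition zX (j : 'I_n) : VC := shalf *: (delta_mx 0 (ia r j) + delta_mx 0 (ib r j)).
Definition zJX (j : 'I_n) : VC := shalf *: ('i%C *: delta_mx 0 (ia r j) - 'i%C *: delta_mx 0 (ib r j)).
Definition zframe (s : seq 'I_n) : seq VC := flatten [seq [:: zX j; zJX j] | j <- s].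

(* The volume form takes the value 1 on (X_1, J X_1, .., X_n, J X_n). *)
Definition lamv : C := (ext_eval (eb R HSn) (zframe (enum 'I_n)))^-1.

Lemma pair_aux (V : lmodType C) (s c : C) (u1 u2 u3 u4 : V) : u1 = 0 -> u4 = 0 -> u3 = - u2 -> s * s + s * s = 1 ->
  s *: (s *: (c *: u1)) + s *: (s *: (c *: u2)) + (s *: (s *: (- c *: u3)) + s *: (s *: (- c *: u4))) = c *: u2.
Proof.
move=> -> -> -> ss; rewrite !scaler0 add0r addr0 !scaleNr !scalerN !opprK !scalerA -scalerDl.
by congr (_ *: _); rewrite -[RHS]mul1r -ss; ring.
Qed.

(** Among the four terms, the two with a repeated vector vanish and the two mixed ones agree by
    anticommutation, each with the factor i/2. *)
Lemma contr_pair j w : ext_contr (zJX j) (ext_contr (zX j) w) =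
  'i%C *: ext_contr (delta_mx 0 (ia r j)) (ext_contr (delta_mx 0 (ib r j)) w).
Proof.
have E1 u : ext_contr (zJX j) u =
    shalf *: ('i%C *: ext_contr (delta_mx 0 (ia r j)) u + (- 'i%C) *: ext_contr (delta_mx 0 (ib r j)) u).
  by rewrite /zJX -scaleNr contrZl contrDl !contrZl.
have E2 u : ext_contr (zX j) u =
    shalf *: (ext_contr (delta_mx 0 (ia r j)) u + ext_contr (delta_mx 0 (ib r j)) u).
  by rewrite /zX contrZl contrDl.
rewrite E1 E2 !linearZ /= !linearD /=.
have sq v : ext_contr v (ext_contr v w) = 0.
  have := contr_anti v v w => /eqP.
  by rewrite -addr_eq0 -mulr2n -scaler_nat scaler_eq0 pnatr_eq0 /= => /eqP.
exact: (pair_aux _ (sq _) (sq _) (contr_anti _ _ _) shalf2).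
Qed.

(** The sign is left undetermined on purpose: what is used of the resulting constant [lamv] is that
    it is not 0 and that its square is (-1)^n. *)
Lemma ext_eval_zframe (s : seq 'I_n) T : uniq s -> (forall j, j \in s -> (ia r j \in T) && (ib r j \in T)) ->
  exists e : nat, foldl (fun w' v => ext_contr v w') (eb R T) (zframe s) =
    ('i%C ^+ size s * (-1) ^+ e) *: eb R (T :\: [set k | k \in [seq ia r j | j <- s] ++ [seq ib r j | j <- s]]%SET).
Proof.
elim: s T => [|j s IH] T.
  move=> _ _; exists 0%N; rewrite /= !expr0 mulr1 scale1r; congr eb; apply/setP => k; by rewrite !inE.
rewrite /= => /andP[js us] H.
have /andP[jaT jbT] : (ia r j \in T) && (ib r j \in T) by apply: H; rewrite mem_head.
have jaT' : ia r j \in T :\ ib r j by rewrite !inE ia_ib jaT.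
have [i|e E] := IH (T :\ ib r j :\ ia r j) us.
  move=> si; have /andP[h1 h2] := H i (mem_behead (s := j :: s) si).
  have ij : i != j by apply: contra js => /eqP <-.
  by rewrite !inE ia_ib ib_ia (inj_eq (@ia_inj n r)) (inj_eq (@ib_inj n r)) ij h1 h2.
exists (sg (ib r j) T + sg (ia r j) (T :\ ib r j) + e)%N.
rewrite contr_pair contr_eb jbT linearZ /= contr_eb jaT' !scalerA.
set c := _ * _ * _.
have fl (a : C) u vs : foldl (fun w' v => ext_contr v w') (a *: u) vs = a *: foldl (fun w' v => ext_contr v w') u vs.
  by elim: vs u => //= v vs IHv u; rewrite -IHv linearZ.
rewrite fl E scalerA; congr (_ *: eb _ _).
  by rewrite /c exprS !exprD; ring.
apply/setP => k; rewrite !inE !mem_cat !inE.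
by case: (k \in T); case: (k \in map _ _); case: (k \in map _ _); case: (k == _); case: (k == _).
Qed.

Lemma ext_eval_top : exists e : nat, ext_eval (eb R HSn) (zframe (enum 'I_n)) = 'i%C ^+ n * (-1) ^+ e.
Proof.
have [j _|e E] := @ext_eval_zframe (enum 'I_n) HSn (enum_uniq _); first by rewrite !inE !kE.
exists e; rewrite /ext_eval E extZE -cardE card_ord.
rewrite (_ : _ :\: _ = finset.set0) ?ebE ?eqxx ?mulr1 //.
apply/setP => k; rewrite !inE mem_cat; move: k; apply: idxP => j; rewrite kE ?andbF //=.
  by rewrite map_f // mem_enum.
by rewrite [X in _ || X]map_f ?orbT // mem_enum.
Qed.

Lemma lamv_neq0 : lamv != 0.
Proof.
have [e E] := ext_eval_top; rewrite invr_eq0 E mulf_neq0 // expf_neq0 //.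
by rewrite eq_complex /= oner_eq0 andbF.
Qed.

Lemma lamv2 : lamv * lamv = (-1) ^+ n.
Proof.
have [e E] := ext_eval_top; rewrite /lamv E -invfM.
have -> : 'i%C ^+ n * (-1) ^+ e * ('i%C ^+ n * (-1) ^+ e) = (-1) ^+ n :> C.
  by rewrite mulrACA sign_sq mulr1 -exprD exprI_double.
by rewrite -signr_odd; case: odd; rewrite ?invr1 ?invrN1.
Qed.


End VolumeCoordinates.

Arguments hset {n r} S.
Arguments kA {n r} k.
Arguments kB {n r} k.
Arguments kC {n r} k.
Local Opaque pullback ewedge ext_contr.

(** * Spans of forms and index sets of the coframe *)

Section ExtSpan.
Variables (R : rcfType) (m : nat).
Local Notation C := R[i].
Local Notation ext := (ext R m).

Lemma ext_span_ind (A : set ext) (Q : ext -> Prop) : Q 0 ->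
  (forall k a b, Q a -> Q b -> Q (k *: a + b)) -> (forall e, A e -> Q e) -> forall w, ext_span A w -> Q w.
Proof.
move=> Q0 QL QA w [k [a [e [eA ->]]]].
elim/big_ind: _ => // [u v Qu Qv|i _]; first by rewrite -[u]scale1r; exact: QL.
by rewrite -[_ *: _]addr0; apply: QL => //; exact/QA/eA.
Qed.

Lemma ext_span_sum (A : set ext) (I : finType) (P : pred I) (a : I -> C) (e : I -> ext) :
  (forall i, P i -> A (e i)) -> ext_span A (\sum_(i | P i) a i *: e i).
Proof.
move=> H; pose B := [set i | P i]%SET.
exists #|B|, (fun j => a (enum_val j)), (fun j => e (enum_val j)); split.
  by move=> j; apply: H; have := enum_valP j; rewrite inE.
rewrite -(big_enum_val (fun i => a i *: e i)) /=.
by apply: eq_bigl => i; rewrite inE.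
Qed.

Lemma ext_span0 (A : set ext) : ext_span A 0.
Proof. by exists 0%N, (fun=> 0), (fun=> 0); split=> [[]//|]; rewrite big_ord0. Qed.

Lemma ext_evalZ (a : C) (w : ext) vs : ext_eval (a *: w) vs = a * ext_eval w vs.
Proof.
rewrite /ext_eval -extZE; congr (_ finset.set0).
elim: vs w => [//|v vs IH] w /=.
have E : ext_contr v (a *: w) = a *: ext_contr v w by exact: linearZ.
by rewrite E IH.
Qed.

End ExtSpan.

Lemma lin1_mxE (R : pzRingType) (a b : nat) (f : 'rV[R]_a -> 'rV[R]_b) u : linear f -> u *m lin1_mx f = f u.
Proof.
move=> lf.
have fs (I : Type) (s : seq I) (c : I -> R) (v : I -> 'rV[R]_a) :
    f (\sum_(i <- s) c i *: v i) = \sum_(i <- s) c i *: f (v i).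
  elim: s => [|i s IH]; last by rewrite !big_cons lf IH.
  by rewrite !big_nil; have := lf (-1) 0 0; rewrite addr0 scaler0 scaleN1r addNr.
rewrite {2}[u]row_sum_delta fs; apply/rowP => j; rewrite mxE summxE; apply: eq_bigr => i _.
by rewrite !mxE.
Qed.

Section IndexSets.
Variables (n r : nat).
Local Notation m := (n + n + r)%N.
Implicit Types (J K : {set 'I_n}) (T : {set 'I_m}).

(** The index of the basis form that theta^{J, Kbar} becomes in the coordinates of an adapted
    frame. *)
Definition iS (i : {set 'I_n} * {set 'I_n}) : {set 'I_m} :=
  (ia r @: i.1 :|: ib r @: i.2)%SET.

Lemma ia_iS i j : (ia r j \in iS i) = (j \in i.1).
Proof.
rewrite inE (mem_imset _ _ (@ia_inj n r)); case: (boolP (j \in i.1)) => //= _.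
by apply/negP => /imsetP[k _ /eqP]; rewrite ia_ib.
Qed.

Lemma ib_iS i j : (ib r j \in iS i) = (j \in i.2).
Proof.
rewrite inE orbC (mem_imset _ _ (@ib_inj n r)); case: (boolP (j \in i.2)) => //= _.
by apply/negP => /imsetP[k _ /eqP]; rewrite ib_ia.
Qed.

Lemma ic_iS i l : (ic n l \in iS i) = false.
Proof.
rewrite inE; apply/negP => /orP[] /imsetP[j _ E]; have := kC_ic n l; by rewrite E kE.
Qed.

Lemma hset_iS i : hset (iS i).
Proof.
by apply/hsetP/fintype.subsetP; apply: idxP => j; rewrite ?ic_iS // => _; rewrite inE kE.
Qed.

Lemma iS_inj : injective iS.
Proof.
move=> [J K] [J' K'] E; congr (_, _); apply/setP => j.
  by rewrite -(ia_iS (J, K)) E ia_iS.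
by rewrite -(ib_iS (J, K)) E ib_iS.
Qed.

Definition piS T : {set 'I_n} * {set 'I_n} := ([set j | ia r j \in T], [set j | ib r j \in T])%SET.

Lemma piSK T : hset T -> iS (piS T) = T.
Proof.
move=> /hsetP/fintype.subsetP hT; apply/setP; apply: idxP => j; [by rewrite ia_iS inE|by rewrite ib_iS inE|].
by rewrite ic_iS; apply/esym/negP => /hT; rewrite inE kE.
Qed.

Lemma deg_iS i : (deg (@kA n r) (iS i) = #|i.1|) * (deg (@kB n r) (iS i) = #|i.2|).
Proof.
split; rewrite /deg.
  rewrite -(card_imset _ (@ia_inj n r)); congr #|pred_of_set _|; apply/setP; apply: idxP => j.
  - by rewrite inE kE andbT ia_iS (mem_imset _ _ (@ia_inj n r)).
  - by rewrite inE kE andbF; apply/esym/negP => /imsetP[k _ /eqP]; rewrite ib_ia.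
  - by rewrite inE kE andbF; apply/esym/negP => /imsetP[k _ E]; have := kC_ic n j; rewrite E kE.
rewrite -(card_imset _ (@ib_inj n r)); congr #|pred_of_set _|; apply/setP; apply: idxP => j.
- by rewrite inE kE andbF; apply/esym/negP => /imsetP[k _ /eqP]; rewrite ia_ib.
- by rewrite inE kE andbT ib_iS (mem_imset _ _ (@ib_inj n r)).
- by rewrite inE kE andbF; apply/esym/negP => /imsetP[k _ E]; have := kC_ic n j; rewrite E kE.
Qed.

Lemma enum_ord_sorted k (A : {set 'I_k}) : sorted (fun i j : 'I_k => (i < j)%N) (enum A).
Proof.
have tr : transitive (fun i j : 'I_k => (i < j)%N) by move=> a b c; exact: ltn_trans.
rewrite {1}/(enum _) /= -enumT; apply: sorted_filter => //.
by have := iota_ltn_sorted 0 k; rewrite -val_enum_ord sorted_map.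
Qed.

(** All Z indices precede all Zbar indices, so the increasing order agrees with the order of the
    factors in theta^{J, Kbar} and no sign appears. *)
Lemma enum_iS i : enum (iS i) = [seq ia r j | j <- enum i.1] ++ [seq ib r j | j <- enum i.2].
Proof.
have tr : transitive (fun i j : 'I_m => (i < j)%N) by move=> a b c; exact: ltn_trans.
apply: (irr_sorted_eq tr) => [k|||k]; first by rewrite ltnn.
- exact: enum_ord_sorted.
- rewrite sorted_pairwise // pairwise_cat; apply/and3P; split.
  + by apply/allrelP => a b /mapP[j _ ->] /mapP[k _ ->] /=; rewrite ltn_addr.
  + by rewrite -sorted_pairwise // sorted_map; exact: (enum_ord_sorted i.1).
  + rewrite -sorted_pairwise // sorted_map.
    by apply: sub_sorted (enum_ord_sorted i.2) => a b /=; rewrite ltn_add2l.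
by rewrite mem_cat mem_enum inE; congr (_ || _); apply/imsetP/mapP => -[j jJ ->]; exists j; rewrite // ?mem_enum // -mem_enum.
Qed.

End IndexSets.

(** * Fibrewise CR geometry in an adapted frame *)

Section RealComplexVectors.
Variables (R : rcfType) (k : nat).
Local Notation C := R[i].
Implicit Types (u v : 'rV[R]_k) (w : 'rV[C]_k).

Lemma toCvD u v : toCv (u + v) = toCv u + toCv v. Proof. exact: map_mxD. Qed.
Lemma toCvN u : toCv (- u) = - toCv u. Proof. exact: map_mxN. Qed.
Lemma toCv0 : toCv (0 : 'rV[R]_k) = 0. Proof. exact: map_mx0. Qed.
Lemma toCvM u (A : 'M[R]_k) : toCv (u *m A) = toCv u *m toCm A. Proof. exact: map_mxM. Qed.

Lemma rVC_split w : w = toCv (Re_vec w) + 'i%C *: toCv (Im_vec w).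
Proof.
apply/rowP => j; rewrite !mxE; case: (w 0 j) => a b /=.
by apply/eqP; rewrite eq_complex /=; apply/andP; split; apply/eqP; ring.
Qed.

Lemma Re_toC u v : Re_vec (toCv u + 'i%C *: toCv v) = u.
Proof. by apply/rowP => j; rewrite !mxE /=; ring. Qed.

Lemma Im_toC u v : Im_vec (toCv u + 'i%C *: toCv v) = v.
Proof. by apply/rowP => j; rewrite !mxE /=; ring. Qed.

End RealComplexVectors.

Section BasisFamilies.
Variables (F : fieldType) (m k : nat) (U : {vspace 'rV[F]_m}) (E : 'I_k -> 'rV[F]_m).
Let Em := \matrix_i E i.

Lemma mul_family (a : 'rV[F]_k) : a *m Em = \sum_i a 0 i *: E i.
Proof. by rewrite mulmx_sum_row; apply: eq_bigr => i _; rewrite rowK. Qed.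

Lemma basis_family : basis_of U [seq E i | i <- enum 'I_k] ->
  [/\ forall a : 'rV[F]_k, a *m Em \in U, forall a : 'rV[F]_k, a *m Em = 0 -> a = 0 &
      forall u, u \in U -> exists a, u = a *m Em].
Proof.
move=> bE; have bt : basis_of U [tuple E i | i < k] by exact: bE.
have eE (i : 'I_k) : [tuple E i | i < k]`_i = E i by rewrite -tnth_nth tnth_mktuple.
split=> [a|a|u uU].
- rewrite mul_family; apply: memv_suml => i _; apply: memvZ; apply: (basis_mem bE).
  by rewrite map_f // mem_enum.
- rewrite mul_family => a0; have /freeP fr := basis_free bt.
  by apply/rowP => i; rewrite mxE; apply: fr; rewrite -[RHS]a0; apply: eq_bigr => j _; rewrite eE.
exists (\row_i coord [tuple E i | i < k] i u).
by rewrite mul_family {1}(coord_basis bt uU); apply: eq_bigr => i _; rewrite mxE eE.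
Qed.

Lemma family_basis : \dim U = k -> (forall i, E i \in U) -> (forall a : 'rV[F]_k, a *m Em = 0 -> a = 0) ->
  basis_of U [seq E i | i <- enum 'I_k].
Proof.
move=> dU EU inj; suff : basis_of U [tuple E i | i < k] by exact.
have eE (i : 'I_k) : [tuple E i | i < k]`_i = E i by rewrite -tnth_nth tnth_mktuple.
rewrite basisEfree size_tuple dU leqnn andbT; apply/andP; split.
  apply/freeP => a a0 i; have : (\row_i a i) *m Em = 0.
    by rewrite mul_family -[RHS]a0; apply: eq_bigr => j _; rewrite mxE eE.
  by move/inj/rowP/(_ i); rewrite !mxE.
by apply/span_subvP => u /mapP[i _ ->].
Qed.

End BasisFamilies.

Lemma daddv_pi_ker (F : fieldType) (vT : vectType F) (U V : {vspace vT}) v :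
  (U :&: V = 0)%VS -> v \in V -> daddv_pi U V v = 0.
Proof.
move=> d vV; have d' : (V :&: U = 0)%VS by rewrite capvC.
have h : v \in (U + V)%VS by apply: (subvP (addvSr _ _)).
have := daddv_pi_add d h; rewrite (daddv_pi_id d' vV) -[X in _ = X]add0r.
exact: addIr.
Qed.

(** * Forms, metrics and gamma at one point *)

Section PointCR.
Variables (R : realType) (n r : nat).
Local Notation m := (n + n + r)%N.
Variables (M : manifold R m) (S : real_CR M n) (x : M).
Local Notation C := R[i].
Local Notation V := 'rV[R]_m.
Local Notation VC := 'rV[C]_m.
Local Notation ext := (ext R m).

Definition adapted (X : 'I_n -> V) (E : 'I_r -> V) : Prop :=
  [/\ forall j, X j \in crL S x, forall j k, gL S x (X j) (X k) = (j == k)%:R &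
      basis_of (crN S x) [seq E i | i <- enum 'I_r]].

Variables (X : 'I_n -> V) (E : 'I_r -> V).

Definition Zv j : VC := shalf R *: (toCv (X j) - 'i%C *: toCv (crJ S x (X j))).
Definition Zbv j : VC := shalf R *: (toCv (X j) + 'i%C *: toCv (crJ S x (X j))).

Local Notation Xm := (\matrix_j X j).
Local Notation JXm := (\matrix_j crJ S x (X j)).
Local Notation Em := (\matrix_l E l).
Definition hv (a b : 'rV[R]_n) : V := a *m Xm + b *m JXm.

(** Its rows are the frame vectors: v |-> v *m [Fmx] goes from frame coordinates to tangent vectors,
    so pulling back by it expresses a form in the dual coframe. *)
Definition Fmx : 'M[C]_m :=
  col_mx (col_mx (\matrix_j Zv j) (\matrix_j Zbv j)) (\matrix_l toCv (E l)).

Lemma row_ia j : row (ia r j) Fmx = Zv j.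
Proof. by apply/rowP => k; rewrite mxE /Fmx /ia !col_mxEu mxE. Qed.
Lemma row_ib j : row (ib r j) Fmx = Zbv j.
Proof. by apply/rowP => k; rewrite mxE /Fmx /ib col_mxEu col_mxEd mxE. Qed.
Lemma row_ic l : row (ic n l) Fmx = toCv (E l).
Proof. by apply/rowP => k; rewrite mxE /Fmx /ic col_mxEd mxE. Qed.

Lemma mul_Fmx (y : VC) : y *m Fmx =
  \sum_j y 0 (ia r j) *: Zv j + \sum_j y 0 (ib r j) *: Zbv j + \sum_l y 0 (ic n l) *: toCv (E l).
Proof.
rewrite mulmx_sum_row big_idx.
apply: (congr2 +%R (congr2 +%R (eq_bigr _ _) (eq_bigr _ _)) (eq_bigr _ _)) => j _.
- exact: (congr1 _ (row_ia j)).
- exact: (congr1 _ (row_ib j)).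
- exact: (congr1 _ (row_ic j)).
Qed.

Hypothesis ad : adapted X E.

Lemma crL_H u : u \in crL S x -> u \in crH S x.
Proof. by move=> uL; rewrite -crL_sum; apply: (fintype.subsetP (addvSl _ _)) || exact: (subvP (addvSl _ _)). Qed.

Lemma dimL : \dim (crL S x) = n.
Proof.
have [W [E' [_ Wx _ bE]]] := crL_subbundle S x.
have bt : basis_of (crL S x) [tuple E' i x | i < n] by exact: bE.
exact: size_basis bt.
Qed.

Lemma gL_mx (a b : 'rV[R]_n) : gL S x (a *m Xm) (b *m Xm) = (a *m b^T) 0 0.
Proof.
have [XL XX _] := ad.
rewrite /gL trmx_mul !mulmxA -[a *m Xm *m _]mulmxA -[a *m (Xm *m _) *m Xm^T]mulmxA.
have -> : Xm *m crg S x *m Xm^T = 1%:M.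
  apply/matrixP => i j; rewrite [RHS]mxE -XX /gL [LHS]mxE [RHS]mxE; apply: eq_bigr => k _.
  congr (_ * _); last by rewrite !mxE.
  by have := row_mul i Xm (crg S x); rewrite rowK => <-; rewrite [RHS]mxE.
by rewrite mulmx1.
Qed.

Lemma X_inj (a : 'rV[R]_n) : a *m Xm = 0 -> a = 0.
Proof.
move=> a0; have := gL_mx a a; rewrite a0 /gL !mul0mx mxE => /esym/eqP.
rewrite mxE; under eq_bigr do rewrite mxE -expr2.
by rewrite psumr_eq0 => [/allP h|i _]; [apply/rowP => i; rewrite mxE; apply/eqP; rewrite -sqrf_eq0; apply: h; rewrite mem_index_enum|exact: sqr_ge0].
Qed.

Lemma X_total u : u \in crL S x -> exists a, u = a *m Xm.
Proof.
have [XL _ _] := ad.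
by have [_ _ h] := basis_family (family_basis dimL XL X_inj); exact: h.
Qed.

Lemma X_in a : a *m Xm \in crL S x.
Proof. have [XL _ _] := ad; rewrite mul_family; apply: memv_suml => i _; exact: memvZ. Qed.

Lemma crJ_X a : crJ S x (a *m Xm) = a *m JXm.
Proof. by rewrite !mul_family linear_sum; apply: eq_bigr => i _; rewrite linearZ. Qed.

Lemma JX_in b : b *m JXm \in JL S x.
Proof. by rewrite -crJ_X; apply: memv_img; exact: X_in. Qed.

Lemma crJ_JX b : crJ S x (b *m JXm) = - b *m Xm.
Proof. by rewrite -crJ_X crJ_sqr ?mulNmx //; apply: crL_H; exact: X_in. Qed.

Lemma JL_H u : u \in JL S x -> u \in crH S x.
Proof. by move=> uL; rewrite -crL_sum; exact: (subvP (addvSr _ _)). Qed.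

Lemma hv_in a b : hv a b \in crH S x.
Proof. by apply: memvD; [exact/crL_H/X_in|exact/JL_H/JX_in]. Qed.

Lemma hv_total u : u \in crH S x -> exists a b, u = hv a b.
Proof.
rewrite -crL_sum => /memv_addP[u1 /X_total[a ->] [u2 /memv_imgP[u3 /X_total[b ->] ->] ->]].
by exists a, b; rewrite crJ_X.
Qed.

Lemma crJ_hv a b : crJ S x (hv a b) = hv (- b) a.
Proof. by rewrite /hv linearD /= crJ_X crJ_JX addrC. Qed.

Lemma projL_hv a b : projL S x (hv a b) = a *m Xm.
Proof.
have dx := crL_direct S x.
by rewrite /projL /hv linearD /= (daddv_pi_id dx (X_in a)) (daddv_pi_ker dx (JX_in b)) addr0.
Qed.

Lemma projJL_hv a b : projJL S x (hv a b) = b *m JXm.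
Proof.
have dx := crL_direct S x; have h : hv a b \in (crL S x + JL S x)%VS by rewrite crL_sum hv_in.
have := daddv_pi_add dx h; rewrite -/(projL S x _) projL_hv -/(projJL S x _) /hv => /eqP.
by rewrite (inj_eq (addrI _)) => /eqP.
Qed.

Lemma gH_hv a b a' b' : gH S x (hv a b) (hv a' b') = (a *m a'^T) 0 0 + (b *m b'^T) 0 0.
Proof.
rewrite /gH /gL_ext !crJ_hv !projL_hv !gL_mx; congr (_ + _).
by rewrite mulNmx linearN /= mulmxN opprK.
Qed.

Lemma projH_H u : u \in crH S x -> projH S x u = u.
Proof. exact: (daddv_pi_id (crN_direct S x)). Qed.

Lemma projH_N u : u \in crN S x -> projH S x u = 0.
Proof.
exact: (daddv_pi_ker (crN_direct S x)).
Qed.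

Lemma E_in l : E l \in crN S x.
Proof. by have [_ _ /basis_family[h _ _]] := ad; have := h (delta_mx 0 l); rewrite -rowE rowK. Qed.


Local Notation tC := (toCv (R := R) (m := m)).

Definition JCm : 'M[C]_m := toCm (lin1_mx (crJ S x)).

Lemma toCv_J u : toCv u *m JCm = toCv (crJ S x u).
Proof. by rewrite /JCm -toCvM mul_rV_lin1. Qed.

Lemma JCE w : JC S x w = w *m JCm.
Proof. by rewrite /JC -!toCv_J {3}(rVC_split w) mulmxDl -scalemxAl. Qed.

Lemma i2 : 'i%C * 'i%C = -1 :> C. Proof. by rewrite -expr2 sqr_i. Qed.

(** One computation serves both Z_j, with e = i, and Zbar_j, with e = - i. *)
Lemma eigJ (e : C) (u : V) : e * e = -1 -> u \in crH S x ->
  (toCv u - e *: toCv (crJ S x u)) *m JCm = e *: (toCv u - e *: toCv (crJ S x u)).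
Proof.
move=> ee uH; rewrite mulmxBl -scalemxAl !toCv_J crJ_sqr // toCvN scalerN opprK scalerBr scalerA ee.
by rewrite scaleN1r opprK addrC.
Qed.

Lemma X_H j : X j \in crH S x. Proof. by have [XL _ _] := ad; exact: crL_H. Qed.

Lemma Zv_J j : Zv j *m JCm = 'i%C *: Zv j.
Proof.
rewrite /Zv -scalemxAl (eigJ i2 (X_H j)) scalerA [_ * 'i%C]mulrC -scalerA //.
Qed.

Lemma Zbv_J j : Zbv j *m JCm = - 'i%C *: Zbv j.
Proof.
have ii : - 'i%C * - 'i%C = -1 :> C by rewrite mulrNN i2.
have := eigJ ii (X_H j); rewrite !scaleNr !opprK => E1.
by rewrite /Zbv -scalemxAl E1 scalerN !scalerA [_ * 'i%C]mulrC -scalerA.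
Qed.

Lemma frame_aux1 (W : lmodType C) (s c : C) (P Q : W) : s * s + s * s = 1 ->
  s *: (s *: (P - c *: Q) + s *: (P + c *: Q)) = P.
Proof. by move=> ss; rewrite -scalerDr scalerA addrACA addNr addr0 scalerDr -scalerDl ss scale1r. Qed.

Lemma frame_aux2 (W : lmodType C) (s c : C) (P Q : W) : s * s + s * s = 1 -> c * c = -1 ->
  s *: (c *: (s *: (P - c *: Q)) - c *: (s *: (P + c *: Q))) = Q.
Proof.
move=> ss cc; rewrite -!scalerBr opprD addrACA subrr add0r -!scaleNr -scalerDl !scalerA.
rewrite -[RHS]scale1r; congr (_ *: _).
transitivity (- (c * c) * (s * s + s * s)); first by ring.
by rewrite cc ss opprK mul1r.
Qed.

Lemma frame_aux3 (W : lmodType C) (s c a b : C) (P Q : W) :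
  a *: (s *: (P + Q)) + b *: (s *: (c *: P - c *: Q)) = (s * (a + c * b)) *: P + (s * (a - c * b)) *: Q.
Proof.
rewrite !scalerDr !scalerN !scalerA addrACA -scaleNr -!scalerDl.
by congr (_ *: _ + _ *: _); ring.
Qed.

Lemma X_Z j : tC (X j) = shalf R *: (Zv j + Zbv j).
Proof. exact: (esym (frame_aux1 _ _ _ (shalf2 R))). Qed.

Lemma JX_Z j : tC (crJ S x (X j)) = shalf R *: ('i%C *: Zv j - 'i%C *: Zbv j).
Proof. exact: (esym (frame_aux2 _ _ (shalf2 R) i2)). Qed.

Definition fc (y : 'rV[C]_n) (z : 'rV[C]_n) (e : 'rV[C]_r) : VC := row_mx (row_mx y z) e.

Lemma fc_ia y z e j : fc y z e 0 (ia r j) = y 0 j.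
Proof. by rewrite /fc /ia !row_mxEl. Qed.
Lemma fc_ib y z e j : fc y z e 0 (ib r j) = z 0 j.
Proof. by rewrite /fc /ib row_mxEl row_mxEr. Qed.
Lemma fc_ic y z e j : fc y z e 0 (ic n j) = e 0 j.
Proof. by rewrite /fc /ic row_mxEr. Qed.

Lemma mul_fc y z e : fc y z e *m Fmx =
  \sum_j y 0 j *: Zv j + \sum_j z 0 j *: Zbv j + \sum_l e 0 l *: tC (E l).
Proof.
rewrite mul_Fmx.
by apply: (congr2 +%R (congr2 +%R (eq_bigr _ _) (eq_bigr _ _)) (eq_bigr _ _)) => j _;
  rewrite ?fc_ia ?fc_ib ?fc_ic.
Qed.

Lemma toCv_lin (k : nat) (f : 'I_k -> R) (g : 'I_k -> V) : tC (\sum_j f j *: g j) = \sum_j (f j)%:C%C *: tC (g j).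
Proof.
apply/rowP => i; rewrite mxE !summxE (rmorph_sum (real_complex R)).
by apply: eq_bigr => j _; rewrite !mxE rmorphM.
Qed.

Lemma toC_hv a b : tC (hv a b) = fc (\row_j (shalf R * (a 0 j +i* b 0 j)%C))
  (\row_j (shalf R * (a 0 j -i* b 0 j)%C)) 0 *m Fmx.
Proof.
rewrite mul_fc [X in _ + X]big1 ?addr0 => [|l _]; last by rewrite mxE scale0r.
rewrite /hv toCvD !mul_family !toCv_lin -!big_split; apply: eq_bigr => j _ /=.
rewrite X_Z JX_Z frame_aux3 2!mxE.
have -> : (a 0 j +i* b 0 j)%C = (a 0 j)%:C%C + 'i%C * (b 0 j)%:C%C.
  by apply/eqP; rewrite eq_complex /=; apply/andP; split; apply/eqP; ring.
have -> : (a 0 j -i* b 0 j)%C = (a 0 j)%:C%C - 'i%C * (b 0 j)%:C%C.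
  by apply/eqP; rewrite eq_complex /=; apply/andP; split; apply/eqP; ring.
by [].
Qed.

Lemma toC_E e : tC (e *m Em) = fc 0 0 (toCv e) *m Fmx.
Proof.
rewrite mul_fc big1 => [|j _]; last by rewrite mxE scale0r.
rewrite big1 => [|j _]; last by rewrite mxE scale0r.
rewrite !add0r mul_family toCv_lin; apply: eq_bigr => l _; by rewrite mxE.
Qed.

Lemma E_total u : u \in crN S x -> exists e, u = e *m Em.
Proof. by have [_ _ bE] := ad; have [_ _ h] := basis_family bE; exact: h. Qed.

Lemma fcD y z e y' z' e' : fc y z e + fc y' z' e' = fc (y + y') (z + z') (e + e').
Proof. by rewrite /fc !add_row_mx. Qed.
Lemma fcZ k y z e : k *: fc y z e = fc (k *: y) (k *: z) (k *: e).
Proof. by rewrite /fc !scale_row_mx. Qed.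

Lemma HC_total w : HC S x w -> exists y z, w = fc y z 0 *m Fmx.
Proof.
move=> [/hv_total[a [b Ea]] /hv_total[a' [b' Ea']]].
rewrite [w]rVC_split Ea Ea' !toC_hv scalemxAl -mulmxDl fcZ fcD scaler0 addr0.
by eexists; eexists.
Qed.

Lemma NC_total w : NC S x w -> exists e, w = fc 0 0 e *m Fmx.
Proof.
move=> [/E_total[e Ee] /E_total[e' Ee']].
rewrite [w]rVC_split Ee Ee' !toC_E scalemxAl -mulmxDl fcZ fcD !scaler0 !addr0.
by eexists.
Qed.

Lemma toC_total (u : V) : exists y, tC u = y *m Fmx.
Proof.
have : u \in (crH S x + crN S x)%VS by rewrite crN_sum memvf.
move=> /memv_addP[v /hv_total[a [b ->]] [v' /E_total[e ->] ->]].
by rewrite toCvD toC_hv toC_E -mulmxDl; eexists.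
Qed.

(** The real standard basis vectors are combinations of the frame, which provides a left inverse. *)
Lemma Fmx_unit : Fmx \in unitmx.
Proof.
have [Y HY] : exists Y : 'I_m -> VC, forall i, tC (delta_mx 0 i) = Y i *m Fmx.
  have [Y HY] := choice (fun i => toC_total (delta_mx 0 i)); by exists Y.
have : (\matrix_i Y i) *m Fmx = 1%:M.
  apply/row_matrixP => i; rewrite row_mul rowK -HY; apply/rowP => j.
  by rewrite !mxE eqxx /= [j == i]eq_sym; case: (i == j).
by move/mulmx1_unit => [].
Qed.

Definition Bmx : 'M[C]_m := invmx Fmx.
Lemma FB : Fmx *m Bmx = 1%:M. Proof. exact: mulmxV Fmx_unit. Qed.
Lemma BF : Bmx *m Fmx = 1%:M. Proof. exact: mulVmx Fmx_unit. Qed.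

Lemma Fmx_inj (y y' : VC) : y *m Fmx = y' *m Fmx -> y = y'.
Proof. by move=> /(congr1 (mulmx^~ Bmx)); rewrite -!mulmxA FB !mulmx1. Qed.

Definition cv (xi : VC) : VC := xi *m Fmx^T.
Lemma cvE xi k : cv xi 0 k = pairing xi (row k Fmx).
Proof. by rewrite /cv mxE /pairing; apply: eq_bigr => j _; rewrite !mxE. Qed.

Lemma pairing_F xi y : pairing xi (y *m Fmx) = \sum_k cv xi 0 k * y 0 k.
Proof. by rewrite -pairing_mul. Qed.

Lemma HC_fr j : HC S x (Zv j) /\ HC S x (Zbv j).
Proof.
have s1 (u v : V) : shalf R *: (toCv u + 'i%C *: toCv v) =
    toCv ((Num.sqrt 2)^-1 *: u) + 'i%C *: toCv ((Num.sqrt 2)^-1 *: v) :> VC.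
  by rewrite scalerDr /toCv !map_mxZ !scalerA [_ * 'i%C]mulrC -!scalerA.
have XH := X_H j; have JH := crJ_H XH.
split; rewrite /HC /= ?/Zv ?/Zbv.
  rewrite -scalerN -toCvN s1 Re_toC Im_toC; split; apply: memvZ => //; by rewrite memvN.
by rewrite s1 Re_toC Im_toC; split; apply: memvZ.
Qed.

Lemma T10_fr j : T10 S x (Zv j).
Proof. by split; [case: (HC_fr j)|rewrite JCE Zv_J]. Qed.
Lemma T01_fr j : T01 S x (Zbv j).
Proof. by split; [case: (HC_fr j)|rewrite JCE Zbv_J]. Qed.
Lemma NC_fr l : NC S x (tC (E l)).
Proof.
have EN := E_in l; rewrite -[tC _]addr0 -(scaler0 _ 'i%C) -(toCv0 R m).
by split; rewrite ?Re_toC ?Im_toC ?mem0v.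
Qed.

Lemma JC_F y z : JC S x (fc y z 0 *m Fmx) = fc ('i%C *: y) (- 'i%C *: z) 0 *m Fmx.
Proof.
rewrite JCE !mul_fc [X in _ + X]big1 ?addr0 => [|l _]; last by rewrite mxE scale0r.
rewrite [X in _ = _ + X]big1 ?addr0 => [|l _]; last by rewrite mxE scale0r.
rewrite mulmxDl !mulmx_suml.
apply: (congr2 +%R (eq_bigr _ _) (eq_bigr _ _)) => j _; rewrite -scalemxAl.
  by rewrite Zv_J [in RHS]mxE scalerA mulrC.
by rewrite Zbv_J [in RHS]mxE scalerA mulrC.
Qed.

Lemma T10_total w : T10 S x w -> exists y, w = fc y 0 0 *m Fmx.
Proof.
move=> [/HC_total[y [z ->]]]; rewrite JC_F scalemxAl fcZ => /Fmx_inj h.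
suff -> : z = 0 by exists y.
apply/rowP => j; have /rowP/(_ (ib r j)) := h; rewrite !fc_ib !mxE => /eqP.
by rewrite mulNr eq_sym -addr_eq0 -mulrDl mulf_eq0 -mulr2n mulrn_eq0 /= eq_complex /= oner_eq0 andbF /= => /eqP.
Qed.

Lemma T01_total w : T01 S x w -> exists z, w = fc 0 z 0 *m Fmx.
Proof.
move=> [/HC_total[y [z ->]]]; rewrite JC_F scalemxAl fcZ => /Fmx_inj h.
suff -> : y = 0 by exists z.
apply/rowP => j; have /rowP/(_ (ia r j)) := h; rewrite !fc_ia !mxE => /eqP.
by rewrite mulNr -addr_eq0 -mulrDl mulf_eq0 -mulr2n mulrn_eq0 /= eq_complex /= oner_eq0 andbF /= => /eqP.
Qed.

Lemma sum_fc xi y z e : \sum_k cv xi 0 k * fc y z e 0 k =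
  \sum_j cv xi 0 (ia r j) * y 0 j + \sum_j cv xi 0 (ib r j) * z 0 j + \sum_l cv xi 0 (ic n l) * e 0 l.
Proof.
rewrite big_idx; congr (_ + _ + _); apply: eq_bigr => j _.
- by rewrite fc_ia.
- by rewrite fc_ib.
- by rewrite fc_ic.
Qed.

Lemma rv0 k j : (0 : 'rV[C]_k) 0 j = 0. Proof. by rewrite mxE. Qed.

Lemma Lambda10P xi : Lambda10 S x xi <-> forall k : 'I_m, ~~ kA k -> cv xi 0 k = 0.
Proof.
split=> [h|h v].
  apply: idxP => j; rewrite kE // => _; rewrite cvE ?row_ib ?row_ic; apply: h.
    by left; exact: T01_fr.
  by right; exact: NC_fr.
case=> [/T01_total[z ->]|/NC_total[e ->]]; rewrite pairing_F sum_fc.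
  by rewrite !big1 ?addr0 // => j _; rewrite ?rv0 ?mulr0 // h ?mul0r // kE.
by rewrite !big1 ?addr0 // => j _; rewrite ?rv0 ?mulr0 // h ?mul0r // kE.
Qed.

Lemma Lambda01P xi : Lambda01 S x xi <-> forall k : 'I_m, ~~ kB k -> cv xi 0 k = 0.
Proof.
split=> [h|h v].
  apply: idxP => j; rewrite kE // => _; rewrite cvE ?row_ia ?row_ic; apply: h.
    by left; exact: T10_fr.
  by right; exact: NC_fr.
case=> [/T10_total[z ->]|/NC_total[e ->]]; rewrite pairing_F sum_fc.
  by rewrite !big1 ?addr0 // => j _; rewrite ?rv0 ?mulr0 // h ?mul0r // kE.
by rewrite !big1 ?addr0 // => j _; rewrite ?rv0 ?mulr0 // h ?mul0r // kE.
Qed.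

Lemma annHP xi : annihilator (HC S x) xi <-> forall k : 'I_m, ~~ kC k -> cv xi 0 k = 0.
Proof.
split=> [h|h v].
  apply: idxP => j; rewrite kE // => _; rewrite cvE ?row_ia ?row_ib; apply: h; by case: (HC_fr j).
case/HC_total => [y [z ->]]; rewrite pairing_F sum_fc.
by rewrite !big1 ?addr0 // => j _; rewrite ?rv0 ?mulr0 // h ?mul0r // kE.
Qed.

Lemma annNP xi : annihilator (NC S x) xi <-> forall k : 'I_m, kC k -> cv xi 0 k = 0.
Proof.
split=> [h|h v].
  by apply: idxP => j; rewrite kE // => _; rewrite cvE row_ic; apply: h; exact: NC_fr.
case/NC_total => [e ->]; rewrite pairing_F sum_fc.
by rewrite !big1 ?addr0 // => j _; rewrite ?rv0 ?mulr0 // h ?mul0r // kE.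
Qed.


(* Coordinates of a form with respect to the adapted frame, and back. *)
Definition co (w : ext) : ext := pullback Fmx w.
Definition un (w : ext) : ext := pullback Bmx w.
HB.instance Definition _ := GRing.isLinear.Build C ext ext *:%R co (pullback_linear Fmx).
HB.instance Definition _ := GRing.isLinear.Build C ext ext *:%R un (pullback_linear Bmx).

Lemma coK w : un (co w) = w.
Proof. by rewrite /un /co; apply: (etrans (pullback_comp _ _ _)); rewrite BF pullback1. Qed.
Lemma unK w : co (un w) = w.
Proof. by rewrite /un /co; apply: (etrans (pullback_comp _ _ _)); rewrite FB pullback1. Qed.

Lemma co_eps xi w : co (eps xi w) = eps (cv xi) (co w).
Proof. exact: pullback_eps. Qed.

Lemma co_inj w w' : co w = co w' -> w = w'.
Proof. by move=> /(congr1 un); rewrite !coK. Qed.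

Definition dcov (k : 'I_m) : VC := (col k Bmx)^T.

Lemma cv_dcov k : cv (dcov k) = delta_mx 0 k.
Proof. by rewrite /cv /dcov -trmx_mul colE mulmxA FB mul1mx trmx_delta. Qed.

Lemma un_eb T : un (eb R T) = wedge_covecs [seq dcov k | k <- enum T].
Proof. exact: pullback_eb. Qed.

(** From left to right, each factor of a product adds an index of its own block. Conversely a basis
    form of this bidegree is itself a product of p dual covectors of type (1,0) followed by q of
    type (0,1), because of the order of the blocks. *)
Lemma Lambda_co p q w : Lambda S p q x w <-> supp (bideg p q) (co w).
Proof.
split.
  apply: (ext_span_ind (Q := fun w => supp (bideg p q) (co w))); first by rewrite linear0; exact: supp0.
    by move=> k a b ha hb; rewrite linearP; exact: suppP.
  move=> _ [a [b [<- <- ha hb ->]]]; rewrite /co pullback_wedge_covecs map_cat.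
  elim: a ha => [|xi a IH] ha /=.
    elim: b hb => [|xi b IH] hb /=.
      by rewrite ext_one_eb; apply: supp_eb; rewrite /bideg /hset !deg0.
    have sb : supp (bideg 0%N (size b)) (wedge_covecs [seq xi *m Fmx^T | xi <- b]).
      by apply: IH => u ub; apply: hb; rewrite /= inE ub orbT.
    apply: supp_eps sb => k T xk kT /and3P[/eqP dA /eqP dB /eqP dC].
    have /Lambda01P h : Lambda01 S x xi by apply: hb; rewrite /= mem_head.
    have kb : kB k by apply: contraNT xk => /h ->.
    move: k kb kT {xk}; apply: idxP => j; rewrite kE // => _ kT; rewrite /bideg /hset !degU1 // !kE dA dB dC.
    by rewrite !eqxx.
  have sb : supp (bideg (size a) (size b)) (wedge_covecs ([seq xi *m Fmx^T | xi <- a] ++ [seq xi *m Fmx^T | xi <- b])).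
    by apply: IH => u ub; apply: ha; rewrite /= inE ub orbT.
  apply: supp_eps sb => k T xk kT /and3P[/eqP dA /eqP dB /eqP dC].
  have /Lambda10P h : Lambda10 S x xi by apply: ha; rewrite /= mem_head.
  have kb : kA k by apply: contraNT xk => /h ->.
  move: k kb kT {xk}; apply: idxP => j; rewrite kE // => _ kT; rewrite /bideg /hset !degU1 // !kE dA dB dC.
  by rewrite !eqxx.
move=> sw; rewrite -[w]coK [co w]ext_eb linear_sum (bigID (bideg p q)) /=.
rewrite [X in _ + X]big1 ?addr0 => [|T nT]; last by rewrite (sw T nT) scale0r linear0.
under eq_bigr do rewrite linearZ /=.
apply: ext_span_sum => T dbar_eb; have hT : hset T by case/and3P: dbar_eb.
have [dA dB] := deg_iS r (piS T); rewrite piSK // in dA dB.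
exists [seq dcov (ia r j) | j <- enum (piS T).1], [seq dcov (ib r j) | j <- enum (piS T).2]; split.
- by rewrite size_map -cardE -dA; case/and3P: dbar_eb => /eqP.
- by rewrite size_map -cardE -dB; case/and3P: dbar_eb => _ /eqP.
- move=> xi /mapP[j _ ->]; apply/Lambda10P; apply: idxP => i; rewrite kE // => _;
    by rewrite cv_dcov mxE eqxx /= ?ib_ia // ; case: eqP => // E1; have := kC_ic n i; rewrite E1 kE.
- move=> xi /mapP[j _ ->]; apply/Lambda01P; apply: idxP => i; rewrite kE // => _;
    by rewrite cv_dcov mxE eqxx /= ?ia_ib // ; case: eqP => // E1; have := kC_ic n i; rewrite E1 kE.
by rewrite -{1}(piSK hT) un_eb enum_iS map_cat -!map_comp.
Qed.

Lemma LambdaH_co w : LambdaH S x w <-> supp hset (co w).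
Proof.
split.
  apply: (ext_span_ind (Q := fun w => supp hset (co w))); first by rewrite linear0; exact: supp0.
    by move=> k a b ha hb; rewrite linearP; exact: suppP.
  by move=> e [p [q /Lambda_co]]; apply: supp_sub => T /and3P[].
move=> sw; rewrite -[w]coK [co w]ext_eb linear_sum (bigID hset) /=.
rewrite [X in _ + X]big1 ?addr0 => [|T nT]; last by rewrite (sw T nT) scale0r linear0.
under eq_bigr do rewrite linearZ /=.
apply: ext_span_sum => T hT; exists (deg kA T), (deg kB T); apply/Lambda_co; rewrite unK; apply: supp_eb.
by rewrite /bideg !eqxx.
Qed.

(** Existence: a basis form outside the bidegree (p,q) either has another bidegree or contains a
    covector of the N block, which annihilates H and so puts it in the ideal. Uniqueness:
    restriction to the indices of bidegree (p,q) kills both kinds. *)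
Lemma component_co p q w : component S p q x w = un (restr (bideg p q) (co w)).
Proof.
apply: xget_unique => [|a [/Lambda_co sa ha]].
  split; first by apply/Lambda_co; rewrite unK; exact: supp_restr.
  have -> : w - un (restr (bideg p q) (co w)) = \sum_(T | ~~ bideg p q T) co w T *: un (eb R T).
    have E1 : co (\sum_(T | ~~ bideg p q T) co w T *: un (eb R T)) = \sum_(T | ~~ bideg p q T) co w T *: eb R T.
      by rewrite linear_sum; apply: eq_bigr => T _; rewrite linearZ /= unK.
    apply: co_inj; rewrite E1 linearB /= unK; apply/ffunP => T.
    rewrite extDE extNE restrE [in RHS]ext_sumE.
    under eq_bigr => T' _ do rewrite extZE ebE.
    case: ifPn => dbar_eb; last by rewrite subr0 (bigD1 T) //= eqxx mulr1 big1 ?addr0 // => T' /andP[_]; rewrite eq_sym => /negPf ->; rewrite mulr0.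
    by rewrite subrr big1 // => T' nT'; case: eqP => [E2|]; rewrite ?mulr0 //; move: nT'; rewrite -E2 dbar_eb.
  apply: ext_span_sum => T nT; have [hT|hT] := boolP (hset T).
    left; exists (deg kA T), (deg kB T); split; last by apply/Lambda_co; rewrite unK; apply: supp_eb; rewrite /bideg !eqxx.
    by move=> [E1 E2]; move: nT; rewrite /bideg E1 E2 !eqxx hT.
  right; have [l lT] : exists l, ic n l \in T.
    apply: contrapT => nl; move/negP: hT; apply; apply/hsetP/fintype.subsetP; apply: idxP => j jT; rewrite inE ?kE //.
    by case: nl; exists j.
  exists ((-1) ^+ sg (ic n l) (T :\ ic n l) *: dcov (ic n l)), (un (eb R (T :\ ic n l))); split.
    apply/annHP; apply: idxP => j; rewrite kE // => _; rewrite /cv -scalemxAl -/(cv _) cv_dcov mxE [X in _ * X]mxE eqxx /=;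
      by case: eqP => [E1|]; rewrite ?mulr0 //; have := kC_ic n l; rewrite -E1 kE.
  apply: co_inj; rewrite unK -/(eps _ _) co_eps unK /cv -scalemxAl -/(cv _) cv_dcov epsZl.
  exact: eb_eps.
apply: co_inj; rewrite unK -[co a](restr_id sa).
have E1 : restr (bideg p q) (co (w - a)) = 0.
  move: ha; apply: (ext_span_ind (Q := fun v => restr (bideg p q) (co v) = 0)).
  - by rewrite !linear0.
  - by move=> k b c hb hc; rewrite !linearP /= hb hc scaler0 addr0.
  move=> e [[p' [q' [ne /Lambda_co se]]]|[xi [c [/annHP hxi ->]]]].
    apply: (restr0 se) => T /and3P[/eqP E1 /eqP E2 _]; apply/negP => /and3P[/eqP E3 /eqP E4 _].
    by apply: ne; rewrite -E1 -E2 E3 E4.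
  rewrite -/(eps _ _) co_eps; apply: (restr0 (P := fun T => ~~ hset T)).
    apply: (supp_eps (P := predT)) => [k T xk kT _|T //].
    have kc : kC k by apply: contraNT xk => /hxi ->.
    by rewrite /hset degU1 // kc.
  by move=> T nh; apply: contra nh => /and3P[].
by move/eqP: E1; rewrite !linearB /= subr_eq0 => /eqP.
Qed.


Definition Gc : 'M[R]_m := Xm^T *m Xm + JXm^T *m JXm.

Lemma gH_nondeg u u' : u \in crH S x -> u' \in crH S x ->
  (forall v, v \in crH S x -> gH S x u v = gH S x u' v) -> u = u'.
Proof.
move=> /hv_total[a [b ->]] /hv_total[a' [b' ->]] H.
have dd (c : 'rV[R]_n) (k : 'I_n) : (c *m (delta_mx 0 k : 'rV[R]_n)^T) 0 0 = c 0 k.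
  rewrite mxE (bigD1 k) //= !mxE !eqxx mulr1 big1 ?addr0 // => j /negPf jk.
  by rewrite !mxE jk mulr0.
have d0 (c : 'rV[R]_n) : (c *m (0 : 'rV[R]_n)^T) 0 0 = 0 by rewrite trmx0 mulmx0 mxE.
congr hv; apply/rowP => k.
  by have := H _ (hv_in (delta_mx 0 k) 0); rewrite !gH_hv !dd !d0 !addr0.
by have := H _ (hv_in 0 (delta_mx 0 k)); rewrite !gH_hv !dd !d0 !add0r.
Qed.

Lemma mul_Gc xi : xi *m Gc = hv (xi *m Xm^T) (xi *m JXm^T).
Proof. by rewrite /Gc /hv mulmxDr !mulmxA. Qed.

Lemma cometricE : cometric S x = Gc.
Proof.
have gG (xi v : V) : v \in crH S x -> gH S x (xi *m Gc) v = (xi *m v^T) 0 0.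
  move=> /hv_total[a [b ->]]; rewrite mul_Gc gH_hv /hv linearD /= !trmx_mul mulmxDr !mulmxA.
  by rewrite [RHS]mxE.
apply: xget_unique => [xi|G HG]; first by split; [rewrite mul_Gc; exact: hv_in|exact: gG].
apply/row_matrixP => i; rewrite !rowE; have [h1 h2] := HG (delta_mx 0 i).
apply: gH_nondeg => // [|v vH]; first by rewrite mul_Gc; exact: hv_in.
by rewrite h2 // gG.
Qed.

Local Notation conjF := (map_mx (@conjc R) Fmx).
Local Notation conjB := (map_mx (@conjc R) Bmx).

Lemma conjFB : conjF *m conjB = 1%:M.
Proof. by rewrite -map_mxM FB map_mx1. Qed.

Lemma conj_Zv j : map_mx (@conjc R) (Zv j) = Zbv j.
Proof.
rewrite /Zv /Zbv; apply/rowP => k; rewrite [LHS]mxE [X in conjc X]mxE [X in _ * X]mxE [X in _ * (_ + X)]mxE [X in _ * (_ - X)]mxE.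
rewrite [RHS]mxE [X in _ = _ * X]mxE [X in _ = _ * (_ + X)]mxE [(toCv _) 0 k]mxE [(toCv (crJ S x (X j))) 0 k]mxE.
apply/eqP; rewrite eq_complex /=; apply/andP; split; apply/eqP; ring.
Qed.

Lemma conj_Zbv j : map_mx (@conjc R) (Zbv j) = Zv j.
Proof. by rewrite -conj_Zv; apply/rowP => k; rewrite !mxE conjcK. Qed.

Lemma Qmx_diag k : (\row_k0 (~~ kC k0)%:R : 'rV[C]_m) 0 k = (~~ kC k)%:R.
Proof. by rewrite mxE. Qed.

Lemma ZZ_entry j i k : Zv j 0 i * conjc (Zv j 0 k) + Zbv j 0 i * conjc (Zbv j 0 k) =
  (X j 0 i * X j 0 k + crJ S x (X j) 0 i * crJ S x (X j) 0 k)%:C%C.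
Proof.
have eZ l : Zv j 0 l = shalf R * ((X j 0 l)%:C%C - 'i%C * (crJ S x (X j) 0 l)%:C%C) by rewrite /Zv !mxE.
have eZb l : Zbv j 0 l = shalf R * ((X j 0 l)%:C%C + 'i%C * (crJ S x (X j) 0 l)%:C%C) by rewrite /Zbv !mxE.
have cZ : conjc (Zv j 0 k) = Zbv j 0 k by rewrite -conj_Zv [RHS]mxE.
have cZb : conjc (Zbv j 0 k) = Zv j 0 k by rewrite -conj_Zbv [RHS]mxE.
rewrite cZ cZb !eZ !eZb.
set a := X j 0 i; set b := crJ S x (X j) 0 i; set c := X j 0 k; set d := crJ S x (X j) 0 k.
rewrite -[RHS]mul1r -(shalf2 R) rmorphD !rmorphM /=.
have -> : b%:C%C * d%:C%C = - ('i%C * 'i%C) * b%:C%C * d%:C%C :> C by rewrite i2 opprK mul1r.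
ring.
Qed.

(** Z_j and Zbar_j are a unitary change of X_j and J X_j, so the real sum that defines the cometric
    becomes a Hermitian sum over the frame, with the N block removed by [Qmx]. *)
Lemma toC_Gc : toCm Gc = Fmx^T *m Qmx R n r *m conjF.
Proof.
apply/matrixP => i k; rewrite [RHS]mxE /Qmx mul_mx_diag.
have E1 l : (\matrix_(i, j) (Fmx^T i j * (\row_k0 (~~ kC k0)%:R : 'rV[C]_m) 0 j)) i l * conjF l k =
   row l Fmx 0 i * (~~ kC l)%:R * conjc (row l Fmx 0 k).
  by rewrite [(\matrix_(_, _) _) i l]mxE Qmx_diag !mxE.
under eq_bigr do rewrite E1.
rewrite big_idx [X in _ + X]big1 ?addr0 => [|l _]; last by rewrite kE mulr0 mul0r.
rewrite -big_split mxE [Gc i k]mxE ![(_ *m _) i k]mxE rmorphD !rmorph_sum -big_split; apply: eq_bigr => j _ /=.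
rewrite row_ia row_ib !kE !mulr1 ZZ_entry !mxE rmorphD; by [].
Qed.

(** In frame coordinates the cometric becomes the projection [Qmx]: the basis forms indexed by
    [hset] are orthonormal, and those with a covector of N contribute nothing. *)
Lemma gstar_co a b : gstar S x a b = \sum_(T | hset T) co a T * conjc (co b T).
Proof.
have -> : gstar S x a b = edot a (pullback (toCm Gc) (ext_conj b)) by rewrite /gstar cometricE.
rewrite -[a]coK -[b in LHS]coK /un ext_conj_pullback edot_pullback.
have E1 : pullback Bmx^T (pullback (toCm Gc) (pullback conjB (ext_conj (co b)))) = restr hset (ext_conj (co b)).
  apply: (etrans (congr1 _ (pullback_comp _ _ _))); apply: (etrans (pullback_comp _ _ _)).
  rewrite -pullback_Q; congr (pullback _ _).
  by rewrite toC_Gc -!mulmxA conjFB mulmx1 !mulmxA -trmx_mul FB trmx1 mul1mx.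
rewrite E1 /edot [RHS]big_mkcond; apply: eq_bigr => T _; rewrite restrE ext_conjE -/(un _) coK.
by case: ifP; rewrite ?mulr0.
Qed.

Lemma involution_lin : linear (fun u => projL S x (projH S x u) - projJL S x (projH S x u)).
Proof.
have pL k u v : projL S x (k *: u + v) = k *: projL S x u + projL S x v by exact: linearP.
have pJ k u v : projJL S x (k *: u + v) = k *: projJL S x u + projJL S x v by exact: linearP.
have pH k u v : projH S x (k *: u + v) = k *: projH S x u + projH S x v by exact: linearP.
by move=> k u v; rewrite pH pL pJ scalerBr opprD addrACA.
Qed.

Lemma involution_hv a b : hv a b *m involution_mx S x = hv a (- b).
Proof.
rewrite /involution_mx (lin1_mxE _ involution_lin) projH_H ?hv_in // projL_hv projJL_hv /hv.
by rewrite mulNmx.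
Qed.

Lemma X_hv j : X j = hv (delta_mx 0 j) 0.
Proof. by rewrite /hv mul0mx addr0 -rowE rowK. Qed.

Lemma JX_hv j : crJ S x (X j) = hv 0 (delta_mx 0 j).
Proof. by rewrite X_hv crJ_hv oppr0. Qed.

(** The involution fixes X_j and negates J X_j, so its complex linear extension sends Z_j to Zbar_j,
    the conjugate of Z_j. Together with the conjugation of forms it therefore acts in frame
    coordinates as plain conjugation of coefficients. *)
Lemma involution_F : Fmx *m toCm (involution_mx S x) = Qmx R n r *m conjF.
Proof.
have IX j : X j *m involution_mx S x = X j by rewrite X_hv involution_hv oppr0.
have IJ j : crJ S x (X j) *m involution_mx S x = - crJ S x (X j).
  by rewrite JX_hv involution_hv /hv !mul0mx !add0r mulNmx.
have IE l : E l *m involution_mx S x = 0.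
  rewrite /involution_mx (lin1_mxE _ involution_lin) projH_N; last exact: E_in.
  have p0 : projL S x 0 = 0 by exact: linear0.
  have q0 : projJL S x 0 = 0 by exact: linear0.
  by rewrite p0 q0 subr0.
apply/row_matrixP => k; rewrite row_mul /Qmx mul_diag_mx.
have -> : row k (\matrix_(i, j) ((\row_k0 (~~ kC k0)%:R : 'rV[C]_m) 0 i * conjF i j)) = (~~ kC k)%:R *: map_mx (@conjc R) (row k Fmx).
  by apply/rowP => j; rewrite !mxE.
move: k; apply: idxP => j; rewrite kE ?scale1r ?scale0r.
- rewrite row_ia conj_Zv /Zv /Zbv -scalemxAl mulmxBl -scalemxAl -!toCvM IX IJ.
  by rewrite toCvN scalerN opprK.
- rewrite row_ib conj_Zbv /Zv /Zbv -scalemxAl mulmxDl -scalemxAl -!toCvM IX IJ.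
  by rewrite toCvN scalerN.
- by rewrite row_ic -toCvM IE toCv0.
Qed.

Lemma underline_co w : co (underline S x w) = restr hset (ext_conj (co w)).
Proof.
rewrite /underline -{1}[w]coK /un ext_conj_pullback -pullback_Q /co.
apply: (etrans (congr1 _ (pullback_comp _ _ _))); apply: (etrans (pullback_comp _ _ _)).
by congr (pullback _ _); rewrite mulmxA involution_F -mulmxA conjFB mulmx1.
Qed.

Lemma bideg_top T : bideg n n T -> T = HS n r.
Proof.
move=> dbar_eb; apply/eqP; rewrite eqEcard (bideg_card dbar_eb) card_HS leqnn andbT.
by apply/hsetP; case/and3P: dbar_eb.
Qed.

Lemma toC_hvB a b : tC (hv a b) *m Bmx = fc (\row_j (shalf R * (a 0 j +i* b 0 j)%C))
  (\row_j (shalf R * (a 0 j -i* b 0 j)%C)) 0.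
Proof. by rewrite toC_hv -mulmxA FB mulmx1. Qed.

Lemma row_hdiag (U W : 'M[C]_n) j :
  row (ia r j) (hdiag r (udiag U W)) = fc (row j U) 0 0 /\
  row (ib r j) (hdiag r (udiag U W)) = fc 0 (row j W) 0.
Proof.
split; apply/rowP; apply: idxP => k; rewrite mxE ?fc_ia ?fc_ib ?fc_ic /hdiag /udiag /ia /ib /ic
  ?block_mxEul ?block_mxEur ?block_mxEdl ?block_mxEdr ?mxE //.
Qed.

(** A frame e_j = a_j X + b_j J X is the image of the reference frame under the complex matrix U = a
    + i b on the Z block and its conjugate on the Zbar block. *)
Lemma frame_coords (U : 'M[C]_n) (e : 'I_n -> V) (a b : 'I_n -> 'rV[R]_n) :
  (forall j, e j = hv (a j) (b j)) -> (forall j k, U j k = (a j 0 k +i* b j 0 k)%C) ->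
  [seq v *m Bmx | v <- [seq tC u | u <- J_frame S x e]] =
  [seq v *m hdiag r (udiag U (map_mx (@conjc R) U)) | v <- zframe R r (enum 'I_n)].
Proof.
move=> He HU; rewrite /J_frame /zframe; elim: (enum 'I_n) => //= j s IH.
rewrite IH; have [rA rB] := row_hdiag U (map_mx (@conjc R) U) j.
congr [:: _, _ & _].
  rewrite He toC_hvB /zX -scalemxAl mulmxDl -!rowE rA rB fcD !addr0 !add0r fcZ scaler0.
  by congr fc; apply/rowP => k; rewrite !mxE HU.
rewrite He crJ_hv toC_hvB /zJX -scalemxAl mulmxBl -!scalemxAl -!rowE rA rB -scaleNr !fcZ fcD !scaler0 !addr0 !add0r fcZ scaler0.
by congr fc; apply/rowP => k; rewrite !mxE HU; apply/eqP; rewrite eq_complex /=; apply/andP; split; apply/eqP; ring.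
Qed.

Lemma dotE (a c : 'rV[R]_n) : (a *m c^T) 0 0 = \sum_k a 0 k * c 0 k.
Proof. by rewrite mxE; apply: eq_bigr => k _; rewrite mxE. Qed.

Lemma ext_eval_frame (U : 'M[C]_n) (e : 'I_n -> V) (a b : 'I_n -> 'rV[R]_n) c :
  (forall j, e j = hv (a j) (b j)) -> (forall j k, U j k = (a j 0 k +i* b j 0 k)%C) ->
  U *m (map_mx (@conjc R) U)^T = 1%:M ->
  ext_eval (un (c *: eb R (HS n r))) [seq tC u | u <- J_frame S x e] = c * (lamv R n r)^-1.
Proof.
move=> He HU UU; rewrite /un ext_eval_pullback (frame_coords He HU).
rewrite -ext_eval_pullback linearZ /= pullback_hdiag hdet_unitary // scale1r ext_evalZ.
by rewrite invrK.
Qed.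

(** The orthonormality conditions on (e_j, J e_j) are the real and imaginary parts of the statement
    that U = a + i b is unitary, so every such frame receives the value 1. For uniqueness the form
    is evaluated on the frame X itself, where U is the identity. *)
Lemma volume_co : volume_form S x = un (lamv R n r *: eb R (HS n r)).
Proof.
have l0 := lamv_neq0 R n r.
apply: xget_unique => [|v [/Lambda_co sv hv1]].
  split; first by apply/Lambda_co; rewrite unK; apply/suppZ/supp_eb; exact: bideg_HS.
  move=> e eH He.
  have Hex j : exists p : 'rV[R]_n * 'rV[R]_n, e j = hv p.1 p.2.
    by have [a [b Eab]] := hv_total (eH j); exists (a, b).
  have [ab Hab] := choice Hex.
  pose U : 'M[C]_n := \matrix_(j, k) ((ab j).1 0 k +i* (ab j).2 0 k)%C.
  rewrite (ext_eval_frame (U := U) _ Hab) ?mulfV // => [j k|]; first by rewrite mxE.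
  apply/matrixP => j l; rewrite mxE [RHS]mxE.
  have T k : U j k * ((map_mx (@conjc R) U)^T) k l =
      (((ab j).1 0 k * (ab l).1 0 k + (ab j).2 0 k * (ab l).2 0 k) +i*
       ((ab j).1 0 k * (- (ab l).2) 0 k + (ab j).2 0 k * (ab l).1 0 k))%C.
    by rewrite !mxE; apply/eqP; rewrite eq_complex /=; apply/andP; split; apply/eqP; ring.
  under eq_bigr do rewrite T.
  have [E1 [E2 _]] := He j l.
  move: E1 E2; rewrite !Hab crJ_hv !gH_hv !dotE => E1 E2.
  rewrite sum_complex !big_split /= E1 E2.
  by case: (j == l).
(* The only index of bidegree (n,n) is [HS], so a single coefficient is unknown. *)
have Ev : v = un (co v (HS n r) *: eb R (HS n r)).
  apply: co_inj; rewrite unK; apply/ffunP => T; rewrite extZE ebE.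
  have [->|TH] := eqVneq T (HS n r); first by rewrite mulr1.
  by rewrite mulr0; apply: sv; apply: contra TH => /bideg_top ->.
have d0 (j k : 'I_n) : ((delta_mx 0 j : 'rV[R]_n) *m (delta_mx 0 k : 'rV[R]_n)^T) 0 0 = (j == k)%:R.
  by rewrite dotE (bigD1 k) //= !mxE !eqxx mulr1 big1 ?addr0 1?eq_sym // => i /negPf ik; rewrite !mxE ik mulr0.
have z0 (c : 'rV[R]_n) : (c *m (0 : 'rV[R]_n)^T) 0 0 = 0 by rewrite trmx0 mulmx0 mxE.
have z1 (c : 'rV[R]_n) : ((0 : 'rV[R]_n) *m c^T) 0 0 = 0 by rewrite mul0mx mxE.
have XH j : X j \in crH S x by exact: X_H.
have XO j k : gH S x (X j) (X k) = (j == k)%:R /\ gH S x (X j) (crJ S x (X k)) = 0 /\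
    gH S x (crJ S x (X j)) (crJ S x (X k)) = (j == k)%:R.
  by rewrite !JX_hv !X_hv !gH_hv !d0 !z0 !z1 !addr0 add0r.
have := hv1 _ XH XO.
have UE j k : (1%:M : 'M[C]_n) j k = ((delta_mx 0 j : 'rV[R]_n) 0 k +i* (0 : 'rV[R]_n) 0 k)%C.
  by rewrite !mxE eqxx /= [k == j]eq_sym; case: (j == k).
have UU : (1%:M : 'M[C]_n) *m (map_mx (@conjc R) 1%:M)^T = 1%:M by rewrite map_mx1 trmx1 mulmx1.
rewrite {1}Ev (ext_eval_frame _ X_hv UE UU) => E1; rewrite Ev; congr (un (_ *: _)).
by rewrite -[LHS](mulfVK l0) E1 mul1r.
Qed.

Lemma star_co p q a : (p <= n)%N -> (q <= n)%N -> supp (bideg p q) (co a) ->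
  star S p q x a = un (hodge (lamv R n r) (co a)).
Proof.
move=> pn qn sa.
have key s b : supp (bideg (n - p)%N (n - q)%N) (co s) -> supp (bideg p q) (co b) ->
  (ewedge b (underline S x s) = gstar S x b a *: volume_form S x <->
   ewedge (co b) (ext_conj (co s)) = ((\sum_T co b T * conjc (co a T)) * lamv R n r) *: eb R (HS n r)).
  move=> ss sb.
  have E1 : co (ewedge b (underline S x s)) = ewedge (co b) (ext_conj (co s)).
    rewrite {1}/co pullback_ewedge -/(co b) -/(co _) underline_co restr_id //.
    by apply: supp_conj; apply: supp_sub ss => T /and3P[].
  have E2 : co (gstar S x b a *: volume_form S x) = ((\sum_T co b T * conjc (co a T)) * lamv R n r) *: eb R (HS n r).
    rewrite linearZ /= volume_co unK scalerA gstar_co; congr ((_ * _) *: _).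
    rewrite big_mkcond; apply: eq_bigr => T _; case: ifPn => // hT.
    by rewrite (sb T) ?mul0r //; apply: contra hT => /and3P[].
  by rewrite -E1 -E2; split=> [->//|]; exact: co_inj.
have sh := supp_hodge (lamv R n r) pn qn sa.
apply: xget_unique => [|s [/Lambda_co ss Hs]].
  split; first by apply/Lambda_co; rewrite unK.
  move=> b /Lambda_co sb; apply/key; rewrite ?unK //.
  by have [_ h] := hodge_char (lamv R n r) pn qn sa sh; exact: h.
apply: co_inj; rewrite unK; have [h _] := hodge_char (lamv R n r) pn qn sa ss; apply: h => b sb.
have sb' : supp (bideg p q) (co (un b)) by rewrite unK.
have Lb : Lambda S p q x (un b) by apply/Lambda_co.
by have := (key s (un b) ss sb').1 (Hs _ Lb); rewrite unK.
Qed.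

Lemma chirality_co w : chirality S x w = un (Gam (lamv R n r) (restr hset (co w))).
Proof.
rewrite -Gam_sum; last exact: supp_restr.
rewrite linear_sum.
apply: eq_bigr => p _; rewrite linear_sum; apply: eq_bigr => q _; rewrite linearZ /=.
have rr : restr (bideg p q) (restr hset (co w)) = restr (bideg p q) (co w).
  by apply/ffunP => T; rewrite !restrE; case: ifPn => // /and3P[_ _ ->].
rewrite rr component_co star_co ?unK //; first by rewrite -ltnS.
  by rewrite -ltnS.
exact: supp_restr.
Qed.

End PointCR.

Local Opaque pullback ewedge ext_contr.
Arguments chart_img_open {R m M} c {U} _.

(** * Smooth frames and sections *)

Section SmoothFields.
Variables (R : realType) (m : nat) (M : manifold R m).
Local Notation C := R[i].
Local Notation V := 'rV[R]_m.
Local Notation VC := 'rV[C]_m.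
Implicit Types (U W : set M) (Y : M -> V) (f g : M -> R).

Lemma vec_inD (c : chart R m M) x (u v : V) : vec_in c x (u + v) = vec_in c x u + vec_in c x v.
Proof. exact: mulmxDl. Qed.

Lemma vec_inZ (c : chart R m M) x a (u : V) : vec_in c x (a *: u) = a *: vec_in c x u.
Proof. by rewrite /vec_in -scalemxAl. Qed.

Lemma vec_in0 (c : chart R m M) x : vec_in c x 0 = 0.
Proof. exact: mul0mx. Qed.

Lemma smooth_vfield_sub U W Y : W `<=` U -> smooth_vfield U Y -> smooth_vfield W Y.
Proof. by move=> WU sY c ac j; apply: smooth_on_sub (sY c ac j); exact: chart_img_sub. Qed.

Lemma smooth_vfieldD U Y Y' : open U -> smooth_vfield U Y -> smooth_vfield U Y' ->
  smooth_vfield U (fun x => Y x + Y' x).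
Proof.
move=> oU sY sY' c ac j; have oUc := chart_img_open c oU.
apply: (smooth_on_congr oUc) (smooth_onD oUc (sY c ac j) (sY' c ac j)) => y _.
by rewrite vec_inD [RHS]mxE.
Qed.

Lemma smooth_vfield0 U : open U -> smooth_vfield U (fun=> 0).
Proof.
move=> oU c ac j; have oUc := chart_img_open c oU.
by apply: (smooth_on_congr oUc) (smooth_on_cst 0 oUc) => y _; rewrite vec_in0 mxE.
Qed.

Lemma smooth_vfieldZ U f Y : open U -> smooth_fun U f -> smooth_vfield U Y ->
  smooth_vfield U (fun x => f x *: Y x).
Proof.
move=> oU sf sY c ac j; have oUc := chart_img_open c oU.
apply: (smooth_on_congr oUc) (smooth_onM oUc (sf c ac) (sY c ac j)) => y _.
by rewrite vec_inZ [RHS]mxE.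
Qed.

Lemma smooth_vfield_sum U I (s : seq I) (P : pred I) (F : I -> M -> V) : open U ->
  (forall i, P i -> smooth_vfield U (F i)) -> smooth_vfield U (fun x => \sum_(i <- s | P i) F i x).
Proof.
move=> oU sF; elim: s => [|i s IH].
  have -> : (fun x => \sum_(i <- [::] | P i) F i x) = (fun=> 0 : V) by apply/funext => x; exact: big_nil.
  exact: smooth_vfield0.
case Pi: (P i).
  have -> : (fun x => \sum_(j <- i :: s | P j) F j x) = (fun x => F i x + \sum_(i <- s | P i) F i x).
    by apply/funext => x; rewrite big_cons Pi.
  by apply: smooth_vfieldD => //; exact: sF.
have -> : (fun x => \sum_(j <- i :: s | P j) F j x) = (fun x => \sum_(i <- s | P i) F i x) by apply/funext => x; rewrite big_cons Pi.
by [].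
Qed.

Lemma smooth_funN U f : open U -> smooth_fun U f -> smooth_fun U (fun x => - f x).
Proof. by move=> oU sf c ac; apply: smooth_onN (sf c ac); exact: chart_img_open. Qed.

Lemma smooth_fun_isqrt U f : open U -> (forall x, U x -> 0 < f x) -> smooth_fun U f ->
  smooth_fun U (fun x => (Num.sqrt (f x))^-1).
Proof.
move=> oU f0 sf c ac; have oUc := chart_img_open c oU.
have fc y : (cmap c @` (U `&` cdom c)) y -> 0 < f (cinv c y).
  by move=> [x [Ux cx] <-]; rewrite cmapK //; exact: f0.
have s1 := smooth_on_sqrt oUc fc (sf c ac).
apply: (smooth_on_inv oUc _ s1) => y Oy /=.
by rewrite gt_eqF // sqrtr_gt0; exact: fc.
Qed.

Definition smooth_cvf U (Z : M -> VC) := forall c, atlas c -> forall j,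
  smoothC_on (cmap c @` (U `&` cdom c)) (fun y => vecC_in c (cinv c y) (Z (cinv c y)) 0 j).

Lemma smooth_cvf_real U Y : open U -> smooth_vfield U Y -> smooth_cvf U (fun x => toCv (Y x)).
Proof.
move=> oU sY c ac j; have oUc := chart_img_open c oU.
apply: (smoothC_on_congr oUc) (smoothC_on_real oUc (sY c ac j)) => y _.
by rewrite /vecC_in -toCvM [RHS]mxE.
Qed.

Lemma smooth_cvf_lin U (a b : C) Z Z' : open U -> smooth_cvf U Z -> smooth_cvf U Z' ->
  smooth_cvf U (fun x => a *: (Z x + b *: Z' x)).
Proof.
move=> oU sZ sZ' c ac j; have oUc := chart_img_open c oU.
have h := smoothC_onM oUc (smoothC_on_cst a oUc)
  (smoothC_onD oUc (sZ c ac j) (smoothC_onM oUc (smoothC_on_cst b oUc) (sZ' c ac j))).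
apply: (smoothC_on_congr oUc) h => y _.
by rewrite /vecC_in -scalemxAl mulmxDl -scalemxAl [RHS]mxE [X in _ = _ * X]mxE [X in _ = _ * (_ + X)]mxE.
Qed.

Lemma smooth_cvf_congr U Z Z' : open U -> (forall x, U x -> Z x = Z' x) -> smooth_cvf U Z -> smooth_cvf U Z'.
Proof.
move=> oU ZZ sZ c ac j; have oUc := chart_img_open c oU.
by apply: (smoothC_on_congr oUc) (sZ c ac j) => y [x [Ux cx] <-]; rewrite (cmapK cx) ZZ.
Qed.

End SmoothFields.

(** * Local orthonormal frames *)

Section LocalFrames.
Variables (R : realType) (n r : nat).
Local Notation m := (n + n + r)%N.
Variables (M : manifold R m) (S : real_CR M n).
Local Notation C := R[i].
Local Notation V := 'rV[R]_m.
Local Notation VC := 'rV[C]_m.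
Local Notation ext := (ext R m).
Implicit Types (U W : set M) (X : 'I_n -> M -> V) (E : 'I_r -> M -> V).

Lemma crN_frame x0 : exists W E, [/\ open W, W x0, forall l, smooth_vfield W (E l) &
  forall x, W x -> basis_of (crN S x) [seq E l x | l <- enum 'I_r]].
Proof.
have := crN_subbundle S; rewrite -addnn (_ : (m - (n + n))%N = r); last by rewrite addnC addnK.
by move=> /(_ x0)[W [E [oW Wx sE bE]]]; exists W, E.
Qed.

Lemma gLDl x (u v w : V) : gL S x (u + v) w = gL S x u w + gL S x v w.
Proof. by rewrite /gL !mulmxDl mxE. Qed.
Lemma gLZl x a (u w : V) : gL S x (a *: u) w = a * gL S x u w.
Proof. by rewrite /gL -!scalemxAl mxE. Qed.
Lemma gL_suml x I (s : seq I) (P : pred I) (F : I -> V) w :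
  gL S x (\sum_(i <- s | P i) F i) w = \sum_(i <- s | P i) gL S x (F i) w.
Proof. by rewrite /gL !mulmx_suml summxE. Qed.

(* Gram-Schmidt; the i-th vector is a combination of the first i ones, so that it does not vanish. *)
Lemma gram_schmidt W (E : 'I_n -> M -> V) k : open W -> (k <= n)%N -> (forall i, smooth_vfield W (E i)) ->
  (forall x, W x -> basis_of (crL S x) [seq E i x | i <- enum 'I_n]) ->
  exists X, [/\ forall j : 'I_n, (j < k)%N -> smooth_vfield W (X j),
    forall j : 'I_n, (j < k)%N -> forall x, W x ->
      exists a : 'rV[R]_n, X j x = a *m (\matrix_i E i x) /\ forall i : 'I_n, (j < i)%N -> a 0 i = 0 &
    forall i j : 'I_n, (i < k)%N -> (j < k)%N -> forall x, W x -> gL S x (X i x) (X j x) = (i == j)%:R].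
Proof.
move=> oW + sE bE; elim: k => [|k IH] kn; first by exists E; split.
have [X [sX aX oX]] := IH (ltnW kn); pose kk := Ordinal kn.
have XL (j : 'I_n) x : (j < k)%N -> W x -> X j x \in crL S x.
  by move=> jk Wx; have [a [-> _]] := aX j jk x Wx; have [h _ _] := basis_family (bE x Wx); exact: h.
have EL i x : W x -> E i x \in crL S x.
  by move=> Wx; apply: (basis_mem (bE x Wx)); rewrite map_f // mem_enum.
pose Y x := E kk x + - \sum_(j < n | (j < k)%N) gL S x (E kk x) (X j x) *: X j x.
have sg (Y1 Y2 : M -> V) : smooth_vfield W Y1 -> smooth_vfield W Y2 -> (forall x, W x -> Y1 x \in crL S x) ->
    (forall x, W x -> Y2 x \in crL S x) -> smooth_fun W (fun x => gL S x (Y1 x) (Y2 x)).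
  by move=> s1 s2 h1 h2; exact: crg_smooth.
have sY : smooth_vfield W Y.
  apply: smooth_vfieldD => //.
  have -> : (fun x => - \sum_(j < n | (j < k)%N) gL S x (E kk x) (X j x) *: X j x) =
      (fun x => \sum_(j < n | (j < k)%N) (- gL S x (E kk x) (X j x)) *: X j x).
    by apply/funext => x; rewrite -sumrN; apply: eq_bigr => j _; rewrite scaleNr.
  apply: smooth_vfield_sum => // j jk; apply: smooth_vfieldZ => //; last exact: sX.
  apply: smooth_funN => //; apply: sg => //; first exact: sX.
    by move=> x Wx; exact: EL.
  by move=> x Wx; exact: XL.
have YL x : W x -> Y x \in crL S x.
  by move=> Wx; rewrite memvB ?EL //; apply: memv_suml => j jk; apply: memvZ; exact: XL.
have aY x : W x -> exists a : 'rV[R]_n, [/\ Y x = a *m (\matrix_i E i x), a 0 kk = 1 &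
    forall i : 'I_n, (k < i)%N -> a 0 i = 0].
  move=> Wx.
  have [b Hb] : {b : 'I_n -> 'rV[R]_n & forall j : 'I_n, (j < k)%N ->
      X j x = b j *m (\matrix_i E i x) /\ forall i : 'I_n, (j < i)%N -> b j 0 i = 0}.
    apply: (@choice _ _ (fun (j : 'I_n) (b : 'rV[R]_n) => (j < k)%N -> X j x = b *m (\matrix_i E i x) /\ forall i : 'I_n, (j < i)%N -> b 0 i = 0)) => j.
    by have [jk|jk] := ltnP j k; [have [a Ha] := aX j jk x Wx; exists a|exists 0].
  exists (delta_mx 0 kk - \sum_(j < n | (j < k)%N) gL S x (E kk x) (X j x) *: b j); split.
  - rewrite mulmxBl -rowE rowK mulmx_suml /Y; congr (_ - _); apply: eq_bigr => j jk.
    by rewrite -scalemxAl -(Hb j jk).1.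
  - rewrite mxE [X in X + _]mxE !eqxx [X in _ + X]mxE summxE big1 ?subr0 // => j jk.
    by rewrite mxE (Hb j jk).2 ?mulr0.
  move=> i ki; rewrite mxE [X in X + _]mxE [X in _ + X]mxE summxE big1 ?subr0 => [|j jk].
    by rewrite eqxx /= (_ : (i == kk) = false) //; apply/negP => /eqP E1; rewrite E1 ltnn in ki.
  by rewrite mxE (Hb j jk).2 ?mulr0 //; exact: ltn_trans jk ki.
have Y0 x : W x -> 0 < gL S x (Y x) (Y x).
  move=> Wx; apply: crg_pos; first exact: YL.
  apply/eqP => Yx; have [a [Ea a1 _]] := aY x Wx.
  have [_ inj _] := basis_family (bE x Wx); have a0 : a = 0 by apply: inj; rewrite -Ea.
  by move: a1; rewrite a0 mxE => /esym/eqP; rewrite oner_eq0.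
have YX x (j : 'I_n) : W x -> (j < k)%N -> gL S x (Y x) (X j x) = 0.
  move=> Wx jk; rewrite /Y gLDl -scaleN1r gLZl gL_suml (bigD1 j) //= big1 ?addr0 => [|i /andP[ik ij]].
    by rewrite gLZl oX // eqxx mulr1 mulN1r subrr.
  by rewrite gLZl oX // (negPf ij) mulr0.
pose q x := (Num.sqrt (gL S x (Y x) (Y x)))^-1.
have sq : smooth_fun W q by apply: smooth_fun_isqrt => //; exact: sg.
exists (fun j : 'I_n => if (j < k)%N then X j else fun x => q x *: Y x); split.
- move=> j; rewrite ltnS => jk; case: ifPn => h; first exact: sX.
  exact: smooth_vfieldZ.
- move=> j; rewrite ltnS => jk x Wx; case: ifPn => h; first exact: aX.
  have [a [Ea _ a0]] := aY x Wx; exists (q x *: a); split; first by rewrite -scalemxAl -Ea.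
  move=> i ji; rewrite mxE a0 ?mulr0 //; apply: leq_ltn_trans ji; by rewrite leqNgt.
move=> i j; rewrite !ltnS => ik jk x Wx.
have sym u v : u \in crL S x -> v \in crL S x -> gL S x u v = gL S x v u by exact: crg_sym.
have ij_kk (l : 'I_n) : (l <= k)%N -> ~~ (l < k)%N -> l = kk.
  by move=> h1 h2; apply: val_inj => /=; apply/eqP; rewrite eqn_leq h1 leqNgt.
case: ifPn => hi; case: ifPn => hj; first exact: oX.
- rewrite sym ?XL // ?memvZ ?YL // gLZl YX // mulr0 (ij_kk j jk hj).
  by case: eqP => // E1; move: hi; rewrite E1 ltnn.
- rewrite gLZl YX // mulr0 (ij_kk i ik hi).
  by case: eqP => // E1; move: hj; rewrite -E1 ltnn.
rewrite gLZl sym ?memvZ ?YL // gLZl (ij_kk i ik hi) (ij_kk j jk hj) eqxx.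
have g0 := Y0 x Wx; rewrite mulrA -invfM -expr2 sqr_sqrtr ?ltW // mulVf // gt_eqF //.
Qed.

Lemma crL_frame x0 : exists W X, [/\ open W, W x0 & orthonormal_frameL S W X].
Proof.
have [W [E [oW Wx sE bE]]] := crL_subbundle S x0.
have [X [sX aX oX]] := gram_schmidt oW (leqnn n) sE bE.
exists W, X; split=> //; split; first by move=> j; exact: sX.
split=> [x Hx j|x Hx j k]; last exact: oX.
by have [a [-> _]] := aX j (ltn_ord j) x Hx; have [h _ _] := basis_family (bE x Hx); exact: h.
Qed.

Definition local_frame W X E := [/\ open W, orthonormal_frameL S W X, forall l, smooth_vfield W (E l) &
  forall x, W x -> basis_of (crN S x) [seq E l x | l <- enum 'I_r]].

Lemma orthonormal_frameL_sub U W X : W `<=` U -> orthonormal_frameL S U X -> orthonormal_frameL S W X.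
Proof.
move=> WU [s [h1 h2]]; split; first by move=> j; exact: smooth_vfield_sub (s j).
by split=> x /WU; [exact: h1|exact: h2].
Qed.

Lemma local_frame_ext U X x0 : open U -> U x0 -> orthonormal_frameL S U X ->
  exists W E, [/\ W x0, W `<=` U & local_frame W X E].
Proof.
move=> oU Ux oX; have [W [E [oW Wx sE bE]]] := crN_frame x0.
exists (U `&` W), E; split; [by []|by move=> x []|split].
- exact: openI.
- by apply: orthonormal_frameL_sub oX => x [].
- by move=> l; apply: smooth_vfield_sub (sE l) => x [].
- by move=> x [_ h]; exact: bE.
Qed.

Lemma local_frame_exists x0 U : open U -> U x0 -> exists W X E, [/\ W x0, W `<=` U & local_frame W X E].
Proof.
move=> oU Ux; have [W [X [oW Wx oX]]] := crL_frame x0.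
have oUW : open (U `&` W) by exact: openI.
have [W' [E [W'x W'U lf]]] := local_frame_ext oUW (conj Ux Wx) (orthonormal_frameL_sub (W := U `&` W) (fun x h => h.2) oX).
by exists W', X, E; split=> // x /W'U[].
Qed.

Lemma local_frame_adapted W X E x : local_frame W X E -> W x -> adapted S x (X^~ x) (E^~ x).
Proof. by move=> [oW [_ [h1 h2]] _ h3] Wx; split; [exact: h1|exact: h2|exact: h3]. Qed.

Section OnFrame.
Variables (W : set M) (X : 'I_n -> M -> V) (E : 'I_r -> M -> V).
Hypothesis lf : local_frame W X E.
Let oW : open W. Proof. by case: lf. Qed.

Lemma smooth_JX j : smooth_vfield W (fun x => crJ S x (X j x)).
Proof.
have [_ [sX [XL _]] _ _] := lf; apply: crJ_smooth => // x Wx; apply: crL_H; exact: XL.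
Qed.

Lemma smooth_frame_row k : smooth_cvf W (fun x => row k (Fmx S x (X^~ x) (E^~ x))).
Proof.
have [_ [sX [XL _]] sE _] := lf; move: k; apply: idxP => j.
- apply: (smooth_cvf_congr oW) (smooth_cvf_lin (shalf R) (- 'i%C) oW (smooth_cvf_real oW (sX j)) (smooth_cvf_real oW (smooth_JX j))).
  by move=> x _; rewrite row_ia /Zv scaleNr.
- apply: (smooth_cvf_congr oW) (smooth_cvf_lin (shalf R) ('i%C) oW (smooth_cvf_real oW (sX j)) (smooth_cvf_real oW (smooth_JX j))).
  by move=> x _; rewrite row_ib.
apply: (smooth_cvf_congr oW) (smooth_cvf_real oW (sE j)).
by move=> x _; rewrite row_ic.
Qed.

Definition Fch (c : chart R m M) x : 'M[C]_m := Fmx S x (X^~ x) (E^~ x) *m toCm (transition_jac (chart_at x) c x).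

Lemma Fch_row c x k j : Fch c x k j = vecC_in c x (row k (Fmx S x (X^~ x) (E^~ x))) 0 j.
Proof. by rewrite /vecC_in -row_mul [RHS]mxE. Qed.

Lemma smooth_Fch c i j : atlas c -> smoothC_on (cmap c @` (W `&` cdom c)) (fun y => Fch c (cinv c y) i j).
Proof.
move=> ac; apply: (smoothC_on_congr (chart_img_open c oW)) (smooth_frame_row i ac j) => y _.
exact: (esym (Fch_row _ _ _ _)).
Qed.

Lemma Fch_inv c x : atlas c -> W x -> cdom c x ->
  Fch c x *m (toCm (transition_jac c (chart_at x) x) *m Bmx S x (X^~ x) (E^~ x)) = 1%:M.
Proof.
move=> ac Wx cx; rewrite /Fch mulmxA -[X in X *m _ = _]mulmxA.
have -> : toCm (transition_jac (chart_at x) c x) *m toCm (transition_jac c (chart_at x) x) = 1%:M.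
  apply: (etrans (esym (toCmM _ _))); apply: (etrans _ (toCm1 _ _)); congr (map_mx _ _).
  exact: transition_jacK.
by rewrite mulmx1; apply: FB; exact: local_frame_adapted Wx.
Qed.

Lemma form_in_un c x phi : atlas c -> W x -> cdom c x ->
  form_in c x (un S x (X^~ x) (E^~ x) phi) = pullback (invmx (Fch c x)) phi.
Proof.
move=> ac Wx cx; apply: (etrans (pullback_comp _ _ _)); congr (pullback _ _).
have FI := Fch_inv ac Wx cx; have [Fu _] := mulmx1_unit FI.
by rewrite -[LHS](mulKmx Fu) FI mulmx1.
Qed.

Lemma co_form_in c x w : atlas c -> W x -> cdom c x ->
  co S x (X^~ x) (E^~ x) w = pullback (Fch c x) (form_in c x w).
Proof.
move=> ac Wx cx; rewrite -{1}(form_inK w ac cx); exact: pullback_comp.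
Qed.

Lemma smooth_un (phi : M -> ext) : (forall T, smoothC_fun W (fun x => phi x T)) ->
  smooth_form W (fun x => un S x (X^~ x) (E^~ x) (phi x)).
Proof.
move=> sp c ac; have oWc := chart_img_open c oW.
apply: (@sform_near _ _ _ (fun y => pullback (invmx (Fch c (cinv c y))) (phi (cinv c y)))).
  move=> y0 Oy0; apply: (near_open oWc Oy0) => y [x [Wx cx] <-].
  by rewrite (cmapK cx) -(form_in_un _ ac Wx cx).
apply: sform_pullback => //; last by move=> T; exact: sp.
apply: smoothC_on_invmx => // [y [x [Wx cx] <-]|i j]; last exact: smooth_Fch.
by rewrite (cmapK cx); have [] := mulmx1_unit (Fch_inv ac Wx cx).
Qed.

Lemma smooth_co (w : M -> ext) T : smooth_form W w ->
  smoothC_fun W (fun x => co S x (X^~ x) (E^~ x) (w x) T).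
Proof.
move=> sw c ac; have oWc := chart_img_open c oW.
have h := sform_pullback oWc (fun i j => smooth_Fch i j ac) (sw c ac) T.
apply: (smoothC_on_congr oWc) h => y [x [Wx cx] <-].
by rewrite /= (cmapK cx) -(co_form_in _ ac Wx cx).
Qed.

End OnFrame.

End LocalFrames.

Local Opaque co un Bmx Fmx.

(** * Smooth functions, vector fields and forms on M *)

Section SmoothFunctions.
Variables (R : realType) (m : nat) (M : manifold R m).
Local Notation C := R[i].
Local Notation V := 'rV[R]_m.
Local Notation VC := 'rV[C]_m.
Local Notation ext := (ext R m).
Implicit Types (U W : set M) (f g : M -> C) (w : M -> ext) (Z : M -> VC).

Lemma smoothC_fun_cst U (a : C) : open U -> smoothC_fun U (fun=> a).
Proof. by move=> oU c ac; exact: smoothC_on_cst (chart_img_open c oU). Qed.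

Lemma smoothC_funD U f g : open U -> smoothC_fun U f -> smoothC_fun U g -> smoothC_fun U (fun x => f x + g x).
Proof. by move=> oU sf sg c ac; exact: smoothC_onD (chart_img_open c oU) (sf c ac) (sg c ac). Qed.

Lemma smoothC_funM U f g : open U -> smoothC_fun U f -> smoothC_fun U g -> smoothC_fun U (fun x => f x * g x).
Proof. by move=> oU sf sg c ac; exact: smoothC_onM (chart_img_open c oU) (sf c ac) (sg c ac). Qed.

Lemma smoothC_fun_conj U f : open U -> smoothC_fun U f -> smoothC_fun U (fun x => conjc (f x)).
Proof. by move=> oU sf c ac; exact: smoothC_on_conj (chart_img_open c oU) (sf c ac). Qed.

Lemma smoothC_fun_inv U f : open U -> (forall x, U x -> f x != 0) -> smoothC_fun U f ->
  smoothC_fun U (fun x => (f x)^-1).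
Proof.
move=> oU f0 sf c ac; apply: (smoothC_on_inv (chart_img_open c oU) _ (sf c ac)) => y [x [Ux cx] <-].
by rewrite /= (cmapK cx); exact: f0.
Qed.

Lemma smoothC_fun_sum U I (s : seq I) (P : pred I) (F : I -> M -> C) : open U ->
  (forall i, P i -> smoothC_fun U (F i)) -> smoothC_fun U (fun x => \sum_(i <- s | P i) F i x).
Proof.
by move=> oU sF c ac; apply: (smoothC_on_sum _ (chart_img_open c oU)) => i Pi; exact: sF.
Qed.

Lemma smoothC_fun_lin U (G : {linear ext -> ext}) w T : open U -> (forall S, smoothC_fun U (fun x => w x S)) ->
  smoothC_fun U (fun x => G (w x) T).
Proof.
move=> oU sw; apply: (smoothC_fun_congr oU (f := fun x => \sum_S w x S * G (eb R S) T)).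
  by move=> x _; rewrite [in RHS](ext_eb (w x)) linear_sum ext_sumE; apply: eq_bigr => S _; rewrite linearZ /= extZE.
by apply: smoothC_fun_sum => // S _; apply: smoothC_funM => //; exact: smoothC_fun_cst.
Qed.

Lemma smooth_vact U Z f : open U -> smooth_cvf U Z -> smoothC_fun U f -> smoothC_fun U (vfield_act Z f).
Proof.
move=> oU sZ sf c ac; have oUc := chart_img_open c oU.
apply: (smoothC_on_congr oUc (f := fun y => \sum_j vecC_in c (cinv c y) (Z (cinv c y)) 0 j * partialC j (f \o cinv c) y)).
  by move=> y [x [Ux cx] <-]; rewrite /= (vfield_act_chart Z ac _ oU _ sf) (cmapK cx).
apply: smoothC_on_sum => // j _; apply: smoothC_onM => //; first exact: sZ.
exact: smoothC_on_partial (sf c ac).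
Qed.

Lemma vact_near Z f g x : (\forall y \near x, f y = g y) -> vfield_act Z f x = vfield_act Z g x.
Proof.
move=> fg; apply: eq_bigr => j _; congr (_ * _); apply: partialC_near.
exact: near_chart (chart_at_dom x) fg.
Qed.

Lemma near_open_set (U : set M) (P : M -> Prop) x : open U -> U x -> (forall y, U y -> P y) -> \forall y \near x, P y.
Proof. by move=> oU Ux h; apply: filterS h _; exact: open_nbhs_nbhs. Qed.

Let at_chart U x : U x -> (cmap (chart_at x) @` (U `&` cdom (chart_at x))) (cmap (chart_at x) x).
Proof. by move=> Ux; apply: in_chart_img => //; exact: chart_at_dom. Qed.

Lemma vact_cst Z (a : C) x : vfield_act Z (fun=> a) x = 0.
Proof. by rewrite /vfield_act big1 // => j _; rewrite partialC_cst mulr0. Qed.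

Lemma vact_sum U I (s : seq I) (F : I -> M -> C) Z x : open U -> U x -> (forall i, smoothC_fun U (F i)) ->
  vfield_act Z (fun y => \sum_(i <- s) F i y) x = \sum_(i <- s) vfield_act Z (F i) x.
Proof.
move=> oU Ux sF; rewrite /vfield_act exchange_big; apply: eq_bigr => j _ /=; rewrite -mulr_sumr; congr (_ * _).
have oUc := chart_img_open (chart_at x) oU.
exact: (partialC_sum (F := fun i => F i \o cinv (chart_at x)) s j oUc (at_chart Ux) (fun i => sF i _ (chart_at_atlas x))).
Qed.

Lemma vactM U f g Z x : open U -> U x -> smoothC_fun U f -> smoothC_fun U g ->
  vfield_act Z (fun y => f y * g y) x = f x * vfield_act Z g x + vfield_act Z f x * g x.
Proof.
move=> oU Ux sf sg; have sf' := sf _ (chart_at_atlas x); have sg' := sg _ (chart_at_atlas x).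
rewrite /vfield_act mulr_sumr mulr_suml -big_split; apply: eq_bigr => j _ /=.
have E := partialCM j (at_chart Ux) sf' sg'.
have Ef : (f \o cinv (chart_at x)) (cmap (chart_at x) x) = f x by rewrite /= (cmapK (chart_at_dom x)).
have Eg : (g \o cinv (chart_at x)) (cmap (chart_at x) x) = g x by rewrite /= (cmapK (chart_at_dom x)).
rewrite Ef Eg in E; apply: (etrans (congr1 _ E)).
by rewrite mulrDr mulrCA -[in RHS]mulrA.
Qed.

Lemma vactZ U (a : C) f Z x : open U -> U x -> smoothC_fun U f ->
  vfield_act Z (fun y => a * f y) x = a * vfield_act Z f x.
Proof.
by move=> oU Ux sf; rewrite (vactM Z oU Ux (smoothC_fun_cst a oU) sf) vact_cst mul0r addr0.
Qed.

Lemma vact_conj U f Z x : open U -> U x -> smoothC_fun U f ->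
  vfield_act Z (fun y => conjc (f y)) x = conjc (vfield_act (fun y => map_mx (@conjc R) (Z y)) f x).
Proof.
move=> oU Ux sf; rewrite /vfield_act rmorph_sum; apply: eq_bigr => j _; rewrite rmorphM mxE /= conjcK.
congr (_ * _); exact: (partialC_conj j (at_chart Ux) (sf _ (chart_at_atlas x))).
Qed.

Lemma smooth_form_sum U I (s : seq I) (F : I -> M -> ext) : open U ->
  (forall i, smooth_form U (F i)) -> smooth_form U (fun x => \sum_(i <- s) F i x).
Proof.
move=> oU sF c ac T; have oUc := chart_img_open c oU.
have h := smoothC_on_sum s (P := xpredT) oUc (fun i _ => sF i c ac T).
by apply: (smoothC_on_congr oUc) h => y _; rewrite /form_in linear_sum ext_sumE.
Qed.

Lemma smooth_formZ U f w : open U -> smoothC_fun U f -> smooth_form U w -> smooth_form U (fun x => f x *: w x).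
Proof.
move=> oU sf sw c ac T; have oUc := chart_img_open c oU.
by apply: (smoothC_on_congr oUc) (smoothC_onM oUc (sf c ac) (sw c ac T)) => y _; rewrite /form_in linearZ /= extZE.
Qed.

Lemma smooth_form0 U : open U -> smooth_form U (fun=> 0).
Proof.
move=> oU c ac T; have oUc := chart_img_open c oU.
by apply: (smoothC_on_congr oUc) (smoothC_on_cst 0 oUc) => y _; rewrite /form_in linear0 ext0E.
Qed.

Lemma form_in_id (x : M) (w : ext) : form_in (chart_at x) x w = w.
Proof.
rewrite /form_in (transition_jac_id (chart_at_atlas x) (chart_at_dom x)).
exact: (etrans (congr2 (@pullback R m) (toCm1 R m) erefl) (pullback1 _)).
Qed.

Lemma ext_d_near w w' x : (\forall y \near x, w y = w' y) -> ext_d w x = ext_d w' x.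
Proof.
move=> ww; apply: dform_near; apply: filterS (near_chart (chart_at_dom x) ww) => y E.
by rewrite E.
Qed.

Definition dfun f x : VC := gradC (f \o cinv (chart_at x)) (cmap (chart_at x) x).

Lemma pairing_dfun f Z x : pairing (dfun f x) (Z x) = vfield_act Z f x.
Proof. by apply: eq_bigr => j _; rewrite mxE mulrC. Qed.

Lemma ext_d_scale U f w x : open U -> U x -> smoothC_fun U f -> smooth_form U w ->
  ext_d (fun y => f y *: w y) x = eps (dfun f x) (w x) + f x *: ext_d w x.
Proof.
move=> oU Ux sf sw; have oUc := chart_img_open (chart_at x) oU.
have sw' : sform (cmap (chart_at x) @` (U `&` cdom (chart_at x)))
    (fun y => form_in (chart_at x) (cinv (chart_at x) y) (w (cinv (chart_at x) y))).
  by move=> T; exact: (sw _ (chart_at_atlas x) T).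
have E := dform_scale oUc (at_chart Ux) (sf _ (chart_at_atlas x)) sw'.
have Ex : cinv (chart_at x) (cmap (chart_at x) x) = x by exact: (cmapK (chart_at_dom x)).
have E2 : form_in (chart_at x) (cinv (chart_at x) (cmap (chart_at x) x)) (w (cinv (chart_at x) (cmap (chart_at x) x))) = w x.
  by rewrite Ex form_in_id.
have E3 : (f \o cinv (chart_at x)) (cmap (chart_at x) x) = f x by rewrite /= Ex.
rewrite E2 E3 in E; apply: (etrans _ E); apply: dform_near; apply: nearV => y.
by rewrite /form_in linearZ.
Qed.

Lemma ext_d_sum U I (s : seq I) (F : I -> M -> ext) x : open U -> U x -> (forall i, smooth_form U (F i)) ->
  ext_d (fun y => \sum_(i <- s) F i y) x = \sum_(i <- s) ext_d (F i) x.
Proof.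
move=> oU Ux sF; have oUc := chart_img_open (chart_at x) oU.
pose G i y := form_in (chart_at x) (cinv (chart_at x) y) (F i (cinv (chart_at x) y)).
have sG i : sform (cmap (chart_at x) @` (U `&` cdom (chart_at x))) (G i).
  by move=> T; exact: (sF i _ (chart_at_atlas x) T).
have E := dform_sum s oUc (at_chart Ux) sG.
apply: (etrans _ E); apply: dform_near; apply: nearV => y.
by rewrite /form_in linear_sum.
Qed.

Lemma ext_d0 (x : M) : ext_d (fun=> 0 : ext) x = 0.
Proof.
have s0 (i : nat) : smooth_form (setT : set M) (fun=> 0 : ext) by apply: smooth_form0; exact: openT.
have E := ext_d_sum ([::] : seq nat) openT (I : setT x) s0.
apply: (etrans _ (etrans E (big_nil _ _ _ _))); apply: ext_d_near.
by apply: (near_open_set openT I) => y _; exact: (esym (big_nil _ _ _ _)).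
Qed.

End SmoothFunctions.

(** * Global sections and independence of the frame *)

Section GlobalSections.
Variables (R : realType) (n r : nat).
Local Notation m := (n + n + r)%N.
Variables (M : manifold R m) (S : real_CR M n).
Local Notation C := R[i].
Local Notation V := 'rV[R]_m.
Local Notation VC := 'rV[C]_m.
Local Notation ext := (ext R m).
Implicit Types (U W : set M) (w : M -> ext).

(** For fibrewise operators that have the same constant matrix [G] in every adapted frame, as the
    components and gamma do. Around each point a smooth frame may then be used. *)
Lemma smooth_form_co U w w' (G : {linear ext -> ext}) : open U ->
  (forall x X E, adapted S x X E -> w' x = un S x X E (G (co S x X E (w x)))) ->
  smooth_form U w -> smooth_form U w'.
Proof.
move=> oU Hw sw; apply: smooth_form_local => x0 Ux0.
have [W [X [E [Wx WU lf]]]] := local_frame_exists S oU Ux0.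
exists W; split=> //; have [oW _ _ _] := lf.
apply: (smooth_form_congr oW (f := fun x => un S x (X^~ x) (E^~ x) (G (co S x (X^~ x) (E^~ x) (w x))))).
  by move=> x Hx; rewrite -Hw //; exact: local_frame_adapted Hx.
apply: (smooth_un lf) => T; apply: smoothC_fun_lin => // T'; apply: (smooth_co lf).
exact: smooth_form_sub sw.
Qed.

Lemma smooth_component U p q w : open U -> smooth_form U w ->
  smooth_form U (fun x => component S p q x (w x)).
Proof.
move=> oU; apply: (smooth_form_co (G := restr (bideg p q))) => // x X E ad.
exact: component_co.
Qed.

Lemma adapted_exists x : exists X E, adapted S x X E.
Proof.
have [W [X [E [Wx _ lf]]]] := local_frame_exists S openT (I : setT x).
by exists (X^~ x), (E^~ x); exact: local_frame_adapted Wx.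
Qed.

Lemma section_chirality w : section S w -> section S (fun x => chirality S x (w x)).
Proof.
move=> [sw hw]; split.
  apply: (smooth_form_co (G := Gam (lamv R n r) \o restr hset)) sw; first exact: openT.
  by move=> x X E ad; rewrite (chirality_co ad).
move=> x; have [X [E ad]] := adapted_exists x; apply/(LambdaH_co ad).
by rewrite (chirality_co ad) (unK ad); exact: supp_Gam.
Qed.

Lemma smooth_dbarH U w : open U -> smooth_form U w -> smooth_form U (dbarH S w).
Proof.
move=> oU sw; apply: smooth_form_sum => // p; apply: smooth_form_sum => // q.
by apply: smooth_component => //; apply: smooth_ext_d => //; exact: smooth_component.
Qed.

Lemma LambdaH_dbarH w x : LambdaH S x (dbarH S w x).
Proof.
have [X [E ad]] := adapted_exists x; apply/(LambdaH_co ad); rewrite linear_sum; apply: supp_sum => p _ /=.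
rewrite linear_sum; apply: supp_sum => q _ /=; rewrite (component_co ad) (unK ad).
by apply: (supp_sub _ (supp_restr _)) => T /and3P[].
Qed.

Lemma section_dbarH w : section S w -> section S (dbarH S w).
Proof. by move=> [sw _]; split; [exact: smooth_dbarH openT sw|move=> x; exact: LambdaH_dbarH]. Qed.

Lemma component0 p q x : component S p q x 0 = 0.
Proof. by have [X [E ad]] := adapted_exists x; rewrite (component_co ad) !linear0. Qed.

Lemma dbarH_near w w' x : (\forall y \near x, w y = w' y) -> dbarH S w x = dbarH S w' x.
Proof.
move=> ww; apply: eq_bigr => p _; apply: eq_bigr => q _; apply: (congr1 (component S p q.+1 x)); apply: ext_d_near.
by apply: filterS ww => y ->.
Qed.

Lemma dbarH0 x : dbarH S (fun=> 0) x = 0.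
Proof.
rewrite /dbarH big1 // => p _; rewrite big1 // => q _.
rewrite (ext_d_near (w' := fun=> 0)) ?ext_d0 ?component0 //.
exact: (near_open_set (P := fun y => component S p q y 0 = 0) openT I (fun y _ => component0 p q y)).
Qed.

Lemma dcov_uniq x X E xi k : adapted S x X E -> cv S x X E xi = delta_mx 0 k -> xi = dcov S x X E k.
Proof.
move=> ad h; have c1 : cv S x X E (dcov S x X E k) = delta_mx 0 k by exact: cv_dcov.
have inj u v : cv S x X E u = cv S x X E v -> u = v.
  move=> /(congr1 (mulmx^~ (Bmx S x X E)^T)); rewrite /cv -!mulmxA -trmx_mul (BF ad) trmx1 !mulmx1 //.
by apply: inj; rewrite h c1.
Qed.

(** A dual covector of the H blocks vanishes on N, whatever basis of N is chosen, and is determined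
    by its values on H. *)
Lemma dcov_indep x X E E' k : adapted S x X E -> adapted S x X E' -> ~~ kC k ->
  dcov S x X E k = dcov S x X E' k.
Proof.
move=> ad ad' hk; apply: dcov_uniq => //.
have h : annihilator (NC S x) (dcov S x X E k).
  apply/(annNP ad) => i ki; rewrite (cv_dcov ad) mxE eqxx /=.
  by case: eqP => // E1; move: hk; rewrite -E1 ki.
have c1 := cv_dcov ad k.
have val i : pairing (dcov S x X E k) (row i (Fmx S x X E)) = (i == k)%:R.
  by rewrite -cvE c1 mxE eqxx.
apply/rowP => i; rewrite cvE [RHS]mxE eqxx /=; move: i; apply: idxP => j.
- by rewrite row_ia -(row_ia S x X E) val.
- by rewrite row_ib -(row_ib S x X E) val.
rewrite -cvE ((annNP ad' _).1 h) ?kE //.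
by case: eqP => // E1; move: hk; rewrite -E1 kE.
Qed.

Lemma un_indep x X E E' phi : adapted S x X E -> adapted S x X E' -> supp hset phi ->
  un S x X E phi = un S x X E' phi.
Proof.
move=> ad ad' sp; rewrite [phi]ext_eb !linear_sum; apply: eq_bigr => T _; rewrite !linearZ /=.
have [hT|hT] := boolP (hset T); last first.
  rewrite (sp T hT); exact: etrans (scale0r _) (esym (scale0r _)).
apply: (congr1 ( *:%R _)); rewrite !un_eb; apply: congr1; apply/eq_in_map => k; rewrite mem_enum => kT.
by apply: dcov_indep => //; have /fintype.subsetP/(_ k kT) := hsetP _ hT; rewrite inE.
Qed.

Lemma co_indep x X E E' (w : ext) : adapted S x X E -> adapted S x X E' -> LambdaH S x w ->
  co S x X E w = co S x X E' w.
Proof.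
move=> ad ad' /(LambdaH_co ad) sw; apply: (can_inj (unK ad)).
apply: (etrans (coK ad w)); apply: (etrans (esym (coK ad' w))).
apply: (un_indep ad' ad); apply/(LambdaH_co ad'); apply/(LambdaH_co ad); exact: sw.
Qed.

End GlobalSections.

Arguments chart_img_open {R m M} c {U} _.
Local Opaque pullback ewedge ext_contr co un Bmx Fmx.

(** * The operator dbar_H in a local frame *)

Section FrameOnU.
Variables (R : realType) (n r : nat).
Local Notation m := (n + n + r)%N.
Variables (M : manifold R m) (S : real_CR M n).
Local Notation C := R[i].
Local Notation V := 'rV[R]_m.
Local Notation VC := 'rV[C]_m.
Local Notation ext := (ext R m).
Variables (U : set M) (X : 'I_n -> M -> V) (E : M -> 'I_r -> V).
Hypothesis oU : open U.
Hypothesis hX : orthonormal_frameL S U X.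
Hypothesis adE : forall x, U x -> adapted S x (X^~ x) (E x).
Implicit Types (w : M -> ext) (phi : M -> ext) (T : {set 'I_m}).

Lemma component_linear p q x : linear (component S p q x).
Proof. by move=> k a b; have [X' [E' ad]] := adapted_exists S x; rewrite !(component_co ad) !linearP. Qed.
HB.instance Definition _ p q x :=
  GRing.isLinear.Build C ext ext *:%R (component S p q x) (component_linear p q x).

(* E is an arbitrary choice of bases of the supplements N, without any regularity:
   the coordinates of sections of the exterior algebra of H^* do not depend on it. *)
Definition cf w x : ext := co S x (X^~ x) (E x) (w x).
Definition uf phi x : ext := un S x (X^~ x) (E x) (phi x).

(** Near each point a smooth basis of N exists, and [un_indep] replaces it by the given [E]. *)
Lemma smooth_uf phi : (forall x, U x -> supp hset (phi x)) -> (forall T, smoothC_fun U (fun x => phi x T)) ->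
  smooth_form U (uf phi).
Proof.
move=> hphi sphi; apply: smooth_form_local => x0 Ux0.
have [W [E' [Wx WU lf]]] := local_frame_ext oU Ux0 hX; have [oW _ _ _] := lf.
exists W; split=> //.
apply: (smooth_form_congr oW) (smooth_un lf (phi := phi) _) => [x Hx|T]; last exact: smoothC_fun_sub (sphi T).
by apply: un_indep; [exact: local_frame_adapted Hx|exact/adE/WU|exact/hphi/WU].
Qed.

Lemma smooth_cf w T : smooth_form U w -> (forall x, U x -> LambdaH S x (w x)) -> smoothC_fun U (fun x => cf w x T).
Proof.
move=> sw hw; apply: smoothC_fun_local => x0 Ux0.
have [W [E' [Wx WU lf]]] := local_frame_ext oU Ux0 hX; have [oW _ _ _] := lf.
exists W; split=> //.
apply: (smoothC_fun_congr oW) (smooth_co lf T (smooth_form_sub WU sw)) => x Hx.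
apply: (congr1 (fun v : ext => v T)).
by apply: co_indep; [exact: local_frame_adapted Hx|exact/adE/WU|exact/hw/WU].
Qed.

Lemma smooth_Zf j : smooth_cvf U (Zf S X j).
Proof.
have [sX [XL _]] := hX; have sJ : smooth_vfield U (fun x => crJ S x (X j x)).
  by apply: crJ_smooth => // x Ux; apply: crL_H; exact: XL.
apply: (smooth_cvf_congr oU) (smooth_cvf_lin (shalf R) (- 'i%C) oU (smooth_cvf_real oU (sX j)) (smooth_cvf_real oU sJ)).
by move=> x _; rewrite scaleNr.
Qed.

Lemma smooth_Zbarf j : smooth_cvf U (Zbarf S X j).
Proof.
have [sX [XL _]] := hX; have sJ : smooth_vfield U (fun x => crJ S x (X j x)).
  by apply: crJ_smooth => // x Ux; apply: crL_H; exact: XL.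
exact: (smooth_cvf_congr oU) (smooth_cvf_lin (shalf R) 'i%C oU (smooth_cvf_real oU (sX j)) (smooth_cvf_real oU sJ)).
Qed.

Lemma ufK phi x : U x -> co S x (X^~ x) (E x) (uf phi x) = phi x.
Proof. by move=> Ux; exact: unK (adE Ux) _. Qed.

Lemma supp_cf w x : U x -> LambdaH S x (w x) -> supp hset (cf w x).
Proof. by move=> Ux; move/(LambdaH_co (adE Ux)). Qed.

Lemma cf_component p q w x : U x -> co S x (X^~ x) (E x) (component S p q x (w x)) = restr (bideg p q) (cf w x).
Proof. by move=> Ux; rewrite (component_co (adE Ux)) (unK (adE Ux)). Qed.

Definition vact (Z : M -> VC) phi x : ext := [ffun T => vfield_act Z (fun y => phi y T) x].

Lemma vactE Z phi x T : vact Z phi x T = vfield_act Z (fun y => phi y T) x.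
Proof. by rewrite [LHS]ffunE. Qed.

Lemma vact_congr Z phi phi' x : U x -> (forall y, U y -> phi y = phi' y) -> vact Z phi x = vact Z phi' x.
Proof.
move=> Ux h; apply/ffunP => T; rewrite !vactE; apply: vact_near.
by apply: (near_open_set oU Ux) => y /h ->.
Qed.

Lemma supp_vact Z phi x P : U x -> (forall y, U y -> supp P (phi y)) -> supp P (vact Z phi x).
Proof.
move=> Ux h T nT; rewrite vactE -(vact_cst Z 0 x); apply: vact_near.
by apply: (near_open_set oU Ux) => y /h; apply.
Qed.

Lemma vact_lin (G : {linear ext -> ext}) Z phi x : U x -> (forall T, smoothC_fun U (fun y => phi y T)) ->
  vact Z (fun y => G (phi y)) x = G (vact Z phi x).
Proof.
move=> Ux sphi; apply/ffunP => T; rewrite vactE.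
have E1 : \forall y \near x, G (phi y) T = \sum_T' G (eb R T') T * phi y T'.
  apply: (near_open_set oU Ux) => y _; rewrite {1}[phi y]ext_eb linear_sum ext_sumE; apply: eq_bigr => T' _.
  by rewrite linearZ /= extZE mulrC.
rewrite (vact_near Z E1).
have s1 T' : smoothC_fun U (fun y => G (eb R T') T * phi y T').
  by apply: smoothC_funM => //; exact: smoothC_fun_cst.
apply: (etrans (vact_sum _ Z oU Ux s1)).
rewrite [in RHS](ext_eb (vact Z phi x)) linear_sum ext_sumE; apply: eq_bigr => T' _.
by rewrite linearZ /= extZE vactE (vactZ _ Z oU Ux (sphi T')) mulrC.
Qed.

Definition frame_form T x : ext := uf (fun=> eb R T) x.

Lemma Thf_smooth T : hset T -> smooth_form U (frame_form T).
Proof.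
move=> hT; apply: smooth_uf => [x _|T']; first exact: supp_eb.
exact: smoothC_fun_cst.
Qed.

(** Of the covectors of the three blocks, only those dual to the Zbar_j raise the bidegree from
    (p,q) to (p,q+1). *)
Lemma restr_eps_top p q T (v : VC) : bideg p q T ->
  restr (bideg p q.+1) (eps v (eb R T)) = \sum_j v 0 (ib r j) *: eps (delta_mx 0 (ib r j)) (eb R T).
Proof.
move=> dbar_eb; rewrite eps_sum linear_sum big_idx.
have dT k : restr (bideg p q.+1) (v 0 k *: eps (delta_mx 0 k) (eb R T)) =
    (kB k)%:R *: (v 0 k *: eps (delta_mx 0 k) (eb R T)).
  rewrite linearZ /= eps_eb; case: ifPn => kT; first by rewrite linear0 !scaler0.
  rewrite linearZ /= restr_eb; case/and3P: dbar_eb => /eqP dA /eqP dB /eqP dC.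
  have -> : bideg p q.+1 (k |: T) = kB k.
    rewrite /bideg /hset !degU1 // dA dB dC; move: k {kT}; apply: idxP => j; rewrite !kE /=.
    - by rewrite add1n eqn_leq ltnn.
    - by rewrite !add0n add1n !eqxx.
    - by rewrite addn0 /= !andbF.
  case: (kB k); first exact: (esym (scale1r _)).
  rewrite !scaler0; exact: (esym (scale0r _)).
have s1 : \sum_j restr (bideg p q.+1) (v 0 (ia r j) *: eps (delta_mx 0 (ia r j)) (eb R T)) = 0.
  by apply: big1 => j _; rewrite dT kE; exact: scale0r.
have s3 : \sum_j restr (bideg p q.+1) (v 0 (ic n j) *: eps (delta_mx 0 (ic n j)) (eb R T)) = 0.
  by apply: big1 => j _; rewrite dT kE; exact: scale0r.
have s2 : \sum_j restr (bideg p q.+1) (v 0 (ib r j) *: eps (delta_mx 0 (ib r j)) (eb R T)) =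
  \sum_j v 0 (ib r j) *: eps (delta_mx 0 (ib r j)) (eb R T).
  by apply: eq_bigr => j _; rewrite dT kE; exact: scale1r.
apply: (etrans (congr2 +%R (congr2 +%R s1 s2) s3)).
by rewrite add0r addr0.
Qed.

(* The zeroth order part of dbar_H. *)
Definition dbar_eb T x : ext := cf (dbarH S (frame_form T)) x.

Lemma sum_bideg (F : 'I_n.+1 -> 'I_n.+1 -> {set 'I_m} -> ext) T (G : ext) : hset T ->
  (forall p q : 'I_n.+1, bideg p q T -> F p q T = G) ->
  \sum_(p < n.+1) \sum_(q < n.+1) (if bideg p q T then F p q T else 0) = G.
Proof.
move=> hT FG.
have pA : (deg kA T < n.+1)%N by rewrite ltnS degA_le.
have pB : (deg kB T < n.+1)%N by rewrite ltnS degB_le.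
have bD : bideg (Ordinal pA) (Ordinal pB) T by rewrite /bideg /= !eqxx hT.
rewrite (bigD1 (Ordinal pA)) //= (bigD1 (Ordinal pB)) //= bD (FG _ _ bD).
rewrite [X in _ + X + _]big1 ?[X in _ + X]big1 ?addr0 //.
- move=> p ne; rewrite big1 // => q _; case: ifP => // /and3P[/eqP E1 _ _].
  by move/eqP: ne; case; apply: val_inj.
- move=> q ne; case: ifP => // /and3P[_ /eqP E1 _].
  by move/eqP: ne; case; apply: val_inj.
Qed.

Lemma linear_bideg_sum (G : {linear ext -> ext}) T (F : 'I_n.+1 -> 'I_n.+1 -> ext) :
  G (\sum_(p < n.+1) \sum_(q < n.+1) if bideg p q T then F p q else 0) =
  \sum_(p < n.+1) \sum_(q < n.+1) if bideg p q T then G (F p q) else 0.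
Proof.
rewrite linear_sum; apply: eq_bigr => p _; rewrite linear_sum; apply: eq_bigr => q _.
by case: ifP => // _; exact: linear0.
Qed.

Lemma component_Thf p q T x : U x -> component S p q x (frame_form T x) = if bideg p q T then frame_form T x else 0.
Proof.
move=> Ux; rewrite (component_co (adE Ux)) ufK // restr_eb.
by case: ifP => // _; exact: linear0.
Qed.

Lemma dbarH_Thf T x : U x -> dbarH S (frame_form T) x =
  \sum_(p < n.+1) \sum_(q < n.+1) if bideg p q T then component S p q.+1 x (ext_d (frame_form T) x) else 0.
Proof.
move=> Ux; apply: eq_bigr => p _; apply: eq_bigr => q _.
case: ifP => bpq.
  apply: (congr1 (component S p q.+1 x)); apply: ext_d_near.
  by apply: (near_open_set oU Ux) => y Uy; rewrite component_Thf // bpq.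
rewrite -[RHS](component0 S p q.+1 x) -(ext_d0 x); apply: (congr1 (component S p q.+1 x)); apply: ext_d_near.
by apply: (near_open_set oU Ux) => y Uy; rewrite component_Thf // bpq.
Qed.

(** The zeroth order part of dbar_H raises the second degree by exactly one as well; this is used
    when degrees are followed through Q_L. *)
Lemma supp_bT p q T x : U x -> bideg p q T -> supp (bideg p q.+1) (dbar_eb T x).
Proof.
move=> Ux bpq; rewrite /dbar_eb /cf dbarH_Thf // linear_sum; apply: supp_sum => p' _ /=.
rewrite linear_sum; apply: supp_sum => q' _ /=; case: ifP => [b|_]; last by rewrite linear0; exact: supp0.
have /and3P[/eqP <- /eqP <- _] := bpq; have /and3P[/eqP -> /eqP -> _] := b.
rewrite (component_co (adE Ux)) (unK (adE Ux)); exact: supp_restr.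
Qed.

(** Expand w in the frame forms and apply d(f theta) = df /\ theta + f d theta. In the first term
    the component of type (p,q+1) keeps only the part of df along the covectors dual to the Zbar_j,
    whose coefficients are the Zbar_j f. The second term contains no derivative of f. *)
Lemma dbarH_cf w x : U x -> section S w ->
  cf (dbarH S w) x = \sum_j eps (delta_mx 0 (ib r j)) (vact (Zbarf S X j) (cf w) x) +
                     \sum_(T | hset T) cf w x T *: dbar_eb T x.
Proof.
move=> Ux [sw hw].
have sU : smooth_form U w by exact: smooth_form_sub sw.
have scf T := smooth_cf T sU (fun y _ => hw y).
have E1 (p q : 'I_n.+1) : ext_d (fun y => component S p q y (w y)) x =
    \sum_T (if bideg p q T then eps (dfun (fun y => cf w y T) x) (frame_form T x) + cf w x T *: ext_d (frame_form T) x else 0).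
  (* Indices outside [hset] are cut off here, since their frame forms involve the covectors of N and
     inherit the irregular choice of [E]. *)
  have s1 T : smooth_form U (if bideg p q T then fun y => cf w y T *: frame_form T y else fun=> 0).
    by case: ifP => [/and3P[_ _ hT]|_]; [apply: smooth_formZ => //; exact: Thf_smooth|exact: smooth_form0].
  rewrite (ext_d_near (w' := fun y => \sum_T (if bideg p q T then fun y => cf w y T *: frame_form T y else fun=> 0) y)).
    rewrite (ext_d_sum _ oU Ux s1); apply: eq_bigr => T _; case: ifP => [/and3P[_ _ hT]|_]; last exact: ext_d0.
    exact: (ext_d_scale oU Ux (scf T) (Thf_smooth hT)).
  apply: (near_open_set oU Ux) => y Uy; apply: (can_inj (coK (adE Uy))).
  rewrite cf_component // [RHS]linear_sum; apply/ffunP => T0; rewrite restrE [RHS]ext_sumE.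
  rewrite (bigD1 T0) //= [X in _ = _ + X]big1 ?addr0 => [|T TT].
    by case: ifP => _; [rewrite linearZ /= ufK // extZE ebE eqxx mulr1|rewrite linear0 ext0E].
  by case: ifP => _; [rewrite linearZ /= ufK // extZE ebE eq_sym (negPf TT) mulr0|rewrite linear0 ext0E].
have E2 : dbarH S w x = \sum_T \sum_(p < n.+1) \sum_(q < n.+1)
   (if bideg p q T then component S p q.+1 x (eps (dfun (fun y => cf w y T) x) (frame_form T x)) +
      cf w x T *: component S p q.+1 x (ext_d (frame_form T) x) else 0).
  rewrite [RHS]exchange_big; apply: eq_bigr => p _; rewrite [RHS]exchange_big; apply: eq_bigr => q _.
  rewrite E1 linear_sum; apply: eq_bigr => T _; case: ifP => _; last exact: linear0.
  by rewrite linearD linearZ.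
rewrite /cf E2 [LHS]linear_sum (bigID hset) /= [X in _ + X]big1 ?addr0 => [|T nT]; last first.
  rewrite big1 ?linear0 // => p _; rewrite big1 // => q _; case: ifP => // /and3P[_ _ hT].
  by rewrite hT in nT.
under eq_bigr => T hT.
  have -> : co S x (X^~ x) (E x) (\sum_(p < n.+1) \sum_(q < n.+1)
   (if bideg p q T then component S p q.+1 x (eps (dfun (fun y => cf w y T) x) (frame_form T x)) +
      cf w x T *: component S p q.+1 x (ext_d (frame_form T) x) else 0)) =
    \sum_j vfield_act (Zbarf S X j) (fun y => cf w y T) x *: eps (delta_mx 0 (ib r j)) (eb R T) + cf w x T *: dbar_eb T x.
    rewrite [dbar_eb T x]/dbar_eb [cf (dbarH _ _) x]/cf (dbarH_Thf T Ux) !linear_bideg_sum.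
    (* Writes the leading term, which depends on neither p nor q, as a double sum with one nonzero
       summand, to compare term by term. *)
    have <- := sum_bideg (F := fun _ _ _ => \sum_j vfield_act (Zbarf S X j) (fun y => cf w y T) x *: eps (delta_mx 0 (ib r j)) (eb R T)) hT (fun _ _ _ => erefl).
    rewrite -[RHS]big_split; apply: eq_bigr => p _ /=.
    rewrite -[RHS]big_split; apply: eq_bigr => q _ /=.
    case: ifP => [bpq|_]; last by rewrite addr0.
    rewrite linearD linearZ; apply: (congr2 +%R) => //.
    rewrite /= (component_co (adE Ux)) (unK (adE Ux)) co_eps ufK // (restr_eps_top _ bpq).
    apply: eq_bigr => j _; apply: (congr2 *:%R) => //; rewrite cvE row_ib -pairing_dfun; by [].
  over.
rewrite big_split; congr (_ + _) => /=.
rewrite exchange_big; apply: eq_bigr => j _ /=.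
rewrite [X in eps _ X]ext_eb linear_sum big_mkcond; apply: eq_bigr => T _; rewrite linearZ /= vactE.
case: ifPn => // hT.
have -> : vfield_act (Zbarf S X j) (fun y => co S y (X^~ y) (E y) (w y) T) x = 0.
  rewrite -(vact_cst (Zbarf S X j) 0 x); apply: vact_near; apply: (near_open_set oU Ux) => y Uy.
  exact: (supp_cf Uy (hw y)).
by rewrite scale0r.
Qed.

End FrameOnU.

(** * The formal adjoint *)

Section ZeroExtension.
Variables (R : realType) (m : nat).
Local Notation V := 'rV[R]_m.
Implicit Types (O : set V) (G u chi : V -> R) (r : R).

Definition zext O G (y : V) : R := if y \in O then G y else 0.

Lemma zextE O G y : O y -> zext O G y = G y.
Proof. by move=> Oy; rewrite /zext mem_set. Qed.

Lemma zextN O G y : ~ O y -> zext O G y = 0.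
Proof. by move=> Oy; rewrite /zext memNset. Qed.

Definition bump_in O (y0 : V) chi r := [/\ smooth_on setT chi, forall y, 0 <= chi y,
  forall y, `|y - y0| <= r -> O y & forall y, chi y != 0 -> `|y - y0| <= r].

Lemma open_far (y0 : V) r : open [set y : V | r < `|y - y0|].
Proof.
have c : continuous (fun y : V => `|y - y0|).
  move=> y; apply: (@continuous_comp _ _ _ (fun z : V => z - y0) (fun z : V => `|z|) y); last exact: norm_continuous.
  exact: (cvgB cvg_id (cvg_cst _)).
rewrite (_ : [set y | _] = (fun y : V => `|y - y0|) @^-1` [set t | r < t]) //.
by apply: open_comp; [move=> y _; exact: c|exact: open_gt].
Qed.

Lemma far_eq0 (a b c : R) : b < c -> (a != 0 -> c <= b) -> a = 0.
Proof. by move=> bc h; apply/eqP; apply: contraTT bc => /h; rewrite -leNgt. Qed.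

Lemma iter_integral0 : iter_integral (fun _ : V => 0 : R) = 0.
Proof.
have L := iter_integral_lin 1 (@Cc0 R m) (@Cc0 R m).
have Z : (fun _ : V => 1 * 0 + 0 : R) = (fun=> 0) by apply/funext => y; rewrite mul1r addr0.
rewrite Z mul1r in L; move/eqP: L; rewrite -[X in X == _]addr0 (inj_eq (addrI _)) eq_sym.
by move/eqP.
Qed.

(** The closed ball lies in O, so O and the complement of the ball cover the space; the extension
    equals G on the first open set and 0 on the second. *)
Lemma Ck_zext k O G (y0 : V) r : open O -> (forall y, `|y - y0| <= r -> O y) ->
  (forall y, O y -> G y != 0 -> `|y - y0| <= r) -> Ck_on k O G -> Ck_on k setT (zext O G).
Proof.
move=> oO bO sG hG; apply: Ck_on_local => x _.
have [Ox|nOx] := pselect (O x).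
  exists O; split=> //; apply: Ck_on_near hG => y Oy.
  by apply: (near_open oO Oy) => z Oz; rewrite zextE.
exists [set y | r < `|y - y0|]; split.
  by rewrite /= ltNge; apply/negP => /bO.
apply: (@Ck_on_near _ _ _ _ (fun=> 0)); last exact: smooth_on_cst (open_far (y0 := y0) (r := r)) k.
move=> y hy; apply: (near_open (open_far (y0 := y0) (r := r)) hy) => z hz.
have [Oz|nOz] := pselect (O z); last by rewrite zextN.
rewrite zextE //; apply: esym; apply/eqP; apply: contraTT hz => Gz.
by rewrite /= -leNgt; exact: sG.
Qed.

Lemma smooth_zext O G (y0 : V) r : open O -> (forall y, `|y - y0| <= r -> O y) ->
  (forall y, O y -> G y != 0 -> `|y - y0| <= r) -> smooth_on O G -> smooth_on setT (zext O G).
Proof. by move=> oO bO sG hG k; apply: Ck_zext bO sG (hG k). Qed.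

Lemma Cc_zext O G (y0 : V) r : open O -> (forall y, `|y - y0| <= r -> O y) ->
  (forall y, O y -> G y != 0 -> `|y - y0| <= r) -> smooth_on O G -> Cc (zext O G).
Proof.
move=> oO bO sG hG; split; first by move=> y; exact: (Ck_zext (k := 0) oO bO sG (hG 0%N)).
exists (`|y0| + r) => y hy; have [Oy|nOy] := pselect (O y); last exact: zextN.
rewrite zextE //; apply/eqP; apply: contraLR hy => /(sG y Oy) h; rewrite -leNgt.
by rewrite -[y](subrK y0) addrC; apply: (le_trans (ler_normD _ _)); rewrite lerD2l.
Qed.

Lemma derive_supp O (y0 : V) chi r j y : bump_in O y0 chi r -> 'D_(evec R j) chi y != 0 -> `|y - y0| <= r.
Proof.
move=> [_ _ _ sc]; apply: contraNT; rewrite -ltNge => hy.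
have E : \forall z \near y, chi z = (fun=> 0) z.
  apply: (near_open (open_far (y0 := y0) (r := r)) hy) => z hz; apply/eqP; apply: contraTT hz => /sc.
  by rewrite /= -leNgt.
by rewrite (near_eq_derive _ E) derive_cst.
Qed.

Section Bump.
Variables (O : set V) (y0 : V) (chi : V -> R) (r : R).
Hypothesis oO : open O.
Hypothesis bc : bump_in O y0 chi r.

Let schi : smooth_on O chi. Proof. by case: bc => s _ _ _; apply: smooth_on_sub s. Qed.
Let bO y : `|y - y0| <= r -> O y. Proof. by case: bc => _ _ h _; exact: h. Qed.

Let chi_supp u y : O y -> chi y * u y != 0 -> `|y - y0| <= r.
Proof. by case: bc => _ _ _ h _; rewrite mulf_eq0 negb_or => /andP[/h]. Qed.

Let dchi_supp j u y : O y -> 'D_(evec R j) chi y * u y != 0 -> `|y - y0| <= r.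
Proof. by move=> _; rewrite mulf_eq0 negb_or => /andP[/(derive_supp bc)]. Qed.

Lemma ibp u j : smooth_on O u ->
  iter_integral (zext O (fun y => 'D_(evec R j) chi y * u y + chi y * 'D_(evec R j) u y)) = 0.
Proof.
move=> su; pose G y := chi y * u y; pose F := zext O G.
have sG : smooth_on O G by exact: smooth_onM.
have sF : smooth_on setT F by exact: (smooth_zext oO bO (@chi_supp u) sG).
have CF : Cc F by exact: (Cc_zext oO bO (@chi_supp u) sG).
have dF y : derivable F y (evec R j) by exact: (smooth_on_derivable (j := j) sF).
have cF : continuous ('D_(evec R j) F) by move=> y; exact: (smooth_on_continuous (smooth_on_derive j sF)).
rewrite -[RHS](iter_integral_derive CF dF cF); congr iter_integral; apply/funext => y.
have [Oy|nOy] := pselect (O y).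
  rewrite zextE //; have E : \forall z \near y, F z = (chi * u) z.
    by apply: (near_open oO Oy) => z Oz; rewrite /F zextE.
  rewrite (near_eq_derive _ E) deriveM; last 2 first.
  - exact: (smooth_on_derivable (j := j) schi Oy).
  - exact: (smooth_on_derivable (j := j) su Oy).
  by rewrite addrC; congr (_ + _); exact: mulrC.
rewrite zextN //; have far : r < `|y - y0| by rewrite ltNge; apply/negP => /bO.
have E : \forall z \near y, F z = (fun=> 0) z.
  apply: (near_open (open_far (y0 := y0) (r := r)) far) => z hz.
  have [Oz|nOz] := pselect (O z); last by rewrite /F zextN.
  rewrite /F zextE //; apply/eqP; apply: contraTT hz => /(chi_supp Oz).
  by rewrite /= -leNgt.
by rewrite (near_eq_derive _ E) derive_cst.
Qed.

Lemma iter_sum I (s : seq I) (F : I -> V -> R) : (forall i, Cc (F i)) ->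
  Cc (fun y => \sum_(i <- s) F i y) /\
  iter_integral (fun y => \sum_(i <- s) F i y) = \sum_(i <- s) iter_integral (F i).
Proof.
move=> CF; elim: s => [|i s [IH1 IH2]].
  have -> : (fun y => \sum_(i <- [::]) F i y) = (fun=> 0) by apply/funext => y; rewrite big_nil.
  split; first exact: Cc0.
  by rewrite big_nil; exact: iter_integral0.
have -> : (fun y => \sum_(i0 <- i :: s) F i0 y) = (fun y => 1 * F i y + \sum_(i <- s) F i y).
  by apply/funext => y; rewrite big_cons mul1r.
split; first exact: Cc_lin.
by rewrite iter_integral_lin // IH2 big_cons mul1r.
Qed.

(** Moves the derivatives from chi to the functions [P l]. The weak equation then says that chi
    times one smooth function has integral 0, the form to which [fundamental_lemma] applies. *)
Lemma integral_by_parts_sum (P : 'I_m -> V -> R) (v g : V -> R) :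
  (forall l, smooth_on O (P l)) -> smooth_on O v -> smooth_on O g ->
  iter_integral (zext O (fun y => \sum_l 'D_(evec R l) chi y * P l y + chi y * v y)) =
  iter_integral (zext O (fun y => chi y * g y)) ->
  iter_integral (zext O (fun y => chi y * (v y - \sum_l 'D_(evec R l) (P l) y - g y))) = 0.
Proof.
move=> sP sv sg E.
have sdc l : smooth_on O ('D_(evec R l) chi) by exact: smooth_on_derive.
have sdP l : smooth_on O ('D_(evec R l) (P l)) by exact: smooth_on_derive.
pose A := zext O (fun y => \sum_l 'D_(evec R l) chi y * P l y + chi y * v y).
pose B := zext O (fun y => chi y * g y).
pose D l := zext O (fun y => 'D_(evec R l) chi y * P l y + chi y * 'D_(evec R l) (P l) y).
have s1 l : smooth_on O (fun y => 'D_(evec R l) chi y * P l y) by exact: smooth_onM.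
have CA : Cc A.
  apply: (Cc_zext oO bO).
    move=> y Oy; apply: contraNT; rewrite -ltNge => hy; rewrite big1 ?add0r => [|l _].
      by apply/eqP; exact: (far_eq0 hy (@chi_supp v y Oy)).
    exact: (far_eq0 hy (@dchi_supp l (P l) y Oy)).
  by apply: smooth_onD => //; [apply: smooth_on_sum => // l _; exact: s1|exact: smooth_onM].
have CB : Cc B by apply: (Cc_zext oO bO (@chi_supp g)); exact: smooth_onM.
have CD l : Cc (D l).
  apply: (Cc_zext oO bO).
    move=> y Oy; apply: contraNT; rewrite -ltNge => hy.
    rewrite (far_eq0 hy (@dchi_supp l (P l) y Oy)) add0r; apply/eqP.
    exact: (far_eq0 hy (@chi_supp ('D_(evec R l) (P l)) y Oy)).
  by apply: smooth_onD => //; exact: smooth_onM.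
have [CDs iDs] := iter_sum (index_enum 'I_m) CD.
have CBD := Cc_lin 1 CB CDs.
have -> : zext O (fun y => chi y * (v y - \sum_l 'D_(evec R l) (P l) y - g y)) =
    (fun y => -1 * (1 * B y + \sum_l D l y) + A y).
  apply/funext => y; have [Oy|nOy] := pselect (O y); last first.
    rewrite /A /B /D !zextN // big1 => [|l _]; last by rewrite zextN.
    by rewrite !mulr0 !addr0 mulr0.
  have ED l : D l y = 'D_(evec R l) chi y * P l y + chi y * 'D_(evec R l) (P l) y by rewrite /D zextE.
  rewrite (eq_bigr _ (fun l _ => ED l)) /A /B !zextE //.
  rewrite big_split /= -mulr_sumr; ring.
by rewrite iter_integral_lin // iter_integral_lin // iDs big1 ?addr0 ?mul1r => [|l _]; [rewrite -/B -E mulN1r addNr|exact: ibp].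
Qed.

End Bump.

(** The tests are nonnegative bumps around y0 only. If k(y0) > 0, a bump carried by the open set
    where k > 0 gives a positive integral; a negative value is handled by - k. *)
Lemma fundamental_lemma O (k : V -> R) (y0 : V) : open O -> O y0 -> smooth_on O k ->
  (forall chi r, bump_in O y0 chi r -> iter_integral (zext O (fun y => chi y * k y)) = 0) -> k y0 = 0.
Proof.
move=> oO Oy0; wlog k0 : k / 0 < k y0 => [H sk Hk|sk Hk].
  have [k0|k0|k0] := ltgtP (k y0) 0; last by [].
    have sN : smooth_on O (fun y => - k y) by exact: smooth_onN.
    have : (fun y => - k y) y0 = 0.
      apply: (H (fun y => - k y)) => //; first by rewrite oppr_gt0.
      move=> chi r bc; have Z := Hk _ _ bc; have [s c b h] := bc.
      have CF : Cc (zext O (fun y => chi y * k y)).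
        apply: (Cc_zext oO b).
          by move=> y _; rewrite mulf_eq0 negb_or => /andP[/h].
        by apply: smooth_onM => //; exact: smooth_on_sub s.
      have := iter_integral_lin (-1) CF (@Cc0 R m).
      rewrite Z mulr0 add0r => E0.
      have -> : zext O (fun y => chi y * - k y) = (fun y => -1 * zext O (fun y => chi y * k y) y + 0).
        apply/funext => y; have [Oy|nOy] := pselect (O y); last by rewrite !zextN // mulr0 addr0.
        by rewrite !zextE // addr0 mulN1r mulrN.
      rewrite E0; have := iter_integral_lin (-1) CF CF; rewrite Z mulr0 add0r => E1.
      by rewrite -[RHS]E1; congr iter_integral; apply/funext => y; rewrite mulN1r addNr.
    by move=> /= /eqP; rewrite oppr_eq0 => /eqP.
  exact: H.
have ck y : O y -> {for y, continuous k} by move=> Oy; exact: smooth_on_continuous sk Oy.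
pose O' := [set y | O y /\ 0 < k y].
have oO' : open O'.
  rewrite openE => y [Oy ky].
  have n0 : nbhs (k y) [set t | 0 < t] by apply: open_nbhs_nbhs; split=> //; exact: open_gt.
  have n1 : \forall z \near y, 0 < k z := ck y Oy _ n0.
  have n2 : \forall z \near y, O z by exact: open_nbhs_nbhs.
  exact: filterS2 _ n2 n1.
(* On the support of this bump k is positive, so the integrand is nonnegative everywhere and
   positive at y0. *)
have [chi [r [s c c0 b h]]] := bump_exists oO' (conj Oy0 k0 : O' y0).
have bc : bump_in O y0 chi r by split=> // y /b[].
have CF : Cc (zext O (fun y => chi y * k y)).
  apply: (Cc_zext oO (y0 := y0) (r := r)); first by move=> y /b[].
    by move=> y _; rewrite mulf_eq0 negb_or => /andP[/h].
  by apply: smooth_onM => //; exact: smooth_on_sub s.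
have F0 y : 0 <= zext O (fun y => chi y * k y) y.
  have [Oy|nOy] := pselect (O y); last by rewrite zextN.
  rewrite zextE //; have [->|cy] := eqVneq (chi y) 0; first by rewrite mul0r.
  by rewrite mulr_ge0 // ltW //; have [_] := b y (h y cy).
have : 0 < iter_integral (zext O (fun y => chi y * k y)).
  by apply: (iter_integral_gt0 (y0 := y0) CF F0); rewrite zextE // mulr_gt0.
by rewrite (Hk _ _ bc) ltxx.
Qed.

End ZeroExtension.

(** * Integrals of functions carried by a ball in a chart *)

Section ChartIntegral.
Variables (R : realType) (m : nat) (M : manifold R m).
Local Notation C := R[i].
Local Notation V := 'rV[R]_m.
Variables (mu : {measure set (borel M) -> \bar R}) (hmu : smooth_positive_density mu).

Lemma Cc_zext_cont (O : set V) (G : V -> R) (y0 : V) r : open O -> (forall y, `|y - y0| <= r -> O y) ->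
  (forall y, O y -> G y != 0 -> `|y - y0| <= r) -> (forall y, O y -> {for y, continuous G}) -> Cc (zext O G).
Proof.
move=> oO bO sG cG; split; first by move=> y; exact: (Ck_zext (k := 0) oO bO sG cG).
exists (`|y0| + r) => y hy; have [Oy|nOy] := pselect (O y); last exact: zextN.
rewrite zextE //; apply/eqP; apply: contraLR hy => /(sG y Oy) h; rewrite -leNgt.
by rewrite -[y](subrK y0) addrC; apply: (le_trans (ler_normD _ _)); rewrite lerD2l.
Qed.

Variables (c : chart R m M) (ac : atlas c) (O : set V) (y0 : V) (r : R).
Hypotheses (oO : open O) (Oimg : O `<=` cmap c @` cdom c) (bO : forall y, `|y - y0| <= r -> O y).

(** A compact subset of the chart domain that contains the supports of all integrands; being closed
    in M, it allows extension by zero to the whole manifold. *)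
Definition chart_ball : set M := cinv c @` [set y : V | `|y - y0| <= r].

Lemma chart_ball_compact : compact chart_ball.
Proof.
apply: continuous_compact.
  apply: continuous_in_subspaceT => y; rewrite inE /= => hy.
  by apply: cinv_continuous; apply: Oimg; exact: bO.
apply: (subclosed_compact _ (@compact_norm_ball R m (`|y0| + r))).
  rewrite -[X in closed X]setCK; apply: open_closedC.
  rewrite (_ : ~` _ = [set y | r < `|y - y0|]); first exact: open_far.
  by apply/seteqP; split=> y /=; rewrite ltNge => /negP.
move=> y /= hy; rewrite -[y](subrK y0) addrC; apply: (le_trans (ler_normD _ _)).
by rewrite lerD2l.
Qed.

Lemma chart_ball_closed : closed chart_ball.
Proof. by apply: compact_closed; [exact: mhausdorff|exact: chart_ball_compact]. Qed.

Lemma chart_ball_dom x : chart_ball x -> cdom c x /\ O (cmap c x).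
Proof.
move=> [y hy <-]; have [z cz Ez] := Oimg (bO hy).
by rewrite -Ez (cmapK cz) Ez; split=> //; exact: bO.
Qed.

Definition ball_supp (W : Type) (z : W) (f : M -> W) := forall x, f x <> z -> chart_ball x.

Lemma compact_supp (W : eqType) (z : W) (f : M -> W) : ball_supp z f ->
  compact (closure [set x | f x != z]) /\ closure [set x | f x != z] `<=` cdom c.
Proof.
move=> sf; have sub : closure [set x | f x != z] `<=` chart_ball.
  rewrite [X in _ `<=` X]((closure_id chart_ball).1 chart_ball_closed).
  by apply: closure_subset => x /eqP; exact: sf.
split; last by move=> x /sub /chart_ball_dom[].
by apply: (subclosed_compact _ chart_ball_compact sub); exact: closed_closure.
Qed.

Lemma chart_continuous (f : M -> R) (G : V -> R) : ball_supp 0 f -> (forall y, O y -> f (cinv c y) = G y) ->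
  (forall y, O y -> {for y, continuous G}) -> continuous f.
Proof.
move=> sf fG cG x; have [Kx|nKx] := pselect (chart_ball x).
  have [cx Ox] := chart_ball_dom Kx.
  have n1 : \forall z \near x, cdom c z by apply: open_nbhs_nbhs; split=> //; exact: cdom_open.
  have n2 : \forall z \near x, O (cmap c z).
    by have := cmap_continuous cx; apply; exact: open_nbhs_nbhs.
  have E : \forall z \near x, G (cmap c z) = f z.
    by apply: filterS2 n1 n2 => z cz Oz; rewrite -fG // (cmapK cz).
  have Ex : f x = G (cmap c x) by rewrite -fG // (cmapK cx).
  apply: (cvg_trans (near_eq_cvg E)); rewrite Ex.
  exact: (cvg_comp _ _ (cmap_continuous cx) (cG _ Ox)).
have E : \forall z \near x, (fun=> 0) z = f z.
  have : \forall z \near x, (~` chart_ball) z.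
    by apply: open_nbhs_nbhs; split=> //; apply: closed_openC; exact: chart_ball_closed.
  by apply: filterS => z nz; apply: esym; apply: contrapT => /sf.
have Ex : f x = 0 by apply: contrapT => /sf.
by apply: (cvg_trans (near_eq_cvg E)); rewrite Ex; exact: cvg_cst.
Qed.

Variable rho : V -> R.
Hypothesis srho : smooth_on (cmap c @` cdom c) rho.
Hypothesis hrho : forall f : M -> R, continuous f -> (forall x, 0 <= f x) ->
  compact (closure [set x | f x != 0]) -> closure [set x | f x != 0] `<=` cdom c ->
  (\int[mu]_x (f x)%:E)%E = (iter_integral (fun y => if y \in cmap c @` cdom c then f (cinv c y) * rho y else 0))%:E.

Lemma rho_cont y : O y -> {for y, continuous rho}.
Proof. by move=> /Oimg; exact: smooth_on_continuous srho. Qed.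

Lemma integral_ge0_chart (f : M -> R) (G : V -> R) : ball_supp 0 f -> (forall y, O y -> f (cinv c y) = G y) ->
  (forall y, O y -> {for y, continuous G}) -> (forall x, 0 <= f x) ->
  (\int[mu]_x (f x)%:E)%E = (iter_integral (zext O (fun y => G y * rho y)))%:E.
Proof.
move=> sf fG cG f0; have [cf1 cf2] := compact_supp sf.
rewrite (hrho (chart_continuous sf fG cG) f0 cf1 cf2); congr (iter_integral _)%:E; apply/funext => y.
have [Oy|nOy] := pselect (O y).
  by rewrite zextE // mem_set; [rewrite fG|exact: Oimg].
rewrite zextN //; case: ifPn => // /set_mem[x cx Ex].
have [->|fx] := eqVneq (f (cinv c y)) 0; first by rewrite mul0r.
have /sf : f (cinv c y) <> 0 by apply/eqP.
by rewrite -Ex (cmapK cx) => /chart_ball_dom[_]; rewrite Ex.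
Qed.

Lemma G_supp (f : M -> R) (G : V -> R) y : ball_supp 0 f -> (forall y, O y -> f (cinv c y) = G y) -> O y ->
  G y * rho y != 0 -> `|y - y0| <= r.
Proof.
move=> sf fG Oy; rewrite mulf_eq0 negb_or -fG // => /andP[/eqP/sf[y' hy' E] _].
have [x cx Ex] := Oimg Oy; have [x' cx' Ex'] := Oimg (bO hy').
by move: E; rewrite -Ex -Ex' (cmapK cx) (cmapK cx') => <-; rewrite Ex'.
Qed.

(** The density is described on nonnegative functions, so f is split into positive and negative
    parts. These are merely continuous, which is why continuity of G, and not smoothness, is the
    hypothesis here and in the preceding lemmas. *)
Lemma Rintegral_chart (f : M -> R) (G : V -> R) : ball_supp 0 f -> (forall y, O y -> f (cinv c y) = G y) ->
  (forall y, O y -> {for y, continuous G}) ->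
  (\int[mu]_x (f x))%R = iter_integral (zext O (fun y => G y * rho y)).
Proof.
move=> sf fG cG.
pose f1 x := Num.max (f x) 0; pose f2 x := Num.max (- f x) 0.
pose G1 y := Num.max (G y) 0; pose G2 y := Num.max (- G y) 0.
have s1 : ball_supp 0 f1.
  by move=> x h; apply: sf => fx; apply: h; rewrite /f1 fx maxxx.
have s2 : ball_supp 0 f2.
  by move=> x h; apply: sf => fx; apply: h; rewrite /f2 fx oppr0 maxxx.
have e1 y : O y -> f1 (cinv c y) = G1 y by move=> Oy; rewrite /f1 fG.
have e2 y : O y -> f2 (cinv c y) = G2 y by move=> Oy; rewrite /f2 fG.
have k1 y : O y -> {for y, continuous G1}.
  move=> Oy; have h0 : {for y, continuous (fun _ : V => 0 : R)} by apply: cst_continuous.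
  exact: (continuous_max (cG y Oy) h0).
have k2 y : O y -> {for y, continuous G2}.
  move=> Oy; have h0 : {for y, continuous (fun _ : V => 0 : R)} by apply: cst_continuous.
  exact: (continuous_max (continuousN (cG y Oy)) h0).
have p1 x : 0 <= f1 x by rewrite /f1 le_max lexx orbT.
have p2 x : 0 <= f2 x by rewrite /f2 le_max lexx orbT.
have I1 := integral_ge0_chart s1 e1 k1 p1; have I2 := integral_ge0_chart s2 e2 k2 p2.
rewrite /Rintegral integralE.
have -> : (fun x => (f x)%:E)^\+%E = (fun x => (f1 x)%:E) by apply/funext => x; rewrite funeposE EFin_max.
have -> : (fun x => (f x)%:E)^\-%E = (fun x => (f2 x)%:E) by apply/funext => x; rewrite funenegE EFin_max.
rewrite I1 I2 /=.
have C1 : Cc (zext O (fun y => G1 y * rho y)).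
  apply: (Cc_zext_cont oO bO) => [y Oy|y Oy]; first exact: (G_supp s1 e1 Oy).
  by apply: continuousM; [exact: k1|exact: rho_cont].
have C2 : Cc (zext O (fun y => G2 y * rho y)).
  apply: (Cc_zext_cont oO bO) => [y Oy|y Oy]; first exact: (G_supp s2 e2 Oy).
  by apply: continuousM; [exact: k2|exact: rho_cont].
have := iter_integral_lin (-1) C2 C1; rewrite mulN1r addrC => <-.
congr iter_integral; apply/funext => y; have [Oy|nOy] := pselect (O y); last first.
  by rewrite !zextN // mulr0 addr0.
rewrite !zextE // mulN1r addrC -mulrBl; congr (_ * _).
rewrite /G1 /G2; have [h|h] := leP 0 (G y).
  by rewrite max_r ?oppr_le0 // subr0.
by rewrite max_l ?oppr_ge0 ?ltW // sub0r opprK.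
Qed.

Lemma integralC_chart (f : M -> C) (G : V -> C) : ball_supp 0 f -> (forall y, O y -> f (cinv c y) = G y) ->
  smoothC_on O G ->
  integralC mu f = ((iter_integral (zext O (fun y => complex.Re (G y) * rho y))) +i*
                    (iter_integral (zext O (fun y => complex.Im (G y) * rho y))))%C.
Proof.
move=> sf fG [sR sI]; rewrite /integralC; congr (_ +i* _)%C; apply: Rintegral_chart.
- by move=> x h; apply: sf => fx; apply: h; rewrite fx.
- by move=> y Oy; rewrite fG.
- by move=> y Oy; exact: smooth_on_continuous sR Oy.
- by move=> x h; apply: sf => fx; apply: h; rewrite fx.
- by move=> y Oy; rewrite fG.
by move=> y Oy; exact: smooth_on_continuous sI Oy.
Qed.

End ChartIntegral.

Section ComplexParts.
Variables (R : realType) (m : nat).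
Local Notation C := R[i].

Lemma zext_congr (O : set 'rV[R]_m) (G G' : 'rV[R]_m -> R) : (forall y, G y = G' y) -> zext O G = zext O G'.
Proof. by move=> H; congr (zext O _); apply/funext. Qed.

Lemma Re_scale (u t : R) (z : C) : complex.Re (u%:C%C * z) * t = u * (complex.Re z * t).
Proof. by case: z => z1 z2 /=; rewrite mul0r subr0 mulrA. Qed.

Lemma Im_scale (u t : R) (z : C) : complex.Im (u%:C%C * z) * t = u * (complex.Im z * t).
Proof. by case: z => z1 z2 /=; rewrite mul0r addr0 mulrA. Qed.

Lemma Re_lin (I : finType) (u : I -> R) (P : I -> C) (s t : R) (v : C) :
  complex.Re (\sum_l (u l)%:C%C * P l + s%:C%C * v) * t = \sum_l u l * (complex.Re (P l) * t) + s * (complex.Re v * t).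
Proof.
rewrite ReD Re_sum mulrDl mulr_suml Re_scale; congr (_ + _).
by apply: eq_bigr => l _; exact: Re_scale.
Qed.

Lemma Im_lin (I : finType) (u : I -> R) (P : I -> C) (s t : R) (v : C) :
  complex.Im (\sum_l (u l)%:C%C * P l + s%:C%C * v) * t = \sum_l u l * (complex.Im (P l) * t) + s * (complex.Im v * t).
Proof.
rewrite ImD Im_sum mulrDl mulr_suml Im_scale; congr (_ + _).
by apply: eq_bigr => l _; exact: Im_scale.
Qed.

End ComplexParts.

(** * The adjoint of dbar_H in a local frame *)

Section AdjointFormula.
Variables (R : realType) (n r : nat).
Local Notation m := (n + n + r)%N.
Variables (M : manifold R m) (S : real_CR M n).
Local Notation C := R[i].
Local Notation V := 'rV[R]_m.
Local Notation VC := 'rV[C]_m.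
Local Notation ext := (ext R m).
Variables (mu : {measure set (borel M) -> \bar R}) (hmu : smooth_positive_density mu).
Variables (Dstar : (M -> ext) -> M -> ext) (hadj : formal_adjoint S mu (dbarH S) Dstar).
Variables (U : set M) (X : 'I_n -> M -> V) (E : M -> 'I_r -> V).
Hypothesis oU : open U.
Hypothesis hX : orthonormal_frameL S U X.
Hypothesis adE : forall x, U x -> adapted S x (X^~ x) (E x).
Local Notation cf := (cf S X E).
Local Notation frame_form := (frame_form S X E).
Local Notation dbar_eb := (dbar_eb S X E).
Local Notation Zb := (Zbarf S X).
Local Notation Zz := (Zf S X).

(** Matrix entries of the exterior multiplication. They are real, and the transposed matrix is that
    of the contraction: these two facts give the adjoint of [eps]. *)
Definition epsE j (T T' : {set 'I_m}) : C := eps (delta_mx 0 (ib r j)) (eb R T) T'.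

Lemma epsE_contr j T T' : epsE j T T' = ext_contr (delta_mx 0 (ib r j)) (eb R T') T.
Proof. by rewrite /epsE -edot_eb_r edot_eps edot_eb_l. Qed.

Lemma epsE_conj j T T' : conjc (epsE j T T') = epsE j T T'.
Proof.
rewrite /epsE -ext_conjE ext_conj_eps ext_conj_eb; congr (eps _ _ _).
by apply/rowP => k; rewrite !mxE; case: (_ && _); rewrite ?conjc1 ?conjc0.
Qed.

Lemma epsE_term j T T' (z : C) : conjc (epsE j T T' * conjc z) = epsE j T T' * z.
Proof. by rewrite rmorphM /= epsE_conj conjcK. Qed.

Lemma contr_expand j (w : ext) T : ext_contr (delta_mx 0 (ib r j)) w T = \sum_T' epsE j T T' * w T'.
Proof.
rewrite {1}[w]ext_eb linear_sum ext_sumE; apply: eq_bigr => T' _.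
by rewrite linearZ /= extZE -epsE_contr mulrC.
Qed.

Lemma gstar_cf x (a b : M -> ext) : U x ->
  gstar S x (a x) (b x) = \sum_(T | hset T) cf a x T * conjc (cf b x T).
Proof. by move=> Ux; exact: gstar_co (adE Ux) _ _. Qed.

Section AtPoint.
Variables (x0 : M) (Ux0 : U x0).
Let c := chart_at x0.
Let ac : atlas c := chart_at_atlas x0.
Let O := cmap c @` (U `&` cdom c).
Let y0 := cmap c x0.
Let oO : open O := chart_img_open c oU.
Let Oy0 : O y0. Proof. by exists x0 => //; split=> //; exact: chart_at_dom. Qed.
Let Oimg : O `<=` cmap c @` cdom c. Proof. by move=> y [x [_ cx] <-]; exists x. Qed.
Let OU y : O y -> U (cinv c y). Proof. by move=> [x [Ux cx] <-]; rewrite (cmapK cx). Qed.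

Definition zeta j l (y : V) : C := vecC_in c (cinv c y) (Zb j (cinv c y)) 0 l.

Let szeta j l : smoothC_on O (zeta j l). Proof. exact: (smooth_Zbarf oU hX j ac l). Qed.

Lemma vact_zeta j f y : O y -> smoothC_fun U f ->
  vfield_act (Zb j) f (cinv c y) = \sum_l zeta j l y * partialC l (f \o cinv c) y.
Proof.
move=> [x [Ux cx] <-] sf; rewrite (cmapK cx) (vfield_act_chart _ ac cx oU Ux sf).
by rewrite /zeta (cmapK cx).
Qed.

Section TestForm.
Variables (chi : V -> R) (rr : R) (T : {set 'I_m}).
Hypotheses (bc : bump_in O y0 chi rr) (hT : hset T).
Let K := chart_ball c y0 rr.
Let bO y : `|y - y0| <= rr -> O y. Proof. by case: bc => _ _ h _; exact: h. Qed.
Let cK : closed K := chart_ball_closed Oimg bO.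

Definition chiC (x : M) : C := (if x \in cdom c then chi (cmap c x) else 0)%:C%C.

Lemma chiC_supp x : chiC x <> 0 -> K x.
Proof.
rewrite /chiC; case: ifPn => // /set_mem cx h; exists (cmap c x); last exact: cmapK.
case: bc => _ _ _ /=; apply; apply/eqP => h0; apply: h; by rewrite h0.
Qed.

Let KU x : K x -> U x. Proof. by move=> /(chart_ball_dom Oimg bO)[cx [z [Uz cz]]] => Ez; rewrite -(cmapK cx) -Ez (cmapK cz). Qed.

Lemma chiC_inv y : O y -> chiC (cinv c y) = (chi y)%:C%C.
Proof. by move=> [x [_ cx] <-]; rewrite /chiC (cmapK cx) mem_set. Qed.

Lemma chiC_smooth : smoothC_fun setT chiC.
Proof.
apply: smoothC_fun_local => x _; have [Kx|nK] := pselect (K x).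
  have [cx _] := chart_ball_dom Oimg bO Kx.
  exists (U `&` cdom c); split; first by split=> //; exact: KU.
  have oUc : open (U `&` cdom c) by apply: openI => //; exact: cdom_open.
  apply: (smoothC_fun_chart ac oUc) => [z []//|].
  have oUcc := chart_img_open c oUc.
  apply: (smoothC_on_congr oUcc (f := fun y => (chi y)%:C%C)).
    by move=> y [z [[Uz cz] _] <-]; rewrite /= chiC_inv //; exists z.
  by apply: smoothC_on_real => //; case: bc => s _ _ _; exact: smooth_on_sub s.
exists (~` K); split=> //; have oK : open (~` K) by exact: closed_openC.
apply: (smoothC_fun_congr oK) (smoothC_fun_cst 0 oK) => z nz; apply: esym.
by apply: contrapT => /chiC_supp.
Qed.

Definition test_form (x : M) : ext := chiC x *: frame_form T x.

Lemma test_supp x : test_form x <> 0 -> K x.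
Proof. by move=> h; apply: chiC_supp => h0; apply: h; rewrite /test_form h0 scale0r. Qed.

Lemma chiC_smoothU : smoothC_fun U chiC. Proof. exact: smoothC_fun_sub chiC_smooth. Qed.

(** The adjunction speaks of global sections, so chi theta^T is extended by zero from the chart ball
    to all of M. *)
Lemma section_test : section S test_form.
Proof.
split.
  apply: smooth_form_local => x _; have [Kx|nK] := pselect (K x).
    exists U; split; first exact: KU.
    by apply: smooth_formZ => //; [exact: chiC_smoothU|exact: Thf_smooth].
  exists (~` K); split=> //; have oK : open (~` K) by exact: closed_openC.
  apply: (smooth_form_congr oK) (smooth_form0 oK) => z nz; apply: esym.
  by apply: contrapT => /test_supp.
move=> x; have [Ux|nU] := pselect (U x).
  apply/(LambdaH_co (adE Ux)); rewrite /test_form linearZ /= (ufK adE _ Ux); apply: suppZ; exact: supp_eb.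
rewrite /test_form (_ : chiC x = 0) ?scale0r; first exact: ext_span0.
by apply: contrapT => /chiC_supp /KU.
Qed.

Lemma cf_test x : U x -> cf test_form x = chiC x *: eb R T.
Proof. by move=> Ux; rewrite /cf /test_form linearZ /= (ufK adE _ Ux). Qed.

Lemma vact_test Z x : U x -> vact Z (cf test_form) x = vfield_act Z chiC x *: eb R T.
Proof.
move=> Ux; apply/ffunP => T'; rewrite vactE extZE ebE.
have E1 : \forall y \near x, cf test_form y T' = (T' == T)%:R * chiC y.
  by apply: (near_open_set oU Ux) => y Uy; rewrite cf_test // extZE ebE mulrC.
by rewrite (vact_near Z E1) (vactZ _ Z oU Ux chiC_smoothU) mulrC.
Qed.

Lemma cf_dbarH_test x : U x -> cf (dbarH S test_form) x =
  \sum_j vfield_act (Zb j) chiC x *: eps (delta_mx 0 (ib r j)) (eb R T) + chiC x *: dbar_eb T x.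
Proof.
move=> Ux; rewrite (dbarH_cf oU hX adE Ux section_test); congr (_ + _).
  by apply: eq_bigr => j _; rewrite vact_test // linearZ.
rewrite (bigD1 T) //= cf_test // extZE ebE eqxx mulr1 big1 ?addr0 // => T' /andP[_ ne].
by rewrite extZE ebE (negPf ne) mulr0 scale0r.
Qed.

End TestForm.

(* Testing the adjunction against chi theta^T, chi a bump function, and integrating
   by parts turns it into an equation between functions at x0. *)
Section Weak.
Variables (h : M -> ext) (sh : section S h) (T : {set 'I_m}) (hT : hset T).

(** For the test form a = chi theta^T, the integrand of (dbar_H a, h) is the sum of the (Zbar_j chi)
    [qf j] plus chi [vf], and that of (a, dbar_H^* h) is chi [gf]. In the chart, [flux l] collects
    all that multiplies the l-th partial derivative of chi. *)
Definition qf j (x : M) : C := \sum_(T' | hset T') epsE j T T' * conjc (cf h x T').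
Definition vf (x : M) : C := \sum_(T' | hset T') dbar_eb T x T' * conjc (cf h x T').
Definition gf (x : M) : C := conjc (cf (Dstar h) x T).
Definition flux l (y : V) : C := \sum_j zeta j l y * qf j (cinv c y).

Lemma smooth_cf_section w T' : section S w -> smoothC_fun U (fun x => cf w x T').
Proof. by move=> [sw hw]; apply: (smooth_cf oU hX adE) => [|x _]; [exact: smooth_form_sub sw|exact: hw]. Qed.

Lemma smooth_qf j : smoothC_fun U (qf j).
Proof.
apply: smoothC_fun_sum => // T' _; apply: smoothC_funM => //; first exact: smoothC_fun_cst.
by apply: smoothC_fun_conj => //; exact: smooth_cf_section.
Qed.

Lemma smooth_bT T' : smoothC_fun U (fun x => dbar_eb T x T').
Proof.
apply: (smooth_cf oU hX adE) => [|x _]; last exact: LambdaH_dbarH.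
by apply: smooth_dbarH => //; exact: Thf_smooth.
Qed.

Lemma smooth_vf : smoothC_fun U vf.
Proof.
apply: smoothC_fun_sum => // T' _; apply: smoothC_funM => //; first exact: smooth_bT.
by apply: smoothC_fun_conj => //; exact: smooth_cf_section.
Qed.

Lemma smooth_gf : smoothC_fun U gf.
Proof. by apply: smoothC_fun_conj => //; apply: smooth_cf_section; exact: hadj.1. Qed.

Lemma smooth_pf l : smoothC_on O (flux l).
Proof. by apply: smoothC_on_sum => // j _; apply: smoothC_onM => //; exact: (smooth_qf j ac). Qed.

Variable rho : V -> R.
Hypothesis srho : smooth_on (cmap c @` cdom c) rho.
Hypothesis hrho : forall f : M -> R, continuous f -> (forall x, 0 <= f x) ->
  compact (closure [set x | f x != 0]) -> closure [set x | f x != 0] `<=` cdom c ->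
  (\int[mu]_x (f x)%:E)%E = (iter_integral (fun y => if y \in cmap c @` cdom c then f (cinv c y) * rho y else 0))%:E.

Let srO : smooth_on O rho. Proof. exact: smooth_on_sub srho. Qed.

Lemma gstar0l x b : gstar S x 0 b = 0.
Proof. by rewrite /gstar big1 // => T' _; rewrite ext0E mul0r. Qed.

Lemma weak_identity chi rr : bump_in O y0 chi rr ->
  (iter_integral (zext O (fun y => \sum_l 'D_(evec R l) chi y * (complex.Re (flux l y) * rho y) + chi y * (complex.Re (vf (cinv c y)) * rho y))) =
   iter_integral (zext O (fun y => chi y * (complex.Re (gf (cinv c y)) * rho y)))) /\
  (iter_integral (zext O (fun y => \sum_l 'D_(evec R l) chi y * (complex.Im (flux l y) * rho y) + chi y * (complex.Im (vf (cinv c y)) * rho y))) =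
   iter_integral (zext O (fun y => chi y * (complex.Im (gf (cinv c y)) * rho y)))).
Proof.
move=> bc; have bO y : `|y - y0| <= rr -> O y by case: bc => _ _ h' _; exact: h'.
have cK := chart_ball_closed Oimg bO.
pose a := test_form chi T.
have sa : section S a by exact: (section_test bc hT).
pose G1 y : C := \sum_l ('D_(evec R l) chi y)%:C%C * flux l y + (chi y)%:C%C * vf (cinv c y).
pose G2 y : C := (chi y)%:C%C * gf (cinv c y).
have schi : smooth_on O chi by case: bc => s _ _ _; exact: smooth_on_sub s.
have sG1 : smoothC_on O G1.
  apply: smoothC_onD => //; last first.
    by apply: smoothC_onM => //; [exact: smoothC_on_real|exact: (smooth_vf ac)].
  apply: smoothC_on_sum => // l _; apply: smoothC_onM => //; last exact: smooth_pf.
  by apply: smoothC_on_real => //; exact: smooth_on_derive.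
have sG2 : smoothC_on O G2.
  by apply: smoothC_onM => //; [exact: smoothC_on_real|exact: (smooth_gf ac)].
have suppa : ball_supp c y0 rr 0 a by move=> x; exact: (test_supp bc).
have supp1 : ball_supp c y0 rr 0 (fun x => gstar S x (dbarH S a x) (h x)).
  move=> x hx; apply: contrapT => nK; apply: hx.
  (* Off the closed ball the test form vanishes near x, and dbar_H is local. *)
  have -> : dbarH S a x = 0.
    rewrite -(dbarH0 S x); apply: dbarH_near.
    apply: (near_open_set (U := ~` chart_ball c y0 rr)) => //; first exact: closed_openC.
    by move=> z nz; apply: contrapT => /suppa.
  exact: gstar0l.
have supp2 : ball_supp c y0 rr 0 (fun x => gstar S x (a x) (Dstar h x)).
  move=> x hx; apply: suppa => ax; apply: hx; rewrite ax; exact: gstar0l.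
have e1 y : O y -> gstar S (cinv c y) (dbarH S a (cinv c y)) (h (cinv c y)) = G1 y.
  move=> Oy; have Uy := OU Oy; rewrite (gstar_cf (dbarH S a) h Uy) (cf_dbarH_test bc hT Uy).
  under eq_bigr => T' _ do rewrite extDE extZE ext_sumE mulrDl.
  rewrite big_split /= /G1 (chiC_inv _ Oy); congr (_ + _); last first.
    by rewrite /vf mulr_sumr; apply: eq_bigr => T' _; rewrite -mulrA.
  transitivity (\sum_j vfield_act (Zb j) (chiC chi) (cinv c y) * qf j (cinv c y)).
    rewrite /qf; under [RHS]eq_bigr do rewrite mulr_sumr.
    rewrite [RHS]exchange_big; apply: eq_bigr => T' _; rewrite mulr_suml; apply: eq_bigr => j _.
    by rewrite extZE -mulrA.
  have dchi j : vfield_act (Zb j) (chiC chi) (cinv c y) = \sum_l zeta j l y * ('D_(evec R l) chi y)%:C%C.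
    rewrite (vact_zeta j Oy (chiC_smoothU bc)); apply: eq_bigr => l _; congr (_ * _).
    have E1 : \forall z \near y, (chiC chi \o cinv c) z = (chi z)%:C%C.
      by apply: (near_open oO Oy) => z Oz; exact: chiC_inv.
    rewrite (partialC_near l E1) /partialC /=; congr (_ +i* _)%C.
    by rewrite (_ : (fun y => _) = cst 0) // derive_cst.
  under eq_bigr do rewrite dchi mulr_suml.
  rewrite exchange_big; apply: eq_bigr => l _; rewrite /flux mulr_sumr; apply: eq_bigr => j _.
  by rewrite mulrA; congr (_ * _); exact: mulrC.
have e2 y : O y -> gstar S (cinv c y) (a (cinv c y)) (Dstar h (cinv c y)) = G2 y.
  move=> Oy; have Uy := OU Oy; rewrite (gstar_cf a (Dstar h) Uy) (cf_test chi T Uy).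
  rewrite (bigD1 T) //= extZE ebE eqxx mulr1 big1 ?addr0 => [|T' /andP[_ ne]].
    by rewrite (chiC_inv _ Oy).
  by rewrite extZE ebE (negPf ne) mulr0 mul0r.
have cs := (compact_supp Oimg bO suppa).1.
have [_ hA] := hadj; have := hA a h sa sh (or_introl cs).
move=> H0; have I1 := integralC_chart oO Oimg bO srho hrho supp1 e1 sG1.
have I2 := integralC_chart oO Oimg bO srho hrho supp2 e2 sG2.
have I12 := etrans (esym I1) (etrans H0 I2).
have cR := congr1 (@complex.Re R) I12; have cI := congr1 (@complex.Im R) I12.
split.
  have L := zext_congr O (fun y => Re_lin (fun l => 'D_(evec R l) chi y) (flux^~ y) (chi y) (rho y) (vf (cinv c y))).
  have L' := zext_congr O (fun y => Re_scale (chi y) (rho y) (gf (cinv c y))).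
  rewrite -L -L'; exact: cR.
have L := zext_congr O (fun y => Im_lin (fun l => 'D_(evec R l) chi y) (flux^~ y) (chi y) (rho y) (vf (cinv c y))).
have L' := zext_congr O (fun y => Im_scale (chi y) (rho y) (gf (cinv c y))).
rewrite -L -L'; exact: cI.
Qed.

(** The bumps are real valued, so the weak identity is separated into real and imaginary parts, each
    treated by integration by parts and the fundamental lemma at y0. *)
Lemma strong_identity : gf x0 * (rho y0)%:C%C =
  vf x0 * (rho y0)%:C%C - \sum_l partialC l (fun y => flux l y * (rho y)%:C%C) y0.
Proof.
have cx0 : cinv c y0 = x0 by exact: cmapK (chart_at_dom x0).
have rr1 (z : C) (u : R) : complex.Re (z * u%:C%C) = complex.Re z * u by case: z => z1 z2 /=; rewrite mulr0 subr0.
have rr2 (z : C) (u : R) : complex.Im (z * u%:C%C) = complex.Im z * u by case: z => z1 z2 /=; rewrite mulr0 add0r.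
have sRe (f : V -> C) : smoothC_on O f -> smooth_on O (fun y => complex.Re (f y) * rho y).
  by move=> [s1 _]; exact: smooth_onM.
have sIm (f : V -> C) : smoothC_on O f -> smooth_on O (fun y => complex.Im (f y) * rho y).
  by move=> [_ s2]; exact: smooth_onM.
have sdRe l : smooth_on O ('D_(evec R l) (fun y => complex.Re (flux l y) * rho y)).
  by apply: smooth_on_derive; apply: sRe; exact: smooth_pf.
have sdIm l : smooth_on O ('D_(evec R l) (fun y => complex.Im (flux l y) * rho y)).
  by apply: smooth_on_derive; apply: sIm; exact: smooth_pf.
have HR : complex.Re (vf (cinv c y0)) * rho y0 - \sum_l 'D_(evec R l) (fun y => complex.Re (flux l y) * rho y) y0 -
    complex.Re (gf (cinv c y0)) * rho y0 = 0.
  apply: (@fundamental_lemma R m O (fun y => complex.Re (vf (cinv c y)) * rho y -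
    \sum_l 'D_(evec R l) (fun y => complex.Re (flux l y) * rho y) y - complex.Re (gf (cinv c y)) * rho y) y0 oO Oy0).
    apply: smooth_onB => //; last exact: sRe (smooth_gf ac).
    by apply: smooth_onB => //; [exact: sRe (smooth_vf ac)|exact: smooth_on_sum].
  move=> chi rr bc; have [W _] := weak_identity bc.
  apply: (integral_by_parts_sum oO bc (P := fun l y => complex.Re (flux l y) * rho y)
    (v := fun y => complex.Re (vf (cinv c y)) * rho y) (g := fun y => complex.Re (gf (cinv c y)) * rho y)) W.
  - by move=> l; apply: sRe; exact: smooth_pf.
  - exact: sRe (smooth_vf ac).
  - exact: sRe (smooth_gf ac).
have HI : complex.Im (vf (cinv c y0)) * rho y0 - \sum_l 'D_(evec R l) (fun y => complex.Im (flux l y) * rho y) y0 -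
    complex.Im (gf (cinv c y0)) * rho y0 = 0.
  apply: (@fundamental_lemma R m O (fun y => complex.Im (vf (cinv c y)) * rho y -
    \sum_l 'D_(evec R l) (fun y => complex.Im (flux l y) * rho y) y - complex.Im (gf (cinv c y)) * rho y) y0 oO Oy0).
    apply: smooth_onB => //; last exact: sIm (smooth_gf ac).
    by apply: smooth_onB => //; [exact: sIm (smooth_vf ac)|exact: smooth_on_sum].
  move=> chi rr bc; have [_ W] := weak_identity bc.
  apply: (integral_by_parts_sum oO bc (P := fun l y => complex.Im (flux l y) * rho y)
    (v := fun y => complex.Im (vf (cinv c y)) * rho y) (g := fun y => complex.Im (gf (cinv c y)) * rho y)) W.
  - by move=> l; apply: sIm; exact: smooth_pf.
  - exact: sIm (smooth_vf ac).
  - exact: sIm (smooth_gf ac).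
rewrite cx0 in HR HI.
have ReP l : complex.Re (partialC l (fun y => flux l y * (rho y)%:C%C) y0) = 'D_(evec R l) (fun y => complex.Re (flux l y) * rho y) y0.
  exact: (congr1 (fun F : V -> R => 'D_(evec R l) F y0) (funext (fun y => rr1 (flux l y) (rho y)))).
have ImP l : complex.Im (partialC l (fun y => flux l y * (rho y)%:C%C) y0) = 'D_(evec R l) (fun y => complex.Im (flux l y) * rho y) y0.
  exact: (congr1 (fun F : V -> R => 'D_(evec R l) F y0) (funext (fun y => rr2 (flux l y) (rho y)))).
have ReN (z : C) : complex.Re (- z) = - complex.Re z by case: z.
have ImN (z : C) : complex.Im (- z) = - complex.Im z by case: z.
apply/eqP; rewrite eq_complex ReD ImD ReN ImN Re_sum Im_sum !rr1 !rr2.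
rewrite (eq_bigr _ (fun l _ => ReP l)) (eq_bigr _ (fun l _ => ImP l)).
by apply/andP; split; rewrite eq_sym -subr_eq0; apply/eqP.
Qed.

Hypothesis rho0 : 0 < rho y0.

(** The divergence of Zbar_j at x0 with respect to the density. *)
Definition dcoef j : C := (\sum_l partialC l (fun y => zeta j l y * (rho y)%:C%C) y0) / (rho y0)%:C%C.

(** The Leibniz rule in the divergence of the flux: derivatives that fall on [qf] reassemble into
    Zbar_j, those that fall on the components of Zbar_j and on the density give the divergence.
    Positivity of the density allows the division. *)
Lemma gf_formula : gf x0 = vf x0 - \sum_j vfield_act (Zb j) (qf j) x0 - \sum_j dcoef j * qf j x0.
Proof.
have cx0 : cinv c y0 = x0 by exact: cmapK (chart_at_dom x0).
have r0 : (rho y0)%:C%C != 0 :> C by apply/eqP => -[/eqP]; rewrite (gt_eqF rho0).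
have srC : smoothC_on O (fun y => (rho y)%:C%C) by exact: smoothC_on_real.
apply: (mulIf r0); rewrite strong_identity !mulrBl -addrA; apply: (congr1 (+%R _)).
rewrite -opprD; apply: (congr1 -%R).
have E1 l : partialC l (fun y => flux l y * (rho y)%:C%C) y0 =
  \sum_j (zeta j l y0 * (rho y0)%:C%C * partialC l (qf j \o cinv c) y0 +
         partialC l (fun y => zeta j l y * (rho y)%:C%C) y0 * qf j x0).
  have E2 : \forall y \near y0, flux l y * (rho y)%:C%C = \sum_j zeta j l y * (rho y)%:C%C * qf j (cinv c y).
    apply: (near_open oO Oy0) => y _; rewrite /flux mulr_suml; apply: eq_bigr => j _; exact: mulrAC.
  rewrite (partialC_near l E2) (partialC_sum _ _ oO Oy0) => [|j]; last first.
    by apply: smoothC_onM => //; [apply: smoothC_onM|exact: (smooth_qf j ac)].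
  apply: eq_bigr => j _; rewrite (partialCM l Oy0 _ (smooth_qf j ac)); last by apply: smoothC_onM.
  by rewrite [(qf j \o cinv c) y0]/= cx0.
rewrite (eq_bigr _ (fun l _ => E1 l)) exchange_big !mulr_suml -big_split; apply: eq_bigr => j _ /=.
rewrite big_split; apply: (congr2 +%R) => /=.
  rewrite -{1}cx0 (vact_zeta j Oy0 (smooth_qf j)) mulr_suml; apply: eq_bigr => l _; exact: mulrAC.
rewrite mulrAC /dcoef divfK // mulr_suml; by [].
Qed.

Lemma conj_qf j y : U y -> conjc (qf j y) = ext_contr (delta_mx 0 (ib r j)) (cf h y) T.
Proof.
move=> Uy; rewrite contr_expand rmorph_sum big_mkcond; apply: eq_bigr => T' _.
case: ifPn => hT'; last by rewrite (supp_cf adE Uy (sh.2 y)) // mulr0.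
exact: epsE_term.
Qed.

(** The conjugate of [gf_formula]. Conjugation turns Zbar_j acting on [qf] into Z_j acting on the
    coefficients of h, and the transpose of [eps] is the contraction; the minus sign is that of the
    integration by parts. *)
Lemma cf_Dstar_hset : cf (Dstar h) x0 T =
  - \sum_j ext_contr (delta_mx 0 (ib r j)) (vact (Zz j) (cf h) x0) T +
  \sum_(T' | hset T') (conjc (dbar_eb T x0 T') - \sum_j conjc (dcoef j) * epsE j T T') * cf h x0 T'.
Proof.
rewrite -[LHS]conjcK -/(gf x0) gf_formula !rmorphB /=.
have EZ j : conjc (vfield_act (Zb j) (qf j) x0) = ext_contr (delta_mx 0 (ib r j)) (vact (Zz j) (cf h) x0) T.
  have EZ1 : (fun y => map_mx conjc (Zz j y)) = Zb j by apply/funext => y; exact: (conj_Zv S y (X^~ y) j).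
  rewrite -[in LHS]EZ1 -(vact_conj (Zz j) oU Ux0 (smooth_qf j)).
  have E2 : \forall y \near x0, conjc (qf j y) = ext_contr (delta_mx 0 (ib r j)) (cf h y) T.
    by apply: (near_open_set oU Ux0) => y Uy; exact: conj_qf.
  rewrite (vact_near (Zz j) E2) -(vactE (Zz j) (fun y => ext_contr _ (cf h y))).
  apply: (congr1 (fun v : ext => v T)); apply: (vact_lin oU (ext_contr (delta_mx 0 (ib r j)))) => // T'.
  exact: smooth_cf_section.
have EV : conjc (vf x0) = \sum_(T' | hset T') conjc (dbar_eb T x0 T') * cf h x0 T'.
  by rewrite rmorph_sum; apply: eq_bigr => T' _; rewrite /= rmorphM /= conjcK.
have ED : \sum_j conjc (dcoef j * qf j x0) =
  \sum_(T' | hset T') (\sum_j conjc (dcoef j) * epsE j T T') * cf h x0 T'.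
  under [RHS]eq_bigr do rewrite mulr_suml.
  rewrite [RHS]exchange_big; apply: eq_bigr => j _; rewrite rmorphM rmorph_sum mulr_sumr /=.
  by apply: eq_bigr => T' _; rewrite epsE_term mulrA.
rewrite EV !rmorph_sum /= (eq_bigr _ (fun j _ => EZ j)) ED addrAC -sumrB addrC; apply: (congr1 (+%R _)).
by apply: eq_bigr => T' _; rewrite mulrBl.
Qed.

End Weak.

Lemma contr_hset j (w : ext) : supp hset w -> supp hset (ext_contr (delta_mx 0 (ib r j)) w).
Proof.
apply: supp_contr => k T _ kT; rewrite /hset (degD1 _ kT) addn_eq0.
by case/andP.
Qed.

(** The coefficients do not depend on h, and they vanish unless the second degree drops by one. The
    latter is recorded because the formula in the extreme degrees needs control of the zeroth order
    terms. *)
Lemma dbarHstar_point : exists beta : {set 'I_m} -> {set 'I_m} -> C,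
  (forall T T', beta T T' != 0 -> [/\ hset T, hset T' & deg kB T' = (deg kB T).+1]) /\
  forall h, section S h -> forall T, cf (Dstar h) x0 T =
    - \sum_j ext_contr (delta_mx 0 (ib r j)) (vact (Zz j) (cf h) x0) T + \sum_T' beta T T' * cf h x0 T'.
Proof.
have [rho [srho rho0 hrho]] := hmu ac.
pose b T T' : C := if hset T && hset T' then conjc (dbar_eb T x0 T') - \sum_j conjc (dcoef rho j) * epsE j T T' else 0.
exists b; split.
  move=> T T'; rewrite /b; case: ifP => [/andP[hT hT']|]; last by rewrite eqxx.
  move=> nz; split=> //; apply/eqP; apply: contraNT nz => ne; apply/eqP.
  have bd : bideg (deg kA T) (deg kB T) T by rewrite /bideg !eqxx.
  have -> : dbar_eb T x0 T' = 0.
    apply: (supp_bT oU adE Ux0 bd); apply: contraNN ne => /and3P[_ /eqP -> _]; exact: eqxx.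
  rewrite conjc0 sub0r big1 ?oppr0 // => j _; rewrite /epsE eps_coefd.
  case: ifPn => jT'; last by rewrite mulr0.
  rewrite ebE; case: eqP => [E1|_]; last by rewrite !mulr0.
  by move: ne; rewrite (degD1 kB jT') E1 kE add1n eqxx.
move=> h sh T; have [hT|nT] := boolP (hset T).
  rewrite (cf_Dstar_hset sh hT srho hrho (rho0 _ _)); last by exists x0 => //; exact: chart_at_dom.
  apply: (congr1 (+%R _)); rewrite big_mkcond; apply: eq_bigr => T' _; rewrite /b hT /=.
  by case: (hset T') => //; rewrite mul0r.
rewrite (supp_cf adE Ux0 ((hadj.1 _ sh).2 x0)) //.
rewrite [X in - X]big1 => [|j _]; last first.
  have sv : supp hset (vact (Zz j) (cf h) x0).
    by apply: (supp_vact oU) => // y Uy; exact: (supp_cf adE Uy (sh.2 y)).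
  exact: (contr_hset j sv nT).
by rewrite big1 ?oppr0 ?addr0 // => T' _; rewrite /b (negPf nT) mul0r.
Qed.

End AtPoint.

(* The zeroth order coefficients are obtained pointwise; they are smooth because
   dbar_H^* maps the smooth section chi theta^T' to a smooth section. *)
Lemma dbarHstar_cf : exists beta : {set 'I_m} -> {set 'I_m} -> M -> C,
  [/\ forall T T', smoothC_fun U (beta T T'),
      forall T T' x, beta T T' x != 0 -> [/\ hset T, hset T' & deg kB T' = (deg kB T).+1] &
      forall h x T, section S h -> U x -> cf (Dstar h) x T =
        - \sum_j ext_contr (delta_mx 0 (ib r j)) (vact (Zz j) (cf h) x) T + \sum_T' beta T T' x * cf h x T'].
Proof.
pose Pt x (b : {set 'I_m} -> {set 'I_m} -> C) :=
  (forall T T', b T T' != 0 -> [/\ hset T, hset T' & deg kB T' = (deg kB T).+1]) /\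
  forall h, section S h -> U x -> forall T, cf (Dstar h) x T =
    - \sum_j ext_contr (delta_mx 0 (ib r j)) (vact (Zz j) (cf h) x) T + \sum_T' b T T' * cf h x T'.
have ex x : exists b, Pt x b.
  have [Ux|nU] := pselect (U x); last by exists (fun _ _ => 0); split=> // T T'; rewrite eqxx.
  by have [b [b1 b2]] := dbarHstar_point Ux; exists b; split=> // h sh _ T; exact: b2.
have [b Hb] := choice ex.
have b2 h x T : section S h -> U x -> cf (Dstar h) x T =
    - \sum_j ext_contr (delta_mx 0 (ib r j)) (vact (Zz j) (cf h) x) T + \sum_T' b x T T' * cf h x T'.
  by move=> sh Ux; exact: ((Hb x).2 h sh Ux T).
exists (fun T T' x => b x T T'); split=> //; last by move=> T T' x; exact: (Hb x).1.
move=> T T'; have [hT'|nT'] := boolP (hset T'); last first.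
  apply: (smoothC_fun_congr oU) (smoothC_fun_cst 0 oU) => x _; apply: esym; apply/eqP.
  by apply: contraNT nT' => /((Hb x).1)[].
apply: smoothC_fun_local => x0 Ux0.
pose c := chart_at x0; pose O := cmap c @` (U `&` cdom c).
have oO : open O := chart_img_open c oU.
have Oy0 : O (cmap c x0) by exists x0 => //; split=> //; exact: chart_at_dom.
have [chi [rr [c1 c2 c3 c4 c5]]] := bump_exists oO Oy0.
have bc : bump_in O (cmap c x0) chi rr by split.
pose ch := chiC x0 chi; pose a := test_form x0 chi T'.
have sa : section S a := section_test bc hT'.
have nch : \forall x \near x0, U x /\ ch x != 0.
  have n1 : \forall x \near x0, U x by exact: (near_open_set oU Ux0).
  have n2 : \forall x \near x0, cdom c x.
    by apply: (near_open_set (cdom_open c)) => //; exact: chart_at_dom.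
  have cc : {for cmap c x0, continuous chi} by exact: (c1 0%N).
  have n3 : \forall y \near cmap c x0, 0 < chi y by exact: (cvgr_gt _ cc _ c3).
  have n4 : \forall x \near x0, 0 < chi (cmap c x) := cmap_continuous (chart_at_dom x0) n3.
  apply: filterS3 n1 n2 n4 => x Ux cx px; split=> //; rewrite /ch /chiC mem_set //.
  by apply/eqP => -[/eqP]; rewrite (gt_eqF px).
have [W [oW Wx0] WU] : exists2 W, open_nbhs x0 W & W `<=` [set x | U x /\ ch x != 0].
  by move: nch; rewrite -[X in X -> _]/(nbhs x0 _) nbhsE.
have sch : smoothC_fun W ch := smoothC_fun_sub (@subsetT _ W) (chiC_smooth bc).
have WsU : W `<=` U by move=> x /WU[].
exists W; split=> //.
pose G x := (cf (Dstar a) x T + \sum_j ext_contr (delta_mx 0 (ib r j)) (eb R T') T * vfield_act (Zz j) ch x) * (ch x)^-1.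
apply: (smoothC_fun_congr oW (f := G)).
  move=> x Wx; have [Ux nz] := WU x Wx; rewrite /G (b2 a x T sa Ux) (bigD1 T') //= [X in _ + (_ + X)]big1 => [|T'' ne]; last first.
    by rewrite (cf_test _ _ _ Ux) extZE ebE (negPf ne) !mulr0.
  rewrite addr0 (cf_test _ _ _ Ux) extZE ebE eqxx mulr1.
  rewrite (eq_bigr (fun j => ext_contr (delta_mx 0 (ib r j)) (eb R T') T * vfield_act (Zz j) ch x)) => [|j _].
    by rewrite addrAC addNr add0r mulfK.
  by rewrite (vact_test T' bc _ Ux) linearZ /= extZE mulrC.
apply: smoothC_funM => //; last by apply: smoothC_fun_inv => // x /WU[].
apply: smoothC_funD => //.
  by apply: smoothC_fun_sub WsU _; apply: smooth_cf_section; exact: hadj.1.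
apply: smoothC_fun_sum => // j _; apply: smoothC_funM => //; first exact: smoothC_fun_cst.
apply: smoothC_fun_sub WsU _; apply: (smooth_vact oU (smooth_Zf oU hX j)).
exact: smoothC_fun_sub (@subsetT _ U) (chiC_smooth bc).
Qed.

End AdjointFormula.

(** * First order operators and the formula *)

Section FirstOrder.
Variables (R : realType) (n r : nat).
Local Notation m := (n + n + r)%N.
Variables (M : manifold R m).
Local Notation C := R[i].
Local Notation VC := 'rV[C]_m.
Local Notation ext := (ext R m).
Local Notation mxf := ({set 'I_m} -> {set 'I_m} -> M -> C).
Variables (U : set M) (I : finType) (Y : I -> M -> VC).
Hypothesis oU : open U.
Hypothesis sY : forall i, smooth_cvf U (Y i).
Implicit Types (W : mxf) (phi : M -> ext) (F : (M -> ext) -> M -> ext).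

Definition smooth_coefs phi := forall T, smoothC_fun U (fun x => phi x T).
Definition smooth_mx W := forall T T', smoothC_fun U (W T T').

Definition mx_op W x (w : ext) : ext := [ffun T => \sum_T' W T T' x * w T'].

Lemma mopE W x w T : mx_op W x w T = \sum_T' W T T' x * w T'.
Proof. by rewrite [LHS]ffunE. Qed.

Lemma mop_linear W x : linear (mx_op W x).
Proof.
move=> k a b; apply/ffunP => T; rewrite extDE extZE !mopE mulr_sumr -big_split; apply: eq_bigr => T' _ /=.
by rewrite extDE extZE mulrDr mulrCA.
Qed.
HB.instance Definition _ W x := GRing.isLinear.Build C ext ext *:%R (mx_op W x) (mop_linear W x).

Definition mmul W W' : mxf := fun T T' x => \sum_T1 W T T1 x * W' T1 T' x.
Definition dmx (Z : M -> VC) W : mxf := fun T T' x => vfield_act Z (W T T') x.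
Definition gmx (G : ext -> ext) : mxf := fun T T' _ => G (eb R T') T.

Lemma mopM W W' x w : mx_op W x (mx_op W' x w) = mx_op (mmul W W') x w.
Proof.
apply/ffunP => T; rewrite !mopE /mmul; under [RHS]eq_bigr do rewrite mulr_suml.
rewrite [RHS]exchange_big; apply: eq_bigr => T1 _; rewrite mopE mulr_sumr.
by apply: eq_bigr => T' _; rewrite mulrA.
Qed.

Lemma mop_gmx (G : {linear ext -> ext}) x w : mx_op (gmx G) x w = G w.
Proof.
apply/ffunP => T; rewrite mopE [in RHS](ext_eb w) linear_sum ext_sumE.
by apply: eq_bigr => T' _; rewrite linearZ /= extZE mulrC.
Qed.

Lemma smx_mmul W W' : smooth_mx W -> smooth_mx W' -> smooth_mx (mmul W W').
Proof. by move=> s s' T T'; apply: smoothC_fun_sum => // T1 _; exact: smoothC_funM. Qed.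

Lemma smx_gmx G : smooth_mx (gmx G).
Proof. by move=> T T'; exact: smoothC_fun_cst. Qed.

Lemma smx_dmx i W : smooth_mx W -> smooth_mx (dmx (Y i) W).
Proof. by move=> s T T'; exact: smooth_vact. Qed.

Lemma smf_mop W phi : smooth_mx W -> smooth_coefs phi -> smooth_coefs (fun x => mx_op W x (phi x)).
Proof.
move=> sW sphi T; apply: (smoothC_fun_congr oU (f := fun x => \sum_T' W T T' x * phi x T')).
  by move=> x _; rewrite mopE.
by apply: smoothC_fun_sum => // T' _; exact: smoothC_funM.
Qed.

Lemma smf_vact i phi : smooth_coefs phi -> smooth_coefs (vact (Y i) phi).
Proof.
move=> sphi T; apply: (smoothC_fun_congr oU (f := vfield_act (Y i) (fun x => phi x T))).
  by move=> x _; rewrite vactE.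
exact: smooth_vact.
Qed.

Lemma smf_lin (G : {linear ext -> ext}) phi : smooth_coefs phi -> smooth_coefs (fun x => G (phi x)).
Proof. by move=> sphi T; apply: smoothC_fun_lin. Qed.

Lemma smf_sum (J : finType) (P : J -> M -> ext) : (forall j, smooth_coefs (P j)) -> smooth_coefs (fun x => \sum_j P j x).
Proof.
move=> s T; apply: (smoothC_fun_congr oU (f := fun x => \sum_j P j x T)).
  by move=> x _; rewrite ext_sumE.
by apply: smoothC_fun_sum => // j _; exact: s.
Qed.

Lemma vactD i phi phi' x : U x -> smooth_coefs phi -> smooth_coefs phi' ->
  vact (Y i) (fun y => phi y + phi' y) x = vact (Y i) phi x + vact (Y i) phi' x.
Proof.
move=> Ux s s'; apply/ffunP => T; rewrite extDE !vactE.
have E1 : \forall y \near x, (phi y + phi' y) T = \sum_(b : bool) (if b then phi y T else phi' y T).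
  by apply: (near_open_set oU Ux) => y _; rewrite big_bool extDE.
rewrite (vact_near (Y i) E1) (vact_sum _ (Y i) oU Ux (F := fun (b : bool) y => if b then phi y T else phi' y T)).
  by rewrite big_bool.
by case.
Qed.

Lemma vact_sumf (J : finType) i (P : J -> M -> ext) x : U x -> (forall j, smooth_coefs (P j)) ->
  vact (Y i) (fun y => \sum_j P j y) x = \sum_j vact (Y i) (P j) x.
Proof.
move=> Ux s; apply/ffunP => T; rewrite ext_sumE vactE.
have E1 : \forall y \near x, (\sum_j P j y) T = \sum_j P j y T.
  by apply: (near_open_set oU Ux) => y _; rewrite ext_sumE.
rewrite (vact_near (Y i) E1) (vact_sum _ (Y i) oU Ux) => [|j]; last exact: s.
by apply: eq_bigr => j _; rewrite vactE.
Qed.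

Lemma vact_mop i W phi x : U x -> smooth_mx W -> smooth_coefs phi ->
  vact (Y i) (fun y => mx_op W y (phi y)) x = mx_op (dmx (Y i) W) x (phi x) + mx_op W x (vact (Y i) phi x).
Proof.
move=> Ux sW sphi; apply/ffunP => T; rewrite extDE !mopE vactE.
have E1 : \forall y \near x, mx_op W y (phi y) T = \sum_T' W T T' y * phi y T'.
  by apply: (near_open_set oU Ux) => y _; rewrite mopE.
rewrite (vact_near (Y i) E1) (vact_sum _ (Y i) oU Ux) => [|T']; last exact: smoothC_funM.
rewrite -big_split; apply: eq_bigr => T' _.
by rewrite (vactM (Y i) oU Ux (sW T T') (sphi T')) addrC vactE.
Qed.

(* O_H(1) as an operator on all coordinates. *)
Definition first_order F := exists (A : I -> mxf) (B : mxf), [/\ forall i, smooth_mx (A i), smooth_mx B &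
  forall phi x, smooth_coefs phi -> U x -> F phi x = \sum_i mx_op (A i) x (vact (Y i) phi x) + mx_op B x (phi x)].

Lemma fo_congr F F' : (forall phi x, smooth_coefs phi -> U x -> F phi x = F' phi x) -> first_order F' -> first_order F.
Proof.
move=> FF [A [B [sA sB E]]]; exists A, B; split=> // phi x sphi Ux.
by rewrite FF // E.
Qed.

Lemma mop0 x w : mx_op (fun _ _ _ => 0) x w = 0.
Proof. by apply/ffunP => T; rewrite mopE ext0E big1 // => T' _; rewrite mul0r. Qed.

Lemma mopDl W W' x w : mx_op (fun T T' y => W T T' y + W' T T' y) x w = mx_op W x w + mx_op W' x w.
Proof.
by apply/ffunP => T; rewrite extDE !mopE -big_split; apply: eq_bigr => T' _; rewrite mulrDl.
Qed.

Lemma fo_mop W : smooth_mx W -> first_order (fun phi x => mx_op W x (phi x)).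
Proof.
move=> sW; exists (fun _ _ _ _ => 0), W; split=> // [i T T'|phi x _ _].
  exact: smoothC_fun_cst.
by rewrite big1 ?add0r // => i _; exact: mop0.
Qed.

Lemma fo_vact i : first_order (fun phi x => vact (Y i) phi x).
Proof.
exists (fun j => gmx (if j == i then idfun else (fun=> 0))), (fun _ _ _ => 0); split.
- by move=> j; exact: smx_gmx.
- by move=> T T'; exact: smoothC_fun_cst.
move=> phi x _ _; rewrite mop0 addr0 (bigD1 i) //= eqxx (mop_gmx (idfun : {linear ext -> ext})) /=.
rewrite big1 ?addr0 // => j /negPf ->.
rewrite -[RHS](mop0 x (vact (Y j) phi x)); congr (mx_op _ _ _); apply/funext => T; apply/funext => T'; apply/funext => y.
exact: ext0E.
Qed.

Lemma foD F F' : first_order F -> first_order F' -> first_order (fun phi x => F phi x + F' phi x).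
Proof.
move=> [A [B [sA sB E]]] [A' [B' [sA' sB' E']]].
exists (fun i T T' y => A i T T' y + A' i T T' y), (fun T T' y => B T T' y + B' T T' y); split.
- by move=> i T T'; apply: smoothC_funD => //; [exact: sA|exact: sA'].
- by move=> T T'; exact: smoothC_funD.
move=> phi x sphi Ux; rewrite E // E' // mopDl addrACA -big_split; apply: (congr2 +%R) => //.
by apply: eq_bigr => i _; exact: esym (mopDl _ _ _ _).
Qed.

Lemma fo0 : first_order (fun _ _ => 0).
Proof.
apply: (fo_congr (F' := fun phi x => mx_op (fun _ _ _ => 0) x (phi x))) => [phi x _ _|].
  by rewrite mop0.
by apply: fo_mop => T T'; exact: smoothC_fun_cst.
Qed.

Lemma fo_sum (J : finType) (F : J -> (M -> ext) -> M -> ext) : (forall j, first_order (F j)) ->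
  first_order (fun phi x => \sum_j F j phi x).
Proof.
move=> H; suff K (s : seq J) : first_order (fun phi x => \sum_(j <- s) F j phi x) by exact: K.
elim: s => [|j s IH].
  by apply: fo_congr fo0 => phi x _ _; rewrite big_nil.
by apply: fo_congr (foD (H j) IH) => phi x _ _; rewrite big_cons.
Qed.

Lemma fo_mopl W F : smooth_mx W -> first_order F -> first_order (fun phi x => mx_op W x (F phi x)).
Proof.
move=> sW [A [B [sA sB E]]]; exists (fun i => mmul W (A i)), (mmul W B); split.
- by move=> i; exact: smx_mmul.
- exact: smx_mmul.
move=> phi x sphi Ux; rewrite E // linearD linear_sum /= mopM; apply: (congr2 +%R) => //.
by apply: eq_bigr => i _; rewrite mopM.
Qed.

Lemma fo_linl (G : {linear ext -> ext}) F : first_order F -> first_order (fun phi x => G (F phi x)).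
Proof.
move=> fF; apply: fo_congr (fo_mopl (smx_gmx G) fF) => phi x _ _; by rewrite mop_gmx.
Qed.

Lemma foN F : first_order F -> first_order (fun phi x => - F phi x).
Proof. exact: (fo_linl (-%R : {linear ext -> ext})). Qed.

(** By the Leibniz rule the derivatives of the entries of [W] enter the zeroth order part. This is
    used to conjugate an error term by gamma. *)
Lemma fo_mopr W F : smooth_mx W -> first_order F -> first_order (fun phi => F (fun y => mx_op W y (phi y))).
Proof.
move=> sW [A [B [sA sB E]]].
apply: (fo_congr (F' := fun phi x => \sum_i (mx_op (mmul (A i) (dmx (Y i) W)) x (phi x) +
   mx_op (mmul (A i) W) x (vact (Y i) phi x)) + mx_op (mmul B W) x (phi x))).
  move=> phi x sphi Ux; rewrite E //; last exact: smf_mop.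
  rewrite mopM; apply: (congr2 +%R) => //; apply: eq_bigr => i _.
  by rewrite vact_mop // linearD /= !mopM.
apply: foD; last by apply: fo_mop; exact: smx_mmul.
apply: fo_sum => i; apply: foD.
  by apply: fo_mop; apply: smx_mmul => //; exact: smx_dmx.
by apply: fo_mopl (fo_vact i); exact: smx_mmul.
Qed.

(** The leading coefficients [G] and [H] are constant in the frame, so vector fields pass through
    them freely and the second order part of the composite keeps the order in which the fields are
    applied. Every other term contains at most one derivative. *)
Lemma fo_comp (J K : finType) (a : J -> I) (b : K -> I) (G : J -> {linear ext -> ext}) (H : K -> {linear ext -> ext})
    (W W' : mxf) : smooth_mx W -> smooth_mx W' ->
  let psi phi y := \sum_k H k (vact (Y (b k)) phi y) + mx_op W y (phi y) in
  first_order (fun phi x => \sum_j G j (vact (Y (a j)) (psi phi) x) + mx_op W' x (psi phi x) -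
    \sum_j \sum_k G j (H k (vact (Y (a j)) (vact (Y (b k)) phi) x))).
Proof.
move=> sW sW' psi.
apply: (fo_congr (F' := fun phi x => \sum_j G j (mx_op (dmx (Y (a j)) W) x (phi x) + mx_op W x (vact (Y (a j)) phi x)) +
   mx_op W' x (psi phi x))).
  move=> phi x sphi Ux; rewrite addrAC; apply: (congr2 +%R) => //; apply/eqP; rewrite subr_eq addrC -big_split /=.
  apply/eqP; apply: eq_bigr => j _.
  have sH k : smooth_coefs (fun y => H k (vact (Y (b k)) phi y)) by apply: smf_lin; exact: smf_vact.
  rewrite (vactD _ Ux (smf_sum sH) (smf_mop sW sphi)) (vact_sumf _ Ux sH) vact_mop //.
  rewrite linearD linear_sum; apply: (congr2 +%R) => //; apply: eq_bigr => k _.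
  by rewrite (vact_lin oU) //; exact: smf_vact.
apply: foD.
  apply: fo_sum => j; apply: fo_linl; apply: foD; first by apply: fo_mop; exact: smx_dmx.
  by apply: fo_mopl => //; exact: fo_vact.
apply: fo_mopl => //; apply: foD; last exact: fo_mop.
by apply: fo_sum => k; apply: fo_linl; exact: fo_vact.
Qed.

End FirstOrder.

Lemma zmod_shift (V : zmodType) (a b a' b' : V) : a - b = (a' - b') + (a - a' - (b - b')).
Proof. by rewrite opprB addrACA addKr [a' + _]addrC subrK. Qed.

(** The relabelling of j and k in one half of each sum. With a, b built on Zbar_j Z_k and a', b' on
    Z_j Zbar_k, it groups the four second order terms of Q_L under common coefficients without
    reordering any derivative. *)
Lemma zmod_swap (V : zmodType) (J : finType) (a b a' b' : J -> J -> V) (f g : V) :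
  (\sum_j \sum_k (a j k - b' k j) + f) - (\sum_j \sum_k (b j k - a' k j) + g) =
  \sum_j \sum_k (a j k + a' j k - (b j k + b' j k)) + (f - g).
Proof.
have E (u v : J -> J -> V) : \sum_j \sum_k (u j k - v k j) = \sum_j \sum_k u j k - \sum_j \sum_k v j k.
  by rewrite [X in _ = _ - X]exchange_big -sumrB; apply: eq_bigr => j _; rewrite -sumrB.
have -> : \sum_j \sum_k (a j k + a' j k - (b j k + b' j k)) =
  (\sum_j \sum_k a j k + \sum_j \sum_k a' j k) - (\sum_j \sum_k b j k + \sum_j \sum_k b' j k).
  by rewrite -!big_split -sumrB; apply: eq_bigr => j _; rewrite -!big_split -sumrB.
rewrite (E a b') (E b a') opprD addrACA; congr (_ + _).
by rewrite opprB addrACA; congr (_ + _); rewrite opprD addrC.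
Qed.

(** * The operator Q_L in a local frame *)

Section LocalFormula.
Variables (R : realType) (n r : nat).
Local Notation m := (n + n + r)%N.
Variables (M : manifold R m) (S : real_CR M n).
Local Notation C := R[i].
Local Notation V := 'rV[R]_m.
Local Notation VC := 'rV[C]_m.
Local Notation ext := (ext R m).
Variables (mu : {measure set (borel M) -> \bar R}) (hmu : smooth_positive_density mu).
Variables (Dstar : (M -> ext) -> M -> ext) (hadj : formal_adjoint S mu (dbarH S) Dstar).
Variables (U : set M) (X : 'I_n -> M -> V) (E : M -> 'I_r -> V).
Hypothesis oU : open U.
Hypothesis hX : orthonormal_frameL S U X.
Hypothesis adE : forall x, U x -> adapted S x (X^~ x) (E x).
Local Notation cf := (cf S X E).
Local Notation dbar_eb := (dbar_eb S X E).
Local Notation Zb := (Zbarf S X).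
Local Notation Zz := (Zf S X).
Local Notation dl j := (delta_mx 0 (ib r j)).
Local Notation ee j := (eps (dl j)).
Local Notation cc j := (ext_contr (dl j)).
Local Notation Gm := (Gam (lamv R n r)).
Local Notation smooth_coefs := (smooth_coefs U).

Definition Yf (p : bool * 'I_n) : M -> VC := if p.1 then Zz p.2 else Zb p.2.

Lemma smooth_Yf p : smooth_cvf U (Yf p).
Proof. by case: p => -[] j; [exact: (smooth_Zf oU hX j)|exact: (smooth_Zbarf oU hX j)]. Qed.

Lemma contrN (v : VC) (w : ext) : ext_contr (- v) w = - ext_contr v w.
Proof. by have := contr_linear_l w (-1) v 0; rewrite addr0 !scaleN1r => ->; rewrite contr0l addr0. Qed.

Lemma ec_swap j k (u v : ext) : ee j (cc k u) - cc k (ee j v) = ext_contr (- dl k) (ee j v) - ee j (ext_contr (- dl k) u).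
Proof.
have A : ee j (ext_contr (- dl k) u) = - ee j (cc k u).
  exact: (etrans (congr1 (ee j) (contrN _ _)) (linearN (ee j : {linear ext -> ext}) _)).
by rewrite A contrN opprK addrC.
Qed.

Lemma ecD j k (u v : ext) : ee j (cc k (u + v)) - cc j (ee k (u + v)) =
  ee j (cc k u) + ee j (cc k v) - (cc j (ee k u) + cc j (ee k v)).
Proof. by rewrite !linearD. Qed.

Lemma smf_cf w : section S w -> smooth_coefs (cf w).
Proof. by move=> sw T; exact: (smooth_cf_section oU hX adE). Qed.

Lemma dbarH_form : exists2 W, smooth_mx U W & forall w x, section S w -> U x ->
  cf (dbarH S w) x = \sum_j ee j (vact (Yf (false, j)) (cf w) x) + mx_op W x (cf w x).
Proof.
exists (fun T T' x => if hset T' then dbar_eb T' x T else 0).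
  move=> T T'; case: (boolP (hset T')) => hT'; last exact: smoothC_fun_cst.
  exact: (smooth_bT oU hX adE hT' T).
move=> w x sw Ux; rewrite (dbarH_cf oU hX adE Ux sw); apply: (congr1 (+%R _)).
apply/ffunP => T; rewrite mopE ext_sumE big_mkcond; apply: eq_bigr => T' _.
by case: (hset T'); [rewrite extZE mulrC|rewrite mul0r].
Qed.

(** The minus sign is put inside the contraction, so that the leading coefficients are linear maps
    of the shape that [fo_comp] takes. *)
Lemma dbarHstar_form : exists2 W, smooth_mx U W & forall w x, section S w -> U x ->
  cf (Dstar w) x = \sum_j ext_contr (- dl j) (vact (Yf (true, j)) (cf w) x) + mx_op W x (cf w x).
Proof.
have [W [sW _ HW]] := dbarHstar_cf hmu hadj oU hX adE; exists W => // w x sw Ux.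
apply/ffunP => T; rewrite HW // extDE mopE ext_sumE; apply: (congr2 +%R) => //.
rewrite -sumrN; apply: eq_bigr => j _; by rewrite contrN extNE.
Qed.

Definition dbar_comm_lead (phi : M -> ext) x : ext := \sum_j \sum_k
  (ee j (cc k (vact (Zb j) (vact (Zz k) phi) x)) - cc k (ee j (vact (Zz k) (vact (Zb j) phi) x))).

Definition dbar_comm w y : ext := Dstar (dbarH S w) y - dbarH S (Dstar w) y.

(** Each of the two compositions is known up to first order by [fo_comp]; the sum of the two error
    operators is [F]. *)
Lemma comm_form : exists2 F, first_order U Yf F & forall w x, section S w -> U x ->
  cf (dbar_comm w) x = dbar_comm_lead (cf w) x + F (cf w) x.
Proof.
have [W1 s1 H1] := dbarH_form; have [W2 s2 H2] := dbarHstar_form.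
have f1 := fo_comp oU smooth_Yf (fun k => (true, k)) (fun j => (false, j))
  (fun k => ext_contr (- dl k) : {linear ext -> ext}) (fun j => ee j : {linear ext -> ext}) s1 s2.
have f2 := fo_comp oU smooth_Yf (fun j => (false, j)) (fun k => (true, k))
  (fun j => ee j : {linear ext -> ext}) (fun k => ext_contr (- dl k) : {linear ext -> ext}) s2 s1.
refine (ex_intro2 _ _ _ (foD oU f1 (foN oU f2)) _).
move=> w x sw Ux /=; rewrite [cf (dbar_comm w) x]linearB /=.
have sD := section_dbarH sw; have sDs := hadj.1 _ sw.
have E1 : cf (Dstar (dbarH S w)) x = \sum_k ext_contr (- dl k) (vact (Yf (true, k))
    (fun y => \sum_j ee j (vact (Yf (false, j)) (cf w) y) + mx_op W1 y (cf w y)) x) +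
    mx_op W2 x (\sum_j ee j (vact (Yf (false, j)) (cf w) x) + mx_op W1 x (cf w x)).
  rewrite (H2 _ _ sD Ux) (H1 _ _ sw Ux); apply: (congr1 (+%R^~ _)); apply: eq_bigr => k _.
  by apply: (congr1 (ext_contr (- dl k))); apply: (vact_congr oU _ Ux) => y Uy; exact: H1.
have E2 : cf (dbarH S (Dstar w)) x = \sum_j ee j (vact (Yf (false, j))
    (fun y => \sum_k ext_contr (- dl k) (vact (Yf (true, k)) (cf w) y) + mx_op W2 y (cf w y)) x) +
    mx_op W1 x (\sum_k ext_contr (- dl k) (vact (Yf (true, k)) (cf w) x) + mx_op W2 x (cf w x)).
  rewrite (H1 _ _ sDs Ux) (H2 _ _ sw Ux); apply: (congr1 (+%R^~ _)); apply: eq_bigr => k _.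
  by apply: (congr1 (ee k)); apply: (vact_congr oU _ Ux) => y Uy; exact: H2.
rewrite -!/(cf _ x) E1 E2; set a := _ + mx_op W2 x _; set b := _ + mx_op W1 x _.
set a' := \sum_k \sum_j _; set b' := \sum_j \sum_k _.
have -> : dbar_comm_lead (cf w) x = a' - b'; last exact: zmod_shift.
rewrite /a' /b' exchange_big -sumrB; apply: eq_bigr => j _; rewrite -sumrB; apply: eq_bigr => k _.
exact: ec_swap.
Qed.

Lemma kC_ibN j : ~~ @kC n r (ib r j). Proof. by rewrite kE. Qed.

Lemma supp_vact2 p q phi x : U x -> (forall y, U y -> supp hset (phi y)) ->
  supp hset (vact (Yf p) (vact (Yf q) phi) x).
Proof.
by move=> Ux h; apply: (supp_vact oU) => // y Uy; apply: (supp_vact oU).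
Qed.

Lemma supp_eps_hset j (w : ext) : supp hset w -> supp hset (ee j w).
Proof.
apply: supp_eps => k T; rewrite mxE eqxx /=; case: (k =P ib r j) => [->|_]; last by rewrite eqxx.
by move=> _ kT; rewrite /hset degU1 // kE.
Qed.

Lemma Gam_ec j k (w : ext) : supp hset w -> Gm (ee j (cc k (Gm w))) = cc j (ee k w).
Proof.
move=> sw; have l2 := lamv2 R n r; have sG := supp_Gam (lamv R n r) w.
rewrite (Gam_eps l2) ?kC_ibN //; last exact: contr_hset.
rewrite Gam_contr ?kC_ibN //. rewrite (GamK l2) // linearZ /= scalerA mulrN -expr2 sqr_i opprK; exact: scale1r.
Qed.

Lemma Gam_ce j k (w : ext) : supp hset w -> Gm (cc k (ee j (Gm w))) = ee k (cc j w).
Proof.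
move=> sw; have l2 := lamv2 R n r; have sG := supp_Gam (lamv R n r) w.
rewrite Gam_contr ?kC_ibN //; last exact: supp_eps_hset.
rewrite (Gam_eps l2) ?kC_ibN //. rewrite (GamK l2) // linearZ /= scalerA mulNr -expr2 sqr_i opprK; exact: scale1r.
Qed.

Lemma QL_form : exists2 F, first_order U Yf F & forall w x, section S w -> U x ->
  cf (QL S Dstar w) x = \sum_j \sum_k (ee j (cc k (vact (Zb j) (vact (Zz k) (cf w)) x + vact (Zz j) (vact (Zb k) (cf w)) x)) -
     cc j (ee k (vact (Zb j) (vact (Zz k) (cf w)) x + vact (Zz j) (vact (Zb k) (cf w)) x))) + F (cf w) x.
Proof.
have [F fF HF] := comm_form.
(* Inside [F] gamma is written as a matrix operator with constant entries, the form required by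
   [fo_mopr]. *)
have fG : first_order U Yf (fun phi x => Gm (F (fun y => mx_op (gmx Gm) y (phi y)) x)).
  by apply: (fo_linl oU); apply: (fo_mopr oU smooth_Yf) => //; exact: smx_gmx.
exists (fun phi x => F phi x - Gm (F (fun y => mx_op (gmx Gm) y (phi y)) x)).
  exact: (foD oU fF (foN oU fG)).
move=> w x sw Ux; have sc := section_chirality sw; set w' := (fun y => chirality S y (w y)) in sc.
have hw y : U y -> supp hset (cf w y) by move=> Uy; exact: (supp_cf adE Uy (sw.2 y)).
have Ew' y : U y -> cf w' y = Gm (cf w y).
  move=> Uy; rewrite /cf /w' (chirality_co (adE Uy)) (unK (adE Uy)) restr_id //; exact: hw.
have sg : supp hset (cf (dbar_comm w') x).
  rewrite [cf (dbar_comm w') x]linearB /=; apply: suppD; [|apply: suppN]; apply: (supp_cf adE Ux).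
    exact: (hadj.1 _ (section_dbarH sc)).2.
  exact: LambdaH_dbarH.
have EQ : cf (QL S Dstar w) x = cf (dbar_comm w) x - Gm (cf (dbar_comm w') x).
  rewrite [cf (QL _ _ _) x]linearB /= (chirality_co (adE Ux)) (unK (adE Ux)) restr_id //.
have Elead : Gm (dbar_comm_lead (cf w') x) = \sum_j \sum_k (cc j (ee k (vact (Zb j) (vact (Zz k) (cf w)) x)) -
     ee k (cc j (vact (Zz k) (vact (Zb j) (cf w)) x))).
  have EV p q : vact (Yf p) (vact (Yf q) (cf w')) x = Gm (vact (Yf p) (vact (Yf q) (cf w)) x).
    have s1 := smf_cf sw.
    rewrite -(vact_lin oU (Gm : {linear ext -> ext})) //; last exact: (smf_vact oU smooth_Yf).
    apply: (vact_congr oU _ Ux) => y Uy; rewrite -(vact_lin oU (Gm : {linear ext -> ext})) //.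
    exact: (vact_congr oU _ Uy).
  have T1 j k : Gm (ee j (cc k (vact (Zb j) (vact (Zz k) (cf w')) x))) = cc j (ee k (vact (Zb j) (vact (Zz k) (cf w)) x)).
    apply: (etrans (congr1 (fun v => Gm (ee j (cc k v))) (EV (false, j) (true, k)))).
    exact: (Gam_ec _ _ (supp_vact2 (false, j) (true, k) Ux hw)).
  have T2 j k : Gm (cc k (ee j (vact (Zz k) (vact (Zb j) (cf w')) x))) = ee k (cc j (vact (Zz k) (vact (Zb j) (cf w)) x)).
    apply: (etrans (congr1 (fun v => Gm (cc k (ee j v))) (EV (true, k) (false, j)))).
    exact: (Gam_ce _ _ (supp_vact2 (true, k) (false, j) Ux hw)).
  rewrite linear_sum; apply: eq_bigr => j _; rewrite linear_sum; apply: eq_bigr => k _.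
  by rewrite -T1 -T2; exact: linearB.
(* The coordinates of gamma w equal [Gam] of those of w on U only. The first order expression of [F]
   shows that its value at x depends on nothing outside U. *)
have EF : F (cf w') x = F (fun y => mx_op (gmx Gm) y (cf w y)) x.
  have [A [B [sA sB EF]]] := fF.
  have s1 := smf_cf sw; have s2 := smf_cf sc.
  rewrite EF // EF //; last by apply: (smf_mop oU) => //; exact: smx_gmx.
  have EE y : U y -> cf w' y = mx_op (gmx Gm) y (cf w y) by move=> Uy; rewrite Ew' // mop_gmx.
  rewrite -(EE _ Ux); apply: (congr1 (+%R^~ _)); apply: eq_bigr => i _.
  by apply: (congr1 (mx_op (A i) x)); exact: (vact_congr oU _ Ux).
have G1 : Gm (cf (dbar_comm w') x) = \sum_j \sum_k (cc j (ee k (vact (Zb j) (vact (Zz k) (cf w)) x)) -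
     ee k (cc j (vact (Zz k) (vact (Zb j) (cf w)) x))) + Gm (F (fun y => mx_op (gmx Gm) y (cf w y)) x).
  rewrite (HF _ _ sc Ux) EF; exact: (etrans (linearD (Gm : {linear ext -> ext}) _ _) (congr1 (+%R^~ _) Elead)).
apply: (etrans EQ); apply: (etrans (congr2 (fun u v => u - v) (HF _ _ sw Ux) G1)).
apply: (etrans (zmod_swap (fun j k => ee j (cc k (vact (Zb j) (vact (Zz k) (cf w)) x)))
  (fun j k => cc j (ee k (vact (Zb j) (vact (Zz k) (cf w)) x)))
  (fun j k => ee j (cc k (vact (Zz j) (vact (Zb k) (cf w)) x)))
  (fun j k => cc j (ee k (vact (Zz j) (vact (Zb k) (cf w)) x))) _ _)).
apply: (congr1 (+%R^~ _)); apply: eq_bigr => j _; apply: eq_bigr => k _; apply: esym; exact: ecD.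
Qed.

End LocalFormula.

(** * Behaviour of the second degree under the operators *)

Section Degrees.
Variables (R : realType) (n r : nat).
Local Notation m := (n + n + r)%N.
Variables (M : manifold R m) (S : real_CR M n).
Local Notation C := R[i].
Local Notation V := 'rV[R]_m.
Local Notation VC := 'rV[C]_m.
Local Notation ext := (ext R m).
Variables (mu : {measure set (borel M) -> \bar R}) (hmu : smooth_positive_density mu).
Variables (Dstar : (M -> ext) -> M -> ext) (hadj : formal_adjoint S mu (dbarH S) Dstar).
Variables (U : set M) (X : 'I_n -> M -> V) (E : M -> 'I_r -> V).
Hypothesis oU : open U.
Hypothesis hX : orthonormal_frameL S U X.
Hypothesis adE : forall x, U x -> adapted S x (X^~ x) (E x).
Local Notation cf := (cf S X E).
Local Notation Gm := (Gam (lamv R n r)).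
Implicit Types (Q : pred nat) (w : M -> ext).

(** A condition on the second degree alone. It is used with the degrees 0 and n, with the bound by n
    that always holds, and with shifted conditions for the intermediate sections. *)
Definition degQ Q (T : {set 'I_m}) := hset T && Q (deg kB T).

Lemma supp_eps_ib Q Q' j (w : ext) : (forall d, Q d -> Q' d.+1) ->
  supp (degQ Q) w -> supp (degQ Q') (eps (delta_mx 0 (ib r j)) w).
Proof.
move=> QQ; apply: supp_eps => k T; rewrite mxE eqxx /=.
case: (k =P ib r j) => [->|_]; last by rewrite eqxx.
move=> _ kT /andP[hT qT]; rewrite /degQ /hset !degU1 // !kE add0n add1n.
by apply/andP; split; [exact: hT|exact: QQ].
Qed.

Lemma supp_contr_ib Q Q' j (w : ext) : (forall d, Q d.+1 -> Q' d) ->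
  supp (degQ Q) w -> supp (degQ Q') (ext_contr (delta_mx 0 (ib r j)) w).
Proof.
move=> QQ; apply: supp_contr => k T; rewrite mxE eqxx /=.
case: (k =P ib r j) => [->|_]; last by rewrite eqxx.
move=> _ kT; rewrite /degQ /hset !(degD1 _ kT) !kE add0n add1n => /andP[-> q] /=; exact: QQ.
Qed.

Lemma supp_Gam_deg Q (w : ext) : (forall d, (d <= n)%N -> Q (n - d)%N -> Q d) -> supp (degQ Q) w ->
  supp (degQ Q) (Gm w).
Proof.
move=> QQ sw T nT; rewrite GamE; case: ifPn => // hT.
rewrite (sw (HS n r :\: T)%SET) ?mulr0 //; apply: contra nT => /andP[hD qD].
rewrite /degQ hT; apply: QQ; first exact: degB_le.
have := bidegC (degA_le hD) (degB_le hD) hT; rewrite {1}/bideg !eqxx hD => /esym/and3P[_ /eqP -> _].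
by rewrite subKn // degB_le.
Qed.

Lemma supp_dbarH Q Q' w x : (forall d, Q d -> Q' d.+1) -> section S w ->
  (forall y, U y -> supp (degQ Q) (cf w y)) -> U x -> supp (degQ Q') (cf (dbarH S w) x).
Proof.
move=> QQ sw hw Ux; rewrite (dbarH_cf oU hX adE Ux sw); apply: suppD.
  by apply: supp_sum => j _; apply: (supp_eps_ib _ QQ); apply: (supp_vact oU).
apply: supp_sum => T hT; have [qT|nT] := boolP (Q (deg kB T)); last first.
  by rewrite (hw x Ux) ?scale0r ?/degQ ?hT //; exact: supp0.
apply: suppZ; have bd : bideg (deg kA T) (deg kB T) T by rewrite /bideg !eqxx.
apply: (supp_sub _ (supp_bT oU adE Ux bd)) => T' /and3P[_ /eqP e hT'].
by rewrite /degQ hT' e QQ.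
Qed.

Lemma supp_Dstar Q Q' w x : (forall d, Q d.+1 -> Q' d) -> section S w ->
  (forall y, U y -> supp (degQ Q) (cf w y)) -> U x -> supp (degQ Q') (cf (Dstar w) x).
Proof.
move=> QQ sw hw Ux; have [b [_ b1 b2]] := dbarHstar_cf hmu hadj oU hX adE.
move=> T nT; rewrite b2 // [X in - X]big1 ?oppr0 ?add0r => [|j _]; last first.
  by apply: (supp_contr_ib _ QQ) nT; apply: (supp_vact oU).
apply: big1 => T' _; have [->|nz] := eqVneq (b T T' x) 0; first by rewrite mul0r.
rewrite (hw x Ux) ?mulr0 //; have [hT hT' e] := b1 _ _ _ nz.
apply: contra nT => /andP[_]; rewrite /degQ hT e; exact: QQ.
Qed.

Lemma supp_comm Q w x : section S w -> (forall y, U y -> supp (degQ Q) (cf w y)) -> U x ->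
  supp (degQ Q) (cf (dbar_comm S Dstar w) x).
Proof.
move=> sw hw Ux; rewrite [cf (dbar_comm S Dstar w) x]linearB /=; apply: suppD; [|apply: suppN].
  apply: (@supp_Dstar (fun d => (0 < d)%N && Q d.-1)) => //; first exact: section_dbarH.
  by move=> y Uy; apply: (@supp_dbarH Q).
apply: (@supp_dbarH (fun d => Q d.+1)) => //; first exact: hadj.1.
by move=> y Uy; apply: (@supp_Dstar Q).
Qed.

Lemma cf_chirality w y : section S w -> U y -> cf (fun z => chirality S z (w z)) y = Gm (cf w y).
Proof.
move=> sw Uy; rewrite /cf (chirality_co (adE Uy)) (unK (adE Uy)) restr_id //.
exact: (supp_cf adE Uy (sw.2 y)).
Qed.

Lemma section_comm w x : section S w -> LambdaH S x (dbar_comm S Dstar w x).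
Proof.
move=> sw; have [X' [E' ad]] := adapted_exists S x; apply/(LambdaH_co ad); rewrite linearB /=.
apply: suppD; [|apply: suppN]; apply/(LambdaH_co ad).
  exact: (hadj.1 _ (section_dbarH sw)).2.
exact: LambdaH_dbarH.
Qed.

Lemma QL_comm w x : section S w -> U x -> cf (QL S Dstar w) x =
  cf (dbar_comm S Dstar w) x - Gm (cf (dbar_comm S Dstar (fun z => chirality S z (w z))) x).
Proof.
move=> sw Ux; rewrite [cf (QL _ _ _) x]linearB /= (chirality_co (adE Ux)) (unK (adE Ux)) restr_id //.
have h := supp_cf adE Ux (section_comm x (section_chirality sw)); exact: h.
Qed.

(** The commutator of dbar_H and its adjoint preserves the second degree and gamma replaces d by n -
    d, whence the symmetry demanded of Q. *)
Lemma supp_QL Q w x : (forall d, (d <= n)%N -> Q (n - d)%N -> Q d) -> section S w ->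
  (forall y, U y -> supp (degQ Q) (cf w y)) -> U x -> supp (degQ Q) (cf (QL S Dstar w) x).
Proof.
move=> QQ sw hw Ux; rewrite QL_comm //; apply: suppD; first exact: supp_comm.
apply/suppN/supp_Gam_deg => //; apply: supp_comm => //; first exact: section_chirality.
by move=> y Uy; rewrite cf_chirality //; apply: supp_Gam_deg => //; exact: hw.
Qed.

Lemma supp_cf_deg w y : section S w -> U y -> supp (degQ (fun d => (d <= n)%N)) (cf w y).
Proof.
move=> sw Uy; apply: supp_sub (supp_cf adE Uy (sw.2 y)) => T hT.
by rewrite /degQ hT degB_le.
Qed.

(* For n = 0 the index set {set 'I_n} * bool lists each form twice, and the second
   formula has to be proved separately. *)
Lemma QL_dim0 w x : n = 0%N -> section S w -> U x -> cf (QL S Dstar w) x = 0.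
Proof.
move=> n0 sw Ux; suff H w' : section S w' -> cf (dbar_comm S Dstar w') x = 0.
  have g0 : Gm 0 = 0 := linear0 (Gm : {linear ext -> ext}).
  apply: (etrans (QL_comm sw Ux)).
  apply: (etrans (congr2 (fun u v => u - Gm v) (H _ sw) (H _ (section_chirality sw)))).
  by rewrite g0 subr0.
move=> sw'; have s0 (v : ext) : supp (degQ pred0) v -> v = 0.
  by move=> h; apply/ffunP => T; rewrite ext0E; apply: h; rewrite /degQ andbF.
rewrite [cf (dbar_comm S Dstar w') x]linearB /= -!/(cf _ x) [cf (Dstar _) x]s0 ?sub0r => [|].
  rewrite [cf (dbarH S _) x]s0 ?oppr0 //.
  have hs := supp_cf_deg (section_dbarH (hadj.1 _ sw')) Ux.
  have hd : supp (degQ (fun d => (0 < d)%N)) (cf (dbarH S (Dstar w')) x).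
    apply: (@supp_dbarH predT) => //; first exact: hadj.1.
    by move=> y Uy; apply: supp_sub (supp_cf_deg (hadj.1 _ sw') Uy) => T /andP[hT _]; rewrite /degQ hT.
  move=> T _; have [d0|d0] := posnP (deg kB T); first by apply: hd; rewrite /degQ d0 andbF.
  by apply: hs; rewrite negb_and -ltnNge (leq_ltn_trans (eq_leq n0) d0) orbT.
apply: (@supp_Dstar (fun d => (d <= n)%N)) => //; first by move=> d; rewrite n0.
  exact: section_dbarH.
by move=> y Uy; exact: supp_cf_deg (section_dbarH sw') Uy.
Qed.

End Degrees.

(** * From the adapted frame to the given coframe *)

Section CoframeFormula.
Variables (R : realType) (n r : nat).
Local Notation m := (n + n + r)%N.
Variables (M : manifold R m) (S : real_CR M n).
Local Notation C := R[i].
Local Notation V := 'rV[R]_m.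
Local Notation VC := 'rV[C]_m.
Local Notation ext := (ext R m).
Variables (mu : {measure set (borel M) -> \bar R}) (hmu : smooth_positive_density mu).
Variables (Dstar : (M -> ext) -> M -> ext) (hadj : formal_adjoint S mu (dbarH S) Dstar).
Variables (U : set M) (X : 'I_n -> M -> V) (E : M -> 'I_r -> V).
Hypothesis oU : open U.
Hypothesis hX : orthonormal_frameL S U X.
Hypothesis adE : forall x, U x -> adapted S x (X^~ x) (E x).
Local Notation cf := (cf S X E).
Local Notation Zb := (Zbarf S X).
Local Notation Zz := (Zf S X).
Local Notation dl j := (delta_mx 0 (ib r j)).
Local Notation ee j := (eps (dl j)).
Local Notation cc j := (ext_contr (dl j)).
Variables (th thbar : 'I_n -> M -> VC) (hth : dual_coframe S U Zz Zb th thbar).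
Local Notation idx := ({set 'I_n} * {set 'I_n})%type.
Local Notation Th := (fun i : idx => theta th thbar i.1 i.2).
Local Notation cx x := (co S x (X^~ x) (E x)).

Lemma cv_th x j : U x -> cv S x (X^~ x) (E x) (th j x) = delta_mx 0 (ia r j).
Proof.
move=> Ux; have [h1 _ h2 _] := hth Ux j; apply/rowP; apply: idxP => k.
- by rewrite cvE row_ia (h2 k).1 mxE eqxx (inj_eq (@ia_inj n r)) eq_sym.
- by rewrite cvE row_ib (h2 k).2 mxE eqxx ib_ia.
- rewrite (annNP (adE Ux) _).1 ?kE // mxE eqxx /=; case: eqP => // e.
  by have := kC_ic n k; rewrite e kE.
Qed.

Lemma cv_thbar x j : U x -> cv S x (X^~ x) (E x) (thbar j x) = delta_mx 0 (ib r j).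
Proof.
move=> Ux; have [_ h1 _ h2] := hth Ux j; apply/rowP; apply: idxP => k.
- by rewrite cvE row_ia (h2 k).2 mxE eqxx ia_ib.
- by rewrite cvE row_ib (h2 k).1 mxE eqxx (inj_eq (@ib_inj n r)) eq_sym.
- rewrite (annNP (adE Ux) _).1 ?kE // mxE eqxx /=; case: eqP => // e.
  by have := kC_ic n k; rewrite e kE.
Qed.

(** The given covectors vanish on N and are dual to the Z_j and Zbar_j, so they are the dual
    covectors of the adapted frame; [enum_iS] matches the order of the factors. *)
Lemma co_theta x i : U x -> cx x (Th i x) = eb R (iS r i).
Proof.
move=> Ux; rewrite -[RHS](unK (adE Ux)); congr (cx x _); rewrite un_eb enum_iS map_cat -!map_comp.
congr (wedge_covecs (_ ++ _)); apply/eq_in_map => j _ /=; apply: (dcov_uniq (adE Ux)).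
  exact: cv_th.
exact: cv_thbar.
Qed.

Lemma co_eps_bar x j (w : ext) : U x -> cx x (eps_bar thbar j x w) = ee j (cx x w).
Proof. by move=> Ux; rewrite [LHS]co_eps cv_thbar. Qed.

Lemma co_iota x j (w : ext) : cx x (iota_th Zb j x w) = cc j (cx x w).
Proof. by rewrite [RHS]contr_pullback -rowE row_ib. Qed.

Lemma ext_iS (w : ext) : supp hset w -> w = \sum_i w (iS r i) *: eb R (iS r i).
Proof.
move=> sw; apply/ffunP => T; rewrite ext_sumE.
have E1 i : (w (iS r i) *: eb R (iS r i)) T = if iS r i == T then w T else 0.
  by rewrite extZE ebE eq_sym; case: eqP => [->|_]; rewrite ?mulr1 ?mulr0.
rewrite (eq_bigr _ (fun i _ => E1 i)) -big_mkcond; have [hT|nT] := boolP (hset T).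
  rewrite (eq_bigl (pred1 (piS T))) ?big_pred1_eq // => i /=.
  by rewrite -{1}(piSK hT) (inj_eq (@iS_inj n r)).
rewrite sw // big_pred0 // => i; apply/eqP => e; by rewrite -e hset_iS in nT.
Qed.

Lemma sum_iS (a : {set 'I_m} -> C) (w : ext) : supp hset w -> \sum_T a T * w T = \sum_i a (iS r i) * w (iS r i).
Proof.
move=> sw; rewrite {1}(ext_iS sw).
under eq_bigr => T _ do rewrite ext_sumE mulr_sumr.
rewrite exchange_big; apply: eq_bigr => i _ /=.
rewrite (bigD1 (iS r i)) //= extZE ebE eqxx mulr1 big1 ?addr0 // => T ne.
by rewrite extZE ebE (negPf ne) !mulr0.
Qed.

Section Expansion.
Variables (eta : M -> ext) (f : idx -> M -> C).
Hypotheses (seta : section S eta) (hf : forall x, U x -> eta x = frame_expand Th f x).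

Lemma cf_frame (g : idx -> M -> C) x : U x -> cx x (frame_expand Th g x) = \sum_i g i x *: eb R (iS r i).
Proof.
move=> Ux; rewrite linear_sum; apply: eq_bigr => i _; rewrite linearZ /=.
exact: (congr1 (fun v => _ *: v) (co_theta i Ux)).
Qed.

Lemma lin_comb2 (G H : {linear ext -> ext}) (c : idx -> C) (v : idx -> ext) :
  G (H (\sum_i c i *: v i)) = \sum_i c i *: G (H (v i)).
Proof. by rewrite !linear_sum; apply: eq_bigr => i _; rewrite !linearZ. Qed.

Lemma coef_iS (g : idx -> C) i : (\sum_j g j *: eb R (iS r j)) (iS r i) = g i.
Proof.
rewrite ext_sumE (bigD1 i) //= extZE ebE eqxx mulr1 big1 ?addr0 // => j ne.
by rewrite extZE ebE (inj_eq (@iS_inj n r)) eq_sym (negPf ne) mulr0.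
Qed.

Lemma cf_coef x i : U x -> cf eta x (iS r i) = f i x.
Proof. by move=> Ux; rewrite /cf hf // cf_frame // coef_iS. Qed.

Lemma vact_coef Z x i : U x -> vact Z (cf eta) x (iS r i) = vfield_act Z (f i) x.
Proof.
move=> Ux; rewrite vactE; apply: vact_near; apply: (near_open_set oU Ux) => y Uy; exact: cf_coef.
Qed.

Lemma vact2_coef Z Z' x i : U x -> vact Z (vact Z' (cf eta)) x (iS r i) = vfield_act Z (vfield_act Z' (f i)) x.
Proof.
move=> Ux; rewrite vactE; apply: vact_near; apply: (near_open_set oU Ux) => y Uy; exact: vact_coef.
Qed.

Let hset_eta y : U y -> supp hset (cf eta y).
Proof. by move=> Uy; exact: (supp_cf adE Uy (seta.2 y)). Qed.

Lemma vact2_expand j k x : U x -> vact (Zb j) (vact (Zz k) (cf eta)) x + vact (Zz j) (vact (Zb k) (cf eta)) x =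
  \sum_i (vfield_act (Zb j) (vfield_act (Zz k) (f i)) x + vfield_act (Zz j) (vfield_act (Zb k) (f i)) x) *: eb R (iS r i).
Proof.
move=> Ux; have s1 := supp_vact2 S X oU (false, j) (true, k) Ux hset_eta.
have s2 := supp_vact2 S X oU (true, j) (false, k) Ux hset_eta.
rewrite [LHS](ext_iS (suppD s1 s2)); apply: eq_bigr => i _; rewrite extDE.
apply: (congr1 (fun c => c *: _)); exact: (congr2 +%R (vact2_coef _ _ _ Ux) (vact2_coef _ _ _ Ux)).
Qed.

Definition lead_term (f' : idx -> M -> C) x : ext := \sum_(j < n) \sum_(k < n) \sum_i
  (vfield_act (Zb j) (vfield_act (Zz k) (f' i)) x + vfield_act (Zz j) (vfield_act (Zb k) (f' i)) x) *:
  (ee j (cc k (eb R (iS r i))) - cc j (ee k (eb R (iS r i)))).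

Lemma QL_expand (F : (M -> ext) -> M -> ext) x : U x ->
  (forall w x, section S w -> U x -> cf (QL S Dstar w) x =
     \sum_j \sum_k (ee j (cc k (vact (Zb j) (vact (Zz k) (cf w)) x + vact (Zz j) (vact (Zb k) (cf w)) x)) -
     cc j (ee k (vact (Zb j) (vact (Zz k) (cf w)) x + vact (Zz j) (vact (Zb k) (cf w)) x))) + F (cf w) x) ->
  cf (QL S Dstar eta) x = lead_term f x + F (cf eta) x.
Proof.
move=> Ux HF; rewrite HF //; apply: (congr1 (+%R^~ _)).
apply: eq_bigr => j _; apply: eq_bigr => k _; rewrite vact2_expand // !lin_comb2 -sumrB.
by apply: eq_bigr => i _; rewrite -scalerBr.
Qed.

End Expansion.

Lemma sum_bool_pair (V' : nmodType) k (g : bool * 'I_k -> V') :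
  \sum_p g p = \sum_j (g (true, j) + g (false, j)).
Proof.
transitivity (\sum_p g (p.1, p.2)); first by apply: eq_bigr => -[].
by rewrite -(pair_bigA _ (fun b j => g (b, j))) /= big_bool -big_split.
Qed.

Definition coframe_op (A : bool * 'I_n -> {set 'I_m} -> {set 'I_m} -> M -> C) (B : {set 'I_m} -> {set 'I_m} -> M -> C)
    (f : idx -> M -> C) (i : idx) (x : M) : C :=
  \sum_i' (\sum_(j < n) (A (true, j) (iS r i) (iS r i') x * vfield_act (Zz j) (f i') x +
                         A (false, j) (iS r i) (iS r i') x * vfield_act (Zb j) (f i') x) +
           B (iS r i) (iS r i') x * f i' x).

Lemma supp_lead f x : supp hset (lead_term f x).
Proof.
apply: supp_sum => j _; apply: supp_sum => k _; apply: supp_sum => i _; apply: suppZ.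
have hi := supp_eb R (hset_iS r i).
apply: suppD; first by apply: supp_eps_hset; exact: contr_hset.
by apply: suppN; apply: contr_hset; exact: supp_eps_hset.
Qed.

(** The error operator is known on all coordinates of C^m. Both Q_L eta and the leading term lie in
    the exterior algebra of H^*, hence so does the error, and its coefficients can be restricted to
    the indices of the coframe. *)
Lemma QL_coords : exists A B, [/\ forall p, smooth_mx U (A p), smooth_mx U B &
  forall eta f, section S eta -> (forall x, U x -> eta x = frame_expand Th f x) -> forall x, U x ->
    cf (QL S Dstar eta) x = lead_term f x + \sum_i coframe_op A B f i x *: eb R (iS r i)].
Proof.
have [F [A [B [sA sB EF]]] HF] := QL_form hmu hadj oU hX adE.
exists A, B; split=> // eta f seta hf x Ux.
have E1 := QL_expand seta hf Ux HF.
have sF : supp hset (F (cf eta) x).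
  have -> : F (cf eta) x = cf (QL S Dstar eta) x - lead_term f x by rewrite E1 addrAC subrr add0r.
  apply: suppD; last by apply: suppN; exact: supp_lead.
  have := supp_QL hmu hadj oU hX adE (Q := fun d => (d <= n)%N) (fun d h _ => h) seta (fun y Uy => supp_cf_deg adE seta Uy) Ux.
  by apply: supp_sub => T /andP[].
rewrite E1; apply: (congr1 (+%R _)); rewrite {1}(ext_iS sF); apply: eq_bigr => i _.
apply: (congr1 (fun c => c *: _)).
have hset_eta y : U y -> supp hset (cf eta y) by move=> Uy; exact: (supp_cf adE Uy (seta.2 y)).
rewrite EF //; last exact: smf_cf.
have E2 p : mx_op (A p) x (vact (Yf S X p) (cf eta) x) (iS r i) =
    \sum_i' A p (iS r i) (iS r i') x * vfield_act (Yf S X p) (f i') x.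
  rewrite mopE (sum_iS (fun T => A p (iS r i) T x)); last exact: (supp_vact oU).
  by apply: eq_bigr => i' _; rewrite (vact_coef hf).
have E3 : mx_op B x (cf eta x) (iS r i) = \sum_i' B (iS r i) (iS r i') x * f i' x.
  rewrite mopE (sum_iS (fun T => B (iS r i) T x)); last exact: hset_eta.
  by apply: eq_bigr => i' _; rewrite (cf_coef hf).
rewrite extDE ext_sumE E3 (eq_bigr _ (fun p _ => E2 p)) exchange_big -big_split; apply: eq_bigr => i' _ /=.
apply: (congr1 (+%R^~ _)).
exact: sum_bool_pair.
Qed.

Definition rhs_lead f x : ext := \sum_(j < n) \sum_(k < n) \sum_i
   (vfield_act (Zb j) (vfield_act (Zz k) (f i)) x + vfield_act (Zz j) (vfield_act (Zb k) (f i)) x) *: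
   (eps_bar thbar j x (iota_th Zb k x (Th i x)) - iota_th Zb j x (eps_bar thbar k x (Th i x))).

Lemma co_rhs_lead f x : U x -> cx x (rhs_lead f x) = lead_term f x.
Proof.
move=> Ux; have T1 j k i : cx x (eps_bar thbar j x (iota_th Zb k x (Th i x)) - iota_th Zb j x (eps_bar thbar k x (Th i x))) =
    ee j (cc k (eb R (iS r i))) - cc j (ee k (eb R (iS r i))).
  by rewrite linearB /= co_eps_bar // !co_iota co_eps_bar // (co_theta i Ux).
rewrite linear_sum; apply: eq_bigr => j _; rewrite linear_sum; apply: eq_bigr => k _.
rewrite linear_sum; apply: eq_bigr => i _; rewrite linearZ /=; exact: (congr1 (fun v => _ *: v) (T1 j k i)).
Qed.

Lemma OH1_pop A B : (forall p, smooth_mx U (A p)) -> smooth_mx U B -> OH1 U Zz Zb (coframe_op A B).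
Proof.
move=> sA sB; exists (fun j i i' => A (true, j) (iS r i) (iS r i')), (fun j i i' => A (false, j) (iS r i) (iS r i')),
  (fun i i' => B (iS r i) (iS r i')); split=> //; by move=> *; exact: sA.
Qed.

Lemma coD x (u v : ext) : cx x (u + v) = cx x u + cx x v.
Proof. exact: (linearD (co S x (X^~ x) (E x) : {linear ext -> ext})). Qed.

Lemma QL_first : exists P, OH1 U Zz Zb P /\
  forall eta f, section S eta -> (forall x, U x -> eta x = frame_expand Th f x) -> forall x, U x ->
    QL S Dstar eta x = rhs_lead f x + frame_expand Th (P f) x.
Proof.
have [A [B [sA sB H]]] := QL_coords; exists (coframe_op A B); split; first exact: OH1_pop.
move=> eta f seta hf x Ux; apply: (can_inj (coK (adE Ux))).
rewrite coD co_rhs_lead // cf_frame //; exact: H.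
Qed.

Local Notation idx2 := ({set 'I_n} * bool)%type.
(* The components of type ( *, 0) and ( *, n). *)
Definition outer_index (i : idx2) : idx := (i.1, if i.2 then [set: 'I_n]%SET else finset.set0).
Local Notation Th2 := (fun i : idx2 => theta th thbar i.1 (if i.2 then [set: 'I_n]%SET else finset.set0)).

(** Coefficients on the extreme types, extended by zero to all types, so that the first formula can
    be applied to them. For n > 0 the two tests exclude each other. *)
Definition ext_f (f : idx2 -> M -> C) (i : idx) : M -> C :=
  if i.2 == [set: 'I_n]%SET then f (i.1, true) else if i.2 == finset.set0 then f (i.1, false) else fun=> 0.

Definition rhs_lead2 (f : idx2 -> M -> C) x : ext := \sum_i ((if i.2 then 1 else -1) *
  \sum_(j < n) (vfield_act (Zz j) (vfield_act (Zb j) (f i)) x + vfield_act (Zb j) (vfield_act (Zz j) (f i)) x)) *: Th2 i x.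

Lemma full_neq0 : (0 < n)%N -> ([set: 'I_n]%SET == finset.set0) = false.
Proof. by move=> n0; apply/negP => /eqP/setP/(_ (Ordinal n0)); rewrite !inE. Qed.

Lemma kap_inj : (0 < n)%N -> injective outer_index.
Proof.
move=> n0 [J b] [J' b'] [->] e; congr (_, _); case: b b' e => -[] // /eqP; first by rewrite full_neq0.
by rewrite eq_sym full_neq0.
Qed.

Lemma sum_kap (V' : nmodType) (g : idx -> V') : (0 < n)%N ->
  (forall i, i.2 != [set: 'I_n]%SET -> i.2 != finset.set0 -> g i = 0) -> \sum_i g i = \sum_i g (outer_index i).
Proof.
move=> n0 g0; rewrite (bigID (fun i => i \in [set outer_index i' | i' : idx2]%SET)) /= [X in _ + X]big1 ?addr0.
  by rewrite big_imset //= => i i' _ _; exact: kap_inj.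
move=> [J K] /= h; apply: g0 => /=; apply: contraNN h => /eqP ->; apply/imsetP.
  by exists (J, true).
by exists (J, false).
Qed.

Lemma ext_f_kap f i : (0 < n)%N -> ext_f f (outer_index i) = f i.
Proof.
by move=> n0; case: i => J [] /=; rewrite /ext_f /= ?eqxx // eq_sym full_neq0.
Qed.

Lemma ext_f0 f i : i.2 != [set: 'I_n]%SET -> i.2 != finset.set0 -> ext_f f i = fun=> 0.
Proof. by rewrite /ext_f => /negPf -> /negPf ->. Qed.

Lemma vact0 (Z Z' : M -> VC) x : vfield_act Z (vfield_act Z' (fun=> 0)) x = 0.
Proof.
have -> : vfield_act Z' (fun=> 0) = fun=> 0 by apply/funext => y; exact: vact_cst.
exact: vact_cst.
Qed.

Lemma op_full J j k : ee j (cc k (eb R (iS r (J, [set: 'I_n]%SET)))) - cc j (ee k (eb R (iS r (J, [set: 'I_n]%SET)))) =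
  (j == k)%:R *: eb R (iS r (J, [set: 'I_n]%SET)).
Proof.
set W := eb R _; have h l : ee l W = 0 by rewrite /W eps_eb ib_iS inE.
have e := contr_eps (dl k) (dl j) W.
have z l : cc l (0 : ext) = 0 := linear0 (cc l : {linear ext -> ext}).
rewrite h z in e; rewrite h z subr0.
move/esym/eqP: e; rewrite subr_eq0 => /eqP <-.
by rewrite pairing_delta_l mxE eqxx /= (inj_eq (@ib_inj n r)).
Qed.

Lemma op_empty J j k : ee j (cc k (eb R (iS r (J, finset.set0)))) - cc j (ee k (eb R (iS r (J, finset.set0)))) =
  - ((j == k)%:R *: eb R (@iS n r (J, finset.set0))).
Proof.
set W := eb R _; have h l : cc l W = 0 by rewrite /W contr_eb ib_iS inE.
have z l : ee l (0 : ext) = 0 := linear0 (ee l : {linear ext -> ext}).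
rewrite contr_eps !h !z subr0 sub0r; congr (- (_ *: _)).
by rewrite pairing_delta_l mxE eqxx /= (inj_eq (@ib_inj n r)) eq_sym.
Qed.

Lemma sum_diag (c : 'I_n -> 'I_n -> C) (W : ext) (s : C) :
  \sum_j \sum_k c j k *: (s *: ((j == k)%:R *: W)) = (s * \sum_j c j j) *: W.
Proof.
rewrite mulr_sumr scaler_suml; apply: eq_bigr => j _.
rewrite (bigD1 j) //= eqxx scale1r big1 ?addr0 => [|k ne]; first by rewrite scalerA mulrC.
by rewrite eq_sym (negPf ne) scale0r !scaler0.
Qed.

Lemma lead_ext_f f x : (0 < n)%N -> lead_term (ext_f f) x = \sum_i ((if i.2 then 1 else -1) *
  \sum_(j < n) (vfield_act (Zz j) (vfield_act (Zb j) (f i)) x + vfield_act (Zb j) (vfield_act (Zz j) (f i)) x)) *: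
  eb R (iS r (outer_index i)).
Proof.
move=> n0; rewrite /lead_term.
under eq_bigr => j _ do rewrite exchange_big.
rewrite exchange_big sum_kap // => [|i i1 i2]; last first.
  by rewrite ext_f0 //; apply: big1 => j _; apply: big1 => k _; rewrite !vact0 addr0 scale0r.
apply: eq_bigr => i _; rewrite ext_f_kap //.
pose c j k := vfield_act (Zb j) (vfield_act (Zz k) (f i)) x + vfield_act (Zz j) (vfield_act (Zb k) (f i)) x.
have -> : \sum_(j < n) (vfield_act (Zz j) (vfield_act (Zb j) (f i)) x + vfield_act (Zb j) (vfield_act (Zz j) (f i)) x) =
    \sum_j c j j by apply: eq_bigr => j _; rewrite addrC.
rewrite -sum_diag; apply: eq_bigr => j _; apply: eq_bigr => k _; apply: (congr1 (fun v => _ *: v)).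
case: i {c} => J [] /=; first by rewrite op_full scale1r.
by rewrite op_empty scaleN1r.
Qed.

Lemma frame_ext_f f x : (0 < n)%N -> frame_expand Th2 f x = frame_expand Th (ext_f f) x.
Proof.
move=> n0; rewrite /frame_expand [RHS]sum_kap // => [|i i1 i2]; last by rewrite ext_f0 // scale0r.
by apply: eq_bigr => i _; rewrite ext_f_kap.
Qed.

Definition outer_op (A : bool * 'I_n -> {set 'I_m} -> {set 'I_m} -> M -> C) (B : {set 'I_m} -> {set 'I_m} -> M -> C)
    (f : idx2 -> M -> C) (i : idx2) (x : M) : C :=
  \sum_i' (\sum_(j < n) (A (true, j) (iS r (outer_index i)) (iS r (outer_index i')) x * vfield_act (Zz j) (f i') x +
                         A (false, j) (iS r (outer_index i)) (iS r (outer_index i')) x * vfield_act (Zb j) (f i') x) +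
           B (iS r (outer_index i)) (iS r (outer_index i')) x * f i' x).

Lemma pop_ext_f A B f i x : (0 < n)%N -> coframe_op A B (ext_f f) (outer_index i) x = outer_op A B f i x.
Proof.
move=> n0; rewrite /coframe_op sum_kap // => [|i' i1 i2]; last first.
  rewrite ext_f0 // mulr0 addr0; apply: big1 => j _; rewrite !vact_cst !mulr0; exact: addr0.
by apply: eq_bigr => i' _; rewrite ext_f_kap.
Qed.

Lemma OH1_pop2 A B : (forall p, smooth_mx U (A p)) -> smooth_mx U B -> OH1 U Zz Zb (outer_op A B).
Proof.
move=> sA sB; exists (fun j i i' => A (true, j) (iS r (outer_index i)) (iS r (outer_index i'))),
  (fun j i i' => A (false, j) (iS r (outer_index i)) (iS r (outer_index i'))),
  (fun i i' => B (iS r (outer_index i)) (iS r (outer_index i'))); split=> //; by move=> *; exact: sA.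
Qed.

Lemma OH1_0 (I : finType) : OH1 (I := I) U Zz Zb (fun _ _ _ => 0).
Proof.
have s0 : smoothC_fun U (fun _ : M => 0 : C) by exact: smoothC_fun_cst.
exists (fun _ _ _ _ => 0), (fun _ _ _ _ => 0), (fun _ _ _ => 0); split=> // f i x _.
rewrite big1 // => i' _; rewrite mul0r addr0 big1 // => j _; rewrite !mul0r; exact: addr0.
Qed.

Lemma co_frame2 (g : idx2 -> C) x : U x -> cx x (\sum_i g i *: Th2 i x) = \sum_i g i *: eb R (iS r (outer_index i)).
Proof.
move=> Ux; rewrite linear_sum; apply: eq_bigr => i _; rewrite linearZ /=.
exact: (congr1 (fun v => _ *: v) (co_theta (outer_index i) Ux)).
Qed.

Lemma card_full (K : {set 'I_n}) : #|K| = n -> K = [set: 'I_n]%SET.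
Proof. by move=> e; apply/eqP; rewrite eqEcard finset.subsetT cardsT card_ord e /=. Qed.

(** The first formula is applied to the coefficients extended by zero. Its error term could have
    components of intermediate type; it has none, because Q_L and the leading term preserve the
    condition that the second degree is 0 or n. The error is then an operator on the extreme
    coefficients alone. *)
Lemma QL_second : exists P, OH1 U Zz Zb P /\
  forall eta f, section S eta -> (forall x, U x -> eta x = frame_expand Th2 f x) -> forall x, U x ->
    QL S Dstar eta x = rhs_lead2 f x + frame_expand Th2 (P f) x.
Proof.
have [n0|n0] := posnP n.
  exists (fun _ _ _ => 0); split; first exact: OH1_0.
  move=> eta f seta hf x Ux; apply: (can_inj (coK (adE Ux))).
  rewrite -/(cf _ x) (QL_dim0 hmu hadj oU hX adE n0 seta Ux) linearD /= !co_frame2 //.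
  rewrite [X in _ = X + _]big1 ?add0r => [|i _]; last first.
    rewrite [X in _ * X]big1 ?mulr0 ?scale0r // => j _.
    by have := ltn_ord j; rewrite ltnNge (leq_trans (eq_leq n0)).
  by rewrite big1 // => i _; rewrite scale0r.
have [A [B [sA sB H]]] := QL_coords; exists (outer_op A B); split; first exact: OH1_pop2.
move=> eta f seta hf x Ux; apply: (can_inj (coK (adE Ux))).
have hf' y : U y -> eta y = frame_expand Th (ext_f f) y by move=> Uy; rewrite hf // frame_ext_f.
have c1 : cx x (rhs_lead2 f x) = _ := co_frame2 _ Ux.
have c2 : cx x (frame_expand Th2 (outer_op A B f) x) = _ := co_frame2 (fun i => outer_op A B f i x) Ux.
rewrite coD c1 c2 -lead_ext_f //.
have E1 := H eta (ext_f f) seta hf' x Ux.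
pose Q d := (d == 0%N) || (d == n).
have sQ y : U y -> supp (degQ Q) (cf eta y).
  move=> Uy T; have [hT|nT] := boolP (hset T); last by rewrite (supp_cf adE Uy (seta.2 y)).
  rewrite /degQ hT /= -(piSK hT) (deg_iS r (piS T)).2 (cf_coef hf' _ Uy) /Q negb_or => /andP[d1 d2].
  rewrite ext_f0 //; first by apply: contraNN d2 => /eqP ->; rewrite cardsT card_ord.
  by apply: contraNN d1 => /eqP ->; rewrite cards0.
have sQL : supp (degQ Q) (cf (QL S Dstar eta) x).
  apply: (supp_QL hmu hadj oU hX adE) => // d dn; rewrite /Q => /orP[|] /eqP e; apply/orP; [right|left]; apply/eqP; lia.
(* At an intermediate index the coefficients of Q_L eta and of the leading term both vanish, so that
   of the error does too. *)
have z i : i.2 != [set: 'I_n]%SET -> i.2 != finset.set0 -> coframe_op A B (ext_f f) i x = 0.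
  move=> i1 i2; have := congr1 (fun v : ext => v (iS r i)) E1; rewrite sQL; last first.
    rewrite /degQ hset_iS (deg_iS r i).2 /Q negb_or cards_eq0 i2; apply: contraNN i1 => /eqP/card_full ->.
    exact: eqxx.
  rewrite extDE coef_iS lead_ext_f // ext_sumE big1 ?add0r // => i' _.
  rewrite extZE ebE (inj_eq (@iS_inj n r)); case: eqP => [e|_]; last by rewrite mulr0.
  by move: i1 i2; rewrite e; case: i' {e} => J [] /=; rewrite eqxx.
apply: (etrans E1); apply: (congr1 (+%R _)); rewrite sum_kap // => [|i i1 i2]; last by rewrite z // scale0r.
by apply: eq_bigr => i _; rewrite pop_ext_f.
Qed.

End CoframeFormula.

Theorem proposition3p2 (R : realType) (m n : nat) (M : manifold R m)
  (S : real_CR M n)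
  (mu : {measure set (borel M) -> \bar R}) (hmu : smooth_positive_density mu)
  (dbarHstar : (M -> ext R m) -> M -> ext R m)
  (hadj : formal_adjoint S mu (dbarH S) dbarHstar)
  (U : set M) (hU : open U)
  (X : 'I_n -> M -> 'rV[R]_m) (hX : orthonormal_frameL S U X)
  (Z Zbar : 'I_n -> M -> 'rV[R[i]]_m) (hZ : Z = Zf S X) (hZbar : Zbar = Zbarf S X)
  (th thbar : 'I_n -> M -> 'rV[R[i]]_m)
  (hth : dual_coframe S U Z Zbar th thbar) :
  (let Th := fun i : {set 'I_n} * {set 'I_n} => theta th thbar i.1 i.2 in
   exists P, OH1 U Z Zbar P /\
     forall (eta : M -> ext R m) (f : {set 'I_n} * {set 'I_n} -> M -> R[i]),
       section S eta -> (forall x, U x -> eta x = frame_expand Th f x) ->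
       forall x, U x ->
         QL S dbarHstar eta x =
         \sum_(j < n) \sum_(k < n) \sum_i
           (vfield_act (Zbar j) (vfield_act (Z k) (f i)) x +
            vfield_act (Z j) (vfield_act (Zbar k) (f i)) x) *:
           (eps_bar thbar j x (iota_th Zbar k x (Th i x)) -
            iota_th Zbar j x (eps_bar thbar k x (Th i x)))
         + frame_expand Th (P f) x)
  /\
  (let Th := fun i : {set 'I_n} * bool =>
       theta th thbar i.1 (if i.2 then [set: 'I_n]%SET else finset.set0) in
   exists P, OH1 U Z Zbar P /\
     forall (eta : M -> ext R m) (f : {set 'I_n} * bool -> M -> R[i]),
       section S eta -> (forall x, U x -> eta x = frame_expand Th f x) ->
       forall x, U x ->
         QL S dbarHstar eta x =
         \sum_i ((if i.2 then 1 else -1) *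
           \sum_(j < n) (vfield_act (Z j) (vfield_act (Zbar j) (f i)) x +
                         vfield_act (Zbar j) (vfield_act (Z j) (f i)) x)) *:
           Th i x
         + frame_expand Th (P f) x).
Proof.
subst Z Zbar.
(* The rank 2n of H at one point bounds the dimension from below, and r is the rank of N. Writing m
   = n + n + r gives the indices their three blocks. *)
have [r mE] : exists r, m = (n + n + r)%N.
  exists (m - (n + n))%N; rewrite subnKC //.
  have [W [B [_ Wp _ /(_ _ Wp) hB]]] := crH_subbundle S point.
  have := dimvS (subvf (crH S point)); rewrite dimvf /dim /= mul1n.
  have hB' : basis_of (crH S point) (in_tuple [seq B i point | i <- enum 'I_n.*2]) by [].
  by rewrite (size_basis hB') size_map size_enum_ord addnn.
subst m.
(* A basis of N_x is chosen at each point separately; on U it completes the given frame X to an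
   adapted one. *)
have ex x : exists B : 'I_r -> 'rV[R]_(n + n + r), U x -> adapted S x (X^~ x) B.
  have [W [B [_ Wx _ hB]]] := crN_frame S x; exists (B^~ x) => Ux.
  by have [_ [h1 h2]] := hX; split; [exact: h1|exact: h2|exact: hB].
have [E adE] := choice ex.
split.
  exact: (QL_first hmu hadj hU hX adE hth).
exact: (QL_second hmu hadj hU hX adE hth).
Qed.
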